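(* Let $K$ be a perfectoid field and $n\ge 1$. Every finite projective module over the perfectoid Tate algebra $T_{n,K}^{\mathrm{perf}}=K\langle X_1^{1/p^\infty},\dots,X_n^{1/p^\infty}\rangle$ is free. Equivalently, all finite vector bundles on the perfectoid unit disk $\mathbb{D}^{n,\mathrm{perf}}_K$ are free (isomorphic to a trivial vector bundle).
   Context: $K$ is a perfectoid field of residue characteristic $p$, with valuation ring $K^\circ$. The perfectoid Tate algebra is the completion, for the Gauss norm, of $\bigcup_{m\ge 0}K\langle X_1^{1/p^m},\dots,X_n^{1/p^m}\rangle$. Explicitly, it consists of the formal series $\sum_{\alpha\in(\mathbb{Z}[1/p]_{\ge 0})^n}a_\alpha X^\alpha$ with $a_\alpha\in K$ such that for every real $\lambda>0$ only finitely many $\alpha$ satisfy $|a_\alpha|\ge\lambda$. The Gauss norm is $\|\sum a_\alpha X^\alpha\|=\sup_\alpha|a_\alpha|$. Its subring of power-bounded elements $(T_{n,K}^{\mathrm{perf}})^\circ$ is the subring of series with coefficients in $K^\circ$. The perfectoid unit disk is the adic space $\mathbb{D}^{n,\mathrm{perf}}_K=\mathrm{Spa}(T_{n,K}^{\mathrm{perf}},(T_{n,K}^{\mathrm{perf}})^\circ)$. *)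

(* Defs.v *)
From HB Require Import structures.
From mathcomp Require Import all_boot all_order all_algebra.
From mathcomp Require Import all_classical all_reals topology.
From mathcomp Require Import ring lra.
Set Implicit Arguments.
Unset Strict Implicit.
Unset Printing Implicit Defensive.
Import Order.TTheory GRing.Theory Num.Theory.
Local Open Scope classical_set_scope.
Local Open Scope quotient_scope.
Local Open Scope ring_scope.

Record perfectoidField (R : realType) (p : nat) := PerfectoidField {
  pf_sort :> fieldType;
  pf_abs : pf_sort -> R;
  pf_prime : prime p;
  pf_abs_ge0 : forall x, 0 <= pf_abs x;
  pf_abs_eq0 : forall x, pf_abs x = 0 <-> x = 0;
  pf_absM : forall x y, pf_abs (x * y) = pf_abs x * pf_abs y;
  pf_absD : forall x y, pf_abs (x + y) <= Num.max (pf_abs x) (pf_abs y);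
  pf_complete : forall u : nat -> pf_sort,
    (forall e : R, 0 < e -> exists N, forall i j, (N <= i)%N -> (N <= j)%N ->
       pf_abs (u i - u j) < e) ->
    exists l, forall e : R, 0 < e -> exists N, forall i, (N <= i)%N ->
       pf_abs (u i - l) < e;
  (* 1 is not isolated in the value group: the rank one valuation is
     non-discrete (in particular non-trivial) *)
  pf_nondiscrete : forall e : R, 0 < e -> exists x, 1 < pf_abs x < 1 + e;
  (* the residue field has characteristic p *)
  pf_residue : pf_abs p%:R < 1;
  (* Frobenius is surjective on the valuation ring modulo p *)
  pf_frobenius : forall x, pf_abs x <= 1 -> exists y z,
    [/\ pf_abs y <= 1, pf_abs z <= 1 & x = y ^+ p + p%:R * z] }.

Section Abs.
Variables (R : realType) (p : nat) (K : perfectoidField R p).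
Implicit Types x y : K.
Local Notation "<| x |>" := (pf_abs x) (at level 0, x at level 99).

Lemma pf_abs0 : <|0 : K|> = 0. Proof. exact/pf_abs_eq0. Qed.

Lemma pf_abs_gt0 x : x != 0 -> 0 < <|x|>.
Proof.
move=> x0; rewrite lt_neqAle pf_abs_ge0 andbT eq_sym.
by apply: contra x0 => /eqP /pf_abs_eq0 ->.
Qed.

Lemma pf_abs1 : <|1 : K|> = 1.
Proof.
have h : <|1 : K|> != 0 by rewrite gt_eqF // pf_abs_gt0 // oner_eq0.
by apply: (mulfI h); rewrite -pf_absM !mulr1.
Qed.

Lemma pf_absN x : <|- x|> = <|x|>.
Proof.
have h : <|-1 : K|> = 1.
  have : <|-1 : K|> ^+ 2 = 1 by rewrite expr2 -pf_absM mulrNN mulr1 pf_abs1.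
  by move=> /eqP; rewrite sqrp_eq1 ?pf_abs_ge0 // => /eqP.
by rewrite -mulN1r pf_absM h mul1r.
Qed.

Lemma pf_absB_le x y e : <|x|> <= e -> <|y|> <= e -> <|x - y|> <= e.
Proof.
move=> hx hy; apply: le_trans (pf_absD _ _) _.
by rewrite ge_max hx pf_absN hy.
Qed.

Lemma pf_absD_le x y e : <|x|> <= e -> <|y|> <= e -> <|x + y|> <= e.
Proof.
by move=> hx hy; apply: le_trans (pf_absD _ _) _; rewrite ge_max hx hy.
Qed.

Lemma pf_absD_lt x y e : <|x|> < e -> <|y|> < e -> <|x + y|> < e.
Proof.
by move=> hx hy; apply: le_lt_trans (pf_absD _ _) _; rewrite gt_max hx hy.
Qed.

Lemma pf_absBC x y : <|x - y|> = <|y - x|>.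
Proof. by rewrite -pf_absN opprB. Qed.

Lemma pf_abs_sum_le (I : eqType) (s : seq I) (f : I -> K) e : 0 <= e ->
  (forall i, i \in s -> <|f i|> <= e) -> <|\sum_(i <- s) f i|> <= e.
Proof.
move=> e0 h; rewrite big_seq; elim/big_ind: _ => //.
- by rewrite pf_abs0.
- by move=> *; exact: pf_absD_le.
Qed.

Lemma pf_abs_sum_lt (I : eqType) (s : seq I) (f : I -> K) e : 0 < e ->
  (forall i, i \in s -> <|f i|> < e) -> <|\sum_(i <- s) f i|> < e.
Proof.
move=> e0 h; rewrite big_seq; elim/big_ind: _ => //.
- by rewrite pf_abs0.
- by move=> *; exact: pf_absD_lt.
Qed.

Lemma pf_absV x : <|x^-1|> = <|x|>^-1.
Proof.
have [->|x0] := eqVneq x 0; first by rewrite invr0 pf_abs0 invr0.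
have h := pf_abs_gt0 x0.
by apply: (mulfI (lt0r_neq0 h)); rewrite -pf_absM !divff ?pf_abs1 ?gt_eqF.
Qed.

Lemma pf_absX x k : <|x ^+ k|> = <|x|> ^+ k.
Proof. by elim: k => [|k ih]; rewrite ?expr0 ?pf_abs1 // !exprS pf_absM ih. Qed.

Lemma le0_small (a : R) : 0 <= a -> (forall e : R, 0 < e -> a <= e) -> a = 0.
Proof.
move=> a0 h; apply/eqP; rewrite eq_le a0 andbT leNgt; apply/negP => ap.
have a2 : 0 < a / 2 by lra.
by have := h _ a2; lra.
Qed.

Lemma half_pow (a b : R) : 0 < a -> 0 < b -> exists m : nat, a / 2 ^+ m <= b.
Proof.
move=> a0 b0; have [m hm] : exists m : nat, a / b <= m%:R.
  exists (Num.trunc (a / b)).+1.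
  by rewrite ltW // Num.Theory.truncnS_gt // ltW // divr_gt0.
exists m; rewrite ler_pdivrMr ?exprn_gt0 //.
have : m%:R <= 2 ^+ m :> R by rewrite -natrX ler_nat ltnW // ltn_expl.
move: hm; rewrite ler_pdivrMr // => hm hp.
by rewrite mulrC; apply: le_trans hm _; rewrite ler_pM2r.
Qed.

Lemma pf_small (e : R) : 0 < e -> exists c : K, [/\ c != 0, <|c|> <= 1 & <|c|> <= e].
Proof.
move=> e0; have [x /andP[x1 _]] := @pf_nondiscrete R p K 1 ltr01.
have x0 : x != 0 by apply/eqP => x0; move: x1; rewrite x0 pf_abs0 ltr10.
set d := <|x|> - 1; have d0 : 0 < d by rewrite subr_gt0.
pose m := (Num.trunc (e^-1 / d)).+1.
have hm : e^-1 / d < m%:R.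
  by rewrite Num.Theory.truncnS_gt // ltW // divr_gt0 // invr_gt0.
have hb : e^-1 <= <|x|> ^+ m.
  have : 1 + m%:R * d <= <|x|> ^+ m.
    have -> : <|x|> = 1 + d by rewrite /d; ring.
    elim: (m) => [|k ih]; first by rewrite mul0r addr0 expr0.
    have h1 : 0 <= k%:R * d * d by rewrite !mulr_ge0 ?ler0n // ltW.
    rewrite exprS; apply: (@le_trans _ _ ((1 + d) * (1 + k%:R * d))).
      by rewrite -[k.+1%:R]natr1; move: h1; nra.
    by rewrite ler_pM2l // addr_gt0.
  move: hm; rewrite ltr_pdivrMr // => hm h; apply: ltW.
  by apply: lt_le_trans hm (le_trans _ h); rewrite lerDr.
exists (x ^- m); split.
- by rewrite invr_eq0 expf_neq0.
- by rewrite pf_absV pf_absX invf_le1 ?exprn_ege1 ?exprn_gt0 ?pf_abs_gt0 // ltW.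
- rewrite pf_absV pf_absX -[e]invrK lef_pV2 ?posrE ?invr_gt0 //.
  by rewrite exprn_gt0 // pf_abs_gt0.
Qed.

End Abs.

(* Unconditional summation in K.  The coefficients of a product of two series
   are infinite sums, since an element of Z[1/p]_{>=0} has infinitely many
   decompositions as a sum of two such elements. *)
Section Summation.
Variables (R : realType) (p : nat) (K : perfectoidField R p).
Local Notation "<| x |>" := (pf_abs x) (at level 0, x at level 99).

Definition null_family (I : choiceType) (f : I -> K) :=
  forall l : R, 0 < l -> finite_set [set i | l <= <| f i |>].

Definition is_nsum (I : choiceType) (f : I -> K) (s : K) :=
  forall e : R, 0 < e -> exists F : seq I, forall G : seq I,
    uniq G -> {subset F <= G} -> <| s - \sum_(i <- G) f i |> < e.

Definition nsum (I : choiceType) (f : I -> K) : K := xget 0 (is_nsum f).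

Lemma null_seq (I : choiceType) (f : I -> K) (l : R) : null_family f -> 0 < l ->
  exists G : seq I, uniq G /\ forall i, (l <= <| f i |>) = (i \in G).
Proof.
move=> nf l0; have /finite_seqP [s hs] := nf _ l0.
exists (undup s); split; first exact: undup_uniq.
move=> i; rewrite mem_undup; apply/idP/idP => h.
- by have : [set` s] i by rewrite -hs.
- by have : [set i | l <= <| f i |>] i by rewrite hs.
Qed.

Lemma null_of_seq (I : choiceType) (f : I -> K) :
  (forall l : R, 0 < l -> exists G : seq I, forall i, l <= <| f i |> -> i \in G) ->
  null_family f.
Proof.
move=> h l l0; have [G hG] := h _ l0.
by apply: (@sub_finite_set _ _ [set` G]) => [i /= /hG|] //; exact: finite_seq.
Qed.

Lemma null_bound (I : choiceType) (f : I -> K) : null_family f ->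
  exists A : R, 0 < A /\ forall i, <| f i |> <= A.
Proof.
move=> nf; have [G [_ hG]] := null_seq nf ltr01.
have [A [A1 hA]] : exists A : R, 1 <= A /\ forall i, i \in G -> <| f i |> <= A.
  elim: (G) => [|x s [A [A1 hA]]]; first by exists 1.
  exists (Num.max A <| f x |>); split; first by rewrite le_max A1.
  move=> i; rewrite inE => /orP [/eqP ->|/hA h]; rewrite le_max ?lexx ?orbT //.
  by rewrite h.
exists A; split; first exact: lt_le_trans ltr01 A1.
move=> i; have [/hA //|] := boolP (i \in G).
by rewrite -hG -ltNge => /ltW h; exact: le_trans h A1.
Qed.

Lemma sum_ext (I : choiceType) (f : I -> K) (F G : seq I) (e : R) : 0 <= e ->
  uniq F -> uniq G -> {subset F <= G} ->
  (forall i, i \notin F -> <| f i |> <= e) ->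
  <| \sum_(i <- G) f i - \sum_(i <- F) f i |> <= e.
Proof.
move=> e0 uF uG FG h.
have hp : perm_eq G (F ++ [seq i <- G | i \notin F]).
  apply: uniq_perm => //.
    rewrite cat_uniq uF filter_uniq // andbT.
    by apply/hasPn => i; rewrite mem_filter => /andP[].
  move=> i; rewrite mem_cat mem_filter.
  by have [/FG ->|] //= := boolP (i \in F).
rewrite (perm_big _ hp) /= big_cat /= addrAC subrr add0r.
by apply: pf_abs_sum_le => // i; rewrite mem_filter => /andP[/h].
Qed.

Lemma nsum_tail (I : choiceType) (f : I -> K) (s : K) (G : seq I) (e : R) :
  0 <= e -> is_nsum f s -> uniq G -> (forall i, i \notin G -> <| f i |> <= e) ->
  <| s - \sum_(i <- G) f i |> <= e.
Proof.
move=> e0 hs uG h; rewrite leNgt; apply/negP => lt.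
have [F hF] := hs _ (le_lt_trans e0 lt).
pose H := undup (F ++ G).
have FH : {subset F <= H} by move=> i iF; rewrite mem_undup mem_cat iF.
have GH : {subset G <= H} by move=> i iF; rewrite mem_undup mem_cat iF orbT.
have h1 := hF H (undup_uniq _) FH.
have h2 := sum_ext e0 uG (undup_uniq _) GH h.
have := pf_absD_lt h1 (le_lt_trans h2 lt).
by rewrite addrA subrK ltxx.
Qed.

Lemma is_nsum_approx (I : choiceType) (f : I -> K) (s : K) :
  (forall e : R, 0 < e -> exists G : seq I, [/\ uniq G,
     <| s - \sum_(i <- G) f i |> <= e & forall i, i \notin G -> <| f i |> <= e]) ->
  is_nsum f s.
Proof.
move=> h e e0; have e2 : 0 < e / 2 by lra.
have [G [uG hG hf]] := h _ e2; exists G => H uH GH.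
have h1 := sum_ext (ltW e2) uG uH GH hf.
have -> : s - \sum_(i <- H) f i = (s - \sum_(i <- G) f i)
   - (\sum_(i <- H) f i - \sum_(i <- G) f i) by ring.
by apply: le_lt_trans (pf_absB_le hG h1) _; lra.
Qed.

Lemma is_nsum_unique (I : choiceType) (f : I -> K) (s s' : K) :
  is_nsum f s -> is_nsum f s' -> s = s'.
Proof.
move=> h h'; apply/eqP; rewrite -subr_eq0; apply/eqP/pf_abs_eq0.
apply: le0_small; first exact: pf_abs_ge0.
move=> e e0; have [F hF] := h _ e0; have [F' hF'] := h' _ e0.
pose H := undup (F ++ F').
have FH : {subset F <= H} by move=> i iF; rewrite mem_undup mem_cat iF.
have FH' : {subset F' <= H} by move=> i iF; rewrite mem_undup mem_cat iF orbT.
have -> : s - s' = (s - \sum_(i <- H) f i) - (s' - \sum_(i <- H) f i) by ring.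
by apply: pf_absB_le; apply: ltW; [apply: hF|apply: hF']; rewrite ?undup_uniq.
Qed.

Lemma nsum_eq (I : choiceType) (f : I -> K) (s : K) : is_nsum f s -> nsum f = s.
Proof.
move=> h; apply: (@is_nsum_unique I f) => //.
exact: (@xgetPex _ 0 (is_nsum f) (ex_intro _ s h)).
Qed.

Lemma nsumP (I : choiceType) (f : I -> K) : null_family f -> is_nsum f (nsum f).
Proof.
move=> nf.
suff [s hs] : exists s, is_nsum f s by rewrite (nsum_eq hs).
have hp (m : nat) : 0 < (2 ^+ m)^-1 :> R by rewrite invr_gt0 exprn_gt0.
have [G hG] : {G : nat -> seq I & forall m, uniq (G m) /\
    forall i, ((2 ^+ m)^-1 <= <| f i |>) = (i \in G m)}.
  by apply: (@choice _ _ (fun m g => uniq g /\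
    forall i, ((2 ^+ m)^-1 <= <| f i |>) = (i \in g))) => m; exact: null_seq.
have Gout m i : i \notin G m -> <| f i |> <= (2 ^+ m)^-1.
  by rewrite -(hG m).2 -ltNge => /ltW.
have Gsub m k : (m <= k)%N -> {subset G m <= G k}.
  move=> mk i; rewrite -!(hG _).2; apply: le_trans.
  by rewrite lef_pV2 ?posrE ?exprn_gt0 // ler_weXn2l // ler1n.
pose u m := \sum_(i <- G m) f i.
have hu m k : (m <= k)%N -> <| u k - u m |> <= (2 ^+ m)^-1.
  by move=> mk; apply: sum_ext (ltW (hp m)) (hG m).1 (hG k).1 (Gsub _ _ mk) (Gout m).
have half (e : R) : 0 < e -> exists m : nat, (2 ^+ m)^-1 <= e.
  by move=> e0; have [m hm] := half_pow ltr01 e0; exists m; rewrite -div1r.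
have [|s hs] := @pf_complete R p K u.
  move=> e e0; have e2 : 0 < e / 2 by lra.
  have [m hm] := half _ e2; exists m => i j mi mj.
  have -> : u i - u j = (u i - u m) - (u j - u m) by ring.
  apply: (@le_lt_trans _ _ (e / 2)); last by lra.
  by apply: le_trans hm; apply: pf_absB_le; exact: hu.
exists s; apply: is_nsum_approx => e e0.
have [N hN] := hs _ e0; have [m hm] := half _ e0.
exists (G (maxn N m)); split; first exact: (hG _).1.
- by rewrite pf_absBC ltW // hN // leq_maxl.
- move=> i hi; apply: le_trans hm.
  by apply: Gout; apply: contra hi; apply: Gsub; rewrite leq_maxr.
Qed.

Lemma nsum_le (I : choiceType) (f : I -> K) (e : R) : null_family f -> 0 <= e ->
  (forall i, <| f i |> <= e) -> <| nsum f |> <= e.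
Proof.
move=> nf e0 h.
by have := @nsum_tail _ f _ [::] e e0 (nsumP nf) erefl (fun i _ => h i);
  rewrite big_nil subr0.
Qed.

Lemma nsum_ge_ex (I : choiceType) (f : I -> K) (e : R) : null_family f -> 0 < e ->
  e <= <| nsum f |> -> exists i, e <= <| f i |>.
Proof.
move=> nf e0 h; apply: contrapT => /forallNP hn.
have hlt i : <| f i |> < e by rewrite ltNge; apply/negP.
have e2 : 0 < e / 2 by lra.
have [G [uG hG]] := null_seq nf e2.
have h1 : <| nsum f - \sum_(i <- G) f i |> <= e / 2.
  apply: nsum_tail => //; [exact: ltW | exact: nsumP|].
  by move=> i; rewrite -hG -ltNge => /ltW.
have h2 : <| \sum_(i <- G) f i |> < e by apply: pf_abs_sum_lt.
have h3 : <| nsum f - \sum_(i <- G) f i |> < e by lra.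
by have := pf_absD_lt h3 h2; rewrite subrK ltNge h.
Qed.

Lemma null_fin (I : choiceType) (f : I -> K) (G : seq I) :
  (forall i, i \notin G -> f i = 0) -> null_family f.
Proof.
move=> h; apply: null_of_seq => l l0; exists G => i.
by apply: contraTT => /h ->; rewrite -ltNge pf_abs0.
Qed.

Lemma nsum_fin (I : choiceType) (f : I -> K) (G : seq I) : uniq G ->
  (forall i, i \notin G -> f i = 0) -> nsum f = \sum_(i <- G) f i.
Proof.
move=> uG h; apply: nsum_eq; apply: is_nsum_approx => e e0; exists G.
by split=> // [|i /h ->]; rewrite ?subrr pf_abs0 ltW.
Qed.

Lemma nullD (I : choiceType) (f g : I -> K) : null_family f -> null_family g ->
  null_family (fun i => f i + g i).
Proof.
move=> nf ng; apply: null_of_seq => l l0.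
have [F [_ hF]] := null_seq nf l0; have [G [_ hG]] := null_seq ng l0.
exists (F ++ G) => i; rewrite mem_cat -hF -hG => h.
by rewrite -le_max; exact: le_trans h (pf_absD _ _).
Qed.

Lemma nullN (I : choiceType) (f : I -> K) : null_family f ->
  null_family (fun i => - f i).
Proof.
move=> nf; apply: null_of_seq => l l0; have [F [_ hF]] := null_seq nf l0.
by exists F => i; rewrite pf_absN hF.
Qed.

Lemma nullM (I J : choiceType) (f : I -> K) (g : J -> K) : null_family f ->
  null_family g -> null_family (fun ij : I * J => f ij.1 * g ij.2).
Proof.
move=> nf ng; apply: null_of_seq => l l0.
have [A [A0 hA]] := null_bound nf; have [B [B0 hB]] := null_bound ng.
have [F [_ hF]] := null_seq nf (divr_gt0 l0 B0).
have [G [_ hG]] := null_seq ng (divr_gt0 l0 A0).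
exists [seq (x, y) | x <- F, y <- G] => -[i j] /=; rewrite pf_absM => h.
apply: allpairs_f.
- rewrite -hF ler_pdivrMr //; apply: le_trans h _.
  by rewrite ler_wpM2l // pf_abs_ge0.
- rewrite -hG ler_pdivrMr //; apply: le_trans h _.
  by rewrite mulrC ler_wpM2l // pf_abs_ge0.
Qed.

Lemma nullZ (I : choiceType) (f : I -> K) c : null_family f ->
  null_family (fun i => c * f i).
Proof.
move=> nf; apply: null_of_seq => l l0.
have c0 : 0 < <| c |> + 1 by rewrite ltr_wpDl ?pf_abs_ge0.
have [F [_ hF]] := null_seq nf (divr_gt0 l0 c0).
exists F => i; rewrite -hF ler_pdivrMr // pf_absM => h.
by apply: le_trans h _; rewrite mulrC ler_wpM2l ?pf_abs_ge0 // lerDl.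
Qed.

Lemma null_dom (I : choiceType) (f : I -> K) (g : I -> K) (A : R) : 0 < A ->
  null_family f -> (forall i, <| g i |> <= <| f i |> * A) -> null_family g.
Proof.
move=> A0 nf h; apply: null_of_seq => l l0.
have [F [_ hF]] := null_seq nf (divr_gt0 l0 A0).
by exists F => i hi; rewrite -hF ler_pdivrMr //; exact: le_trans hi (h i).
Qed.

Lemma null_inj (I J : choiceType) (f : I -> K) (h : J -> I) : injective h ->
  null_family f -> null_family (fun j => f (h j)).
Proof.
move=> hI nf l l0.
apply: (finite_preimage (B := [set i | l <= <| f i |>]) (f := h)); last exact: nf.
by move=> x y _ _ /hI.
Qed.

Lemma nsum_bij (I J : choiceType) (f : I -> K) (h : J -> I) (k : I -> J) :
  cancel h k -> cancel k h -> null_family f -> nsum (fun j => f (h j)) = nsum f.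
Proof.
move=> hk kh nf; apply: nsum_eq; apply: is_nsum_approx => e e0.
have [G [uG hG]] := null_seq nf e0; exists (map k G); split.
- by rewrite map_inj_uniq //; exact: can_inj kh.
- rewrite big_map; under eq_bigr do rewrite kh.
  apply: nsum_tail => //; [exact: ltW | exact: nsumP |].
  by move=> i; rewrite -hG -ltNge => /ltW.
- move=> j hj; rewrite leNgt; apply/negP => /ltW; rewrite hG => hin.
  by move/negP: hj; apply; apply/mapP; exists (h j).
Qed.

Lemma nsumD (I : choiceType) (f g : I -> K) : null_family f -> null_family g ->
  nsum (fun i => f i + g i) = nsum f + nsum g.
Proof.
move=> nf ng; apply: nsum_eq => e e0.
have [F hF] := nsumP nf e0; have [G hG] := nsumP ng e0.
exists (F ++ G) => H uH sH; rewrite big_split /= opprD addrACA.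
by apply: pf_absD_lt; [apply: hF|apply: hG] => // i hi; apply: sH;
  rewrite mem_cat hi ?orbT.
Qed.

Lemma nsumZ (I : choiceType) (f : I -> K) c : null_family f ->
  nsum (fun i => c * f i) = c * nsum f.
Proof.
move=> nf; apply: nsum_eq => e e0.
have c0 : 0 < <| c |> + 1 by rewrite ltr_wpDl ?pf_abs_ge0.
have [F hF] := nsumP nf (divr_gt0 e0 c0).
exists F => H uH sH; rewrite -mulr_sumr -mulrBr pf_absM.
have := hF _ uH sH; rewrite ltr_pdivlMr //; apply: le_lt_trans.
by rewrite mulrC ler_wpM2l ?pf_abs_ge0 // lerDl.
Qed.

Lemma null_row (I J : choiceType) (F : I * J -> K) i : null_family F ->
  null_family (fun j => F (i, j)).
Proof. by apply: (@null_inj _ _ F (fun j => (i, j))) => x y []. Qed.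

Lemma null_rows (I J : choiceType) (F : I * J -> K) : null_family F ->
  null_family (fun i => nsum (fun j => F (i, j))).
Proof.
move=> nF; apply: null_of_seq => l l0; have [G [_ hG]] := null_seq nF l0.
exists (map fst G) => i /(nsum_ge_ex (null_row i nF) l0) [j].
by rewrite hG => hj; apply/mapP; exists (i, j).
Qed.

Lemma nsum_pair (I J : choiceType) (F : I * J -> K) : null_family F ->
  nsum (fun i => nsum (fun j => F (i, j))) = nsum F.
Proof.
move=> nF; apply: nsum_eq; apply: is_nsum_approx => e e0.
have [G [uG hG]] := null_seq nF e0.
have out ij : ij \notin G -> <| F ij |> <= e by rewrite -hG -ltNge => /ltW.
pose I0 := undup (map fst G); pose J0 := undup (map snd G).
have GI ij : ij \in G -> ij.1 \in I0.
  by move=> h; rewrite mem_undup; apply/mapP; exists ij.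
have GJ ij : ij \in G -> ij.2 \in J0.
  by move=> h; rewrite mem_undup; apply/mapP; exists ij.
pose H := [seq (i, j) | i <- I0, j <- J0].
have uH : uniq H by apply: allpairs_uniq; rewrite ?undup_uniq // => -[? ?] [? ?] _ _ [-> ->].
have hH ij : ij \notin H -> <| F ij |> <= e.
  move=> h; apply: out; apply: contra h => h; rewrite (surjective_pairing ij).
  by apply: allpairs_f; [exact: GI | exact: GJ].
have h1 := nsum_tail (ltW e0) (nsumP nF) uH hH.
exists I0; split; first exact: undup_uniq.
- have -> : nsum F - \sum_(i <- I0) nsum (fun j => F (i, j)) =
    (nsum F - \sum_(ij <- H) F ij) -
    \sum_(i <- I0) (nsum (fun j => F (i, j)) - \sum_(j <- J0) F (i, j)).
    rewrite big_allpairs_dep /= sumrB; ring.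
  apply: pf_absB_le => //; apply: pf_abs_sum_le => [|i _]; first exact: ltW.
  apply: nsum_tail; rewrite ?undup_uniq ?ltW //; first exact/nsumP/null_row.
  by move=> j hj; apply: out; apply: contra hj => /GJ.
- move=> i hi; apply: nsum_le; rewrite ?ltW //; first exact: null_row.
  by move=> j; apply: out; apply: contra hi => /GI.
Qed.

Lemma nsum_swap (I J : choiceType) (F : I * J -> K) : null_family F ->
  nsum (fun i => nsum (fun j => F (i, j))) =
  nsum (fun j => nsum (fun i => F (i, j))).
Proof.
move=> nF; rewrite nsum_pair //.
have sw : injective (fun ji : J * I => (ji.2, ji.1)) by move=> [? ?] [? ?] [-> ->].
rewrite -(@nsum_bij _ _ F (fun ji : J * I => (ji.2, ji.1)) (fun ij => (ij.2, ij.1))) //;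
  try by case.
by rewrite -nsum_pair //; exact: (null_inj sw nF).
Qed.

End Summation.

(* (Z[1/p]_{>=0})^n, as row vectors of rationals *)
Definition pexponent (p n : nat) (al : 'rV[rat]_n) : Prop :=
  forall i, exists m k : nat, al 0 i = m%:R / p%:R ^+ k.

(* The perfectoid Tate algebra K<X_1^{1/p^oo}, ..., X_n^{1/p^oo}>.  Series are
   indexed by all of Q^n, with the coefficients outside of the set of exponents
   required to vanish. *)
Record perfTate (R : realType) (p : nat) (K : perfectoidField R p) (n : nat) :=
  PerfTate {
    tcoef :> 'rV[rat]_n -> K;
    tcoef_supp : forall al, tcoef al != 0 -> pexponent p al;
    tcoef_null : null_family tcoef }.

HB.instance Definition _ R p K n := gen_eqMixin (@perfTate R p K n).
HB.instance Definition _ R p K n := gen_choiceMixin (@perfTate R p K n).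

Section PerfTate.
Variables (R : realType) (p : nat) (K : perfectoidField R p) (n : nat).
Local Notation "<| x |>" := (pf_abs x) (at level 0, x at level 99).
Local Notation T := (perfTate K n).
Implicit Types (a b c : T) (al be ga : 'rV[rat]_n).

Lemma tateP a b : (forall al, a al = b al) -> a = b.
Proof.
case: a b => f sf nf [g sg ng] /= h; have fg : f = g by exact/funext.
rewrite {}fg in sf nf h *.
by rewrite (Prop_irrelevance sf sg) (Prop_irrelevance nf ng).
Qed.

Lemma pexponent0 : pexponent p (0 : 'rV[rat]_n).
Proof. by move=> i; exists 0%N, 0%N; rewrite mxE mul0r. Qed.

Lemma pexponentD al be : pexponent p al -> pexponent p be -> pexponent p (al + be).
Proof.
have p0 : p%:R != 0 :> rat by rewrite pnatr_eq0 -lt0n prime_gt0 // (pf_prime K).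
move=> ha hb i; have [m [k hm]] := ha i; have [m' [k' hm']] := hb i.
exists (m * p ^ k' + m' * p ^ k)%N, (k + k')%N.
rewrite mxE hm hm' natrD !natrM !natrX exprD.
by field; rewrite !expf_neq0.
Qed.

Fact tconst_supp (x : K) al :
  (if al == 0 then x else 0) != 0 -> pexponent p al.
Proof.
by have [-> _|_] := eqVneq al 0; [exact: pexponent0 | rewrite eqxx].
Qed.
Fact tconst_null (x : K) : null_family (fun al : 'rV[rat]_n => if al == 0 then x else 0).
Proof. by apply: (@null_fin _ _ _ 'rV[rat]_n _ [:: 0]) => al; rewrite inE => /negPf ->. Qed.
Definition tconst (x : K) : T := PerfTate (@tconst_supp x) (@tconst_null x).

Fact tadd_supp a b al : a al + b al != 0 -> pexponent p al.
Proof.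
have [a0|/tcoef_supp //] := eqVneq (a al) 0.
by rewrite a0 add0r => /tcoef_supp.
Qed.
Definition tadd a b : T :=
  PerfTate (@tadd_supp a b) (nullD (@tcoef_null _ _ _ _ a) (@tcoef_null _ _ _ _ b)).

Fact topp_supp a al : - a al != 0 -> pexponent p al.
Proof. by rewrite oppr_eq0 => /tcoef_supp. Qed.
Definition topp a : T := PerfTate (@topp_supp a) (nullN (@tcoef_null _ _ _ _ a)).

Definition tconv a b ga : K := nsum (fun al => a al * b (ga - al)).

Lemma tconv_inner_null a b ga : null_family (fun al => a al * b (ga - al)).
Proof.
have [B [B0 hB]] := null_bound (@tcoef_null _ _ _ _ b).
apply: (null_dom B0 (@tcoef_null _ _ _ _ a)) => al.
by rewrite pf_absM ler_wpM2l // pf_abs_ge0.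
Qed.

Fact tconv_supp a b ga : tconv a b ga != 0 -> pexponent p ga.
Proof.
move=> h.
have hp : 0 < <| tconv a b ga |> by exact: pf_abs_gt0.
have [al hal] := nsum_ge_ex (tconv_inner_null a b ga) hp (lexx _).
have : a al * b (ga - al) != 0.
  by apply: contraTneq hal => ->; rewrite pf_abs0 -ltNge.
rewrite mulf_eq0 negb_or => /andP[/tcoef_supp h1 /tcoef_supp h2].
by rewrite -(subrK al ga); exact: pexponentD.
Qed.

Fact tconv_null a b : null_family (tconv a b).
Proof.
apply: null_of_seq => l l0.
have [G [_ hG]] := null_seq (nullM (@tcoef_null _ _ _ _ a) (@tcoef_null _ _ _ _ b)) l0.
exists [seq x.1 + x.2 | x <- G] => ga.
move=> /(nsum_ge_ex (tconv_inner_null a b ga) l0)[al hal].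
by apply/mapP; exists (al, ga - al); rewrite -?hG //= addrC subrK.
Qed.
Definition tmul a b : T := PerfTate (@tconv_supp a b) (@tconv_null a b).

Fact taddA : associative tadd.
Proof. by move=> a b c; apply: tateP => al /=; rewrite addrA. Qed.
Fact taddC : commutative tadd.
Proof. by move=> a b; apply: tateP => al /=; rewrite addrC. Qed.
Fact tadd0 : left_id (tconst 0) tadd.
Proof. by move=> a; apply: tateP => al /=; rewrite if_same add0r. Qed.
Fact taddN : left_inverse (tconst 0) topp tadd.
Proof. by move=> a; apply: tateP => al /=; rewrite if_same addNr. Qed.

HB.instance Definition _ := GRing.isZmodule.Build T taddA taddC tadd0 taddN.

Fact tmulA : associative tmul.
Proof.
move=> a b c; apply: tateP => de /=; rewrite /tconv /= /tconv.
pose G (x : 'rV[rat]_n * 'rV[rat]_n) := a x.2 * b (x.1 - x.2) * c (de - x.1).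
have nG : null_family G.
  have [B [B0 hB]] := null_bound (@tcoef_null _ _ _ _ c).
  have hI : injective (fun x : 'rV[rat]_n * 'rV[rat]_n => (x.2, x.1 - x.2)).
    by move=> [x y] [x' y'] [-> /addIr ->].
  apply: (null_dom B0 (null_inj hI
    (nullM (@tcoef_null _ _ _ _ a) (@tcoef_null _ _ _ _ b)))) => x.
  by rewrite /G /= [X in X <= _]pf_absM ler_wpM2l // pf_abs_ge0.
transitivity (nsum (fun ga => nsum (fun al => G (ga, al)))); last first.
  congr nsum; apply/funext => ga; rewrite mulrC -nsumZ; last exact: tconv_inner_null.
  by congr nsum; apply/funext => al; rewrite mulrC.
rewrite nsum_swap //; congr nsum; apply/funext => al.
rewrite -nsumZ; last exact: tconv_inner_null.
rewrite -(@nsum_bij _ _ _ _ _ (fun ga => G (ga, al)) (fun be => be + al) (fun ga => ga - al));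
  [|exact: addrK | exact: subrK |].
- congr nsum; apply/funext => be; rewrite /G /= addrK mulrA; congr (_ * c _).
  by rewrite opprD addrA addrAC.
- apply: null_inj nG; by move=> x y [].
Qed.

Fact tmulC : commutative tmul.
Proof.
move=> a b; apply: tateP => ga /=; rewrite /tconv.
rewrite -(@nsum_bij _ _ _ _ _ _ (fun al => ga - al) (fun al => ga - al)) ?subKr //.
- by congr nsum; apply/funext => al; rewrite subKr mulrC.
- by move=> x; rewrite subKr.
- by move=> x; rewrite subKr.
- exact: tconv_inner_null.
Qed.

Fact tmul1 : left_id (tconst 1) tmul.
Proof.
move=> a; apply: tateP => ga /=; rewrite /tconv.
rewrite (@nsum_fin _ _ _ 'rV[rat]_n _ [:: 0]) ?big_seq1 //=.
- by rewrite eqxx subr0 mul1r.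
- by move=> al; rewrite inE => /negPf ->; rewrite mul0r.
Qed.

Fact tmulDl : left_distributive tmul tadd.
Proof.
move=> a b c; apply: tateP => ga /=; rewrite /tconv /=.
rewrite -nsumD; try exact: tconv_inner_null.
by congr nsum; apply/funext => al; rewrite mulrDl.
Qed.

Fact tone_neq0 : tconst 1 != 0.
Proof.
apply/eqP => /(congr1 (fun a : T => a 0)) /=; rewrite eqxx => /eqP.
by rewrite oner_eq0.
Qed.

HB.instance Definition _ := GRing.Zmodule_isComNzRing.Build T
  tmulA tmulC tmul1 tmulDl tone_neq0.

Lemma tcoefD a b al : (a + b) al = a al + b al. Proof. by []. Qed.
Lemma tcoefN a al : (- a) al = - a al. Proof. by []. Qed.
Lemma tcoefM a b ga : (a * b) ga = nsum (fun al => a al * b (ga - al)).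
Proof. by []. Qed.

Lemma tconstM_coef x a al : (tconst x * a) al = x * a al.
Proof.
rewrite tcoefM (@nsum_fin _ _ _ 'rV[rat]_n _ [:: 0]) ?big_seq1 //=.
- by rewrite eqxx subr0.
- by move=> be; rewrite inE => /negPf ->; rewrite mul0r.
Qed.

Lemma tconstM x y : tconst (x * y) = tconst x * tconst y.
Proof.
by apply: tateP => al; rewrite tconstM_coef /=; case: eqP; rewrite ?mulr0.
Qed.

Lemma tconstN x : tconst (- x) = - tconst x.
Proof. by apply: tateP => al; rewrite tcoefN /=; case: eqP; rewrite ?oppr0. Qed.

Lemma tconst1 : tconst 1 = 1. Proof. by []. Qed.

Definition gauss_norm a : R := sup (range (fun al => <| a al |>)).

(* (T_{n,K}^perf)° *)
Definition tate_int a : Prop := forall al, <| a al |> <= 1.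

Definition tate_open (S : set T) : Prop :=
  forall a, S a -> exists2 e : R, 0 < e &
    forall b, gauss_norm (b - a) < e -> S b.

End PerfTate.

(* A ring topology given by a decreasing sequence of neighbourhoods of 0 that
   are additive subgroups stable under multiplication. *)
Record linTopology (B : comPzRingType) := LinTopology {
  lt_nbh :> nat -> set B;
  lt_nbh0 : forall j, lt_nbh j 0;
  lt_nbhB : forall j x y, lt_nbh j x -> lt_nbh j y -> lt_nbh j (x - y);
  lt_nbh_decr : forall i j, (i <= j)%N -> lt_nbh j `<=` lt_nbh i;
  lt_nbhM : forall j x y, lt_nbh j x -> lt_nbh j y -> lt_nbh j (x * y);
  lt_nbh_absorb : forall b j, exists i, forall x, lt_nbh i x -> lt_nbh j (b * x) }.

Record cauchySeq (B : comPzRingType) (N : linTopology B) := CauchySeq {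
  cs_val :> nat -> B;
  cs_cauchy : forall j, exists M, forall m m', (M <= m)%N -> (M <= m')%N ->
    N j (cs_val m - cs_val m') }.

HB.instance Definition _ B N := gen_eqMixin (@cauchySeq B N).
HB.instance Definition _ B N := gen_choiceMixin (@cauchySeq B N).

(* The separated completion: Cauchy sequences modulo null sequences. *)
Section Completion.
Variables (B : comPzRingType) (N : linTopology B).
Local Notation S := (cauchySeq N).
Implicit Types u v w : S.

Lemma lt_nbhN j x : N j x -> N j (- x).
Proof. by move=> h; rewrite -sub0r; apply: lt_nbhB => //; exact: lt_nbh0. Qed.
Lemma lt_nbhD j x y : N j x -> N j y -> N j (x + y).
Proof. by move=> hx hy; rewrite -[y]opprK; apply: lt_nbhB => //; exact: lt_nbhN. Qed.

Definition cs_equiv u v : bool :=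
  `[< forall j, exists M, forall m, (M <= m)%N -> N j (u m - v m) >].

Fact cs_equiv_refl : reflexive cs_equiv.
Proof. by move=> u; apply/asboolP => j; exists 0%N => m _; rewrite subrr; exact: lt_nbh0. Qed.
Fact cs_equiv_sym : symmetric cs_equiv.
Proof.
suff h u v : cs_equiv u v -> cs_equiv v u by move=> u v; apply/idP/idP; exact: h.
move=> /asboolP h; apply/asboolP => j; have [M hM] := h j.
by exists M => m /hM /lt_nbhN; rewrite opprB.
Qed.
Fact cs_equiv_trans : transitive cs_equiv.
Proof.
move=> v u w /asboolP h /asboolP h'; apply/asboolP => j.
have [M hM] := h j; have [M' hM'] := h' j.
exists (maxn M M') => m; rewrite geq_max => /andP[/hM h1 /hM' h2].
by have := lt_nbhD h1 h2; rewrite addrA subrK.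
Qed.
Definition cs_equiv_rel := EquivRel cs_equiv cs_equiv_refl cs_equiv_sym cs_equiv_trans.

Definition completion := {eq_quot cs_equiv_rel}.
HB.instance Definition _ : EqQuotient S cs_equiv completion := EqQuotient.on completion.
HB.instance Definition _ := Choice.on completion.

Definition cs_class u : completion := \pi_completion u.

Lemma cs_classP u v : cs_class u = cs_class v <->
  forall j, exists M, forall m, (M <= m)%N -> N j (u m - v m).
Proof.
split; first by move=> /eqmodP /asboolP.
by move=> h; apply/eqmodP/asboolP.
Qed.

Lemma cs_class_eq u v : (forall m, u m = v m) -> cs_class u = cs_class v.
Proof.
move=> h; apply/cs_classP => j; exists 0%N => m _.
by rewrite h subrr; exact: lt_nbh0.
Qed.

Lemma cs_reprK (x : completion) : cs_class (repr x) = x.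
Proof. exact: reprK. Qed.

Fact cs_const_cauchy (b : B) j : exists M, forall m m', (M <= m)%N -> (M <= m')%N ->
  N j (b - b).
Proof. by exists 0%N => *; rewrite subrr; exact: lt_nbh0. Qed.
Definition cs_const (b : B) : S := CauchySeq (@cs_const_cauchy b).

Fact cs_add_cauchy u v j : exists M, forall m m', (M <= m)%N -> (M <= m')%N ->
  N j ((u m + v m) - (u m' + v m')).
Proof.
have [M hM] := cs_cauchy u j; have [M' hM'] := cs_cauchy v j.
exists (maxn M M') => m m'; rewrite !geq_max => /andP[a b] /andP[c d].
by rewrite opprD addrACA; apply: lt_nbhD; [exact: hM | exact: hM'].
Qed.
Definition cs_add u v : S := CauchySeq (@cs_add_cauchy u v).

Fact cs_opp_cauchy u j : exists M, forall m m', (M <= m)%N -> (M <= m')%N ->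
  N j (- u m - - u m').
Proof.
have [M hM] := cs_cauchy u j; exists M => m m' h h'.
by rewrite -opprD; apply: lt_nbhN; exact: hM.
Qed.
Definition cs_opp u : S := CauchySeq (@cs_opp_cauchy u).

Lemma cs_absorb u j : exists i M, (j <= i)%N /\
  forall m x, (M <= m)%N -> N i x -> N j (u m * x).
Proof.
have [M hM] := cs_cauchy u j; have [i hi] := lt_nbh_absorb N (u M) j.
exists (maxn i j), M; split; first exact: leq_maxr.
move=> m x Mm hx; rewrite -(subrK (u M) (u m)) mulrDl; apply: lt_nbhD.
- by apply: lt_nbhM; [exact: hM | apply: lt_nbh_decr hx; exact: leq_maxr].
- by apply: hi; apply: lt_nbh_decr hx; exact: leq_maxl.
Qed.

Fact cs_mul_cauchy u v j : exists M, forall m m', (M <= m)%N -> (M <= m')%N ->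
  N j (u m * v m - u m' * v m').
Proof.
have [i [M [ji hM]]] := cs_absorb u j; have [i' [M' [ji' hM']]] := cs_absorb v j.
have [L hL] := cs_cauchy u i'; have [L' hL'] := cs_cauchy v i.
exists (maxn (maxn M M') (maxn L L')) => m m'.
rewrite !geq_max => /andP[/andP[a b] /andP[c d]] /andP[/andP[a' b'] /andP[c' d']].
have -> : u m * v m - u m' * v m' = u m * (v m - v m') + v m' * (u m - u m').
  by rewrite !mulrBr [v m' * u m]mulrC [v m' * u m']mulrC addrA subrK.
by apply: lt_nbhD; [apply: hM => //; exact: hL' | apply: hM' => //; exact: hL].
Qed.
Definition cs_mul u v : S := CauchySeq (@cs_mul_cauchy u v).

Definition cadd (x y : completion) := cs_class (cs_add (repr x) (repr y)).
Definition copp (x : completion) := cs_class (cs_opp (repr x)).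
Definition cmul (x y : completion) := cs_class (cs_mul (repr x) (repr y)).

Lemma caddE u v : cadd (cs_class u) (cs_class v) = cs_class (cs_add u v).
Proof.
have /cs_classP h := cs_reprK (cs_class u).
have /cs_classP h' := cs_reprK (cs_class v).
apply/cs_classP => j /=; have [M hM] := h j; have [M' hM'] := h' j.
exists (maxn M M') => m; rewrite geq_max => /andP[a b].
by rewrite opprD addrACA; apply: lt_nbhD; [exact: hM | exact: hM'].
Qed.

Lemma coppE u : copp (cs_class u) = cs_class (cs_opp u).
Proof.
have /cs_classP h := cs_reprK (cs_class u).
apply/cs_classP => j /=; have [M hM] := h j.
by exists M => m Mm; rewrite -opprD; apply: lt_nbhN; exact: hM.
Qed.

Lemma cmulE u v : cmul (cs_class u) (cs_class v) = cs_class (cs_mul u v).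
Proof.
have /cs_classP := cs_reprK (cs_class u); set u' := repr _ => h.
have /cs_classP := cs_reprK (cs_class v); rewrite /cmul; set v' := repr _ => h'.
apply/cs_classP => j /=.
have [i [M [ji hM]]] := cs_absorb u' j; have [i' [M' [ji' hM']]] := cs_absorb v j.
have [L hL] := h i'; have [L' hL'] := h' i.
exists (maxn (maxn M M') (maxn L L')) => m.
rewrite !geq_max => /andP[/andP[a b] /andP[c d]].
have -> : u' m * v' m - u m * v m = u' m * (v' m - v m) + v m * (u' m - u m).
  by rewrite !mulrBr [v m * u' m]mulrC [v m * u m]mulrC addrA subrK.
by apply: lt_nbhD; [apply: hM => //; exact: hL' | apply: hM' => //; exact: hL].
Qed.

Lemma completion_ind (P : completion -> Prop) :
  (forall u, P (cs_class u)) -> forall x, P x.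
Proof. by move=> h x; rewrite -(cs_reprK x). Qed.

Fact caddA : associative cadd.
Proof.
elim/completion_ind => u; elim/completion_ind => v; elim/completion_ind => w.
by rewrite !caddE; apply: cs_class_eq => m /=; rewrite addrA.
Qed.
Fact caddC : commutative cadd.
Proof.
elim/completion_ind => u; elim/completion_ind => v.
by rewrite !caddE; apply: cs_class_eq => m /=; rewrite addrC.
Qed.
Fact cadd0 : left_id (cs_class (cs_const 0)) cadd.
Proof.
by elim/completion_ind => u; rewrite caddE; apply: cs_class_eq => m /=; rewrite add0r.
Qed.
Fact caddN : left_inverse (cs_class (cs_const 0)) copp cadd.
Proof.
by elim/completion_ind => u; rewrite coppE caddE; apply: cs_class_eq => m /=; rewrite addNr.
Qed.
HB.instance Definition _ := GRing.isZmodule.Build completion caddA caddC cadd0 caddN.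

Fact cmulA : associative cmul.
Proof.
elim/completion_ind => u; elim/completion_ind => v; elim/completion_ind => w.
by rewrite !cmulE; apply: cs_class_eq => m /=; rewrite mulrA.
Qed.
Fact cmulC : commutative cmul.
Proof.
elim/completion_ind => u; elim/completion_ind => v.
by rewrite !cmulE; apply: cs_class_eq => m /=; rewrite mulrC.
Qed.
Fact cmul1 : left_id (cs_class (cs_const 1)) cmul.
Proof.
by elim/completion_ind => u; rewrite cmulE; apply: cs_class_eq => m /=; rewrite mul1r.
Qed.
Fact cmulDl : left_distributive cmul cadd.
Proof.
elim/completion_ind => u; elim/completion_ind => v; elim/completion_ind => w.
by rewrite caddE !cmulE caddE; apply: cs_class_eq => m /=; rewrite mulrDl.
Qed.
HB.instance Definition _ := GRing.Zmodule_isComPzRing.Build completion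
  cmulA cmulC cmul1 cmulDl.

(* the basic neighbourhoods of 0 in the completion *)
Definition completion_nbh (j : nat) : set completion :=
  [set x | exists2 u : S, cs_class u = x & forall m, N j (u m)].

End Completion.

(* Points of Spa(A, A°) for A = T_{n,K}^perf.  An equivalence class of
   valuations |.| on A is encoded by the relation |a| <= |b|; an element of the
   value group is a quotient |a| / |b| with |a|, |b| <> 0. *)
Record perfDisk (R : realType) (p : nat) (K : perfectoidField R p) (n : nat) :=
  PerfDisk {
    val_le : perfTate K n -> perfTate K n -> Prop;
    val_total : forall a b, val_le a b \/ val_le b a;
    val_trans : forall b a c, val_le a b -> val_le b c -> val_le a c;
    val_mul : forall a b c, val_le a b -> val_le (a * c) (b * c);
    val_cancel : forall a b c, ~ val_le c 0 -> val_le (a * c) (b * c) -> val_le a b;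
    val_add : forall a b c, val_le a c -> val_le b c -> val_le (a + b) c;
    val_one : ~ val_le 1 0;
    val_continuous : forall a b, ~ val_le a 0 -> ~ val_le b 0 ->
      tate_open [set x | ~ val_le a (x * b)];
    val_integral : forall a, tate_int a -> val_le a 1 }.

(* The f_i of a rational subset generate an open ideal; as A is a Tate ring this
   means that they generate the unit ideal. *)
Record ratDatum (R : realType) (p : nat) (K : perfectoidField R p) (n : nat) :=
  RatDatum {
    rat_size : nat;
    rat_num : 'I_rat_size -> perfTate K n;
    rat_den : perfTate K n;
    rat_unit : exists a, \sum_(i < rat_size) a i * rat_num i = 1 }.

Definition rat_subset R p K n (D : @ratDatum R p K n) : set (perfDisk K n) :=
  [set x | (forall i, val_le x (rat_num (r := D) i) (rat_den D)) /\
           ~ val_le x (rat_den D) 0].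

HB.instance Definition _ R p K n := gen_eqMixin (@perfDisk R p K n).
HB.instance Definition _ R p K n := gen_choiceMixin (@perfDisk R p K n).
HB.instance Definition _ R p K n := @isSubBaseTopological.Build (@perfDisk R p K n)
  (set (perfDisk K n)) (range (@rat_subset R p K n)) id.

Section RationalLocalization.
Variables (R : realType) (p : nat) (K : perfectoidField R p) (n : nat).
Local Notation "<| x |>" := (pf_abs x) (at level 0, x at level 99).
Local Notation A := (perfTate K n).
Variable D : ratDatum K n.

(* The preimage under A[X] -> A[1/g], X |-> 1/g, of A°[f_1/g, ..., f_k/g]. *)
Inductive rat_int : {poly A} -> Prop :=
| rat_int_const a : tate_int a -> rat_int a%:P
| rat_int_frac i : rat_int ((rat_num (r := D) i)%:P * 'X)
| rat_int_ideal q : rat_int (((rat_den D)%:P * 'X - 1) * q)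
| rat_int_add q r : rat_int q -> rat_int r -> rat_int (q + r)
| rat_int_mul q r : rat_int q -> rat_int r -> rat_int (q * r).

(* A°[f_1/g, ..., f_k/g] is a ring of definition of A[1/g]: its multiples by
   the c in K with |c| -> 0 are a basis of neighbourhoods of 0. *)
Definition rat_nbh (j : nat) : set {poly A} :=
  [set q | exists (c : K) (r : {poly A}),
     [/\ <| c |> <= (2 ^+ j)^-1, rat_int r & q = (tconst n c)%:P * r]].

Lemma tate_int_const (c : K) : <| c |> <= 1 -> tate_int (tconst n c).
Proof. by move=> h al /=; case: ifP; rewrite ?pf_abs0 ?ler01. Qed.

Lemma rat_intZ (c : K) r : <| c |> <= 1 -> rat_int r -> rat_int ((tconst n c)%:P * r).
Proof. by move=> h hr; apply: rat_int_mul => //; apply/rat_int_const/tate_int_const. Qed.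

Lemma rat_int0 : rat_int 0.
Proof. by rewrite -(mulr0 (((rat_den D)%:P * 'X - 1))); exact: rat_int_ideal. Qed.

Lemma tconstPM (c d : K) : (tconst n (c * d))%:P = (tconst n c)%:P * (tconst n d)%:P.
Proof. by rewrite tconstM polyCM. Qed.

Fact rat_nbh0 j : rat_nbh j 0.
Proof.
exists 0, 0; split; rewrite ?mulr0 //; last exact: rat_int0.
by rewrite pf_abs0 invr_ge0 exprn_ge0.
Qed.

Fact rat_nbhB j x y : rat_nbh j x -> rat_nbh j y -> rat_nbh j (x - y).
Proof.
have key (c d : K) r s : <| c |> <= <| d |> -> rat_int r -> rat_int s ->
  exists t, rat_int t /\
    (tconst n c)%:P * r + (tconst n d)%:P * s = (tconst n d)%:P * t.
  have [->|d0] := eqVneq d 0; first rewrite pf_abs0 => c0.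
    have -> : c = 0 by apply/pf_abs_eq0/eqP; rewrite eq_le c0 pf_abs_ge0.
    move=> hr hs; exists (r + s); split; first exact: rat_int_add.
    by rewrite mulrDr.
  move=> cd hr hs; exists ((tconst n (c / d))%:P * r + s); split.
    apply: rat_int_add => //; apply: rat_intZ => //.
    by rewrite pf_absM pf_absV ler_pdivrMr ?mul1r // pf_abs_gt0.
  by rewrite mulrDr mulrA -tconstPM [d * _]mulrC divfK.
have opp (d : K) s : - ((tconst n d)%:P * s) = (tconst n (- d))%:P * s.
  by rewrite tconstN polyCN mulNr.
move=> [c [r [hc hr ->]]] [d [s [hd hs ->]]]; rewrite opp.
have hd' : <| - d |> <= (2 ^+ j)^-1 by rewrite pf_absN.
have [h|h] := leP <| c |> <| - d |>.
- by have [t [ht ->]] := key _ _ _ _ h hr hs; exists (- d), t.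
- by have [t [ht e]] := key _ _ _ _ (ltW h) hs hr; exists c, t; rewrite addrC.
Qed.

Fact rat_nbh_decr i j : (i <= j)%N -> rat_nbh j `<=` rat_nbh i.
Proof.
move=> ij x [c [r [hc hr ->]]]; exists c, r; split=> //; apply: le_trans hc _.
by rewrite lef_pV2 ?posrE ?exprn_gt0 // ler_weXn2l // ler1n.
Qed.

Lemma rat_nbh_int j x : rat_nbh j x -> rat_int x.
Proof.
move=> [c [r [hc hr ->]]]; apply: rat_intZ => //; apply: le_trans hc _.
by rewrite invf_le1 ?exprn_gt0 // exprn_ege1 // ler1n.
Qed.

Fact rat_nbhM j x y : rat_nbh j x -> rat_nbh j y -> rat_nbh j (x * y).
Proof.
move=> [c [r [hc hr ->]]] /rat_nbh_int hy; exists c, (r * y).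
by split; rewrite ?mulrA //; exact: rat_int_mul.
Qed.

Lemma tate_absorb (a : A) :
  exists c : K, [/\ c != 0, <| c |> <= 1 & tate_int (tconst n c * a)].
Proof.
have [M [M0 hM]] := null_bound (@tcoef_null _ _ _ _ a).
have [c [c0 c1 hc]] : exists c : K, [/\ c != 0, <| c |> <= 1 & <| c |> <= M^-1].
  by apply: pf_small; rewrite invr_gt0.
exists c; split=> // al; rewrite tconstM_coef pf_absM.
rewrite -(mulVf (lt0r_neq0 M0)).
by apply: ler_pM; rewrite ?pf_abs_ge0.
Qed.

Definition rat_absorbed (q : {poly A}) :=
  exists c : K, [/\ c != 0, <| c |> <= 1 & rat_int ((tconst n c)%:P * q)].

Lemma rat_absorbedD q r : rat_absorbed q -> rat_absorbed r -> rat_absorbed (q + r).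
Proof.
move=> [c [c0 c1 hc]] [d [d0 d1 hd]]; exists (c * d); split.
- by rewrite mulf_neq0.
- by rewrite pf_absM mulr_ile1 ?pf_abs_ge0.
- rewrite mulrDr; apply: rat_int_add.
  + by rewrite [c * d]mulrC tconstPM -mulrA; exact: rat_intZ.
  + by rewrite tconstPM -mulrA; exact: rat_intZ.
Qed.

Lemma rat_absorbedM q r : rat_absorbed q -> rat_absorbed r -> rat_absorbed (q * r).
Proof.
move=> [c [c0 c1 hc]] [d [d0 d1 hd]]; exists (c * d); split.
- by rewrite mulf_neq0.
- by rewrite pf_absM mulr_ile1 ?pf_abs_ge0.
- by rewrite tconstPM mulrACA; exact: rat_int_mul.
Qed.

Lemma rat_absorbedC a : rat_absorbed a%:P.
Proof.
have [c [c0 c1 h]] := tate_absorb a; exists c; split=> //.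
by rewrite -polyCM; exact: rat_int_const.
Qed.

Lemma rat_absorbed_int q : rat_int q -> rat_absorbed q.
Proof.
by move=> h; exists 1; split; rewrite ?oner_eq0 ?pf_abs1 // tconst1 mul1r.
Qed.

Lemma rat_absorbedX : rat_absorbed 'X.
Proof.
have [a ha] := rat_unit D.
rewrite -['X]mul1r -polyC1 -ha rmorph_sum /= mulr_suml.
elim/big_ind: _ => [||i _]; first exact/rat_absorbed_int/rat_int0.
- by move=> *; exact: rat_absorbedD.
- rewrite polyCM -mulrA; apply: rat_absorbedM; first exact: rat_absorbedC.
  exact/rat_absorbed_int/rat_int_frac.
Qed.

Lemma rat_absorbed_all q : rat_absorbed q.
Proof.
elim/poly_ind: q => [|q a hq]; first exact/rat_absorbed_int/rat_int0.
apply: rat_absorbedD; last exact: rat_absorbedC.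
by apply: rat_absorbedM => //; exact: rat_absorbedX.
Qed.

Fact rat_nbh_absorb (b : {poly A}) j :
  exists i, forall x, rat_nbh i x -> rat_nbh j (b * x).
Proof.
have [c [c0 c1 hc]] := rat_absorbed_all b.
have cp := pf_abs_gt0 c0.
have jp : 0 < (2 ^+ j)^-1 :> R by rewrite invr_gt0 exprn_gt0.
have [i hi] := half_pow (a := 1) ltr01 (mulr_gt0 jp cp).
exists i => x [d [r [hd hr ->]]].
exists (d / c), ((tconst n c)%:P * b * r); split.
- rewrite pf_absM pf_absV ler_pdivrMr //; apply: le_trans hd _.
  by rewrite -div1r.
- exact: rat_int_mul.
- by rewrite !mulrA -tconstPM divfK //; congr (_ * _); rewrite mulrC.
Qed.

Definition rat_topology : linTopology {poly A} :=
  LinTopology rat_nbh0 rat_nbhB rat_nbh_decr rat_nbhM rat_nbh_absorb.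

(* A<f_1/g, ..., f_k/g>, the completion of A[1/g].  The ideal (g X - 1) lies in
   every neighbourhood of 0, so the separated completion of A[X] is that of
   A[X]/(g X - 1) = A[1/g]. *)
Definition rat_ring := completion rat_topology.

Definition rat_can (a : A) : rat_ring := cs_class (cs_const rat_topology a%:P).

End RationalLocalization.

Section StructureSheaf.
Variables (R : realType) (p : nat) (K : perfectoidField R p) (n : nat).
Local Notation A := (perfTate K n).
Local Notation X := (perfDisk K n).
Implicit Types (D : ratDatum K n) (W V : set X).

(* Continuous homomorphisms of A-algebras between rational localizations.  When
   rat_subset D' is contained in rat_subset D there is exactly one from
   rat_ring D to rat_ring D': the restriction map. *)
Definition rat_restriction D D' (phi : {rmorphism rat_ring D -> rat_ring D'}) :=
  (forall a, phi (rat_can D a) = rat_can D' a) /\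
  (forall j, exists i, forall s, completion_nbh i s -> completion_nbh j (phi s)).

(* O_X(W): compatible families of elements of the rings of the rational subsets
   contained in W *)
Record strSheaf W := StrSheaf {
  str_val : forall D, rat_subset D `<=` W -> rat_ring D;
  str_compat : forall D D' (h : rat_subset D `<=` W) (h' : rat_subset D' `<=` W),
    rat_subset D' `<=` rat_subset D ->
    forall phi : {rmorphism rat_ring D -> rat_ring D'}, rat_restriction phi ->
    phi (str_val h) = str_val h' }.

HB.instance Definition _ W := gen_eqMixin (strSheaf W).
HB.instance Definition _ W := gen_choiceMixin (strSheaf W).

Section Ring.
Variable W : set X.
Implicit Types s t u : strSheaf W.

Lemma strP s t : (forall D (h : rat_subset D `<=` W), str_val s h = str_val t h) ->
  s = t.
Proof.
case: s t => f cf [g cg] /= h.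
have fg : f = g by apply: functional_extensionality_dep => D; exact/funext.
rewrite {}fg in cf h *; by rewrite (Prop_irrelevance cf cg).
Qed.

Program Definition str_zero : strSheaf W := @StrSheaf W (fun _ _ => 0) _.
Next Obligation. by move=> *; rewrite rmorph0. Qed.
Program Definition str_one : strSheaf W := @StrSheaf W (fun _ _ => 1) _.
Next Obligation. by move=> *; rewrite rmorph1. Qed.
Program Definition str_add s t : strSheaf W :=
  @StrSheaf W (fun _ h => str_val s h + str_val t h) _.
Next Obligation.
move=> s t D D' h h' hD phi hphi /=; rewrite rmorphD.
by rewrite !(str_compat _ h h' hD hphi).
Qed.
Program Definition str_opp s : strSheaf W := @StrSheaf W (fun _ h => - str_val s h) _.
Next Obligation.
move=> s D D' h h' hD phi hphi /=; rewrite rmorphN.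
by rewrite !(str_compat _ h h' hD hphi).
Qed.
Program Definition str_mul s t : strSheaf W :=
  @StrSheaf W (fun _ h => str_val s h * str_val t h) _.
Next Obligation.
move=> s t D D' h h' hD phi hphi /=; rewrite rmorphM.
by rewrite !(str_compat _ h h' hD hphi).
Qed.

Fact str_addA : associative str_add.
Proof. by move=> *; apply: strP => D h /=; rewrite addrA. Qed.
Fact str_addC : commutative str_add.
Proof. by move=> *; apply: strP => D h /=; rewrite addrC. Qed.
Fact str_add0 : left_id str_zero str_add.
Proof. by move=> *; apply: strP => D h /=; rewrite add0r. Qed.
Fact str_addN : left_inverse str_zero str_opp str_add.
Proof. by move=> *; apply: strP => D h /=; rewrite addNr. Qed.
HB.instance Definition _ := GRing.isZmodule.Build (strSheaf W)
  str_addA str_addC str_add0 str_addN.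

Fact str_mulA : associative str_mul.
Proof. by move=> *; apply: strP => D h /=; rewrite mulrA. Qed.
Fact str_mulC : commutative str_mul.
Proof. by move=> *; apply: strP => D h /=; rewrite mulrC. Qed.
Fact str_mul1 : left_id str_one str_mul.
Proof. by move=> *; apply: strP => D h /=; rewrite mul1r. Qed.
Fact str_mulDl : left_distributive str_mul str_add.
Proof. by move=> *; apply: strP => D h /=; rewrite mulrDl. Qed.
HB.instance Definition _ := GRing.Zmodule_isComPzRing.Build (strSheaf W)
  str_mulA str_mulC str_mul1 str_mulDl.
End Ring.

Definition str_res W V (VW : V `<=` W) (s : strSheaf W) : strSheaf V :=
  @StrSheaf V (fun D h => str_val s (subset_trans h VW))
    (fun D D' h h' => @str_compat W s D D' (subset_trans h VW) (subset_trans h' VW)).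

End StructureSheaf.

(* Sheaves of O_X-modules on X.  Only the values on open subsets matter. *)
Record modSheaf (R : realType) (p : nat) (K : perfectoidField R p) (n : nat) :=
  ModSheaf {
    ms_sec :> forall W : set (perfDisk K n), lmodType (strSheaf W);
    ms_res : forall W V, V `<=` W -> ms_sec W -> ms_sec V;
    ms_resD : forall W V (VW : V `<=` W), open W -> open V ->
      forall s t, ms_res VW (s + t) = ms_res VW s + ms_res VW t;
    ms_resZ : forall W V (VW : V `<=` W), open W -> open V ->
      forall a s, ms_res VW (a *: s) = str_res VW a *: ms_res VW s;
    ms_res_id : forall W (WW : W `<=` W), open W -> forall s, ms_res WW s = s;
    ms_res_comp : forall W V U (VW : V `<=` W) (UV : U `<=` V) (UW : U `<=` W),
      open W -> open V -> open U ->
      forall s, ms_res UV (ms_res VW s) = ms_res UW s;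
    ms_sheaf : forall (I : Type) (U : I -> set (perfDisk K n)) W
      (UW : forall i, U i `<=` W), open W -> (forall i, open (U i)) ->
      W = \bigcup_i U i ->
      forall s : forall i, ms_sec (U i),
      (forall i j, ms_res (@subIsetl _ (U i) (U j)) (s i) =
                   ms_res (@subIsetr _ (U i) (U j)) (s j)) ->
      exists! t, forall i, ms_res (UW i) t = s i }.

Section Bundles.
Variables (R : realType) (p : nat) (K : perfectoidField R p) (n : nat).
Variable E : modSheaf K n.

(* the restriction of E to the open subset V is isomorphic to O_V^r *)
Definition trivial_on (V : set (perfDisk K n)) (r : nat) : Prop :=
  exists f : forall W, {linear 'rV[strSheaf W]_r -> E W},
    (forall W, open W -> W `<=` V -> bijective (f W)) /\
    (forall W W' (h : W' `<=` W), open W -> open W' -> W `<=` V ->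
       forall v, ms_res h (f W v) = f W' (map_mx (str_res h) v)).

Definition finite_vector_bundle : Prop :=
  forall x : perfDisk K n, exists V r, [/\ open V, V x & trivial_on V r].

Definition free_bundle : Prop := exists r, trivial_on setT r.

End Bundles.

Section Modules.
Variables (A : comNzRingType) (M : lmodType A).

Definition finite_module : Prop :=
  exists (r : nat) (f : {linear 'rV[A]_r -> M}), forall x, exists v, f v = x.

Definition projective_module : Prop :=
  forall (P Q : lmodType A) (f : {linear P -> Q}) (g : {linear M -> Q}),
    (forall y, exists x, f x = y) ->
    exists h : {linear M -> P}, forall x, f (h x) = g x.

Definition finite_free_module : Prop :=
  exists (r : nat) (f : {linear 'rV[A]_r -> M}), bijective f.

End Modules.

(* Main.v *)
Require Import Defs.
From HB Require Import structures.
From mathcomp Require Import all_boot all_order all_algebra.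
From mathcomp Require Import all_classical all_reals topology.
From mathcomp Require Import ring lra zify.
Set Implicit Arguments.
Unset Strict Implicit.
Unset Printing Implicit Defensive.
Import Order.TTheory GRing.Theory Num.Theory.
Local Open Scope classical_set_scope.
Local Open Scope quotient_scope.
Local Open Scope ring_scope.

(** Modules.  Let A be the perfectoid Tate algebra.  It is the completion of an
    increasing union of isometric copies [level m] of the classical Tate algebra T in
    the variables X_i^(1/p^m).  By the argument of Quillen and Suslin finitely
    generated projective T-modules are free ([tate_projective_free]): T has
    Weierstrass preparation, so modulo a coordinate change every nonzero element is
    a monic polynomial up to a unit; a projective module is then stably free by
    induction on the number of variables, and Suslin's theorem on unimodular rows
    with a monic entry ([suslin_monic]) yields freeness.  A projective A-module is
    given by an idempotent matrix.  Such a matrix is close to one over a finite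
    level, which is corrected to an idempotent by Newton iteration, and close
    idempotents are conjugate; so A inherits the property ([perf_projective_free]).

    Bundles.  It remains to show that a vector bundle E comes from a projective
    module of global sections.  Call a chart of E over W an idempotent matrix over
    O(W) together with sections of E that present E as its image over every open
    subset of W.  Charts exist locally.  Over the whole disk the global functions
    are A ([can_surj]), the idempotent of a chart splits, and its splitting is a
    basis of E.  So the point is to glue charts.

    The basic step glues along a division of a rational subset W into the part W1
    where |a| <= |b| and the part W2 where |b| <= |a| ([chart_glue]).  It needs two
    facts on the structure sheaf.  First, sections glue along the division
    ([sheaf_inj], [sheaf_glue]).  Secondly, products of elementary matrices over the
    intersection are quotients of invertible matrices over W1 and W2
    ([sheaf_cartan]); this follows from the additive decomposition of functions on
    the intersection, by the iteration of Cartan.  With it the transition matrix of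
    two charts is split, as two idempotents with isomorphic images are conjugate by
    elementary matrices after adding complements.

    Both facts rest on the exactness of the two term complex, with control of norms
    so that it survives completion.  The rings of definition are compared inside the
    fraction field of A.  The splitting of Laurent polynomials in h = a / b is
    evident.  The other statement is that an element belonging to the rings of
    definition of both parts belongs, up to a bounded factor, to that of W
    ([strict_covering]).  It says that division by X - h is bounded.  When all data
    come from a finite level, this holds over T because ideals of T and of its
    polydisk algebras are strictly closed, again by Weierstrass division
    ([tate_strict_noetherian], [finite_level_strict]).  It passes to A with the same
    constant, because A is the completed direct sum of the slices X^al T with al in a
    system of representatives of the exponents.  General data are reduced to a finite
    level by a perturbation, which does not change the rational subsets
    ([split_covering]).

    Rational subsets are sets of valuations, while the localizations are rings; the
    translation uses the compactness of rational subsets ([rational_compact]), by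
    ultrafilter limits, and the existence of points by Chevalley's valuation rings
    ([chevalley_point]).  They show that an inclusion of rational subsets induces a
    restriction map ([den_unit], [frac_bounded]).

    Finally an arbitrary covering by finitely many rational subsets is reached by
    successive divisions.  Form the products of one defining function of each
    member, at least one of them being a denominator.  Where such a product is
    maximal in absolute value, its denominators are maximal among their own
    competitors, so one is inside a member of the covering ([champion]).  Comparing
    the products two at a time, as in a tournament, divides the disk into such
    pieces ([tournament]). *)

(** * Completion of unimodular rows containing a monic polynomial *)

(** A finitely generated projective module is the image of an idempotent matrix, and a
    matrix factorization e = U V with V U = 1 is a basis of that image. *)
Definition projective_free (B : comNzRingType) : Prop :=
  forall N (e : 'M[B]_N), e *m e = e ->
  exists r (U : 'M[B]_(N, r)) (V : 'M[B]_(r, N)), U *m V = e /\ V *m U = 1%:M.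

Definition row_equiv (Q : comNzRingType) k (v w : 'rV[Q]_k) : Prop :=
  exists g g' : 'M[Q]_k, g *m g' = 1%:M /\ v *m g = w.

Definition hermite (B : comNzRingType) : Prop :=
  forall k (w : 'rV[B]_k.+1) (z : 'cV_k.+1), w *m z = 1%:M ->
  row_equiv w (delta_mx 0 0).

Section RowEquiv.
Variable Q : comNzRingType.

Lemma row_equiv_refl k (v : 'rV[Q]_k) : row_equiv v v.
Proof. by exists 1%:M, 1%:M; rewrite !mulmx1. Qed.

Lemma row_equiv_sym k (v w : 'rV[Q]_k) : row_equiv v w -> row_equiv w v.
Proof.
move=> [g [g' [gg <-]]]; exists g', g; rewrite -mulmxA gg mulmx1; split=> //.
exact: mulmx1C.
Qed.

Lemma row_equiv_trans k (v u w : 'rV[Q]_k) :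
  row_equiv v u -> row_equiv u w -> row_equiv v w.
Proof.
move=> [g [g' [gg <-]]] [h [h' [hh <-]]]; exists (g *m h), (h' *m g').
by rewrite !mulmxA -[_ *m _ *m h']mulmxA hh mulmx1 gg.
Qed.

Lemma row_equiv_map (Q' : comNzRingType) (f : {rmorphism Q -> Q'}) k
  (v w : 'rV[Q]_k) : row_equiv v w -> row_equiv (map_mx f v) (map_mx f w).
Proof.
move=> [g [g' [gg <-]]]; exists (map_mx f g), (map_mx f g').
by rewrite -!map_mxM gg map_mx1.
Qed.

Lemma det1_inv k (g : 'M[Q]_k) : \det g = 1 -> exists g', g *m g' = 1%:M.
Proof. by move=> h; exists (\adj g); rewrite mul_mx_adj h. Qed.
End RowEquiv.

(** The kernel of a unimodular row w is the image of the idempotent 1 - z w; a basis of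
    it, together with z, is a basis of the whole space. *)
Lemma projective_free_hermite (B : comNzRingType) : projective_free B -> hermite B.
Proof.
move=> pf k w z wz.
have [|r [U [V [UV VU]]]] := pf _ (1%:M - z *m w).
  rewrite mulmxBl mul1mx mulmxBr mulmx1 -mulmxA [w *m (_ *m _)]mulmxA wz mul1mx.
  by rewrite subrr subr0.
have Vz : V *m z = 0.
  rewrite -[V]mul1mx -VU -[_ *m V]mulmxA UV -mulmxA mulmxBl mul1mx -mulmxA wz.
  by rewrite mulmx1 subrr mulmx0.
have wU : w *m U = 0.
  rewrite -[U]mulmx1 -VU [U *m _]mulmxA UV mulmxA mulmxBr mulmx1 mulmxA wz mul1mx.
  by rewrite subrr mul0mx.
have h1 : row_mx z U *m col_mx w V = 1%:M.
  by rewrite mul_row_col UV addrC subrK.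
have h2 : col_mx w V *m row_mx z U = 1%:M.
  by rewrite mul_col_row wz VU Vz wU -scalar_mx_block.
have e : r = k.
  have a1 := mulmx1_min h1; have a2 := mulmx1_min h2.
  by apply/eqP; rewrite eqn_leq -[(r <= k)%N]ltnS -[(k <= r)%N]ltnS -[r.+1]add1n a1 a2.
subst r.
exists (row_mx z U), (col_mx w V); split=> //.
have -> : w *m row_mx z U = row_mx 1%:M 0 :> 'rV_(1 + k) by rewrite mul_mx_row wz wU.
apply/rowP => j; rewrite [LHS]mxE [RHS]mxE.
case: splitP => [i|i] ji; rewrite mxE.
- have -> : j = 0 by apply/val_inj; rewrite /= ji (ord1 i).
  by rewrite (ord1 i) !eqxx.
- by have -> : (j == 0) = false by apply/eqP => j0; move: ji; rewrite j0.
Qed.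

(** ** Maximal ideals *)

Lemma Zorn_above (T : Type) (P : set T -> Prop) (J : set T) : P J ->
  (forall F : set (set T), F !=set0 -> F `<=` P -> total_on F subset ->
     P (\bigcup_(X in F) X)) ->
  exists M, [/\ J `<=` M, P M & forall N, P N -> M `<=` N -> N = M].
Proof.
move=> PJ hF.
have [|M [PM hM]] := @Zorn_bigcup T (fun X => P (J `|` X)).
  move=> F FP tot; have [[Y FY]|/nonemptyPn ->] := pselect (F !=set0); last first.
    by rewrite bigcup_set0 setU0.
  have -> : J `|` \bigcup_(X in F) X = \bigcup_(X in [set J `|` X | X in F]) X.
    rewrite bigcup_image; apply/seteqP; split=> x.
    - by move=> [Jx|[X FX Xx]]; [exists Y; [|left]|exists X; [|right]].
    - by move=> [X FX [Jx|Xx]]; [left|right; exists X].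
  apply: hF; first by exists (J `|` Y), Y.
  - by move=> _ [X FX <-]; exact: FP.
  - move=> _ _ [X FX <-] [X' FX' <-].
    by have [h|h] := tot _ _ FX FX'; [left|right]; exact: setUS.
exists (J `|` M); split=> //.
move=> N PN MN; apply: contrapT => NM.
have MN' : M `<=` N by move=> x Mx; apply: MN; right.
have JN : J `<=` N by move=> x Jx; apply: MN; left.
apply: (hM N); last by have -> : J `|` N = N by apply/seteqP; split=> [x [/JN|]|x Nx] //; right.
split=> // NM'; apply: NM; apply/seteqP; split=> // x /NM'; by right.
Qed.

Definition ideal_set (Q : comNzRingType) (I : set Q) : Prop :=
  [/\ I 0, (forall x y, I x -> I y -> I (x + y)) & forall a x, I x -> I (a * x)].

Section ResidueField.
Variables (Q : comNzRingType) (M : set Q).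
Hypotheses (idM : ideal_set M) (M1 : ~ M 1)
  (maxM : forall N, ideal_set N -> ~ N 1 -> M `<=` N -> N = M).

Definition mpred : Q -> bool := fun x => `[< M x >].

Fact mpred_closed : idealr_closed mpred.
Proof.
have [m0 mD mM] := idM; split; [exact/asboolP | exact/asboolP | ].
by move=> a x y /asboolP hx /asboolP hy; apply/asboolP; apply: mD => //; exact: mM.
Qed.
Definition max_idealr : idealr Q := HB.pack mpred (isIdealr.Build Q mpred mpred_closed).
Local Notation quo := {ideal_quot max_idealr}.

Lemma pi_eq0 x : (\pi_quo x == 0 :> quo) = `[< M x >].
Proof.
by rewrite -(rmorph0 (\pi_quo : {rmorphism Q -> quo})) -Quotient.idealrBE subr0.
Qed.

Lemma quo_inv (x : quo) : exists y : quo, x != 0 -> y * x = 1.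
Proof.
have [m0 mD mM] := idM.
have [->|] := eqVneq x 0; first by exists 0.
elim/quotW: x => x; rewrite pi_eq0 => /asboolP Mx.
have [] := pselect (exists a b, M b /\ a * x + b = 1).
  move=> [a [b [Mb e]]]; exists (\pi_quo a) => _; apply/eqP.
  rewrite -subr_eq0 -(rmorph1 (\pi_quo : {rmorphism Q -> quo})).
  rewrite -(rmorphM (\pi_quo : {rmorphism Q -> quo})).
  rewrite -(rmorphB (\pi_quo : {rmorphism Q -> quo})) pi_eq0 -e.
  rewrite opprD addrA subrr sub0r -mulN1r; apply/asboolP; exact: mM.
move=> h; exfalso; apply: Mx.
suff <- : [set y | exists a b, M b /\ a * x + b = y] = M.
  by exists 1, 0; rewrite mul1r addr0.
apply: maxM => //; last by move=> y My; exists 0, y; rewrite mul0r add0r.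
split; first by exists 0, 0; rewrite mul0r addr0.
- move=> _ _ [a [b [Mb <-]]] [a' [b' [Mb' <-]]]; exists (a + a'), (b + b').
  by split; [exact: mD | rewrite mulrDl addrACA].
- move=> c _ [a [b [Mb <-]]]; exists (c * a), (c * b).
  by split; [exact: mM | rewrite mulrDr mulrA].
Qed.

Lemma residue_field : exists (k : fieldType) (phi : {rmorphism Q -> k}),
  (forall y, exists x, phi x = y) /\ forall x, M x -> phi x = 0.
Proof.
have [inv hinv] := choice quo_inv.
pose inv' (x : quo) := if x == 0 then 0 else inv x.
have mulVx (x : quo) : x != 0 -> inv' x * x = 1.
  by move=> x0; rewrite /inv' (negPf x0) hinv.
have inv0 : inv' 0 = 0 by rewrite /inv' eqxx.
pose k : fieldType := HB.pack quo (GRing.ComNzRing_isField.Build quo mulVx inv0).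
exists k, (\pi_quo : {rmorphism Q -> quo}); split.
- by move=> y; exists (repr (y : quo)); exact: (@reprK _ quo).
- by move=> x Mx; apply/eqP; rewrite pi_eq0; exact/asboolP.
Qed.
End ResidueField.

(** A maximal ideal is found by Zorn: this allows an argument over a field instead of
    over the unknown quotients of Q. *)
Lemma ideal_residue (Q : comNzRingType) (J : set Q) : ideal_set J -> ~ J 1 ->
  exists (k : fieldType) (phi : {rmorphism Q -> k}),
  (forall y, exists x, phi x = y) /\ forall x, J x -> phi x = 0.
Proof.
move=> idJ J1.
have [|F [X FX] FP tot|M [JM [idM M1] hM]] :=
  @Zorn_above Q (fun I => ideal_set I /\ ~ I 1) J; first by [].
- split; last by move=> [Y /FP [_ h]].
  split; first by have [[h _ _] _] := FP _ FX; exists X.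
  + move=> x y [Y FY Yx] [Z FZ Zy].
    have [h|h] := tot _ _ FY FZ.
    * by exists Z => //; have [[_ hD _] _] := FP _ FZ; apply: hD => //; exact: h.
    * by exists Y => //; have [[_ hD _] _] := FP _ FY; apply: hD => //; exact: h.
  + move=> a x [Y FY Yx]; exists Y => //; have [[_ _ h] _] := FP _ FY.
    exact: h.
have [|k [phi [sphi h]]] := residue_field idM M1.
  by move=> N idN N1 MN; exact: hM.
by exists k, phi; split=> // x /JM; exact: h.
Qed.

(** ** Suslin's lemma *)

(** A semilocal stable range argument: the prime factors of f0 that do not divide f1 are
    collected in [gdcop f1 f0]. *)
Lemma stable_range_poly (k : fieldType) (f0 f1 f2 u0 u1 : {poly k}) : f0 != 0 ->
  u0 * f0 + u1 * f1 + f2 = 1 -> exists g, coprimep f0 (f1 + g * f2).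
Proof.
move=> f00 e.
have tri d : d %| f0 -> d %| f1 -> d %| f2 -> size d = 1%N.
  by move=> h0 h1 h2; apply/eqP; rewrite -dvdp1 -e !dvdp_add ?dvdp_mull.
have [f10|f10] := eqVneq f1 0.
  exists 1; rewrite f10 add0r mul1r; apply/coprimepP => d h0 h2.
  by rewrite -size_poly_eq1; apply/eqP; apply: tri => //; rewrite f10 dvdp0.
exists (gdcop f1 f0); set g := gdcop f1 f0.
have cg : coprimep g f1 by exact: coprimep_gdco.
have dg : f0 %| g * f1 ^+ size f0 by exact: dvdp_gdcor.
have gf : g %| f0 by exact: dvdp_gdco.
apply/coprimepP => d d0 d1.
have cdg : coprimep d g.
  apply/coprimepP => a ad ag.
  have : a %| f1.
    by rewrite -(@dvdp_addl _ (g * f2)) ?dvdp_mulr // (dvdp_trans ad).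
  by move=> af; move/coprimepP: cg; apply.
have df : d %| f1 ^+ size f0 by rewrite -(Gauss_dvdpr _ cdg) (dvdp_trans d0).
have cdf : coprimep d f1.
  apply/coprimepP => b bd bf; rewrite -size_poly_eq1; apply/eqP; apply: tri => //.
    exact: dvdp_trans bd d0.
  have cbg : coprimep b g by apply: coprimep_dvdr cdg.
  rewrite -(Gauss_dvdpr _ cbg) -(@dvdp_addr _ f1) //; exact: dvdp_trans bd d1.
have : coprimep d (f1 ^+ size f0) by exact: coprimep_expr.
move/coprimepP; apply => //; exact: dvdpp.
Qed.

Import Pdiv.CommonRing.
Import Pdiv.RingMonic.

Section Suslin.
Variable Q : idomainType.
Implicit Types b d : {poly Q}.

Lemma comp_poly_diff (q b e : {poly Q}) : exists y, q \Po (b + e) = q \Po b + e * y.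
Proof.
elim/poly_ind: q => [|q c [y hy]]; first by exists 0; rewrite !comp_poly0 mulr0 addr0.
exists (y * (b + e) + (q \Po b)); rewrite !comp_poly_MXaddC hy; ring.
Qed.

(** Suslin's ideal: these c form an ideal of Q, so that 1 belongs to it as soon as no
    residue field of Q kills it. *)
Definition shift_ok k (v : 'rV[{poly Q}]_k) (c : Q) : Prop := forall b d,
  row_equiv (map_mx (comp_poly b) v) (map_mx (comp_poly (b + c%:P * d)) v).

Lemma shift_ok_ideal k (v : 'rV[{poly Q}]_k) : ideal_set (shift_ok v).
Proof.
split.
- by move=> b d; rewrite mul0r addr0; exact: row_equiv_refl.
- move=> c c' h h' b d; rewrite polyCD mulrDl addrA.
  exact: row_equiv_trans (h b d) (h' _ d).
- by move=> a c h b d; rewrite [a * c]mulrC polyCM -mulrA; exact: h.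
Qed.

Lemma shift_ok_equiv k (v w : 'rV[{poly Q}]_k) c :
  row_equiv v w -> shift_ok w c -> shift_ok v c.
Proof.
move=> vw h b d; apply: row_equiv_trans (row_equiv_map _ vw) _.
apply: row_equiv_trans (h b d) _; apply: row_equiv_map; exact: row_equiv_sym.
Qed.

Lemma mul_row_col2 (S : comNzRingType) (F : 'rV[S]_2) (H : 'cV[S]_2) :
  F *m H = (F 0 0 * H 0 0 + F 0 1 * H 1 0)%:M.
Proof.
apply/matrixP => i j; rewrite !ord1 !mxE big_ord_recl big_ord1 /=.
by have -> : lift ord0 ord0 = 1 :> 'I_2 by apply/val_inj.
Qed.

Lemma scalar_mx1_inj (S : comNzRingType) (a b : S) : a%:M = b%:M :> 'M_1 -> a = b.
Proof. by move=> /matrixP/(_ 0 0); rewrite !mxE. Qed.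

(** Suslin's explicit matrix.  If F H = c, F' = F + c d Y and F' (H + c d Z) = c
    for a row F of length 2, then M = 1 + d (H Y + P Z'), with P and Z'
    orthogonal to F and Z, carries F to F' and has determinant 1. *)
Lemma suslin_pair (S : idomainType) (c d : S) (F Y : 'rV[S]_2) (H Z : 'cV[S]_2) :
  c != 0 -> F *m H = c%:M -> (F + (c * d) *: Y) *m (H + (c * d) *: Z) = c%:M ->
  exists M : 'M[S]_2, \det M = 1 /\ F *m M = F + (c * d) *: Y.
Proof.
move=> c0 FHm.
pose P : 'cV[S]_2 := \col_i (if i == 0 then F 0 1 else - F 0 0).
pose Z' : 'rV[S]_2 := \row_i (if i == 0 then Z 1 0 else - Z 0 0).
have FH := FHm; move: FH; rewrite mul_row_col2 => /scalar_mx1_inj FH.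
rewrite mul_row_col2 !mxE => /scalar_mx1_inj FH'.
exists (1%:M + d *: (H *m Y + P *m Z')); split; last first.
  rewrite mulmxDr mulmx1 -scalemxAr mulmxDr !mulmxA FHm.
  have -> : F *m P = 0.
    rewrite mul_row_col2 !mxE /= mulrN [F 0 1 * _]mulrC subrr.
    by apply/matrixP => i j; rewrite !mxE mul0rn.
  by rewrite mul0mx addr0 mul_scalar_mx scalerA mulrC.
rewrite (expand_det_row _ 0) big_ord_recl big_ord1 /cofactor /= !det_mx11 !mxE.
rewrite !big_ord1 !mxE /=.
have -> : lift ord0 ord0 = 1 :> 'I_2 by apply/val_inj.
have -> : lift (1 : 'I_2) (0 : 'I_1) = 0 :> 'I_2 by apply/val_inj.
rewrite -?[ord0]/(0 : 'I_2) -?[ord0]/(0 : 'I_1) -?[(0 + bump 0 0)%N]/1%N expr1.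
rewrite -?[(0 + 0)%N]/0%N expr0.
have hS : d * (Y 0 0 * H 0 0 + Y 0 1 * H 1 0 + F 0 0 * Z 0 0 + F 0 1 * Z 1 0
    + c * d * (Y 0 0 * Z 0 0 + Y 0 1 * Z 1 0)) = 0.
  apply: (mulfI c0); rewrite mulr0.
  transitivity ((F 0 0 + c * d * Y 0 0) * (H 0 0 + c * d * Z 0 0) +
    (F 0 1 + c * d * Y 0 1) * (H 1 0 + c * d * Z 1 0)
    - (F 0 0 * H 0 0 + F 0 1 * H 1 0)); first by ring.
  by rewrite FH' FH subrr.
rewrite -[RHS]addr0 -hS -FH; ring.
Qed.

Lemma shift_ok_pair k (v2 : 'rV[{poly Q}]_2) (v' : 'rV[{poly Q}]_k) (h : 'cV_2) c :
  v2 *m h = (c%:P)%:M -> shift_ok (row_mx v2 v') c.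
Proof.
move=> vh b d.
have [->|c0] := eqVneq c 0; first by rewrite mul0r addr0; exact: row_equiv_refl.
have diff m n (A : 'M[{poly Q}]_(m, n)) : exists Y,
    map_mx (comp_poly (b + c%:P * d)) A = map_mx (comp_poly b) A + (c%:P * d) *: Y.
  have [Y hY] : exists Y : 'I_m -> 'I_n -> {poly Q}, forall i j,
      A i j \Po (b + c%:P * d) = A i j \Po b + c%:P * d * Y i j.
    have [Y hY] := choice (fun ij : 'I_m * 'I_n => comp_poly_diff (A ij.1 ij.2) b (c%:P * d)).
    by exists (fun i j => Y (i, j)) => i j; rewrite (hY (i, j)).
  by exists (\matrix_(i, j) Y i j); apply/matrixP => i j; rewrite !mxE hY.
have [Y hY] := diff _ _ v2; have [Z hZ] := diff _ _ h; have [y hy] := diff _ _ v'.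
have c0' : c%:P != 0 :> {poly Q} by rewrite polyC_eq0.
have FH : map_mx (comp_poly b) v2 *m map_mx (comp_poly b) h = (c%:P)%:M.
  by rewrite -map_mxM vh map_scalar_mx /= comp_polyC.
have [|M [detM FM]] := @suslin_pair _ c%:P d _ Y _ Z c0' FH.
  by rewrite -hY -hZ -map_mxM vh map_scalar_mx /= comp_polyC.
pose g := block_mx M (map_mx (comp_poly b) h *m (d *: y)) 0 1%:M.
have [|g' gg] := @det1_inv _ _ g; first by rewrite det_ublock detM det1 mulr1.
exists g, g'; split=> //; rewrite !map_row_mx /g mul_row_block mulmx0 addr0 FM.
by rewrite mulmxA FH mulmx1 mul_scalar_mx scalerA hY hy [X in row_mx _ X]addrC.
Qed.

(** If f0 is monic and f0, w generate the unit ideal over the residue field k, then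
    Q[X]/(f0, w) is a finite Q-module that vanishes over k; the determinant trick
    yields an element of Q annihilating it that is nonzero in k. *)
Lemma monic_nakayama (k : fieldType) (phi : {rmorphism Q -> k}) (f0 w : {poly Q}) :
  (forall y, exists x, phi x = y) -> f0 \is monic ->
  coprimep (map_poly phi f0) (map_poly phi w) ->
  exists c, phi c = 1 /\ exists a b, c%:P = a * f0 + b * w.
Proof.
move=> sphi mf cop.
have lift_poly (q : {poly k}) : exists q', map_poly phi q' = q.
  have [s hs] := choice sphi.
  exists (\poly_(i < size q) s q`_i); apply/polyP => i.
  rewrite coef_map coef_poly; case: ltnP => [_|h]; first exact: hs.
  by rewrite (nth_default 0 h); exact: rmorph0.
have [u [u' e]] : exists u u', u * map_poly phi f0 + u' * map_poly phi w = 1.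
  have := Bezout_eq1_coprimepP _ _ cop.
  by move=> [[u u'] /= e]; exists u, u'.
have [U hU] := lift_poly u; have [U' hU'] := lift_poly u'.
pose mu := 1 - (U * f0 + U' * w).
have hmu : map_poly phi mu = 0.
  by rewrite /mu rmorphB rmorph1 rmorphD !rmorphM /= hU hU' e subrr.
have mpf : map_poly phi f0 \is monic by exact: monic_map.
have rem0 q : map_poly phi q = 0 -> map_poly phi (rmodp q f0) = 0.
  move=> q0; have := congr1 (map_poly phi) (rdivp_eq mf q).
  rewrite q0 rmorphD rmorphM /= => /eqP; rewrite eq_sym addr_eq0 => /eqP h.
  have sz : (size (map_poly phi (rmodp q f0)) < size (map_poly phi f0))%N.
    apply: leq_ltn_trans (size_poly _ _) _.
    by rewrite size_map_poly_id0 ?(monicP mf) ?rmorph1 ?oner_eq0 //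
       ltn_rmodpN0 // monic_neq0.
  have [d0|d0] := eqVneq (map_poly phi (rdivp q f0)) 0.
    by move: h; rewrite d0 mul0r => /eqP; rewrite eq_sym oppr_eq0 => /eqP.
  move: sz; rewrite -[map_poly phi (rmodp q f0)]opprK size_polyN -h.
  rewrite size_Mmonic //; move: d0; rewrite -size_poly_gt0.
  by case: (size _) => // m _; rewrite addSn /= ltnNge leq_addl.
set s := (size f0).-1; have sE : size f0 = s.+1.
  by rewrite /s prednK // size_poly_gt0 monic_neq0.
case: (posnP s) => [s0|sp].
  have f1 : f0 = 1.
    have : size f0 = 1%N by rewrite sE s0.
    move=> /eqP/size_poly1P [x x0 ex]; move: mf; rewrite ex monicE lead_coefC.
    by move=> /eqP ->.
  by exists 1; split; [rewrite rmorph1 | exists 1, 0; rewrite f1 mul0r addr0 mulr1].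
pose r i := rmodp ('X^i * mu) f0.
have hr i : 'X^i = ('X^i * U + rdivp ('X^i * mu) f0) * f0 + ('X^i * U') * w + r i.
  have := rdivp_eq mf ('X^i * mu); rewrite -/(r i) => h.
  transitivity ('X^i * (U * f0 + U' * w) + 'X^i * mu); first by rewrite /mu; ring.
  by rewrite {1}h; ring.
pose N : 'M[Q]_s := 1%:M - \matrix_(i, j) (r i)`_j.
pose xv : 'cV[{poly Q}]_s := \col_i 'X^i.
(* N is congruent to 1 modulo the kernel of phi and carries the powers of X into
   the ideal of f0 and w *)
exists (\det N); split.
  rewrite -det_map_mx /=; suff -> : map_mx phi N = 1%:M by rewrite det1.
  apply/matrixP => i j; rewrite !mxE rmorphB rmorph_nat.
  rewrite -coef_map (rem0 _ _) ?coef0 ?subr0 //.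
  by rewrite rmorphM /= hmu mulr0.
pose A : 'cV[{poly Q}]_s := \col_i ('X^i * U + rdivp ('X^i * mu) f0).
pose A' : 'cV[{poly Q}]_s := \col_i ('X^i * U').
have key : map_mx polyC N *m xv = f0 *: A + w *: A'.
  apply/colP => i; rewrite !mxE (eq_bigr (fun j : 'I_s => (i == j)%:R * 'X^j
     - (r i)`_j *: 'X^j)); last first.
    by move=> j _; rewrite !mxE polyCB mulrBl polyC_natr mul_polyC.
  rewrite sumrB (bigD1 i) //= eqxx mul1r big1 ?addr0; last first.
    by move=> j /negPf; rewrite eq_sym => ->; rewrite mul0r.
  have -> : \sum_(j < s) (r i)`_j *: 'X^j = r i.
    rewrite -poly_def; apply/polyP => j; rewrite coef_poly; case: ltnP => // h.
    rewrite nth_default // (leq_trans _ h) // -ltnS -sE.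
    by rewrite ltn_rmodpN0 // monic_neq0.
  by rewrite {1}(hr i); ring.
pose B := map_mx polyC (\adj N).
have h0 : (\det N)%:P = (B *m (f0 *: A + w *: A')) (Ordinal sp) 0.
  rewrite -key mulmxA /B -map_mxM mul_adj_mx map_scalar_mx mul_scalar_mx !mxE /=.
  by rewrite expr0 mulr1.
exists ((B *m A) (Ordinal sp) 0), ((B *m A') (Ordinal sp) 0).
by rewrite h0 mulmxDr -!scalemxAr !mxE mulrC [w * _]mulrC.
Qed.

(** If Suslin's ideal were proper, it would vanish in some residue field k. Over k the
    stable range argument makes the first two entries coprime after adding multiples of
    the others; as the first one is monic, coprimality lifts to an element c that is
    nonzero in k and a combination of the two entries, and such a c lies in the ideal. *)
Lemma suslin_shift k (v : 'rV[{poly Q}]_k.+2) (z : 'cV_k.+2) :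
  v *m z = 1%:M -> v 0 0 \is monic -> shift_ok v 1.
Proof.
move=> vz mf; apply: contrapT => J1.
have [kf [phi [sphi phi0]]] := ideal_residue (shift_ok_ideal v) J1.
pose v2 := lsubmx (v : 'rV_(2 + k)); pose v' := rsubmx (v : 'rV_(2 + k)).
pose z2 := usubmx (z : 'cV_(2 + k)); pose z' := dsubmx (z : 'cV_(2 + k)).
have vE : v = row_mx v2 v' by rewrite hsubmxK.
have zE : z = col_mx z2 z' by rewrite vsubmxK.
have v20 : v2 0 0 = v 0 0 by rewrite mxE; congr (v _ _); apply/val_inj.
pose f2 := (v' *m z') 0 0.
have e : z2 0 0 * v2 0 0 + z2 1 0 * v2 0 1 + f2 = 1.
  have : (v : 'rV_(2 + k)) *m (z : 'cV_(2 + k)) = 1%:M := vz.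
  rewrite vE zE mul_row_col => /(congr1 (fun M : 'M_1 => M 0 0)).
  rewrite 2!mxE big_ord_recl big_ord1 [RHS]mxE eqxx mulr1n => <-.
  have -> : lift ord0 ord0 = 1 :> 'I_2 by apply/val_inj.
  by rewrite -[ord0]/(0 : 'I_2) [v2 0 0 * _]mulrC [v2 0 1 * _]mulrC.
have [||g cop] := @stable_range_poly kf (map_poly phi (v2 0 0)) (map_poly phi (v2 0 1))
   (map_poly phi f2) (map_poly phi (z2 0 0)) (map_poly phi (z2 1 0)).
- by rewrite monic_neq0 // monic_map // v20.
- by rewrite -!rmorphM -!rmorphD /= e rmorph1.
have [G hG] : exists G, map_poly phi G = g.
  have [s hs] := choice sphi.
  exists (\poly_(i < size g) s g`_i); apply/polyP => i.
  rewrite coef_map coef_poly; case: ltnP => [_|h]; first exact: hs.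
  by rewrite (nth_default 0 h); exact: rmorph0.
have mf2 : v2 0 0 \is monic by rewrite v20.
have [|c [c1 [a [b cE]]]] := @monic_nakayama kf phi (v2 0 0) (v2 0 1 + G * f2) sphi mf2.
  by rewrite rmorphD rmorphM /= hG.
suff : phi c = 0 by move/eqP; rewrite c1 oner_eq0.
apply: phi0.
pose E : 'M[{poly Q}]_(2 + k) := block_mx 1%:M 0 ((G *: z') *m delta_mx 0 1) 1%:M.
have [|E' EE] := @det1_inv _ _ E; first by rewrite det_lblock !det1 mulr1.
apply: (@shift_ok_equiv _ _ (v *m E)); first by exists E, E'.
have -> : v *m E = row_mx (v2 + v' *m ((G *: z') *m delta_mx 0 1)) v'.
  have h : row_mx v2 v' *m E = row_mx (v2 + v' *m ((G *: z') *m delta_mx 0 1)) v'.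
    by rewrite mul_row_block !mulmx1 mulmx0 add0r.
  by rewrite -h -vE.
apply: (@shift_ok_pair _ _ _ (\col_i (if i == 0 then a else b))).
have vv : v' *m ((G *: z') *m delta_mx 0 1) = (G * f2)%:M *m delta_mx 0 1 :> 'rV_2.
  rewrite mulmxA -scalemxAr [v' *m z']mx11_scalar scale_scalar_mx.
  by [].
rewrite vv mul_row_col2 mul_scalar_mx !mxE cE /=; congr (_%:M).
rewrite ![v2 _ _]mxE; ring.
Qed.

(** A shift of X by -X, allowed by the previous lemma, replaces the row by its value at
    X = 0, which has entries in Q. *)
Lemma suslin_monic k (v : 'rV[{poly Q}]_k.+1) (z : 'cV_k.+1) : hermite Q ->
  v *m z = 1%:M -> v 0 0 \is monic -> row_equiv v (delta_mx 0 0).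
Proof.
case: k v z => [|k] v z hQ vz mf.
  exists z, v; rewrite vz (mulmx1C vz); split=> //.
  by apply/matrixP => i j; rewrite !ord1 !mxE.
have h := suslin_shift vz mf 'X (- 'X).
move: h; rewrite mul1r subrr.
have -> : map_mx (comp_poly 'X) v = v.
  by apply/matrixP => i j; rewrite mxE comp_polyXr.
move=> h; apply: row_equiv_trans h _.
pose ev (q : {poly Q}) := q.[0].
have -> : map_mx (comp_poly 0) v = map_mx polyC (map_mx (horner_eval 0) v).
  by apply/matrixP => i j; rewrite !mxE comp_poly0r /horner_eval horner_coef0.
have [|g [g' [gg hg]]] := hQ _ (map_mx (horner_eval 0) v) (map_mx (horner_eval 0) z).
  by rewrite -map_mxM vz map_mx1.
exists (map_mx polyC g), (map_mx polyC g'); rewrite -!map_mxM gg map_mx1 hg; split=> //.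
by apply/matrixP => i j; rewrite !mxE; case: (_ && _).
Qed.
End Suslin.

(** * Projective modules over rings with Weierstrass division *)

(** The division property says that the quotient B/w(x) is free over R' with basis 1,
    x, ..., x^(deg w - 1). *)
Definition weierstrass (B R' : idomainType) (iota : {rmorphism R' -> B}) (x : B)
    (w : {poly R'}) : Prop :=
  [/\ w \is monic,
     forall b, exists q (r : {poly R'}), (size r < size w)%N /\
       b = q * (map_poly iota w).[x] + (map_poly iota r).[x] &
     forall q (r : {poly R'}), (size r < size w)%N ->
       q * (map_poly iota w).[x] + (map_poly iota r).[x] = 0 -> q = 0 /\ r = 0].

(** Rings in which, in suitable coordinates, every nonzero element becomes a monic
    polynomial up to a unit.  Tate algebras have this property by the Weierstrass
    preparation theorem. *)
Fixpoint weierstrass_ring n (B : idomainType) : Prop :=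
  if n is n'.+1 then
    forall f : B, f != 0 -> exists (R' : idomainType) (iota : {rmorphism R' -> B})
       (x : B) (w : {poly R'}) (u : B),
       [/\ weierstrass_ring n' R', weierstrass iota x w, u \is a GRing.unit &
           f * u = (map_poly iota w).[x]]
  else forall f : B, f != 0 -> f \is a GRing.unit.

Lemma fraction_numden (B : idomainType) (y : {fraction B}) : exists n d : B,
  d != 0 /\ y * FracField.tofrac d = FracField.tofrac n.
Proof.
elim/quotW: y => y; exists (\n_y), (\d_y); split; first exact: denom_ratioP.
rewrite !piE; apply/eqmodP; rewrite /= /FracField.equivf /FracField.mulf /=.
by rewrite !numden_Ratio ?mulf_neq0 ?denom_ratioP ?oner_eq0 // !mulr1 mulrC.
Qed.

Lemma clear_denominators (B : idomainType) m n (M : 'M[{fraction B}]_(m, n)) :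
  exists (d : B) (M' : 'M[B]_(m, n)), d != 0 /\
  map_mx (@FracField.tofrac B) M' = FracField.tofrac d *: M.
Proof.
have [nu hnu] := choice (fun ij : 'I_m * 'I_n => fraction_numden (M ij.1 ij.2)).
have [de hde] := choice hnu.
exists (\prod_ij de ij), (\matrix_(i, j) (nu (i, j) * \prod_(ij | ij != (i, j)) de ij)).
split; first by apply/prodf_neq0 => ij _; have [] := hde ij.
apply/matrixP => i j; rewrite !mxE tofracM -(hde (i, j)).2 /=.
by rewrite [in RHS](bigD1 (i, j)) //= tofracM [RHS]mulrC mulrA.
Qed.

Lemma map_tofrac_inj (B : idomainType) m n :
  injective (map_mx (@FracField.tofrac B) : 'M_(m, n) -> _).
Proof.
move=> X Y /matrixP h; apply/matrixP => i j; apply/eqP.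
by rewrite -tofrac_eq; have := h i j; rewrite !mxE => ->.
Qed.

(** The rank factorization of e over the fraction field, with denominators cleared. *)
Lemma generically_free (B : idomainType) N (e : 'M[B]_N) : e *m e = e ->
  exists r (U : 'M[B]_(N, r)) (V : 'M[B]_(r, N)) f,
    [/\ f != 0, U *m V = f *: e, V *m U = f%:M, e *m U = U & V *m e = V].
Proof.
move=> ee; pose tf := @FracField.tofrac B.
pose E := map_mx tf e; have EE : E *m E = E by rewrite -map_mxM ee.
pose C := col_base E; pose D := row_base E.
have CD : C *m D = E by exact: mulmx_base.
have DC : D *m C = 1%:M.
  apply: (row_full_inj (col_base_full E)); apply: (row_free_inj (row_base_free E)).
  by rewrite -/C -/D /= mulmx1 mulmxA -mulmxA CD.
have EC : E *m C = C by have := congr1 (mulmx^~ C) CD; rewrite /= -mulmxA DC mulmx1.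
have DE : D *m E = D by have := congr1 (mulmx D) CD; rewrite /= mulmxA DC mul1mx.
have [d [U [d0 hU]]] := clear_denominators C.
have [d' [V [d0' hV]]] := clear_denominators D.
exists (\rank E), U, V, (d * d'); split; first by rewrite mulf_neq0.
- apply: map_tofrac_inj; rewrite map_mxM hU hV map_mxZ rmorphM /=.
  by rewrite -scalemxAl -scalemxAr scalerA CD.
- apply: map_tofrac_inj; rewrite map_mxM hU hV map_scalar_mx /= rmorphM /=.
  by rewrite -scalemxAl -scalemxAr scalerA DC scalemx1 mulrC.
- by apply: map_tofrac_inj; rewrite map_mxM hU -scalemxAr EC.
- by apply: map_tofrac_inj; rewrite map_mxM hV -scalemxAl DE.
Qed.

Lemma col_mul (Q : pzSemiRingType) m n p (A : 'M[Q]_(m, n)) (M : 'M[Q]_(n, p)) j :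
  col j (A *m M) = A *m col j M.
Proof. by rewrite !colE mulmxA. Qed.

Lemma linear_rows (Q : comNzRingType) m n (F : 'rV[Q]_m -> 'rV[Q]_n) :
  (forall u v, F (u + v) = F u + F v) -> (forall c u, F (c *: u) = c *: F u) ->
  exists E, forall u, F u = u *m E.
Proof.
move=> FD FZ; have F0 : F 0 = 0 by rewrite -(scale0r 0) FZ scale0r.
exists (\matrix_i F (delta_mx 0 i)) => u.
rewrite {1}(row_sum_delta u) (big_morph F FD F0) mulmx_sum_row.
by apply: eq_bigr => i _; rewrite FZ rowK.
Qed.

Section StablyFree.
Variables (B R' : idomainType) (iota : {rmorphism R' -> B}) (x : B) (w : {poly R'}).
Hypothesis hw : weierstrass iota x w.
Local Notation ev p := (map_poly iota p).[x].

Lemma evD p q : ev (p + q) = ev p + ev q. Proof. by rewrite rmorphD hornerD. Qed.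
Lemma evZ c p : ev (c *: p) = iota c * ev p. Proof. by rewrite map_polyZ hornerZ. Qed.
Lemma ev0 : ev 0 = 0. Proof. by rewrite rmorph0 horner0. Qed.

Lemma weier_neq0 : ev w != 0.
Proof.
have [mw _ u] := hw; apply/eqP => e0.
have [||/eqP] := u 1 0; last by rewrite oner_eq0.
- by rewrite size_poly0 size_poly_gt0 monic_neq0.
- by rewrite mul1r e0 ev0 addr0.
Qed.

Lemma weier_maps : exists (wq : B -> B) (wr : B -> {poly R'}),
  [/\ forall b, (size (wr b) < size w)%N, forall b, b = wq b * ev w + ev (wr b),
      forall b (r : {poly R'}), (size r < size w)%N -> wq (b * ev w + ev r) = b /\
                                        wr (b * ev w + ev r) = r,
      forall b c, wq (b + c) = wq b + wq c /\ wr (b + c) = wr b + wr c &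
      forall k b, wq (iota k * b) = iota k * wq b /\ wr (iota k * b) = k *: wr b].
Proof.
have [mw ex un] := hw; have [wq h] := choice ex; have [wr hr] := choice h.
have s b := (hr b).1; have e b := (hr b).2.
have uniq b (r : {poly R'}) : (size r < size w)%N -> wq (b * ev w + ev r) = b /\
    wr (b * ev w + ev r) = r.
  move=> sr; set c := _ + _; have := e c; rewrite {1}/c => /eqP.
  rewrite -subr_eq0 => /eqP h0.
  have [||/eqP h1 /eqP h2] := un (b - wq c) (r - wr c).
  - by apply: leq_ltn_trans (size_polyD _ _) _; rewrite gtn_max sr size_polyN s.
  - rewrite -[RHS]h0 -[r - _]/(r + - wr c) evD rmorphN hornerN; ring.
  - by rewrite subr_eq0 in h1; rewrite subr_eq0 in h2; rewrite (eqP h1) -(eqP h2).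
exists wq, wr; split=> //.
- move=> b c; rewrite {1 3}(e b) {1 3}(e c) addrACA -mulrDl -evD; apply: uniq.
  by apply: leq_ltn_trans (size_polyD _ _) _; rewrite gtn_max !s.
- move=> k b; rewrite {1 3}(e b) mulrDr mulrA -evZ; apply: uniq.
  by apply: leq_ltn_trans (size_scale_leq _ _) _.
Qed.

(** With V U = w(x), let C be the cokernel of V on the module eB^N.  The map
    y - V q(U y), where q is the quotient of the Weierstrass division by w(x), is
    R'-linear, kills the image of V and is the identity modulo it.  It exhibits C as
    a direct summand of the free R'-module (B/w(x))^r; so C is free over R', with
    coordinates beta and section alpha. *)
Lemma cokernel_free N r (e : 'M[B]_N) (U : 'M[B]_(N, r)) (V : 'M[B]_(r, N)) :
  projective_free R' -> U *m V = ev w *: e -> V *m U = (ev w)%:M -> V *m e = V ->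
  exists d (beta : 'cV[B]_r -> 'rV[R']_d) (alpha : 'rV[R']_d -> 'cV[B]_r),
  [/\ forall y z, beta (y + z) = beta y + beta z,
      forall y, beta y = 0 <-> exists z, y = V *m z,
      forall c, beta (alpha c) = c,
      forall c c', alpha (c + c') = alpha c + alpha c' &
      forall k c, alpha (k *: c) = iota k *: alpha c].
Proof.
move=> pf UV VU Ve.
have [wq [wr [ws we wu wD wZ]]] := weier_maps.
pose qm m (y : 'cV[B]_m) := map_mx wq y.
have qD m (y z : 'cV[B]_m) : qm m (y + z) = qm m y + qm m z.
  by apply/matrixP => i j; rewrite !mxE (wD _ _).1.
have qZ m k (y : 'cV[B]_m) : qm m (iota k *: y) = iota k *: qm m y.
  by apply/matrixP => i j; rewrite !mxE (wZ _ _).1.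
have w0 : (size (0%R : {poly R'}) < size w)%N.
  by have [mw _ _] := hw; rewrite size_poly0 size_poly_gt0 monic_neq0.
have qw m (y : 'cV[B]_m) : qm m (ev w *: y) = y.
  by apply/matrixP => i j; rewrite !mxE; have [] := wu (y i j) 0 w0;
    rewrite ev0 addr0 mulrC.
pose sg (y : 'cV[B]_r) := y - V *m qm _ (U *m y).
have sgD y z : sg (y + z) = sg y + sg z.
  by rewrite /sg mulmxDr qD mulmxDr opprD addrACA.
have sgZ k y : sg (iota k *: y) = iota k *: sg y.
  by rewrite /sg -scalemxAr qZ -scalemxAr scalerBr.
have sgV z : sg (V *m z) = 0.
  by rewrite /sg mulmxA UV -scalemxAl qw mulmxA Ve subrr.
have sgsg y : sg (sg y) = sg y.
  by rewrite {2}/sg -[V *m _]opprK -mulmxN opprK sgD sgV addr0.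
pose s := (size w).-1.
have sE : size w = s.+1 by rewrite /s prednK // (leq_ltn_trans _ w0).
pose co (y : 'cV[B]_r) : 'M[R']_(r, s) := \matrix_(i, j) (wr (y i 0))`_j.
pose un (m : 'M[R']_(r, s)) : 'cV[B]_r := \col_i ev (\poly_(j < s) (if insub j is Some j' then m i j' else 0)).
have polyE (p : {poly R'}) : (size p < size w)%N -> \poly_(j < s) p`_j = p.
  rewrite sE ltnS => sp; apply/polyP => j; rewrite coef_poly; case: ltnP => // h.
  by rewrite nth_default // (leq_trans sp).
have yE y : y = ev w *: qm _ y + un (co y).
  apply/colP => i; rewrite !mxE {1}(we (y i 0)) mulrC; congr (_ + (map_poly iota _).[x]).
  rewrite -[LHS]polyE //; apply/polyP => j; rewrite !coef_poly; case: ltnP => // hj.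
  by rewrite insubT mxE.
have coD y z : co (y + z) = co y + co z.
  by apply/matrixP => i j; rewrite !mxE (wD _ _).2 coefD.
have coZ k y : co (iota k *: y) = k *: co y.
  by apply/matrixP => i j; rewrite !mxE (wZ _ _).2 coefZ.
have unD m m' : un (m + m') = un m + un m'.
  apply/colP => i; rewrite !mxE -evD; congr (map_poly iota _).[x]; apply/polyP => j.
  rewrite coefD !coef_poly; case: ltnP => h; last by rewrite addr0.
  by rewrite insubT mxE.
have unZ k m : un (k *: m) = iota k *: un m.
  apply/colP => i; rewrite !mxE -evZ; congr (map_poly iota _).[x]; apply/polyP => j.
  rewrite coefZ !coef_poly; case: ltnP => h; last by rewrite mulr0.
  by rewrite insubT mxE.
have sgw y : sg (ev w *: y) = 0.
  by rewrite -[y]mul1mx scalemxAl scalemx1 -VU -mulmxA sgV.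
have sgE y : sg y = sg (un (co y)) by rewrite {1}(yE y) sgD sgw add0r.
pose F (u : 'rV[R']_(r * s)) := mxvec (co (sg (un (vec_mx u)))).
have [||E hE] := @linear_rows _ _ _ F.
- by move=> u v; rewrite /F !linearD unD sgD coD linearD.
- by move=> c u; rewrite /F linearZ unZ sgZ coZ linearZ.
have FF u : F (F u) = F u by rewrite /F mxvecK -sgE sgsg.
have EE : E *m E = E.
  apply/row_matrixP => i; rewrite !rowE -!hE -[in RHS]FF.
  by rewrite [F (F _)]hE [F _]hE mulmxA.
have [d [U' [V' [UV' VU']]]] := pf _ E EE.
have FE y : mxvec (co (sg y)) = F (mxvec (co y)) by rewrite /F mxvecK -sgE.
exists d, (fun y => mxvec (co (sg y)) *m U'), (fun c => un (vec_mx (c *m V'))).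
split.
- by move=> y z; rewrite sgD coD linearD mulmxDl.
- move=> y; split; last first.
    move=> [z ->]; rewrite sgV; suff -> : co 0 = 0 by rewrite linear0 mul0mx.
    by rewrite -(scale0r 0) -(rmorph0 iota) coZ scale0r.
  move=> h; have c0 : co (sg y) = 0.
    apply: (can_inj mxvecK); rewrite [RHS]linear0 FE -FF [LHS]hE -UV' mulmxA -FE h.
    by rewrite mul0mx.
  have un0 : un 0 = 0 by rewrite -(scale0r 0) unZ rmorph0 scale0r.
  have := yE (sg y); rewrite c0 un0 addr0 {1}/sg => /eqP; rewrite subr_eq => /eqP ->.
  exists (U *m qm _ (sg y) + qm _ (U *m y)).
  by rewrite mulmxDr mulmxA VU mul_scalar_mx.
- by move=> c; rewrite -/(F _) hE -UV' -!mulmxA VU' mulmx1 VU' mulmx1.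
- by move=> c c'; rewrite mulmxDl linearD unD.
- by move=> k c; rewrite -scalemxAl linearZ unZ.
Qed.

(** Schanuel's lemma for the two presentations of C: the cokernel of V, and, as C is
    free over R' with x acting by a matrix Theta, the cokernel of X = x - Theta on
    B^d. *)
Lemma stably_free N r (e : 'M[B]_N) (U : 'M[B]_(N, r)) (V : 'M[B]_(r, N)) :
  projective_free R' -> e *m e = e ->
  U *m V = ev w *: e -> V *m U = (ev w)%:M -> V *m e = V ->
  exists d k (G : 'M[B]_(d + N, k)) (G' : 'M[B]_(k, d + N)),
  G *m G' = block_mx 1%:M 0 0 e /\ G' *m G = 1%:M.
Proof.
move=> pf ee UV VU Ve.
have [d [be [al [beD be0 beal alD alZ]]]] := cokernel_free pf UV VU Ve.
have be00 : be 0 = 0 by apply/be0; exists 0; rewrite mulmx0.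
have beN y : be (- y) = - be y.
  by apply/eqP; rewrite -subr_eq0 opprK -beD addNr be00.
have be_eq y z : be y = be z <-> exists t, y - z = V *m t.
  split=> [h|]; first by apply/be0; rewrite beD beN h subrr.
  by move=> /be0; rewrite beD beN => /eqP; rewrite subr_eq0 => /eqP.
have beS (b : B) y : be y = 0 -> be (b *: y) = 0.
  by move=> /be0 [z ->]; apply/be0; exists (b *: z); rewrite -scalemxAr.
have al0 : al 0 = 0 by rewrite -(scale0r 0) alZ rmorph0 scale0r.
(* a lifts the generators of C to B^r *)
pose a : 'M[B]_(r, d) := \matrix_(i, j) (al (delta_mx 0 j)) i 0.
have aE (c : 'rV[R']_d) : a *m (map_mx iota c)^T = al c.
  rewrite {2}(row_sum_delta c) (big_morph al alD al0).
  apply/colP => i; rewrite !mxE summxE; apply: eq_bigr => j _.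
  by rewrite alZ !mxE mulrC.
have acol j : col j a = al (delta_mx 0 j) by apply/colP => i; rewrite !mxE.
have [||Th hTh] := @linear_rows _ _ _ (fun c => be (x *: al c)).
- by move=> c c'; rewrite alD scalerDr beD.
- have beZ k y : be (iota k *: y) = k *: be y.
    rewrite -{1}[y](subrK (al (be y))) scalerDr beD beS ?add0r; last first.
      by rewrite beD beN beal subrr.
    by rewrite -alZ beal.
  by move=> k c; rewrite alZ scalerA mulrC -scalerA beZ.
pose X : 'M[B]_d := x%:M - (map_mx iota Th)^T.
have cols m n (M : 'M[B]_(m, n)) k (L : 'M[B]_(m, k)) :
    (forall j, exists z, col j M = L *m z) -> exists H, M = L *m H.
  move=> h; have [z hz] := choice h; exists (\matrix_(i, j) z j i 0).
  apply/matrixP => i j; have := hz j => /colP /(_ i); rewrite !mxE => ->.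
  by apply: eq_bigr => l _; rewrite !mxE.
have [H0 hH0] : exists H, a *m X = V *m H.
  apply: cols => j; apply/be0.
  rewrite col_mul /X linearB /= mulmxBr beD beN.
  have -> : col j x%:M = x *: (map_mx iota (delta_mx 0 j : 'rV[R']_d))^T.
    by apply/colP => i; rewrite !mxE; case: (i == j); rewrite ?rmorph1 ?rmorph0 ?mulr1 ?mulr0.
  have -> : col j (map_mx iota Th)^T = (map_mx iota ((delta_mx 0 j : 'rV[R']_d) *m Th))^T.
    by rewrite -rowE; apply/colP => i; rewrite !mxE.
  by rewrite -scalemxAr !aE hTh beal subrr.
have beaX z : be (a *m (X *m z)) = 0.
  by rewrite mulmxA hH0 -mulmxA; apply/be0; exists (H0 *m z).
(* modulo X every vector is a constant vector *)
have cst (p : {poly R'}) (c : 'rV[R']_d) : exists z c',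
    ev p *: (map_mx iota c)^T = X *m z + (map_mx iota c')^T.
  elim/poly_ind: p => [|p k [z [c' h]]].
    by exists 0, 0; rewrite ev0 scale0r mulmx0 map_mx0 trmx0 addr0.
  exists (x *: z + (map_mx iota c')^T), (c' *m Th + k *: c).
  rewrite rmorphD rmorphM /= map_polyX map_polyC hornerMXaddC /= scalerDl mulrC.
  rewrite -scalerA h scalerDr mulmxDr -scalemxAr map_mxD map_mxM map_mxZ linearD /=.
  rewrite linearZ /= addrA; congr (_ + _); rewrite -addrA; congr (_ + _).
  by rewrite mulmxBl mul_scalar_mx trmx_mul subrK.
have [mw ex un] := hw.
have wX : exists Z, (ev w)%:M = X *m Z.
  apply: cols => j.
  have -> : col j (ev w)%:M = ev w *: (map_mx iota (delta_mx 0 j : 'rV[R']_d))^T.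
    by apply/colP => i; rewrite !mxE; case: (i == j); rewrite ?rmorph1 ?rmorph0 ?mulr1 ?mulr0.
  have [z [c' h]] := cst w (delta_mx 0 j); exists z; rewrite h.
  suff -> : c' = 0 by rewrite map_mx0 trmx0 addr0.
  rewrite -[c']beal -aE -[_^T](addKr (X *m z)) -h mulmxDr mulmxN beD beN beaX oppr0.
  rewrite add0r -scalemxAr; apply/be0; exists (U *m (a *m (map_mx iota (delta_mx 0 j))^T)).
  by rewrite mulmxA VU mul_scalar_mx.
have [Z hZ] := wX.
have Xinj n : injective (mulmx X : 'M_(d, n) -> _).
  move=> M M' h; have dX : \det X != 0.
    apply/eqP => d0; have := congr1 determinant hZ.
    rewrite det_scalar det_mulmx d0 mul0r => /eqP; rewrite expf_eq0.
    by rewrite (negPf weier_neq0) andbF.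
  apply/matrixP => i j; apply: (mulfI dX).
  have := congr1 (mulmx (\adj X)) h; rewrite !mulmxA mul_adj_mx !mul_scalar_mx.
  by move=> /matrixP /(_ i j); rewrite !mxE.
have kerX (y : 'cV[B]_d) : be (a *m y) = 0 -> exists z, y = X *m z.
  move=> h; suff [z [c' e']] : exists z c', y = X *m z + (map_mx iota c')^T.
    exists z; rewrite e'; suff -> : c' = 0 by rewrite map_mx0 trmx0 addr0.
    by move: h; rewrite e' mulmxDr beD beaX add0r aE beal.
  have -> : y = \sum_i y i 0 *: (map_mx iota (delta_mx 0 i : 'rV[R']_d))^T.
    apply/colP => i; rewrite summxE (bigD1 i) //= big1 => [|j ji]; last first.
      by rewrite !mxE eqxx eq_sym (negPf ji) rmorph0 mulr0.
    by rewrite !mxE !eqxx rmorph1 mulr1 addr0.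
  elim/big_ind: _ => [|y1 y2 [z1 [c1 h1]] [z2 [c2 h2]]|i _].
  - by exists 0, 0; rewrite mulmx0 map_mx0 trmx0 addr0.
  - exists (z1 + z2), (c1 + c2); rewrite h1 h2 mulmxDr map_mxD linearD /=.
    by rewrite addrACA.
  - have [q [rr [_ ->]]] := ex (y i 0); have [z [c' h']] := cst rr (delta_mx 0 i).
    exists (Z *m (q *: (map_mx iota (delta_mx 0 i))^T) + z), c'.
    rewrite mulmxDr mulmxA -hZ mul_scalar_mx scalerDl h' addrA; congr (_ + _ + _).
    by rewrite scalerA mulrC.
(* b lifts the generators of B^r to B^d *)
pose b : 'M[B]_(d, r) := \matrix_(i, j) iota (be (delta_mx j 0) 0 i).
have bcol j : col j b = (map_mx iota (be (delta_mx j 0)))^T.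
  by apply/colP => i; rewrite !mxE.
have [H1' hH1'] : exists H, 1%:M - a *m b = V *m H.
  apply: cols => j; apply/be0; rewrite linearB /= col_mul bcol aE beD beN beal.
  have -> : col j 1%:M = delta_mx j 0 :> 'cV[B]_r.
    by apply/colP => i; rewrite !mxE eqxx andbT.
  by rewrite subrr.
have be1 y : be (a *m (b *m y)) = be y.
  apply/esym/be_eq; exists (H1' *m y); rewrite [RHS]mulmxA -hH1' mulmxBl mul1mx.
  by rewrite mulmxA.
have [H2 hH2] : exists H, b *m V = X *m H.
  apply: cols => j; apply: kerX; rewrite col_mul be1; apply/be0.
  by exists (delta_mx j 0); rewrite colE.
have [H3 hH3] : exists H, 1%:M - b *m a = X *m H.
  apply: cols => j; apply: kerX; rewrite linearB /= mulmxBr col_mul beD beN be1.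
  by rewrite !colE mul1mx subrr.
have Vinj n (M M' : 'M[B]_(N, n)) : V *m M = V *m M' -> e *m M = e *m M'.
  move=> h; apply/matrixP => i j; apply: (mulfI weier_neq0).
  have := congr1 (mulmx U) h; rewrite !mulmxA UV -!scalemxAl.
  by move=> /matrixP /(_ i j); rewrite !mxE.
pose K1 := e *m H1'; pose K0 := e *m H0.
have hK1 : V *m K1 = 1%:M - a *m b by rewrite mulmxA Ve.
have hK0 : V *m K0 = a *m X by rewrite mulmxA Ve.
have eK1 : e *m K1 = K1 by rewrite mulmxA ee.
have eK0 : e *m K0 = K0 by rewrite mulmxA ee.
clearbody K1 K0.
exists d, (d + r)%N, (block_mx X b (- K0) K1), (block_mx H3 (- H2) a V).
rewrite !mulmx_block; split.
- congr block_mx.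
  + by rewrite -hH3 subrK.
  + by rewrite mulmxN -hH2 addNr.
  + rewrite -eK0 -eK1 mulNmx -!mulmxA -mulmxN -mulmxDr -[RHS](mulmx0 _ e).
    apply: Vinj; rewrite mulmx0 mulmxDr mulmxN !mulmxA hK0 hK1 -mulmxA -hH3.
    by rewrite mulmxBl mulmxBr mul1mx mulmx1 mulmxA addNr.
  + rewrite -eK0 -eK1 mulNmx mulmxN opprK -!mulmxA -mulmxDr -[RHS]mulmx1.
    apply: Vinj; rewrite mulmx1 mulmxDr !mulmxA hK0 hK1 -mulmxA -hH2.
    by rewrite mulmxBl mul1mx mulmxA addrC subrK.
- rewrite [RHS]scalar_mx_block; congr block_mx.
  + apply: Xinj; rewrite mulNmx mulmxN opprK mulmxDr !mulmxA -hH3 -hH2 mulmx1.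
    by rewrite -[_ *m V *m _]mulmxA hK0 mulmxBl mul1mx mulmxA subrK.
  + apply: Xinj; rewrite mulNmx mulmxDr mulmxN !mulmxA -hH3 -hH2 mulmx0.
    rewrite -[_ *m V *m _]mulmxA hK1 mulmxBl mulmxBr mul1mx mulmx1 mulmxA.
    by rewrite subrr.
  + by rewrite mulmxN hK0 subrr.
  + by rewrite hK1 addrC subrK.
Qed.

(** Up to a unit the first entry is a monic polynomial, and the others may be reduced
    modulo it to polynomials; so Suslin's theorem applies. *)
Lemma hermite_weierstrass k (v : 'rV[B]_k.+1) (z : 'cV_k.+1) u : hermite R' ->
  u \is a GRing.unit -> v 0 0 * u = ev w -> v *m z = 1%:M ->
  row_equiv v (delta_mx 0 0).
Proof.
move=> hR uu vu vz; have [mw ex un] := hw.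
pose evm := horner_eval x \o map_poly iota.
pose v' : 'rV_k := rsubmx (v : 'rV_(1 + k)).
have vE : v = row_mx (v 0 0)%:M v'.
  transitivity (row_mx (lsubmx (v : 'rV_(1 + k))) v'); first by rewrite hsubmxK.
  suff -> : lsubmx (v : 'rV_(1 + k)) = (v 0 0)%:M by [].
  by apply/matrixP => i j; rewrite !ord1 !mxE eqxx; congr (v _ _); apply/val_inj.
have [q hq] := choice (fun j => ex (v' 0 j)); have [p hp] := choice hq.
pose vp : 'rV[{poly R'}]_(1 + k) := row_mx w%:M (\row_j p j).
have v_vp : row_equiv v (map_mx evm vp).
  pose g1 : 'M_(1 + k) := block_mx u%:M 0 0 1%:M.
  pose g1' : 'M_(1 + k) := block_mx (u^-1)%:M 0 0 1%:M.
  pose g2 : 'M_(1 + k) := block_mx 1%:M (- \row_j q j) 0 1%:M.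
  pose g2' : 'M_(1 + k) := block_mx 1%:M (\row_j q j) 0 1%:M.
  have gg1 : g1 *m g1' = 1%:M.
    rewrite mulmx_block !mulmx1 !mul0mx !mulmx0 !add0r !addr0.
    by rewrite -scalar_mxM mulrV // -scalar_mx_block.
  have gg2 : g2 *m g2' = 1%:M.
    rewrite mulmx_block !mul1mx !mulmx1 !mul0mx !mulmx0 !add0r !addr0 addrN.
    by rewrite -scalar_mx_block.
  exists (g1 *m g2), (g2' *m g1'); split.
    by rewrite mulmxA -[_ *m _ *m g2']mulmxA gg2 mulmx1.
  have -> : v *m (g1 *m g2) = row_mx (v 0 0)%:M v' *m (g1 *m g2) by rewrite -vE.
  rewrite mulmxA !mul_row_block !mulmx1 !mulmx0 !addr0 add0r -scalar_mxM vu.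
  have -> : map_mx evm vp = row_mx (ev w)%:M (\row_j ev (p j)).
    rewrite map_row_mx map_scalar_mx; congr row_mx.
    by apply/rowP => j; rewrite !mxE.
  suff -> : (ev w)%:M *m - (\row_j q j) + v' = \row_j ev (p j) by [].
  apply/rowP => j; rewrite mul_scalar_mx; have := (hp j).2; rewrite !mxE => ->.
  by rewrite mulrN mulrC addKr.
have [z' hz'] : exists z', map_mx evm vp *m z' = 1%:M.
  have [g [g' [gg <-]]] := v_vp; exists (g' *m z).
  by rewrite -mulmxA [g *m _]mulmxA gg mul1mx.
apply: row_equiv_trans v_vp _.
suff [zp hzp] : exists zp, vp *m zp = 1%:M.
  have vp0 : vp 0 0 = w.
    rewrite mxE; case: splitP => [i|i] //= _.
    by rewrite (ord1 i) mxE eqxx.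
  have h := suslin_monic hR hzp; rewrite vp0 in h.
  have := row_equiv_map evm (h mw); congr row_equiv.
  by apply/matrixP => i j; rewrite !mxE; case: (_ && _); rewrite ?rmorph1 ?rmorph0.
have [sw|sw] := leqP (size w) 1.
  have w1 : w = 1.
    have : size w = 1%N.
      by apply/eqP; rewrite eqn_leq sw size_poly_gt0 monic_neq0.
    by move=> /eqP/size_poly1P [y _ e]; move: mw; rewrite e monicE lead_coefC => /eqP ->.
  exists (col_mx 1%:M 0); rewrite mul_row_col mulmx0 addr0 w1 mulmx1.
  by [].
have [qz hqz] := choice (fun j => ex (dsubmx (z' : 'cV_(1 + k)) j 0)).
have [s hs] := choice hqz.
pose S := \sum_j p j * s j.
have [t ht] : exists t, 1 = t * ev w + ev S.
  exists (z' 0 0 + \sum_j ev (p j) * qz j).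
  transitivity ((map_mx evm vp *m z') 0 0); first by rewrite hz' mxE eqxx.
  rewrite -[in LHS](vsubmxK (z' : 'cV_(1 + k))) map_row_mx mul_row_col mxE.
  rewrite map_scalar_mx mul_scalar_mx mulrDl -addrA !mxE; congr (_ + _).
    by rewrite mulrC; congr (z' _ _ * _); apply/val_inj.
  rewrite /S rmorph_sum horner_sum mulr_suml -big_split /=; apply: eq_bigr => j _.
  rewrite !mxE /= /horner_eval; have := (hqz j); rewrite mxE => hh.
  have := (hs j).2; rewrite mxE => ->.
  by rewrite rmorphM hornerM mulrDr mulrA.
have SE := Pdiv.RingMonic.rdivp_eq mw S.
set Q := Pdiv.CommonRing.rdivp S w in SE; set rho := Pdiv.CommonRing.rmodp S w in SE.
have [||h1 /eqP] := un (t + ev Q) (rho - 1).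
- apply: leq_ltn_trans (size_polyD _ _) _.
  by rewrite gtn_max size_polyN size_poly1 sw Pdiv.CommonRing.ltn_rmodpN0 ?monic_neq0.
- rewrite evD rmorphN rmorph1 hornerN hornerC mulrDl addrA -[ev Q * ev w]hornerM.
  rewrite -rmorphM -addrA -[_ + (_ + _)]addrA [ev _ + (_ + _)]addrA -evD -SE addrA -ht.
  by rewrite subrr.
rewrite subr_eq0 => /eqP rho1.
exists (col_mx (- Q)%:M (\col_j s j)).
rewrite mul_row_col -scalar_mxM; apply/matrixP => i j; rewrite !ord1 !mxE eqxx !mulr1n.
rewrite (eq_bigr (fun j => p j * s j)) => [|l _]; last by rewrite !mxE.
rewrite -[X in _ + X]/S SE rho1; ring.
Qed.
End StablyFree.

(** A free rank one summand can be cancelled: complete the unimodular row of its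
    coordinates. *)
Lemma cancel_free (B : comNzRingType) d N k (e : 'M[B]_N) (G : 'M[B]_(d + N, k))
    (G' : 'M[B]_(k, d + N)) : hermite B ->
  G *m G' = block_mx 1%:M 0 0 e -> G' *m G = 1%:M ->
  exists r (U : 'M[B]_(N, r)) (V : 'M[B]_(r, N)), U *m V = e /\ V *m U = 1%:M.
Proof.
move=> hB; elim: d k G G' => [|d ih] k G G' GG GG'.
  exists k, (dsubmx G), (rsubmx G'); split.
  - by rewrite mul_dsub_mx mulmx_rsub GG block_mxEh row_mxKr col_mxKd.
  - rewrite -GG' -[in RHS](vsubmxK G) -[in RHS](hsubmxK G') mul_row_col.
    by rewrite [usubmx G]flatmx0 mulmx0 add0r.
have split1 : block_mx (1%:M : 'M_d.+1) 0 0 e =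
    block_mx 1%:M 0 0 (block_mx 1%:M 0 0 e : 'M_(d + N)) :> 'M_(1 + (d + N)).
  have := @block_mxA _ 1 d N 1 d N 1%:M 0 0 0 1%:M 0 0 0 e.
  rewrite /= !row_mx0 !col_mx0 -scalar_mx_block => ->; apply/esym; exact: castmx_id.
rewrite split1 in GG.
pose G1 := usubmx (G : 'M_(1 + (d + N), k)); pose G2 := dsubmx (G : 'M_(1 + (d + N), k)).
pose G1' := lsubmx (G' : 'M_(k, 1 + (d + N))).
pose G2' := rsubmx (G' : 'M_(k, 1 + (d + N))).
have GE : (G : 'M_(1 + (d + N), k)) = col_mx G1 G2 by rewrite vsubmxK.
have GE' : (G' : 'M_(k, 1 + (d + N))) = row_mx G1' G2' by rewrite hsubmxK.
have {}GG : col_mx G1 G2 *m row_mx G1' G2' =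
   block_mx 1%:M 0 0 (block_mx 1%:M 0 0 e : 'M_(d + N)) by rewrite -GE -GE'.
have {}GG' : row_mx G1' G2' *m col_mx G1 G2 = 1%:M by rewrite -GE -GE'.
rewrite mul_col_row in GG; have [h11 h12 h21 h22] := eq_block_mx GG.
case: k G G' G1 G2 G1' G2' GE GE' GG GG' h11 h12 h21 h22
  => [|k] G G' G1 G2 G1' G2' GE GE' GG GG' h11 h12 h21 h22.
  move: h11; rewrite [G1]thinmx0 mul0mx => /matrixP /(_ 0 0) /eqP.
  by rewrite !mxE eqxx eq_sym oner_eq0.
have [g [g' [gg hg]]] := hB _ G1 G1' h11.
have gg' := mulmx1C gg.
(* after the change of basis the first coordinate row is (1, 0) *)
pose H2 := G2 *m g; pose H1' := g' *m G1'; pose H2' := g' *m G2'.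
have d1 : delta_mx 0 0 = row_mx 1%:M 0 :> 'rV[B]_(1 + k).
  apply/matrixP => i j; rewrite [RHS]mxE mxE (ord1 i) eqxx /=.
  case: splitP => l jl; rewrite mxE.
  - by have -> : j = 0 by [apply/val_inj; rewrite /= jl (ord1 l)]; rewrite (ord1 l).
  - by have -> : (j == 0) = false by apply/eqP => j0; move: jl; rewrite j0.
pose e1 : 'rV[B]_(1 + k) := delta_mx 0 0.
have k2 : e1 *m H2' = 0 by rewrite /e1 -hg mulmxA -[_ *m g *m _]mulmxA gg mulmx1.
have k4 : H2 *m H2' = block_mx 1%:M 0 0 e.
  by rewrite mulmxA -[_ *m g *m _]mulmxA gg mulmx1.
have kk : H1' *m e1 + H2' *m H2 = 1%:M.
  rewrite /e1 -hg /H1' /H2' /H2 -!mulmxA -mulmxDr !mulmxA -mulmxDl -mul_row_col.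
  by rewrite GG' mul1mx.
pose D' := dsubmx (H2' : 'M_(1 + k, d + N)).
have D'E : (H2' : 'M_(1 + k, d + N)) = col_mx 0 D'.
  transitivity (col_mx (usubmx (H2' : 'M_(1 + k, d + N))) D'); first by rewrite vsubmxK.
  suff -> : usubmx (H2' : 'M_(1 + k, d + N)) = 0 by [].
  have : row_mx 1%:M 0 *m col_mx (usubmx (H2' : 'M_(1 + k, d + N))) D' = 0.
    by rewrite vsubmxK -d1.
  by rewrite mul_row_col mul1mx mul0mx addr0.
pose D := rsubmx (H2 : 'M_(d + N, 1 + k)).
have DE : (H2 : 'M_(d + N, 1 + k)) = row_mx (lsubmx (H2 : 'M_(d + N, 1 + k))) D.
  by rewrite hsubmxK.
apply: (ih k D D').
- have : row_mx (lsubmx (H2 : 'M_(d + N, 1 + k))) D *m col_mx 0 D' =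
    block_mx 1%:M 0 0 e by rewrite -D'E -DE.
  by rewrite mul_row_col mulmx0 add0r.
- have : col_mx (usubmx (H1' : 'M_(1 + k, 1))) (dsubmx (H1' : 'M_(1 + k, 1))) *m row_mx 1%:M 0
    + col_mx 0 D' *m row_mx (lsubmx (H2 : 'M_(d + N, 1 + k))) D = 1%:M :> 'M_(1 + k).
    by rewrite vsubmxK -d1 -D'E -DE.
  rewrite !mul_col_row add_block_mx [RHS]scalar_mx_block => /eq_block_mx [_ _ _].
  by rewrite mulmx0 add0r.
Qed.

(** Induction on the number of variables. The module is free after inverting some f,
    which may be taken to be a monic w(x) over R'. The cokernel of the resulting
    embedding into a free module is projective, hence free, over R'; so the module is
    stably free. Unimodular rows can be completed by the theorem of Suslin, and the free
    summands cancelled. *)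
Theorem weierstrass_projective_free n (B : idomainType) :
  weierstrass_ring n B -> projective_free B.
Proof.
elim: n B => [|n IH] B hB N e ee;
  have [r [U [V [f [f0 UV VU eU Ve]]]]] := generically_free ee.
  exists r, (f^-1 *: U), V; rewrite -scalemxAl UV scalerA mulVr ?hB // scale1r; split=> //.
  by rewrite -scalemxAr VU scale_scalar_mx mulVr ?hB.
have hermB : hermite B.
  move=> k v z vz.
  have [j vj] : exists j, v 0 j != 0.
    apply: contrapT => h; have v0 : v = 0.
      by apply/rowP => j; rewrite !mxE; apply/eqP/negPn/negP => vj; apply: h; exists j.
    move: vz; rewrite v0 mul0mx => /matrixP /(_ 0 0) /eqP.
    by rewrite !mxE eqxx eq_sym oner_eq0.
  have [R' [iota [x [w [u [/IH pR hw uu fu]]]]]] := hB _ vj.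
  have sw : row_equiv v (v *m tperm_mx 0 j).
    by exists (tperm_mx 0 j), (tperm_mx 0 j); rewrite -perm_mxM perm.tperm2 perm_mx1.
  apply: row_equiv_trans sw _.
  apply: (hermite_weierstrass hw (projective_free_hermite pR) uu (z := tperm_mx 0 j *m z)).
  - by rewrite -xcolE mxE perm.tpermL.
  - by rewrite -mulmxA [tperm_mx _ _ *m (_ *m _)]mulmxA -perm_mxM perm.tperm2 perm_mx1 mul1mx.
have [R' [iota [x [w [u [/IH pR hw uu fu]]]]]] := hB _ f0.
have [||d [k [G [G' [h1 h2]]]]] :=
    @stably_free B R' iota x w hw N r e (u *: U) V pR ee _ _ Ve.
- by rewrite -scalemxAl UV scalerA mulrC fu.
- by rewrite -scalemxAr VU scale_scalar_mx mulrC fu.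
exact: cancel_free hermB h1 h2.
Qed.

(** * Complete normed rings and restricted power series *)

(** Complete rings over K with a multiplicative ultrametric norm taking the same
    values as the absolute value of K.  Completeness is stated for sequences
    converging geometrically, which suffices and keeps explicit bounds. *)
Record nring (R : realType) (p : nat) (K : perfectoidField R p) := NRing {
  nr :> idomainType;
  nm : nr -> R;
  kst : {rmorphism K -> nr};
  nm_ge0 : forall x, 0 <= nm x;
  nm_eq0 : forall x, nm x = 0 -> x = 0;
  nmM : forall x y, nm (x * y) = nm x * nm y;
  nmD : forall x y, nm (x + y) <= Num.max (nm x) (nm y);
  nm_kst : forall c, nm (kst c) = pf_abs c;
  nm_val : forall x, exists c : K, nm x = pf_abs c;
  nm_complete : forall u : nat -> nr,
    (forall k, nm (u k.+1 - u k) <= (2 ^+ k)^-1) ->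
    exists l, forall k, nm (l - u k) <= (2 ^+ k)^-1 }.

Arguments nm : simpl never.
Arguments nr : simpl never.
Arguments kst : simpl never.

Section RealPow.
Variable R : realType.

Lemma exp_small (q e : R) : 0 <= q -> q < 1 -> 0 < e -> exists m, q ^+ m <= e.
Proof.
move=> q0 q1 e0; have [->|qn0] := eqVneq q 0.
  by exists 1%N; rewrite expr1 ltW.
have qp : 0 < q by rewrite lt_neqAle eq_sym qn0.
pose d := q^-1 - 1; have d0 : 0 < d by rewrite subr_gt0 invf_gt1.
have bern m : 1 + m%:R * d <= (1 + d) ^+ m.
  elim: m => [|m ih]; first by rewrite mul0r addr0 expr0.
  rewrite exprS; apply: (@le_trans _ _ ((1 + d) * (1 + m%:R * d))); last first.
    by rewrite ler_pM2l // addr_gt0.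
  have h1 : 0 <= m%:R * d * d by rewrite !mulr_ge0 ?ler0n // ltW.
  by rewrite -natr1; nra.
exists (Num.trunc (e^-1 / d)).+1; set m := _.+1.
have hm : e^-1 / d < m%:R.
  by rewrite Num.Theory.truncnS_gt // ltW // divr_gt0 // invr_gt0.
have : e^-1 <= (1 + d) ^+ m.
  apply: le_trans (bern m); move: hm; rewrite ltr_pdivrMr // => hm.
  by rewrite ltW // (lt_le_trans hm) // lerDr.
have -> : 1 + d = q^-1 by rewrite /d; ring.
by rewrite exprVn lef_pV2 ?posrE ?exprn_gt0.
Qed.

Lemma half_small (e : R) : 0 < e -> exists k, (2 ^+ k)^-1 <= e.
Proof.
move=> e0; have [||k hk] := @exp_small 2^-1 e _ _ e0; try by lra.
by exists k; rewrite -exprVn.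
Qed.

Lemma half_pow_gt0 k : 0 < (2 ^+ k)^-1 :> R.
Proof. by rewrite invr_gt0 exprn_gt0. Qed.

Lemma half_pow_le1 k : (2 ^+ k)^-1 <= 1 :> R.
Proof. by rewrite invf_le1 ?exprn_gt0 // exprn_ege1 // ler1n. Qed.

Lemma half_pow_decr i j : (i <= j)%N -> (2 ^+ j)^-1 <= (2 ^+ i)^-1 :> R.
Proof. by move=> h; rewrite lef_pV2 ?posrE ?exprn_gt0 // ler_weXn2l // ler1n. Qed.
End RealPow.

(** Invertibility is decided classically, which gives rings of power series a unit
    structure. *)
Section ClassicalUnit.
Variable T : comNzRingType.
Definition cunit : pred T := fun x => `[< exists y, y * x = 1 >].
Definition cinv (x : T) : T := xget x [set y | y * x = 1].
Fact cmulVr : {in cunit, left_inverse 1 cinv *%R}.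
Proof. by move=> x /asboolP [y yx]; exact: (@xgetPex _ x [set y | y * x = 1]) (ex_intro _ y yx). Qed.
Fact cunitPl (x y : T) : y * x = 1 -> cunit x.
Proof. by move=> h; apply/asboolP; exists y. Qed.
Fact cinv_out : {in predC cunit, cinv =1 id}.
Proof.
move=> x /negP hx; rewrite /cinv; case: xgetP => // y _ yx.
by exfalso; apply: hx; apply/asboolP; exists y.
Qed.
End ClassicalUnit.

Section NRing.
Variables (R : realType) (p : nat) (K : perfectoidField R p) (B : nring K).
Implicit Types x y : B.

Lemma nm0 : nm (0 : B) = 0.
Proof. by rewrite -(rmorph0 (kst B)) nm_kst pf_abs0. Qed.
Lemma nm1 : nm (1 : B) = 1.
Proof. by rewrite -(rmorph1 (kst B)) nm_kst pf_abs1. Qed.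
Lemma nmN x : nm (- x) = nm x.
Proof.
have h : nm (-1 : B) = 1 by rewrite -(rmorphN1 (kst B)) nm_kst pf_absN pf_abs1.
by rewrite -mulN1r nmM h mul1r.
Qed.
Lemma nmBC x y : nm (x - y) = nm (y - x). Proof. by rewrite -nmN opprB. Qed.
Lemma nmX x k : nm (x ^+ k) = nm x ^+ k.
Proof. by elim: k => [|k ih]; rewrite ?expr0 ?nm1 // !exprS nmM ih. Qed.
Lemma nm_gt0 x : x != 0 -> 0 < nm x.
Proof.
by move=> x0; rewrite lt_neqAle nm_ge0 andbT eq_sym; apply: contra x0 => /eqP/nm_eq0 ->.
Qed.
Lemma nmD_le x y e : nm x <= e -> nm y <= e -> nm (x + y) <= e.
Proof. by move=> hx hy; apply: le_trans (nmD _ _) _; rewrite ge_max hx. Qed.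
Lemma nmB_le x y e : nm x <= e -> nm y <= e -> nm (x - y) <= e.
Proof. by move=> hx hy; apply: nmD_le; rewrite ?nmN. Qed.
Lemma nmD_lt x y e : nm x < e -> nm y < e -> nm (x + y) < e.
Proof. by move=> hx hy; apply: le_lt_trans (nmD _ _) _; rewrite gt_max hx. Qed.
Lemma nmD_eq x y : nm x < nm y -> nm (x + y) = nm y.
Proof.
move=> h; apply/le_anti; rewrite nmD_le ?(ltW h) //= leNgt; apply/negP => lt.
have : nm (x + y - x) < nm y by apply: nmD_lt => //; rewrite nmN.
by rewrite addrC addKr ltxx.
Qed.
Lemma nmM_le1 x y e : nm x <= 1 -> nm y <= e -> nm (x * y) <= e.
Proof.
by move=> hx hy; rewrite nmM -[e]mul1r; apply: ler_pM; rewrite ?nm_ge0.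
Qed.
Lemma nmX_le1 x k : nm x <= 1 -> nm (x ^+ k) <= 1.
Proof. by move=> h; rewrite nmX exprn_ile1 ?nm_ge0. Qed.
Lemma nm_sum_le (I : eqType) (s : seq I) (f : I -> B) e : 0 <= e ->
  (forall i, i \in s -> nm (f i) <= e) -> nm (\sum_(i <- s) f i) <= e.
Proof.
by move=> e0 h; rewrite big_seq; elim/big_ind: _ => //; [rewrite nm0|move=> *; exact: nmD_le].
Qed.
Lemma nm_sum_lt (I : eqType) (s : seq I) (f : I -> B) e : 0 < e ->
  (forall i, i \in s -> nm (f i) < e) -> nm (\sum_(i <- s) f i) < e.
Proof.
by move=> e0 h; rewrite big_seq; elim/big_ind: _ => //; [rewrite nm0|move=> *; exact: nmD_lt].
Qed.
Lemma nm_small x : (forall k, nm x <= (2 ^+ k)^-1) -> x = 0.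
Proof.
move=> h; apply: nm_eq0; apply: le0_small; first exact: nm_ge0.
by move=> e /half_small [k hk]; exact: le_trans (h k) hk.
Qed.

Lemma nm_unit x : nm (1 - x) < 1 -> x \is a GRing.unit /\ nm x = 1 /\ nm x^-1 = 1.
Proof.
move=> h; set y := 1 - x in h.
have [m hm] := exp_small (nm_ge0 y) h (half_pow_gt0 R 1).
pose u k := \sum_(i < m * k) y ^+ i.
have geo k : x * u k = 1 - y ^+ (m * k).
  by rewrite -[1 in RHS](expr1n _ (m * k)) subrXX /u /y; congr (_ * _);
    [ring | apply: eq_bigr => i _; rewrite expr1n mul1r].
have yk k : nm (y ^+ (m * k)) <= (2 ^+ k)^-1.
  rewrite exprM nmX -exprVn; apply: lerXn2r; rewrite ?nnegrE ?nm_ge0 ?invr_ge0 //.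
  by rewrite nmX (le_trans hm) // expr1.
have [|l hl] := @nm_complete _ _ _ B u.
  move=> k; rewrite /u mulnS addnC big_split_ord /= addrAC subrr add0r.
  apply: nm_sum_le => [|i _]; first exact/ltW/half_pow_gt0.
  by rewrite exprD nmM mulrC -nmM; apply: nmM_le1 => //; apply/nmX_le1/ltW.
have nx : nm x = 1.
  have -> : x = - y + 1 by rewrite /y; ring.
  by rewrite nmD_eq ?nm1 // nmN.
have xl : x * l = 1.
  apply/eqP; rewrite -subr_eq0; apply/eqP/nm_small => k.
  have -> : x * l - 1 = x * (l - u k) - y ^+ (m * k) by rewrite mulrBr geo; ring.
  by apply: nmB_le => //; apply: nmM_le1; rewrite ?nx.
have ux : x \is a GRing.unit by apply/unitrPr; exists l.
split=> //; split=> //; apply: (@mulfI _ (nm x)); first by rewrite nx oner_eq0.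
by rewrite -nmM mulrV // nm1 nx mulr1.
Qed.

Definition null_seqn (f : nat -> B) :=
  forall e : R, 0 < e -> exists N, forall i, (N <= i)%N -> nm (f i) < e.

Definition is_sum (f : nat -> B) (s : B) := forall e : R, 0 < e ->
  exists N, forall n, (N <= n)%N -> nm (s - \sum_(i < n) f i) < e.

Lemma is_sum_ex f : null_seqn f -> exists s, is_sum f s.
Proof.
move=> nf; have [N hN] := choice (fun k => nf _ (half_pow_gt0 R k)).
pose M k := \max_(j < k.+1) N j.
have NM k : (N k <= M k)%N by exact: (leq_bigmax (F := fun j : 'I_k.+1 => N j) ord_max).
have tail k m : (M k <= m)%N -> nm (\sum_(i < m) f i - \sum_(i < M k) f i) <= (2 ^+ k)^-1.
  move=> h; rewrite -(subnKC h) big_split_ord /= addrAC subrr add0r.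
  apply: nm_sum_le => [|i _]; first exact/ltW/half_pow_gt0.
  by apply/ltW/hN; rewrite (leq_trans (NM k)) // leq_addr.
have Minc k : (M k <= M k.+1)%N.
  by rewrite /M [X in (_ <= X)%N]big_ord_recr leq_maxl.
have [l hl] := @nm_complete _ _ _ B _ (fun k => tail k _ (Minc k)).
exists l => e e0; have e2 : 0 < e / 2 by lra.
have [k hk] := half_small e2; exists (M k) => n hn.
have -> : l - \sum_(i < n) f i = (l - \sum_(i < M k) f i)
    - (\sum_(i < n) f i - \sum_(i < M k) f i) by ring.
apply: le_lt_trans (_ : e / 2 < e); last by lra.
by apply: nmB_le; apply: le_trans hk; [exact: hl | exact: tail].
Qed.

Lemma is_sum_unique f s s' : is_sum f s -> is_sum f s' -> s = s'.
Proof.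
move=> h h'; apply/eqP; rewrite -subr_eq0; apply/eqP/nm_small => k.
have [N hN] := h _ (half_pow_gt0 R k); have [N' hN'] := h' _ (half_pow_gt0 R k).
pose n := maxn N N'.
have -> : s - s' = (s - \sum_(i < n) f i) - (s' - \sum_(i < n) f i) by ring.
by apply: nmB_le; apply/ltW; [apply: hN|apply: hN']; rewrite ?leq_maxl ?leq_maxr.
Qed.

Lemma is_sum_le f s e : is_sum f s -> (forall i, nm (f i) <= e) -> nm s <= e.
Proof.
move=> h hf; have e0 : 0 <= e by exact: le_trans (nm_ge0 _) (hf 0%N).
rewrite leNgt; apply/negP => lt.
have [N hN] := h _ (le_lt_trans e0 lt).
have h1 := hN N (leqnn _); have h2 : nm (\sum_(i < N) f i) < nm s.
  by apply: le_lt_trans lt; apply: nm_sum_le.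
by have := nmD_lt h1 h2; rewrite subrK ltxx.
Qed.

Lemma is_sumD f g s t : is_sum f s -> is_sum g t -> is_sum (fun i => f i + g i) (s + t).
Proof.
move=> hf hg e e0; have [N hN] := hf _ e0; have [N' hN'] := hg _ e0.
exists (maxn N N') => n; rewrite geq_max => /andP[h h'].
by rewrite big_split /= opprD addrACA; apply: nmD_lt; [exact: hN|exact: hN'].
Qed.

Lemma is_sumZ f s a : is_sum f s -> is_sum (fun i => a * f i) (a * s).
Proof.
move=> hf e e0; have h1 : 0 < nm a + 1 by rewrite ltr_wpDl ?nm_ge0.
have [N hN] := hf _ (divr_gt0 e0 h1); exists N => n hn.
rewrite -mulr_sumr -mulrBr nmM; have := hN n hn.
rewrite ltr_pdivlMr //; apply: le_lt_trans.
by rewrite mulrC ler_wpM2l ?nm_ge0 // lerDl.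
Qed.

Lemma is_sum_fin f N : (forall i, (N <= i)%N -> f i = 0) -> is_sum f (\sum_(i < N) f i).
Proof.
move=> h e e0; exists N => n hn; rewrite -(subnKC hn) big_split_ord /=.
rewrite opprD addrA subrr sub0r nmN big1 ?nm0 // => i _.
by rewrite h // leq_addr.
Qed.

Lemma nullseq_max f : null_seqn f -> exists i0, forall i, nm (f i) <= nm (f i0).
Proof.
move=> nf; have [h|h] := pselect (forall i, f i = 0).
  by exists 0%N => i; rewrite !h.
have [j /eqP fj] : exists j, f j <> 0 by apply/existsNP.
have [N hN] := nf _ (nm_gt0 fj).
have jN : (j < N)%N by rewrite ltnNge; apply/negP => /hN; rewrite ltxx.
pose i0 := [arg max_(i > Ordinal jN) nm (f i)]%O.
have hi0 (i : 'I_N) : nm (f i) <= nm (f i0).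
  by rewrite /i0; case: arg_maxP => // k _; apply.
exists i0 => i; have [iN|Ni] := ltnP i N; first exact: (hi0 (Ordinal iN)).
exact: le_trans (ltW (hN _ Ni)) (hi0 (Ordinal jN)).
Qed.
End NRing.

(** ** Restricted power series *)

Record rser (R : realType) (p : nat) (K : perfectoidField R p) (B : nring K) := RSer {
  sf :> nat -> B;
  sf_null : null_seqn sf }.

HB.instance Definition _ R p K B := gen_eqMixin (@rser R p K B).
HB.instance Definition _ R p K B := gen_choiceMixin (@rser R p K B).

Section RSer.
Variables (R : realType) (p : nat) (K : perfectoidField R p) (B : nring K).
Local Notation S := (rser B).
Implicit Types (f g h : S) (a b : B).

Lemma serP f g : (forall i, f i = g i) -> f = g.
Proof.
case: f g => f nf [g ng] /= h; have fg : f = g by exact/funext.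
by rewrite {}fg in nf h *; rewrite (Prop_irrelevance nf ng).
Qed.

Fact mono_null a n : null_seqn (fun i => if i == n then a else 0).
Proof.
by move=> e e0; exists n.+1 => i hi; rewrite gtn_eqF // nm0.
Qed.
Definition smono a n : S := RSer (@mono_null a n).
Definition sconst a : S := smono a 0.
Definition sX : S := smono 1 1.

Fact sadd_null f g : null_seqn (fun i => f i + g i).
Proof.
move=> e e0; have [N hN] := sf_null f e0; have [N' hN'] := sf_null g e0.
exists (maxn N N') => i; rewrite geq_max => /andP[h1 h2].
by apply: nmD_lt; [exact: hN|exact: hN'].
Qed.
Definition sadd f g : S := RSer (@sadd_null f g).

Fact sopp_null f : null_seqn (fun i => - f i).
Proof.
by move=> e e0; have [N hN] := sf_null f e0; exists N => i /hN; rewrite nmN.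
Qed.
Definition sopp f : S := RSer (@sopp_null f).

Fact saddA : associative sadd. Proof. by move=> *; apply: serP => i /=; rewrite addrA. Qed.
Fact saddC : commutative sadd. Proof. by move=> *; apply: serP => i /=; rewrite addrC. Qed.
Fact sadd0 : left_id (smono 0 0) sadd.
Proof. by move=> *; apply: serP => i /=; rewrite if_same add0r. Qed.
Fact saddN : left_inverse (smono 0 0) sopp sadd.
Proof. by move=> *; apply: serP => i /=; rewrite if_same addNr. Qed.
HB.instance Definition _ := GRing.isZmodule.Build S saddA saddC sadd0 saddN.

Lemma sbound f : exists A : R, 0 < A /\ forall i, nm (f i) <= A.
Proof.
have [i0 hi] := nullseq_max (sf_null f); exists (nm (f i0) + 1).
split; first by rewrite ltr_wpDl ?nm_ge0.
by move=> i; apply: le_trans (hi i) _; rewrite lerDl.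
Qed.

Fact smul_null f g : null_seqn (fun n => \sum_(i < n.+1) f i * g (n - i)%N).
Proof.
move=> e e0; have [A [A0 hA]] := sbound f; have [A' [A0' hA']] := sbound g.
have [N hN] := sf_null f (divr_gt0 e0 A0'); have [N' hN'] := sf_null g (divr_gt0 e0 A0).
exists (N + N')%N => n hn; apply: nm_sum_lt => // i _; rewrite nmM.
have [h|h] := leqP N i.
- apply: (@le_lt_trans _ _ (nm (f i) * A')); first by rewrite ler_wpM2l ?nm_ge0.
  by rewrite -ltr_pdivlMr // hN.
- apply: (@le_lt_trans _ _ (A * nm (g (n - i)%N))); first by rewrite ler_wpM2r ?nm_ge0.
  by rewrite mulrC -ltr_pdivlMr // hN' //; lia.
Qed.
Definition smul f g : S := RSer (@smul_null f g).

(* ring laws are inherited from polynomials, coefficient by coefficient *)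
Let tr n f : {poly B} := \poly_(i < n) f i.
Lemma trM n f g i : (i < n)%N -> (tr n f * tr n g)`_i = smul f g i.
Proof.
move=> hi; rewrite coefM /=; apply: eq_bigr => j _.
have jn : (j < n)%N by apply: leq_ltn_trans hi; rewrite -ltnS.
by rewrite !coef_poly jn (leq_ltn_trans (leq_subr _ _) hi).
Qed.
Lemma trE n f i : (i < n)%N -> (tr n f)`_i = f i.
Proof. by move=> h; rewrite coef_poly h. Qed.

Fact smulA : associative smul.
Proof.
move=> f g h; apply: serP => n.
transitivity ((tr n.+1 f * (tr n.+1 g * tr n.+1 h))`_n).
  rewrite coefM /=; apply: eq_bigr => i _; rewrite trE ?ltn_ord // trM //.
  by rewrite ltnS leq_subr.
rewrite mulrA coefM /=; apply: eq_bigr => i _.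
by rewrite trM ?ltn_ord // trE // ltnS leq_subr.
Qed.
Fact smulC : commutative smul.
Proof.
by move=> f g; apply: serP => n; rewrite -!(@trM n.+1) // mulrC.
Qed.
Fact smul1 : left_id (sconst 1) smul.
Proof.
move=> f; apply: serP => n /=; rewrite big_ord_recl /= mul1r subn0 big1 ?addr0 //.
by move=> i _; rewrite mul0r.
Qed.
Fact smulDl : left_distributive smul sadd.
Proof.
move=> f g h; apply: serP => n /=; rewrite -big_split /=; apply: eq_bigr => i _.
by rewrite mulrDl.
Qed.
Fact sone_neq0 : sconst 1 != 0.
Proof.
apply/eqP => /(congr1 (fun f : S => f 0%N)) /= /eqP.
by rewrite oner_eq0.
Qed.
HB.instance Definition _ := GRing.Zmodule_isComNzRing.Build S
  smulA smulC smul1 smulDl sone_neq0.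

Lemma scoefD f g i : (f + g) i = f i + g i. Proof. by []. Qed.
Lemma scoefN f i : (- f) i = - f i. Proof. by []. Qed.
Lemma scoefB f g i : (f - g) i = f i - g i. Proof. by []. Qed.
Lemma scoef0 i : (0 : S) i = 0. Proof. by rewrite /= if_same. Qed.
Lemma scoefM f g n : (f * g) n = \sum_(i < n.+1) f i * g (n - i)%N. Proof. by []. Qed.
Lemma scoef_sum (I : Type) (s : seq I) (P : pred I) (F : I -> S) i :
  (\sum_(j <- s | P j) F j) i = \sum_(j <- s | P j) F j i.
Proof. by elim/big_rec2: _ => [|j x y _ <-]; rewrite ?scoef0. Qed.

Definition imax f := projT1 (cid (nullseq_max (sf_null f))).
Definition rnm f : R := nm (f (imax f)).
Lemma rnm_coef f i : nm (f i) <= rnm f.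
Proof. by rewrite /rnm /imax; case: cid => /= i0; apply. Qed.
Lemma rnm_le f e : (forall i, nm (f i) <= e) -> rnm f <= e. Proof. by apply. Qed.
Lemma rnm_lt f e : (forall i, nm (f i) < e) -> rnm f < e. Proof. by apply. Qed.
Lemma rnm_attained f : exists i, nm (f i) = rnm f. Proof. by exists (imax f). Qed.

Lemma rnmM f g : rnm (f * g) = rnm f * rnm g.
Proof.
have r0 h : 0 <= rnm h by exact: nm_ge0.
have up : rnm (f * g) <= rnm f * rnm g.
  apply: rnm_le => n; apply: nm_sum_le => [|i _]; first by rewrite mulr_ge0.
  by rewrite nmM ler_pM ?nm_ge0 ?rnm_coef.
have [f0|f0] := eqVneq (rnm f) 0.
  by apply/le_anti; rewrite up f0 mul0r r0.
have [g0|g0] := eqVneq (rnm g) 0.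
  by apply/le_anti; rewrite up g0 mulr0 r0.
have fg0 : 0 < rnm f * rnm g by rewrite lt_neqAle mulr_ge0 // andbT eq_sym mulf_neq0.
have fp : 0 < rnm f by rewrite lt_neqAle r0 eq_sym f0.
have gp : 0 < rnm g by rewrite lt_neqAle r0 eq_sym g0.
have exm h : exists i, nm (h i) == rnm h by exists (imax h).
case: (ex_minnP (exm f)) => i /eqP fi mi; case: (ex_minnP (exm g)) => j /eqP gj mj.
have lf l : (l < i)%N -> nm (f l) < rnm f.
  by move=> li; rewrite lt_neqAle rnm_coef andbT; apply: contraTN li => /mi; rewrite -leqNgt.
have lg l : (l < j)%N -> nm (g l) < rnm g.
  by move=> li; rewrite lt_neqAle rnm_coef andbT; apply: contraTN li => /mj; rewrite -leqNgt.
apply/le_anti; rewrite up /=; apply: le_trans (rnm_coef _ (i + j)%N).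
have hi : (i < (i + j).+1)%N by rewrite ltnS leq_addr.
rewrite scoefM (bigD1 (Ordinal hi)) //= addrC addKn nmD_eq nmM fi gj //.
rewrite big_mkcond /=; apply: nm_sum_lt => // l _.
case: eqP => [_|li]; first by rewrite nm0.
rewrite nmM; have [h|h] := ltnP l i.
  apply: (@le_lt_trans _ _ (nm (f l) * rnm g)); first by rewrite ler_wpM2l ?nm_ge0 ?rnm_coef.
  by rewrite ltr_pM2r // lf.
have il : (i < l)%N.
  by rewrite ltn_neqAle h andbT; apply/eqP => e; apply: li; apply/val_inj.
apply: (@le_lt_trans _ _ (rnm f * nm (g (i + j - l)%N))).
  by rewrite ler_wpM2r ?nm_ge0 ?rnm_coef.
rewrite ltr_pM2l // lg //; have := ltn_ord l; lia.
Qed.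

Lemma rnm_ge0 f : 0 <= rnm f. Proof. exact: nm_ge0. Qed.
Lemma rnm_eq0 f : rnm f = 0 -> f = 0.
Proof.
move=> h; apply: serP => i; rewrite scoef0; apply: nm_eq0; apply/le_anti.
by rewrite nm_ge0 andbT -h rnm_coef.
Qed.
Lemma rnmD f g : rnm (f + g) <= Num.max (rnm f) (rnm g).
Proof.
by apply: rnm_le => i; apply: le_trans (nmD _ _) _; rewrite ge_max !le_max !rnm_coef ?orbT.
Qed.

HB.instance Definition _ := GRing.ComNzRing_hasMulInverse.Build S
  (@cmulVr S) (@cunitPl S) (@cinv_out S).
Fact ser_idomain f g : f * g = 0 -> (f == 0) || (g == 0).
Proof.
move=> fg; have : rnm f * rnm g = 0.
  by rewrite -rnmM fg; apply/le_anti; rewrite rnm_ge0 andbT; apply: rnm_le => i;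
    rewrite scoef0 nm0.
by move=> /eqP; rewrite mulf_eq0 => /orP [/eqP/rnm_eq0 ->|/eqP/rnm_eq0 ->];
  rewrite eqxx ?orbT.
Qed.
HB.instance Definition _ := GRing.ComUnitRing_isIntegral.Build S ser_idomain.

Lemma smonoE a n i : smono a n i = if i == n then a else 0. Proof. by []. Qed.

Lemma smonoM a b m n : smono a m * smono b n = smono (a * b) (m + n).
Proof.
apply: serP => i; rewrite scoefM; have [h|h] := leqP m i; last first.
  rewrite big1 => [|j _]; first by rewrite /= ltn_eqF // ltn_addr.
  by rewrite /= ltn_eqF ?mul0r // (leq_ltn_trans _ h) // -ltnS.
rewrite (bigD1 (Ordinal (h : (m < i.+1)%N))) //= eqxx big1 ?addr0 => [|j jm].
- have -> : (i - m == n)%N = (i == m + n)%N by apply/eqP/eqP; lia.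
  by case: eqP => _; rewrite ?mulr0.
- by case: eqP => [e|_]; rewrite ?mul0r //; case/eqP: jm; apply/val_inj.
Qed.

Fact sconst_zmod : zmod_morphism sconst.
Proof. by move=> a b; apply: serP => i /=; case: eqP => _; rewrite ?subr0. Qed.
Fact sconst_monoid : monoid_morphism sconst.
Proof. by split=> // a b; rewrite /sconst smonoM. Qed.
HB.instance Definition _ := GRing.isZmodMorphism.Build B S sconst sconst_zmod.
HB.instance Definition _ := GRing.isMonoidMorphism.Build B S sconst sconst_monoid.

Lemma sXn n : sX ^+ n = smono 1 n.
Proof. by elim: n => // n ih; rewrite exprS ih smonoM mul1r. Qed.
Lemma smono_CX a n : smono a n = sconst a * sX ^+ n.
Proof. by rewrite sXn smonoM mulr1. Qed.
Lemma sconstM_coef a f i : (sconst a * f) i = a * f i.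
Proof.
rewrite scoefM big_ord_recl /= subn0 big1 ?addr0 // => j _; by rewrite mul0r.
Qed.
Lemma sXn_coef n f i : (sX ^+ n * f) i = if (n <= i)%N then f (i - n)%N else 0.
Proof.
rewrite sXn scoefM; case: leqP => h; last first.
  by rewrite big1 // => j _; rewrite /= ltn_eqF ?mul0r // (leq_ltn_trans _ h) // -ltnS.
rewrite (bigD1 (Ordinal (h : (n < i.+1)%N))) //= eqxx mul1r big1 ?addr0 // => j jm.
by case: eqP => [e|_]; rewrite ?mul0r //; case/eqP: jm; apply/val_inj.
Qed.

Definition strunc N f : S := \sum_(i < N) smono (f i) i.
Lemma struncE N f i : strunc N f i = if (i < N)%N then f i else 0.
Proof.
rewrite scoef_sum; case: ltnP => h.
  rewrite (bigD1 (Ordinal h)) //= eqxx big1 ?addr0 // => j jm.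
  by case: eqP => [e|//]; case/eqP: jm; apply/val_inj.
by rewrite big1 // => j _; rewrite /= gtn_eqF // (leq_trans _ h).
Qed.
Lemma strunc_approx f e : 0 < e -> exists N, rnm (f - strunc N f) < e.
Proof.
move=> e0; have [N hN] := sf_null f e0; exists N; apply: rnm_lt => i.
rewrite scoefB struncE; case: ltnP => h; rewrite ?subrr ?nm0 // subr0; exact: hN.
Qed.

Lemma rnm_smono a n : rnm (smono a n) = nm a.
Proof.
apply/le_anti/andP; split; last by have := rnm_coef (smono a n) n; rewrite /= eqxx.
by apply: rnm_le => i /=; case: eqP; rewrite ?nm0 ?nm_ge0.
Qed.

Fact rnm_val f : exists c : K, rnm f = pf_abs c.
Proof. exact: nm_val. Qed.

Fact rnm_complete (u : nat -> S) : (forall k, rnm (u k.+1 - u k) <= (2 ^+ k)^-1) ->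
  exists l, forall k, rnm (l - u k) <= (2 ^+ k)^-1.
Proof.
move=> hu.
have [l hl] := choice (fun i => @nm_complete _ _ _ B (fun k => u k i)
   (fun k => le_trans (rnm_coef (u k.+1 - u k) i) (hu k))).
have nl : null_seqn l.
  move=> e e0; have e2 : 0 < e / 2 by lra.
  have [k hk] := half_small e2; have [N hN] := sf_null (u k) e0.
  exists N => i hi; rewrite -(subrK (u k i) (l i)); apply: nmD_lt; last exact: hN.
  by apply: le_lt_trans (hl i k) _; apply: le_lt_trans hk _; lra.
by exists (RSer nl) => k; apply: rnm_le => i; exact: hl.
Qed.

Definition rs : nring K := @NRing R p K S rnm
  (sconst \o kst B : {rmorphism K -> S}) rnm_ge0 rnm_eq0 rnmM rnmD
  (fun c => etrans (rnm_smono _ 0) (nm_kst B c)) rnm_val rnm_complete.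

End RSer.

Fixpoint tate (R : realType) (p : nat) (K : perfectoidField R p) (K0 : nring K) (n : nat) :
  nring K := if n is n'.+1 then rs (tate K0 n') else K0.

Section BaseField.
Variables (R : realType) (p : nat) (K : perfectoidField R p).

Fact base_complete (u : nat -> K) : (forall k, pf_abs (u k.+1 - u k) <= (2 ^+ k)^-1) ->
  exists l, forall k, pf_abs (l - u k) <= (2 ^+ k)^-1.
Proof.
move=> hu; have tail k m : (k <= m)%N -> pf_abs (u m - u k) <= (2 ^+ k)^-1.
  elim: m => [|m ih]; first by rewrite leqn0 => /eqP ->; rewrite subrr pf_abs0 ltW ?half_pow_gt0.
  rewrite leq_eqVlt => /orP [/eqP -> |]; first by rewrite subrr pf_abs0 ltW ?half_pow_gt0.
  rewrite ltnS => km; rewrite -(subrK (u m) (u m.+1)) -addrA; apply: pf_absD_le (ih km).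
  exact: le_trans (hu m) (half_pow_decr R km).
have [|l hl] := @pf_complete R p K u.
  move=> e e0; have e2 : 0 < e / 2 by lra.
  have [k hk] := half_small e2; exists k => i j hi hj.
  apply: le_lt_trans (_ : e / 2 < e); last by lra.
  have -> : u i - u j = (u i - u k) - (u j - u k) by ring.
  by apply: pf_absB_le; apply: le_trans hk; exact: tail.
exists l => k; have [N hN] := hl _ (half_pow_gt0 R k).
have -> : l - u k = (u (maxn N k) - u k) - (u (maxn N k) - l) by ring.
apply: pf_absB_le; first exact/tail/leq_maxr.
exact/ltW/hN/leq_maxl.
Qed.

Definition base : nring K := @NRing R p K K (@pf_abs R p K) idfun (@pf_abs_ge0 R p K)
  (fun x => (pf_abs_eq0 x).1) (@pf_absM R p K) (@pf_absD R p K) (fun=> erefl)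
  (fun x => ex_intro _ x erefl) base_complete.
End BaseField.

(** The Tate algebra K<X_1, ..., X_n> *)
Notation TA K := (tate (base K)).

(** ** Contractive homomorphisms and evaluation of power series *)

Record chom (R : realType) (p : nat) (K : perfectoidField R p) (A B : nring K) := CHom {
  ch :> {rmorphism A -> B};
  ch_le : forall x, nm (ch x) <= nm x;
  ch_kst : forall c, ch (kst A c) = kst B c }.

Lemma eq_ler (R : realType) (x y : R) : x = y -> x <= y.
Proof. by move=> ->. Qed.

Section Chom.
Variables (R : realType) (p : nat) (K : perfectoidField R p).
Implicit Types A B C : nring K.

Definition ccomp A B C (g : chom B C) (f : chom A B) : chom A C :=
  @CHom _ _ _ A C (g \o f : {rmorphism A -> C})
    (fun x => le_trans (ch_le g (f x)) (ch_le f x))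
    (fun c => etrans (congr1 g (ch_kst f c)) (ch_kst g c)).

Definition cid_hom A : chom A A :=
  @CHom _ _ _ A A (idfun : {rmorphism A -> A}) (fun x => lexx _) (fun c => erefl).

Definition cconst B : chom B (rs B) :=
  @CHom _ _ _ B (rs B) (@sconst _ _ _ B : {rmorphism B -> rser B})
    (fun x => eq_ler (rnm_smono x 0)) (fun c => erefl).

Definition ckst B : chom (base K) B :=
  @CHom _ _ _ (base K) B (kst B) (fun c => eq_ler (nm_kst B c)) (fun c => erefl).

Lemma chom_rs_ext A B (f g : chom (rs A) B) : (forall a, f (sconst a) = g (sconst a)) ->
  f (sX A) = g (sX A) -> forall x, f x = g x.
Proof.
move=> hc hX x; apply/eqP; rewrite -subr_eq0; apply/eqP/nm_small => k.
have [N hN] := strunc_approx x (half_pow_gt0 R k).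
have e : f (strunc N x) = g (strunc N x).
  rewrite /strunc !rmorph_sum; apply: eq_bigr => i _.
  by rewrite smono_CX !rmorphM !rmorphXn /= hc hX.
have -> : f x - g x = f (x - strunc N x) - g (x - strunc N x).
  by rewrite !rmorphB e; ring.
have hN' : nm (x - strunc N x : rs A) <= (2 ^+ k)^-1 := ltW hN.
by apply: nmB_le; [exact: le_trans (ch_le f _) hN' | exact: le_trans (ch_le g _) hN'].
Qed.

Section Eval.
Variables (A B : nring K) (phi : chom A B) (b : B).
Hypothesis hb : nm b <= 1.

Lemma sev_null (f : rser A) : null_seqn (fun i => phi (f i) * b ^+ i).
Proof.
move=> e e0; have [N hN] := sf_null f e0; exists N => i hi.
rewrite mulrC; apply: le_lt_trans (hN i hi).
by apply: nmM_le1; [exact: nmX_le1 | exact: ch_le].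
Qed.
Definition sev (f : rser A) : B := xget 0 [set s | is_sum (fun i => phi (f i) * b ^+ i) s].
Lemma sevP (f : rser A) : is_sum (fun i => phi (f i) * b ^+ i) (sev f).
Proof. exact: (@xgetPex _ 0 [set s | is_sum _ s]) (is_sum_ex (@sev_null f)). Qed.
Lemma sev_eq (f : rser A) s : is_sum (fun i => phi (f i) * b ^+ i) s -> sev f = s.
Proof. exact: is_sum_unique (sevP f). Qed.

Lemma sev_le (f : rser A) : nm (sev f) <= rnm f.
Proof.
apply: is_sum_le (sevP f) _ => i; rewrite mulrC; apply: le_trans (rnm_coef f i).
by apply: nmM_le1; [exact: nmX_le1 | exact: ch_le].
Qed.

Fact sev_zmod : zmod_morphism sev.
Proof.
move=> f g; apply: sev_eq.
have := is_sumD (sevP f) (is_sumZ (-1) (sevP g)); rewrite mulN1r; congr is_sum.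
by apply/funext => i; rewrite scoefB rmorphB; ring.
Qed.
HB.instance Definition _ := GRing.isZmodMorphism.Build (rser A) B sev sev_zmod.

Lemma sev_mono a n : sev (smono a n) = phi a * b ^+ n.
Proof.
apply: sev_eq; have := @is_sum_fin _ _ _ B (fun i => phi (smono a n i) * b ^+ i) n.+1.
rewrite big_ord_recr /= eqxx big1 ?add0r => [|i _].
  by apply=> i hi; rewrite gtn_eqF // rmorph0 mul0r.
by rewrite ltn_eqF // rmorph0 mul0r.
Qed.

Fact sev_monoid : monoid_morphism sev.
Proof.
split; first by rewrite -[1]/(smono 1 0) sev_mono rmorph1 mulr1.
move=> f g; pose D (x y : rser A) := sev (x * y) - sev x * sev y.
have Dl x x' y : D (x - x') y = D x y - D x' y.
  by rewrite /D mulrBl !raddfB /=; ring.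
have Dr x y y' : D x (y - y') = D x y - D x y'.
  by rewrite /D mulrBr !raddfB /=; ring.
have Dle x y : nm (D x y) <= rnm x * rnm y.
  apply: nmB_le; first by rewrite -rnmM sev_le.
  by rewrite nmM; apply: ler_pM; rewrite ?nm_ge0 ?sev_le.
have Dtr N : D (strunc N f) (strunc N g) = 0.
  apply/eqP; rewrite subr_eq0; apply/eqP; rewrite /strunc !raddf_sum mulr_suml.
  rewrite raddf_sum mulr_suml; apply: eq_bigr => i _; rewrite !mulr_sumr raddf_sum.
  apply: eq_bigr => j _; rewrite /= smonoM !sev_mono rmorphM exprD; ring.
apply/eqP; rewrite -subr_eq0 -/(D f g); apply/eqP/nm_eq0/le0_small; first exact: nm_ge0.
move=> e e0; pose M := rnm f + rnm g + 1.
have M0 : 0 < M by rewrite ltr_wpDl ?addr_ge0 ?rnm_ge0.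
have d0 : 0 < e / M by exact: divr_gt0.
have [N1 hN1] := sf_null f d0; have [N2 hN2] := sf_null g d0.
pose N := maxn N1 N2.
have tf (h : rser A) N' : (forall i, (N' <= i)%N -> nm (h i) < e / M) -> (N' <= N)%N ->
    rnm (h - strunc N h) <= e / M.
  move=> hh NN; apply: rnm_le => i; rewrite scoefB struncE; case: ltnP => hi.
    by rewrite subrr nm0 ltW.
  by rewrite subr0 ltW // hh // (leq_trans NN).
have trf : rnm (strunc N f) <= rnm f.
  by apply: rnm_le => i; rewrite struncE; case: ltnP; rewrite ?rnm_coef // nm0 rnm_ge0.
have -> : D f g = D (f - strunc N f) g + D (strunc N f) (g - strunc N g).
  by rewrite Dl Dr Dtr; ring.
have hM x : 0 <= x -> x <= M -> e / M * x <= e.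
  by move=> x0 xM; rewrite mulrAC ler_pdivrMr // ler_pM2l.
apply: nmD_le; apply: le_trans (Dle _ _) _.
- apply: le_trans (hM (rnm g) _ _); rewrite ?rnm_ge0 //; last first.
    by rewrite /M -addrA addrCA lerDl addr_ge0 ?rnm_ge0.
  by apply: ler_wpM2r; [exact: rnm_ge0 | apply: tf hN1 (leq_maxl _ _)].
- apply: le_trans (hM (rnm f) _ _); rewrite ?rnm_ge0 //; last first.
    by rewrite /M -addrA lerDl addr_ge0 ?rnm_ge0.
  rewrite mulrC; apply: ler_pM; rewrite ?rnm_ge0 //.
  by apply: tf hN2 (leq_maxr _ _).
Qed.
HB.instance Definition _ := GRing.isMonoidMorphism.Build (rser A) B sev sev_monoid.

Fact sev_kst c : sev (kst (rs A) c) = kst B c.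
Proof. by rewrite sev_mono mulr1 ch_kst. Qed.

Definition sev_hom : chom (rs A) B :=
  @CHom _ _ _ (rs A) B (sev : {rmorphism rser A -> B}) sev_le sev_kst.

Lemma sev_const a : sev_hom (sconst a) = phi a.
Proof. by rewrite /= sev_mono mulr1. Qed.
Lemma sev_X : sev_hom (sX A) = b.
Proof. by rewrite /= sev_mono rmorph1 mul1r expr1. Qed.
End Eval.

Fixpoint tvar n (i : nat) : TA K n :=
  match n return TA K n with
  | 0 => 0
  | n'.+1 => if i == n' then sX (TA K n') else sconst (tvar n' i)
  end.

Lemma tvar_last n : tvar n.+1 n = sX (TA K n). Proof. by rewrite /= eqxx. Qed.
Lemma tvar_lt n i : (i < n)%N -> tvar n.+1 i = sconst (tvar n i).
Proof. by move=> h; rewrite /= ltn_eqF. Qed.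
Lemma nm_sX B : nm (sX B : rs B) = 1. Proof. by rewrite [LHS]rnm_smono nm1. Qed.
Lemma nm_sconst B (a : B) : nm (sconst a : rs B) = nm a. Proof. exact: rnm_smono. Qed.
Lemma tvar_le n i : nm (tvar n i) <= 1.
Proof.
elim: n => [|n ih]; first by rewrite nm0 ler01.
rewrite [tvar _ _]/=; case: eqP => _; first by rewrite nm_sX.
by rewrite nm_sconst.
Qed.

Fixpoint tev B (bs : nat -> B) (hbs : forall i, nm (bs i) <= 1) n : chom (TA K n) B :=
  if n is n'.+1 then sev_hom (tev hbs n') (hbs n') else ckst B.

Lemma tev_var B (bs : nat -> B) (hbs : forall i, nm (bs i) <= 1) n i : (i < n)%N ->
  tev hbs n (tvar n i) = bs i.
Proof.
elim: n => // n ih; rewrite ltnS leq_eqVlt => /orP [/eqP ->|h].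
  by rewrite tvar_last; exact: sev_X.
by rewrite tvar_lt // [LHS]sev_const ih.
Qed.

Lemma tate_hom_ext B n (f g : chom (TA K n) B) :
  (forall i, (i < n)%N -> f (tvar n i) = g (tvar n i)) -> forall x, f x = g x.
Proof.
elim: n f g => [|n ih] f g h x.
  by have := ch_kst f x; rewrite /= => ->; have := ch_kst g x; rewrite /= => ->.
apply: chom_rs_ext => [a|]; last by have := h n (ltnSn n); rewrite tvar_last.
apply: (ih (ccomp f (cconst _)) (ccomp g (cconst _))) => i hi /=.
by have := h i (ltnW hi : (i < n.+1)%N); rewrite tvar_lt.
Qed.

Lemma ser_horner A (q : {poly A}) i : (map_poly (@sconst _ _ _ A) q).[sX A] i = q`_i.
Proof.
have -> : (map_poly (@sconst _ _ _ A) q).[sX A] = \sum_(j < size q) smono q`_j j.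
  rewrite (@horner_coef_wide _ (size q)) ?size_poly //; apply: eq_bigr => j _.
  by rewrite coef_map smono_CX.
rewrite scoef_sum; have [h|h] := ltnP i (size q); last first.
  rewrite nth_default // big1 // => j _.
  by rewrite smonoE gtn_eqF // (leq_trans _ h).
rewrite (bigD1 (Ordinal h)) //= eqxx big1 ?addr0 // => j jm.
by case: eqP => [e|//]; case/eqP: jm; apply/val_inj.
Qed.
End Chom.

(** ** Weierstrass preparation *)

Section Weierstrass.
Variables (R : realType) (p : nat) (K : perfectoidField R p) (B : nring K).
Implicit Types (f g q r : rs B) (s : nat).

(** The Weierstrass condition for a series of norm at most 1: its reduction is a
    polynomial of degree s with invertible leading coefficient. *)
Definition distinguished f s : Prop :=
  [/\ forall i, nm (f i) <= 1, forall i, (s < i)%N -> nm (f i) < 1,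
      f s \is a GRing.unit & nm (f s) = 1].

Lemma nm_inv1 (a : B) : a \is a GRing.unit -> nm a = 1 -> nm a^-1 = 1.
Proof.
by move=> ua na; apply: (@mulfI _ (nm a)); rewrite -?nmM ?mulrV // ?nm1 ?na ?oner_eq0 ?mulr1.
Qed.

Lemma nm_smono (a : B) n : nm (smono a n : rs B) = nm a. Proof. exact: rnm_smono. Qed.

Lemma divide_monic_poly (w g : rs B) s N : (forall i, nm (w i) <= 1) -> w s = 1 ->
  (forall i, (s < i)%N -> w i = 0) -> (forall i, (N <= i)%N -> g i = 0) ->
  exists q r, [/\ g = q * w + r, nm q <= nm g, nm r <= nm g &
                 forall i, (s <= i)%N -> r i = 0].
Proof.
move=> w1 ws wz; elim: N g => [|N ih] g hg.
  exists 0, 0; rewrite !nm0 nm_ge0; split=> //; last by move=> i _; rewrite scoef0.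
  by rewrite mul0r add0r; apply: serP => i; rewrite hg // scoef0.
have [Ns|sN] := ltnP N s.
  exists 0, g; rewrite nm0 nm_ge0 mul0r add0r; split=> // i hi.
  by apply: hg; exact: leq_trans Ns hi.
pose t := smono (g N) (N - s)%N * w.
have tE i : t i = if (N - s <= i)%N then g N * w (i - (N - s))%N else 0.
  by rewrite /t smono_CX -mulrA sconstM_coef sXn_coef; case: ifP => _; rewrite ?mulr0.
have nt : nm (t : rs B) <= nm g.
  rewrite nmM nm_smono mulrC; apply: le_trans (_ : 1 * nm (g N) <= _).
    apply: ler_wpM2r; [exact: nm_ge0 | exact: rnm_le].
  by rewrite mul1r; exact: rnm_coef.
have [|q [r [e nq nr hr]]] := ih (g - t).
  move=> i; rewrite scoefB tE leq_eqVlt => /orP [/eqP <-|Ni].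
    by rewrite leq_subr subKn // ws mulr1 subrr.
  rewrite hg // sub0r; case: ifP => _; rewrite ?oppr0 // wz ?mulr0 ?oppr0 //; lia.
have ngt : nm (g - t) <= nm g by exact: nmB_le.
exists (q + smono (g N) (N - s)%N), r; split=> //.
- by rewrite mulrDl addrAC -e -/t subrK.
- apply: nmD_le; first exact: le_trans nq ngt.
  by rewrite nm_smono; exact: rnm_coef.
- exact: le_trans nr ngt.
Qed.

(** Dividing a truncation of g by the monic polynomial that approximates f leaves an
    error smaller by a fixed factor; the errors sum up. *)
Lemma weierstrass_division f s g : distinguished f s -> exists q r,
  [/\ g = q * f + r, nm q <= nm g, nm r <= nm g & forall i, (s <= i)%N -> r i = 0].
Proof.
move=> [f1 fs fu fn]; have fn' := nm_inv1 fu fn.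
pose fl : rs B := strunc s.+1 f; pose fh : rs B := f - fl.
have fhE i : fh i = if (i <= s)%N then 0 else f i.
  by rewrite /fh scoefB struncE ltnS; case: leqP => _; rewrite ?subrr ?subr0.
have nfh : nm fh < 1.
  by apply: rnm_lt => i; rewrite fhE; case: leqP => h; rewrite ?nm0 // fs.
pose w : rs B := sconst (f s)^-1 * fl.
have wE i : w i = (f s)^-1 * (if (i <= s)%N then f i else 0).
  by rewrite /w sconstM_coef struncE ltnS.
pose la := Num.max 2^-1 (nm fh).
have la0 : 0 <= la by rewrite le_max nm_ge0 orbT.
have la1 : la < 1 by rewrite gt_max nfh andbT; lra.
have step h : exists qr : rs B * rs B, [/\ nm qr.1 <= nm h, nm qr.2 <= nm h,
    nm (h - (qr.1 * f + qr.2)) <= la * nm h & forall i, (s <= i)%N -> qr.2 i = 0].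
  have [->|h0] := eqVneq h 0.
    exists (0, 0); rewrite /= mul0r !addr0 subr0 !nm0 mulr0; split=> // i _.
    by rewrite if_same.
  have hp : 0 < nm h / 2 by have := nm_gt0 h0; lra.
  have [N hN] := strunc_approx h hp; set h' : rs B := strunc N h in hN.
  have nh' : nm h' <= nm h.
    by apply: rnm_le => i; rewrite struncE; case: ltnP; rewrite ?nm0 ?nm_ge0 // => _;
      exact: rnm_coef.
  have [||||q [r [e nq nr hr]]] := @divide_monic_poly w h' s N.
  - move=> i; rewrite wE nmM fn' mul1r; case: leqP => _; rewrite ?nm0 //.
  - by rewrite wE leqnn mulVr.
  - by move=> i hi; rewrite wE leqNgt hi mulr0.
  - by move=> i hi; rewrite struncE ltnNge hi.
  exists (q * sconst (f s)^-1, r); split=> //=.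
  + rewrite nmM nm_sconst fn' mulr1; exact: le_trans nq nh'.
  + exact: le_trans nr nh'.
  have -> : h - (q * sconst (f s)^-1 * f + r) = (h - h') - q * sconst (f s)^-1 * fh.
    have -> : fh = f - fl by []. rewrite e /w; ring.
  apply: nmB_le.
    apply: le_trans (ltW hN) _; rewrite mulrC ler_wpM2r ?nm_ge0 //.
    by rewrite le_max lexx.
  rewrite !nmM nm_sconst fn' mulr1 mulrC; apply: ler_pM; rewrite ?nm_ge0 //.
    by rewrite le_max lexx orbT.
  exact: le_trans nq nh'.
have [F hF] := choice step.
pose E h := h - ((F h).1 * f + (F h).2).
pose gk k := iter k E g.
have ngk k : nm (gk k) <= la ^+ k * nm g.
  elim: k => [|k ih]; first by rewrite expr0 mul1r.
  rewrite /gk iterS -/(gk k) exprS -mulrA; have [_ _ h _] := hF (gk k).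
  apply: le_trans h _; exact: ler_wpM2l.
have nullk (G : rs B -> rs B) : (forall h, nm (G h) <= nm h) ->
    null_seqn (fun k => G (gk k)).
  move=> hG e e0; have e1 : 0 < e / (nm g + 1) by rewrite divr_gt0 // ltr_wpDl ?nm_ge0.
  have [m hm] := exp_small la0 la1 e1; exists m => i hi.
  apply: le_lt_trans (hG _) _; apply: le_lt_trans (ngk i) _.
  apply: (@le_lt_trans _ _ (e / (nm g + 1) * nm g)).
    apply: ler_wpM2r; first exact: nm_ge0.
    by apply: le_trans hm; rewrite -(subnKC hi) exprD ler_piMr ?exprn_ge0 // exprn_ile1 // ltW.
  have ng1 : 0 < nm g + 1 by rewrite ltr_wpDl ?nm_ge0.
  by rewrite mulrAC ltr_pdivrMr // ltr_pM2l // ltrDl.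
have gkle k : nm (gk k) <= nm g.
  by apply: le_trans (ngk k) _; rewrite ler_piMl ?nm_ge0 // exprn_ile1 // ltW.
have n1 : null_seqn (fun k => (F (gk k)).1).
  by apply: (nullk (fun h => (F h).1)) => h; have [] := hF h.
have n2 : null_seqn (fun k => (F (gk k)).2).
  by apply: (nullk (fun h => (F h).2)) => h; have [] := hF h.
have [q hq] := is_sum_ex n1; have [r hr] := is_sum_ex n2.
exists q, r; split.
- have h1 := is_sumD (is_sumZ f hq) hr; rewrite mulrC.
  apply: is_sum_unique h1 => e e0.
  have [N hN] := nullk id (fun h => lexx _) _ e0; exists N => n hn.
  suff -> : g - \sum_(i < n) (f * (F (gk i)).1 + (F (gk i)).2) = gk n by exact: hN.
  elim: (n) => [|k ih]; first by rewrite big_ord0 subr0.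
  rewrite big_ord_recr /= opprD addrA ih.
  by rewrite /E [f * _]mulrC.
- by apply: is_sum_le hq _ => k; apply: le_trans (gkle k); have [] := hF (gk k).
- by apply: is_sum_le hr _ => k; apply: le_trans (gkle k); have [] := hF (gk k).
- move=> i hi; apply: nm_small => k; have [N hN] := hr _ (half_pow_gt0 R k).
  apply: le_trans (ltW (hN N (leqnn N))); apply: le_trans (rnm_coef _ i).
  rewrite scoefB scoef_sum big1 ?subr0 // => j _.
  by have [_ _ _ ->] := hF (gk j).
Qed.

Lemma weierstrass_unique f s q r : distinguished f s -> q * f + r = 0 ->
  (forall i, (s <= i)%N -> r i = 0) -> q = 0 /\ r = 0.
Proof.
move=> [f1 fs fu fn] e hr.
suff q0 : q = 0 by split=> //; move: e; rewrite q0 mul0r add0r.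
apply/eqP/negPn/negP => q0; have qp : 0 < rnm q := nm_gt0 q0.
have [N hN] := sf_null q qp.
have [|j' hj'|j /eqP qj mj] := @ex_maxnP (fun j => nm (q j) == rnm q) N.
- by have [j hj] := rnm_attained q; exists j; rewrite hj.
- rewrite leqNgt; apply/negP => h; have := hN j' (ltnW h).
  by rewrite (eqP hj') ltxx.
have lq l : (j < l)%N -> nm (q l) < rnm q.
  by move=> jl; rewrite lt_neqAle rnm_coef andbT; apply: contraTN jl => /mj; rewrite -leqNgt.
have : nm ((q * f) (j + s)%N) = 0.
  have -> : q * f = - r by apply/eqP; rewrite -addr_eq0 e.
  by rewrite scoefN hr ?leq_addl // oppr0 nm0.
have hj : (j < (j + s).+1)%N by rewrite ltnS leq_addr.
rewrite scoefM (bigD1 (Ordinal hj)) //= addrC addKn nmD_eq; rewrite nmM qj fn mulr1.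
  by move=> h; move: qp; rewrite h ltxx.
rewrite big_mkcond /=; apply: nm_sum_lt => // l _.
case: eqP => [_|lj]; first by rewrite nm0.
rewrite nmM; have [h|h] := ltnP l j.
  apply: (@le_lt_trans _ _ (rnm q * nm (f (j + s - l)%N))).
    by rewrite ler_wpM2r ?nm_ge0 ?rnm_coef.
  rewrite gtr_pMr // fs //; lia.
have jl : (j < l)%N.
  by rewrite ltn_neqAle h andbT; apply/eqP => e'; apply: lj; apply/val_inj.
apply: (@le_lt_trans _ _ (nm (q l) * 1)); first by rewrite ler_wpM2l ?nm_ge0.
by rewrite mulr1 lq.
Qed.

Lemma weierstrass_preparation f s : distinguished f s ->
  exists (w : {poly B}) (u : rs B),
  [/\ weierstrass (@sconst _ _ _ B) (sX B) w, u \is a GRing.unit, size w = s.+1,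
      f * u = (map_poly (@sconst _ _ _ B) w).[sX B] &
      forall g, exists q (r : {poly B}), [/\ (size r <= s)%N,
        g = q * (map_poly (@sconst _ _ _ B) w).[sX B] + (map_poly (@sconst _ _ _ B) r).[sX B]
        & forall i, nm r`_i <= nm g]].
Proof.
move=> df; have [q [r [e nq nr hr]]] := weierstrass_division (sX B ^+ s) df.
pose w : {poly B} := 'X^s - \poly_(i < s) r i.
have sw : size w = s.+1.
  by rewrite /w size_polyDl size_polyXn // size_polyN ltnS size_poly.
have wE : (map_poly (@sconst _ _ _ B) w).[sX B] = q * f.
  have -> : q * f = sX B ^+ s - r by rewrite e addrK.
  apply: serP => i; rewrite ser_horner scoefB sXn coefB coefXn coef_poly smonoE.
  by case: (ltnP i s) => h; [|rewrite hr //]; case: eqP.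
set W := (map_poly _ w).[_] in wE *.
have nXs : nm (sX B ^+ s : rs B) = 1 by rewrite nmX nm_sX expr1n.
have Wi i : W i = w`_i by exact: ser_horner.
have ws : w`_s = 1 by rewrite coefB coefXn eqxx coef_poly ltnn subr0.
have dW : distinguished W s.
  split; rewrite ?Wi ?ws ?unitr1 ?nm1 //.
  - move=> i; rewrite Wi coefB coefXn coef_poly; apply: nmB_le.
      by case: eqP => _; rewrite ?nm1 ?nm0.
    by case: ifP => _; rewrite ?nm0 //; apply: le_trans (rnm_coef _ _) _; rewrite -nXs.
  - by move=> i hi; rewrite Wi nth_default ?nm0 // sw.
have mw : w \is monic by rewrite monicE lead_coefE sw ws.
have poly_of (r' : rs B) : (forall i, (s <= i)%N -> r' i = 0) ->
    r' = (map_poly (@sconst _ _ _ B) (\poly_(i < s) r' i)).[sX B].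
  by move=> h; apply: serP => i; rewrite ser_horner coef_poly; case: ltnP => // /h.
have div g : exists q' (r' : {poly B}), [/\ (size r' <= s)%N,
    g = q' * W + (map_poly (@sconst _ _ _ B) r').[sX B] & forall i, nm r'`_i <= nm g].
  have [q' [r' [e' nq' nr' hr']]] := weierstrass_division g dW.
  exists q', (\poly_(i < s) r' i); rewrite size_poly -poly_of //; split=> // i.
  rewrite coef_poly; case: ifP => _; rewrite ?nm0 ?nm_ge0 //.
  exact: le_trans (rnm_coef _ _) nr'.
exists w, q; split=> //; last by rewrite -/W wE mulrC.
- split=> //.
  + move=> g; have [q' [r' [s' e' _]]] := div g; exists q', r'; split=> //.
    by rewrite sw ltnS.
  + move=> q' r' s' e'; have [|-> h] := weierstrass_unique dW e'.
      move=> i hi; rewrite ser_horner nth_default // (leq_trans _ hi) //.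
      by rewrite -ltnS -sw.
    split=> //; apply/polyP => i; rewrite -ser_horner h scoef0.
    by rewrite coef0.
- have [q' [r' [e' _ _ hr']]] := weierstrass_division f dW.
  have [|h _] := @weierstrass_unique f s (q' * q - 1) r' df _ hr'.
    have -> : (q' * q - 1) * f + r' = (q' * W + r') - f by rewrite wE; ring.
    by rewrite -e' subrr.
  by apply/unitrPr; exists q'; rewrite mulrC; apply/eqP; rewrite -subr_eq0 h.
Qed.
End Weierstrass.

(** ** Coordinates in Weierstrass position *)

Section Coordinates.
Variables (R : realType) (p : nat) (K : perfectoidField R p).

Section TopDegree.
Variable B : nring K.
Implicit Types g h : rs B.

(** The reduction of g is a polynomial of degree d whose leading coefficient is a
    nonzero constant of the residue field of K. *)
Definition topdeg g d : Prop := exists a : K,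
  [/\ pf_abs a = 1, nm (g d - kst B a) < 1 & forall i, (d < i)%N -> nm (g i) < 1].

Lemma topdegM g h d d' : nm g <= 1 -> nm h <= 1 -> topdeg g d -> topdeg h d' ->
  topdeg (g * h) (d + d').
Proof.
move=> ng nh [a [a1 ga hg]] [b [b1 hb hh]].
have cg i : nm (g i) <= 1 by exact: le_trans (rnm_coef g i) ng.
have ch i : nm (h i) <= 1 by exact: le_trans (rnm_coef h i) nh.
have small i j : nm (g i) < 1 \/ nm (h j) < 1 -> nm (g i * h j) < 1.
  move=> [hl|hl]; rewrite nmM; [rewrite mulrC|];
    apply: le_lt_trans (ler_piMl _ _) hl; by rewrite ?nm_ge0 ?cg ?ch.
exists (a * b); split; first by rewrite pf_absM a1 b1 mulr1.
- have hd : (d < (d + d').+1)%N by rewrite ltnS leq_addr.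
  rewrite scoefM (bigD1 (Ordinal hd)) //= addKn addrAC; apply: nmD_lt.
    have -> : g d * h d' - kst B (a * b) = (g d - kst B a) * h d' +
       kst B a * (h d' - kst B b) by rewrite rmorphM; ring.
    apply: nmD_lt; rewrite nmM; [rewrite mulrC|rewrite nm_kst a1 mul1r //].
    by apply: le_lt_trans (ler_piMl _ _) ga; rewrite ?nm_ge0 ?ch.
  rewrite big_mkcond /=; apply: nm_sum_lt => // l _; case: eqP => [_|ld].
    by rewrite nm0.
  apply: small; have [h1|h1] := ltnP l d; [right; apply: hh; lia|left; apply: hg].
  by rewrite ltn_neqAle h1 andbT; apply/eqP => e; apply: ld; apply/val_inj.
- move=> i hi; rewrite scoefM; apply: nm_sum_lt => // l _; apply: small.
  by have [h1|h1] := ltnP d l; [left; exact: hg | right; apply: hh; lia].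
Qed.

Lemma topdeg_shift (y : B) e : nm y <= 1 -> (0 < e)%N ->
  topdeg (sconst y + sX B ^+ e) e.
Proof.
move=> ny e0; exists 1; rewrite pf_abs1; split=> //.
- by rewrite scoefD sXn !smonoE eqxx gtn_eqF // add0r rmorph1 subrr nm0.
- move=> i hi; rewrite scoefD sXn !smonoE !gtn_eqF ?addr0 ?nm0 //.
  exact: leq_ltn_trans hi.
Qed.

Lemma topdegX g d k : nm g <= 1 -> topdeg g d -> topdeg (g ^+ k) (d * k).
Proof.
move=> ng hg; elim: k => [|k ih]; last by rewrite exprS mulnS; apply: topdegM => //; exact: nmX_le1.
rewrite muln0 expr0; exists 1; rewrite pf_abs1 rmorph1; split=> //.
- by rewrite smonoE eqxx subrr nm0.
- by move=> i hi; rewrite smonoE gtn_eqF // nm0.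
Qed.

Lemma topdegD g h d : topdeg g d -> (forall i, (d <= i)%N -> nm (h i) < 1) ->
  topdeg (g + h) d.
Proof.
move=> [a [a1 ga hg]] hh; exists a; split=> //.
- by rewrite scoefD addrAC; apply: nmD_lt => //; exact: hh.
- by move=> i hi; apply: nmD_lt; [exact: hg|exact/hh/ltnW].
Qed.

Lemma topdeg_distinguished g d : nm g <= 1 -> topdeg g d -> distinguished g d.
Proof.
move=> ng [a [a1 ga hg]].
have a0 : a != 0 by apply/eqP => a0; move: a1; rewrite a0 pf_abs0 => /eqP; rewrite eq_sym oner_eq0.
have [|ug [n1 _]] := @nm_unit _ _ _ B (kst B a^-1 * g d).
  have -> : 1 - kst B a^-1 * g d = - (kst B a^-1 * (g d - kst B a)).
    by rewrite mulrBr -rmorphM mulVf // rmorph1; ring.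
  by rewrite nmN nmM nm_kst pf_absV a1 invr1 mul1r.
split=> //.
- by move=> i; exact: le_trans (rnm_coef g i) ng.
- by move: ug; rewrite unitrM => /andP[].
- by move: n1; rewrite nmM nm_kst pf_absV a1 invr1 mul1r.
Qed.

(** The term of largest top degree dominates: the others have small coefficients from
    there on. *)
Lemma topdeg_sum N (P : pred 'I_N) (F : 'I_N -> rs B) (D : 'I_N -> nat) (I : 'I_N) :
  (forall i, nm (F i) <= 1) -> P I ->
  (forall i, P i -> topdeg (F i) (D i)) -> (forall i, ~~ P i -> nm (F i) < 1) ->
  (forall i, P i -> i != I -> (D i < D I)%N) -> topdeg (\sum_i F i) (D I).
Proof.
move=> nF PI hF hP hD; rewrite (bigD1 I) //=; apply: topdegD; first exact: hF.
move=> j hj; rewrite scoef_sum big_mkcond /=; apply: nm_sum_lt => // i _.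
case: ifP => [iI|_]; last by rewrite nm0.
have [Pi|Pi] := boolP (P i).
  by have [a [_ _ h]] := hF i Pi; apply: h; apply: leq_trans hj; exact: hD.
exact: le_lt_trans (rnm_coef _ _) (hP i Pi).
Qed.
End TopDegree.

Lemma shift_le1 (B : nring K) (y : nat -> B) (hy : forall i, nm (y i) <= 1)
  (c : nat -> nat) i : nm (sconst (y i) + sX B ^+ c i : rs B) <= 1.
Proof. by apply: nmD_le; [rewrite nm_sconst | apply/nmX_le1; rewrite nm_sX]. Qed.

(** For c growing fast enough the substitution X_i -> y_i + X^(c_i) separates the
    monomials by their degrees in X. *)
Lemma generic_shift (B : nring K) (y : nat -> B) (hy : forall i, nm (y i) <= 1) k t
    (G : seq (TA K k)) : (0 < t)%N -> (forall g, g \in G -> nm g = 1) ->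
  exists c : nat -> nat, forall g, g \in G -> exists d, (t %| d)%N /\
    topdeg (tev (shift_le1 hy c) k g) d.
Proof.
move=> t0; elim: k G => [|k ih] G hG.
  exists (fun=> 1%N) => g gG; exists 0%N; split=> //; exists g.
  split; first exact: hG.
  - change (nm (smono (kst B g) 0 0%N - kst B g) < 1).
    by rewrite smonoE eqxx subrr nm0.
  - move=> i hi; change (nm (smono (kst B g) 0 i) < 1).
    by rewrite smonoE gtn_eqF // nm0.
have [N hN] := choice (fun g : rser (TA K k) => sf_null g ltr01).
pose G' := flatten [seq [seq (g : rser _) i | i <- iota 0 (N g) & nm ((g : rser _) i) == 1] | g <- G].
have inG' (g : rs (TA K k)) i : g \in G -> nm (g i) = 1 -> g i \in G'.
  move=> gG gi; apply/flatten_mapP; exists g => //; apply/mapP; exists i => //.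
  rewrite mem_filter gi eqxx /= mem_iota add0n ltnNge.
  by apply/negP => /hN; rewrite gi ltxx.
have [|c hc] := ih G'.
  move=> h /flatten_mapP [g gG /mapP [i]]; rewrite mem_filter => /andP[/eqP hi _] ->.
  by [].
have [M hM] : exists M, forall h, h \in G' -> exists d, [/\ (t %| d)%N, (d < M)%N &
    topdeg (tev (shift_le1 hy c) k h) d].
  elim: (G') hc => [|h s ihs] hs; first by exists 0%N.
  have [|M hM] := ihs; first by move=> g gs; apply: hs; rewrite inE gs orbT.
  have [|d [td hd]] := hs h; first by rewrite inE eqxx.
  exists (maxn M d.+1) => g; rewrite inE => /orP [/eqP ->|/hM [d' [td' dM hd']]].
    by exists d; rewrite td leq_max ltnSn orbT.
  by exists d'; rewrite td' leq_max dM.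
pose e := (t * M.+1)%N; have e0 : (0 < e)%N by rewrite muln_gt0 t0.
have Me : (M < e)%N by rewrite /e; nia.
pose c' i := if i == k then e else c i.
exists c' => g gG.
have tevc x : tev (shift_le1 hy c') k x = tev (shift_le1 hy c) k x.
  apply: tate_hom_ext => i hi; rewrite !tev_var //.
  by rewrite /c' ltn_eqF.
have ck : c' k = e by rewrite /c' eqxx.
clearbody c'.
pose Y : rs B := sconst (y k) + sX B ^+ e.
have nY : nm Y <= 1 by rewrite /Y -ck; exact: (shift_le1 hy c' k).
pose F (i : 'I_(N g)) : rs B := tev (shift_le1 hy c) k ((g : rser _) i) * Y ^+ i.
have ng i : nm ((g : rser _) i) <= 1.
  by rewrite -(hG _ gG); exact: rnm_coef.
have nF i : nm (F i) <= 1.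
  by apply: nmM_le1; [exact: le_trans (ch_le _ _) (ng i) | exact: nmX_le1].
have gE : topdeg (\sum_i F i) =1 topdeg (tev (shift_le1 hy c') k.+1 (strunc (N g) g)).
  move=> d; congr topdeg; rewrite rmorph_sum; apply: eq_bigr => i _.
  rewrite /F /= sev_mono; last by rewrite ck.
  by congr (_ * _); [exact: esym (tevc _) | rewrite ck].
have eg : tev (shift_le1 hy c') k.+1 g = tev (shift_le1 hy c') k.+1 (strunc (N g) g) +
    tev (shift_le1 hy c') k.+1 (g - strunc (N g) g).
  have gs : g = strunc (N g) g + (g - strunc (N g) g) by rewrite addrC subrK.
  by rewrite -rmorphD -gs.
have nsm : nm (tev (shift_le1 hy c') k.+1 (g - strunc (N g) g)) < 1.
  apply: le_lt_trans (ch_le _ _) _; apply: rnm_lt => i; rewrite scoefB struncE.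
  by case: ltnP => h; rewrite ?subrr ?nm0 // subr0 hN.
pose P (i : 'I_(N g)) := nm ((g : rser _) i) == 1.
have hP i : exists d, P i -> [/\ (t %| d)%N, (d < M)%N &
    topdeg (tev (shift_le1 hy c) k ((g : rser _) i)) d].
  have [h|h] := boolP (P i); last by exists 0%N.
  by have [d hd] := hM _ (inG' g i gG (eqP h)); exists d.
have [D0 hD0] := choice hP.
have [i1 Pi1] : exists i, P i.
  have [i hi] := rnm_attained g.
  have hi' : nm ((g : rser _) i) = 1 by rewrite hi; exact: hG.
  have iN : (i < N g)%N by rewrite ltnNge; apply/negP => /hN; rewrite hi' ltxx.
  by exists (Ordinal iN); apply/eqP.
pose I := [arg max_(i > i1 | P i) (i : nat)].
have [PI mI] : P I /\ forall i, P i -> (i <= I)%N.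
  by rewrite /I; case: arg_maxnP.
pose D i := (D0 i + e * i)%N.
exists (D I); split.
  by have [h _ _] := hD0 I PI; rewrite dvdn_add // /e -mulnA dvdn_mulr.
rewrite eg; apply: topdegD; last by move=> i _; exact: le_lt_trans (rnm_coef _ _) nsm.
rewrite -gE; apply: (topdeg_sum (P := P)) => // i.
- move=> Pi; have [_ _ h] := hD0 i Pi; apply: topdegM => //.
  + exact: le_trans (ch_le _ _) (ng i).
  + exact: nmX_le1.
  + apply: topdegX => //; exact: topdeg_shift.
- rewrite /P => Pi; rewrite nmM; apply: le_lt_trans (_ : nm ((g : rser _) i) < 1).
    apply: le_trans (ler_piMr (nm_ge0 _) (nmX_le1 _ nY)) (ch_le _ _).
  by rewrite lt_neqAle Pi ng.
- move=> Pi iI; have := mI _ Pi; rewrite leq_eqVlt => /orP [/eqP h|h].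
    by case/eqP: iI; apply/val_inj.
  have [_ h1 _] := hD0 i Pi; rewrite /D; nia.
Qed.

Variable n : nat.
Let T := TA K n.

Fact coord_le1 (sg : rs T -> rs T) (hsg : forall x, nm (sg x) = nm x) (c : nat -> nat) i :
  nm ((if (i < n)%N then sconst (tvar K n i) + sg (sX T ^+ c i) else sX T) : rs T) <= 1.
Proof.
case: ifP => _; last by rewrite nm_sX.
apply: nmD_le; first by rewrite nm_sconst tvar_le.
by rewrite hsg; apply/nmX_le1; rewrite nm_sX.
Qed.

(** After a scaling of f to norm 1, a generic substitution X_i -> X_i + X_n^(c_i)
    turns the reduction of f into a polynomial in X_n whose leading coefficient is
    constant. *)
Lemma tate_coordinates (f : TA K n.+1) : f != 0 ->
  exists (sg sg' : chom (TA K n.+1) (TA K n.+1)) (c : K) s,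
  [/\ forall x, sg' (sg x) = x, forall x, sg (sg' x) = x, c != 0 &
      distinguished (B := T) (sg (kst _ c * f)) s].
Proof.
move=> f0; have [c' hc'] := nm_val f.
have c0' : c' != 0.
  by apply/eqP => c0; move: (nm_gt0 f0); rewrite hc' c0 pf_abs0 ltxx.
pose g : rs T := kst _ c'^-1 * f.
have ng : nm g = 1 by rewrite nmM nm_kst pf_absV -hc' mulVf // gt_eqF // nm_gt0.
have [N hN] := sf_null g ltr01.
pose P (i : 'I_N) := nm ((g : rser _) i) == 1.
have cg i : nm ((g : rser _) i) <= 1 by rewrite -ng; exact: rnm_coef.
have [||c hc] := @generic_shift T (tvar K n) (@tvar_le _ _ K n) n N.+1
   [seq (g : rser _) i | i <- iota 0 N & nm ((g : rser _) i) == 1].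
- by [].
- by move=> h /mapP [i]; rewrite mem_filter => /andP [/eqP hi _] ->.
have [i1 Pi1] : exists i, P i.
  have [i hi] := rnm_attained g.
  have hi' : nm ((g : rser _) i) = 1 by rewrite hi; exact: ng.
  have iN : (i < N)%N by rewrite ltnNge; apply/negP => /hN; rewrite hi' ltxx.
  by exists (Ordinal iN); apply/eqP.
have idn (x : rs T) : nm (idfun x) = nm x by [].
have opn (x : rs T) : nm (- x) = nm x by exact: nmN.
pose sg := tev (coord_le1 idn c) n.+1; pose sg' := tev (coord_le1 opn c) n.+1.
have sgX : sg (sX T) = sX T.
  by rewrite -[X in sg X](tvar_last K n) tev_var // ltnn.
have sgX' : sg' (sX T) = sX T.
  by rewrite -[X in sg' X](tvar_last K n) tev_var // ltnn.
have sgv i : (i < n)%N -> sg (sconst (tvar K n i)) = sconst (tvar K n i) + sX T ^+ c i.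
  move=> hi; have h : (i < n.+1)%N := leq_trans hi (leqnSn n).
  by rewrite -[in LHS]tvar_lt // (tev_var _ h) hi.
have sgv' i : (i < n)%N -> sg' (sconst (tvar K n i)) = sconst (tvar K n i) - sX T ^+ c i.
  move=> hi; have h : (i < n.+1)%N := leq_trans hi (leqnSn n).
  by rewrite -[in LHS]tvar_lt // (tev_var _ h) hi.
exists sg, sg', c'^-1; pose hP := hc.
have K1 x : sg' (sg x) = x.
  apply: (tate_hom_ext (f := ccomp sg' sg) (g := cid_hom _)) => i hi.
  change (sg' (sg (tvar K n.+1 i)) = tvar K n.+1 i).
  move: hi; rewrite ltnS leq_eqVlt => /orP [/eqP ->|hi].
    by rewrite (tvar_last K n) (sgX : sg (sX (TA K n)) = sX (TA K n)) sgX'.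
  by rewrite tvar_lt // sgv // rmorphD rmorphXn sgX' sgv' // subrK.
have K2 x : sg (sg' x) = x.
  apply: (tate_hom_ext (f := ccomp sg sg') (g := cid_hom _)) => i hi.
  change (sg (sg' (tvar K n.+1 i)) = tvar K n.+1 i).
  move: hi; rewrite ltnS leq_eqVlt => /orP [/eqP ->|hi].
    by rewrite (tvar_last K n) (sgX' : sg' (sX (TA K n)) = sX (TA K n)) sgX.
  by rewrite tvar_lt // sgv' // rmorphB rmorphXn sgX sgv // addrK.
have hD i : exists d, P i -> (N.+1 %| d)%N /\
    topdeg (sg (sconst ((g : rser _) i))) d.
  have [h|h] := boolP (P i); last by exists 0%N.
  have [|d [td hd]] := hc ((g : rser _) i).
    apply/mapP; exists (i : nat) => //; rewrite mem_filter mem_iota /= add0n ltn_ord.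
    by rewrite [_ == _]h.
  exists d => _; split=> //; move: hd; congr (topdeg _ d).
  apply: (tate_hom_ext (g := ccomp sg (cconst _))) => j hj.
  by rewrite tev_var //= sgv.
have [D0 hD0] := choice hD.
pose D i := (D0 i + i)%N.
pose I := [arg max_(i > i1 | P i) D i].
have [PI mI] : P I /\ forall i, P i -> (D i <= D I)%N.
  by rewrite /I; case: arg_maxnP.
exists (D I); split; [exact: K1|exact: K2|by rewrite invr_eq0|].
apply: topdeg_distinguished; first by apply: le_trans (ch_le _ _) _; rewrite -/g ng.
rewrite -/g; have -> : g = strunc N g + (g - strunc N g) by rewrite addrC subrK.
rewrite rmorphD; apply: topdegD; last first.
  have h0 : nm (g - strunc N g : rs T) < 1.
    apply: rnm_lt => j; rewrite scoefB struncE.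
    by case: ltnP => h; rewrite ?subrr ?nm0 // subr0 hN.
  move=> i _; apply: le_lt_trans (rnm_coef _ _) _; exact: le_lt_trans (ch_le sg _) h0.
rewrite rmorph_sum.
have nX : nm (sX T : rs T) <= 1 by rewrite nm_sX.
have tX : topdeg (sX T) 1.
  have := @topdeg_shift T 0 1; rewrite rmorph0 add0r expr1; apply=> //.
  by rewrite nm0.
have monoE i : sg (smono ((g : rser _) i) i) = sg (sconst ((g : rser _) i)) * sX T ^+ i.
  by rewrite smono_CX rmorphM rmorphXn /= sgX.
apply: (topdeg_sum (P := P)) => // i.
- rewrite monoE; apply: nmM_le1; last exact: nmX_le1.
  by apply: le_trans (ch_le _ _) _; rewrite nm_sconst.
- move=> Pi; rewrite monoE; apply: topdegM.
  + by apply: le_trans (ch_le _ _) _; rewrite nm_sconst.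
  + exact: nmX_le1.
  + by have [] := hD0 i Pi.
  + by have := topdegX i nX tX; rewrite mul1n.
- rewrite /P => Pi; rewrite monoE nmM.
  apply: le_lt_trans (_ : nm ((g : rser _) i) < 1).
    apply: le_trans (ler_piMr (nm_ge0 _) (nmX_le1 _ nX)) _.
    by apply: le_trans (ch_le _ _) _; rewrite nm_sconst.
  by rewrite lt_neqAle Pi cg.
- move=> Pi iI; have := mI _ Pi; rewrite leq_eqVlt => /orP [/eqP h|//].
  have [d1 _] := hD0 i Pi; have [d2 _] := hD0 I PI.
  case/eqP: iI; apply/val_inj; move: h; rewrite /D => h.
  have iN := ltn_ord i; have IN := ltn_ord I.
  have : (D0 i + i = D0 I + I %[mod N.+1])%N by rewrite h.
  rewrite -modnDml (eqP d1) add0n -[in RHS]modnDml (eqP d2) add0n.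
  by rewrite !modn_small // (ltn_trans (ltn_ord _)).
Qed.
End Coordinates.

Lemma weierstrass_transport (B B' R' : idomainType) (iota : {rmorphism R' -> B})
    (x : B) w (f : {rmorphism B -> B'}) (g : B' -> B) : cancel f g -> cancel g f ->
  weierstrass iota x w -> weierstrass (f \o iota : {rmorphism R' -> B'}) (f x) w.
Proof.
move=> fg gf [mw ex un].
have evf (q : {poly R'}) : (map_poly (f \o iota) q).[f x] = f (map_poly iota q).[x].
  by rewrite map_poly_comp horner_map.
split=> //.
- move=> b; have [q [r [s e]]] := ex (g b); exists (f q), r; split=> //.
  by rewrite !evf -rmorphM -rmorphD -e gf.
- move=> q r s; rewrite !evf -{1}(gf q) -rmorphM -rmorphD => /eqP.
  rewrite -(rmorph0 f) (inj_eq (can_inj fg)) => /eqP e.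
  by have [h ->] := un _ _ s e; rewrite -[q]gf h rmorph0.
Qed.

(** Weierstrass preparation in the coordinates found above, transported back along the
    change of coordinates. *)
Theorem tate_weierstrass_ring (R : realType) (p : nat) (K : perfectoidField R p) n :
  weierstrass_ring n (TA K n).
Proof.
elim: n => [|n ih] f f0.
  have f0' : (f : K) != 0 by [].
  by apply/unitrPr; exists ((f : K)^-1); exact: (mulfV f0').
have [sg [sg' [c [s [K1 K2 c0 df]]]]] := tate_coordinates f0.
have [w [u [hw uu _ e _]]] := weierstrass_preparation df.
exists (TA K n), (sg' \o @sconst _ _ _ (TA K n) : {rmorphism _ -> TA K n.+1}).
exists (sg' (sX _)), w, (kst _ c * sg' u); split=> //.
- exact: (weierstrass_transport (f := sg') (g := sg)).
- have h1 : kst (TA K n.+1) c \is a GRing.unit by rewrite rmorph_unit // unitfE.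
  have h2 : sg' u \is a GRing.unit by exact: rmorph_unit.
  by rewrite unitrM h1 h2.
- transitivity (sg' (sg (kst _ c * f) * u)); last by rewrite e map_poly_comp horner_map.
  by rewrite rmorphM /= K1; ring.
Qed.

Theorem tate_projective_free (R : realType) (p : nat) (K : perfectoidField R p) n :
  projective_free (TA K n).
Proof. exact: weierstrass_projective_free (tate_weierstrass_ring K n). Qed.

(** * Descent of freeness along dense subrings *)

Section DetClose.
Variables (Q : comPzRingType) (S I : set Q).
Hypotheses (S1 : S 1) (SM : forall x y, S x -> S y -> S (x * y))
  (SN : forall x, S x -> S (- x))
  (I0 : I 0) (ID : forall x y, I x -> I y -> I (x + y))
  (IM : forall x y, S x -> I y -> I (x * y)).

(** S plays a ring of bounded elements and I an ideal of small ones. Only closure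
    properties are assumed, so that the same computation serves the norm and the levels
    of an adic ring. *)
Lemma det_close n (A B : 'M[Q]_n) : (forall i j, S (A i j)) -> (forall i j, S (B i j)) ->
  (forall i j, I (A i j - B i j)) -> I (\det A - \det B).
Proof.
move=> SA SB IAB; rewrite /determinant -sumrB; elim/big_ind: _ => // s0 _.
set s := perm.fun_of_perm s0; move: s => s.
have IN x : I x -> I (- x) by move=> h; rewrite -mulN1r; apply: IM => //; exact: SN.
have key : S (\prod_i A i (s i)) /\ S (\prod_i B i (s i)) /\
    I (\prod_i A i (s i) - \prod_i B i (s i)).
  elim/big_rec2: _ => [|i x y _ [Sx [Sy Ixy]]]; first by rewrite subrr.
  split; first exact: SM; split; first exact: SM.
  have -> : A i (s i) * y - B i (s i) * x = A i (s i) * (y - x) + x * (A i (s i) - B i (s i)).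
    by rewrite !mulrBr [x * B _ _]mulrC [x * A _ _]mulrC addrA subrK.
  by apply: ID; apply: IM.
rewrite -mulrBr; have [_ [_ h]] := key; case: (perm.odd_perm s0) => /=.
- by rewrite expr1 mulN1r; exact: IN.
- by rewrite expr0 mul1r.
Qed.
End DetClose.

Section MatrixNorm.
Variables (R : realType) (p : nat) (K : perfectoidField R p).

Definition mxle (B : nring K) m n (M : 'M[B]_(m, n)) (c : R) := forall i j, nm (M i j) <= c.

Section Basic.
Variable B : nring K.

Lemma mxleD m n (M M' : 'M[B]_(m, n)) c : mxle M c -> mxle M' c -> mxle (M + M') c.
Proof. by move=> h h' i j; rewrite mxE; exact: nmD_le. Qed.
Lemma mxleB m n (M M' : 'M[B]_(m, n)) c : mxle M c -> mxle M' c -> mxle (M - M') c.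
Proof. by move=> h h' i j; rewrite !mxE; exact: nmB_le. Qed.
Lemma mxleW m n (M : 'M[B]_(m, n)) c d : c <= d -> mxle M c -> mxle M d.
Proof. by move=> cd h i j; exact: le_trans (h i j) cd. Qed.
Lemma mxleM m n k (M : 'M[B]_(m, n)) (M' : 'M[B]_(n, k)) c d : 0 <= c -> 0 <= d ->
  mxle M c -> mxle M' d -> mxle (M *m M') (c * d).
Proof.
move=> c0 d0 h h' i j; rewrite mxE; apply: nm_sum_le => [|l _]; first exact: mulr_ge0.
by rewrite nmM; apply: ler_pM; rewrite ?nm_ge0.
Qed.
Lemma mxle1 n : mxle (1%:M : 'M[B]_n) 1.
Proof. by move=> i j; rewrite mxE; case: eqP; rewrite ?nm1 ?nm0. Qed.
Lemma mxle_bound m n (M : 'M[B]_(m, n)) : exists c, 1 <= c /\ mxle M c.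
Proof.
exists (1 + \sum_(ij : 'I_m * 'I_n) nm (M ij.1 ij.2)); split.
  by rewrite lerDl sumr_ge0 // => *; exact: nm_ge0.
move=> i j; rewrite (bigD1 (i, j)) //= addrCA lerDl addr_ge0 // sumr_ge0 // => *.
exact: nm_ge0.
Qed.

Lemma near1_inv n (M : 'M[B]_n) c : c < 1 -> mxle (M - 1%:M) c -> exists M', M *m M' = 1%:M.
Proof.
move=> c1 h.
have [n0|n0] := posnP n.
  by subst n; exists M; rewrite [LHS]flatmx0 [RHS]flatmx0.
have c0 : 0 <= c by have := h (Ordinal n0) (Ordinal n0); apply: le_trans; exact: nm_ge0.
have M1 : mxle M 1.
  by rewrite -(subrK 1%:M M); apply: mxleD; [apply: mxleW h; exact: ltW | exact: mxle1].
have hd : nm (\det M - \det (1%:M : 'M[B]_n)) <= c.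
  have P := @det_close B [set x : B | nm x <= 1] [set x : B | nm x <= c].
  apply: (P _ _ _ _ _ _ n M 1%:M) => /=.
  - by rewrite nm1.
  - by move=> x y hx hy; exact: nmM_le1.
  - by move=> x; rewrite nmN.
  - by rewrite nm0.
  - by move=> *; exact: nmD_le.
  - by move=> *; exact: nmM_le1.
  - exact: M1.
  - exact: mxle1.
  - by move=> i j; have := h i j; rewrite !mxE.
move: hd; rewrite det1 => hd; have [|ud _] := @nm_unit _ _ _ B (\det M).
  by rewrite nmBC; exact: le_lt_trans hd c1.
exists ((\det M)^-1 *: \adj M).
by rewrite -scalemxAr mul_mx_adj scale_scalar_mx mulVr.
Qed.

(** Newton iteration for x^2 = x: replacing x by 3x^2 - 2x^3 squares the defect. *)
Lemma newton_step n (x : 'M[B]_n) : let e := x *m x - x in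
  let x' := x + (e - 2%:R *: (x *m e)) in
  x' *m x' - x' = 4%:R *: (e *m e *m e) - 3%:R *: (e *m e).
Proof.
case: n x => [|n] x e x'; first by rewrite [LHS]flatmx0 [RHS]flatmx0.
have h (q q' : {poly B}) : q = q' -> horner_mx x q = horner_mx x q' by move=> ->.
pose E : {poly B} := 'X ^+ 2 - 'X.
pose X' : {poly B} := 'X + (E - 2%:R *: ('X * E)).
have hE : horner_mx x E = e by rewrite rmorphB rmorphXn /= horner_mx_X expr2.
have hX : horner_mx x X' = x'.
  by rewrite rmorphD rmorphB /= linearZ rmorphM /= horner_mx_X hE.
have : X' * X' - X' = 4%:R *: (E * E * E) - 3%:R *: (E * E).
  by rewrite /X' /E -!mul_polyC !polyC_natr; ring.
clearbody E X'.
have hl : horner_mx x (X' * X' - X') = x' * x' - x' by rewrite -hX rmorphB rmorphM.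
have hr : horner_mx x (4%:R *: (E * E * E) - 3%:R *: (E * E)) =
    4%:R *: (e * e * e) - 3%:R *: (e * e).
  have hZ a q : horner_mx x (a *: q) = a *: horner_mx x q by rewrite linearZ.
  have m2 : horner_mx x (E * E) = e * e by rewrite -hE; exact: rmorphM.
  have m3 : horner_mx x (E * E * E) = e * e * e by rewrite -m2 -hE; exact: rmorphM.
  by rewrite -m3 -m2 -!hZ; exact: rmorphB.
by move=> /h; rewrite hl hr.
Qed.

(** Newton iteration starting from x: it converges because the defect of x is small
    against its size M, and moves x by at most s. *)
Lemma lift_idempotent n (x : 'M[B]_n) (M s : R) : 1 <= M -> 0 < s -> s <= 1 ->
  mxle x M -> mxle (x *m x - x) (s / (2 * M)) ->
  exists y, y *m y = y /\ mxle (y - x) s.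
Proof.
move=> M1 s0 s1 xM he; have M0 : 0 < M by exact: lt_le_trans M1.
pose st (z : 'M[B]_n) := z + ((z *m z - z) - 2%:R *: (z *m (z *m z - z))).
pose u k := iter k st x.
have nat1 k : nm (k%:R : B) <= 1.
  by elim: k => [|k ih]; rewrite ?nm0 // -natr1; apply: nmD_le; rewrite ?nm1.
have mxleZ k m l (N : 'M[B]_(m, l)) c : mxle N c -> mxle (k%:R *: N) c.
  by move=> hN i j; rewrite mxE; exact: nmM_le1.
have inv (k : nat) : mxle (u k) M /\ mxle (u k *m u k - u k) (s / (2 * M) / 2 ^+ k).
  elim: k => [|k [ukM ue]]; first by rewrite expr0 divr1.
  rewrite /u iterS -/(u k); set e := u k *m u k - u k in ue.
  set d := s / (2 * M) / 2 ^+ k in ue *.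
  have d0 : 0 <= d by rewrite /d !divr_ge0 ?exprn_ge0 ?mulr_ge0 // ltW.
  have Md : M * d <= 1.
    have -> : M * d = s / 2 / 2 ^+ k by rewrite /d; field; rewrite expf_neq0 ?gt_eqF //.
    rewrite ler_pdivrMr ?exprn_gt0 // mul1r; apply: (@le_trans _ _ 1); first by lra.
    by rewrite exprn_ege1 // ler1n.
  have d2 : d <= 2^-1.
    have : d <= s / (2 * M).
      rewrite /d ler_pdivrMr ?exprn_gt0 // ler_peMr ?exprn_ege1 ?ler1n //.
      by rewrite divr_ge0 ?mulr_ge0 // ltW.
    move=> h; apply: le_trans h _; rewrite ler_pdivrMr ?mulr_gt0 //.
    by lra.
  have dM : d <= M by lra.
  split.
    apply: (mxleD ukM); apply: mxleB; first exact: mxleW ue.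
    apply: mxleZ; apply: (@mxleW _ _ _ (M * d)); first exact: le_trans M1.
    exact: (mxleM (ltW M0) d0 ukM ue).
  rewrite newton_step -/e.
  have dd : d * d <= s / (2 * M) / 2 ^+ k.+1.
    have -> : s / (2 * M) / 2 ^+ k.+1 = d * 2^-1.
      by rewrite /d exprS; field; rewrite expf_neq0 ?gt_eqF.
    by rewrite ler_wpM2l.
  apply: mxleW dd _; have h2 : mxle (e *m e) (d * d) by exact: mxleM.
  have dd0 : 0 <= d * d by exact: mulr_ge0.
  have d1 : d <= 1 by apply: le_trans d2 _; lra.
  have h3 : mxle (e *m e *m e) (d * d).
    by apply: mxleW (mxleM dd0 d0 h2 ue); exact: ler_piMr.
  by apply: mxleB; apply: mxleZ.
have step k : mxle (u k.+1 - u k) (s * (2 ^+ k)^-1).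
  have [uM ue] := inv k; rewrite [u k.+1]/(st (u k)) /st addrC addKr.
  set e := u k *m u k - u k in ue *.
  have h1 : M * (s / (2 * M) / 2 ^+ k) <= s * (2 ^+ k)^-1.
    have -> : M * (s / (2 * M) / 2 ^+ k) = s / 2 * (2 ^+ k)^-1.
      by field; rewrite expf_neq0 ?gt_eqF.
    by rewrite ler_wpM2r ?invr_ge0 ?exprn_ge0 //; lra.
  have h0 : 0 <= s / (2 * M) / 2 ^+ k by rewrite !divr_ge0 ?exprn_ge0 ?mulr_ge0 // ltW.
  apply: mxleW h1 _; apply: mxleB; first by apply: mxleW ue; rewrite ler_peMl.
  by apply: mxleZ; apply: mxleM => //; exact: ltW.
have cv i j : exists l, forall k, nm (l - u k i j) <= (2 ^+ k)^-1.
  apply: nm_complete => k; have := step k i j; rewrite !mxE => h.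
  by apply: le_trans h _; rewrite ler_piMl ?invr_ge0 ?exprn_ge0.
have [l hl] := choice (fun ij : 'I_n * 'I_n => cv ij.1 ij.2).
pose y : 'M[B]_n := \matrix_(i, j) l (i, j).
have yu k : mxle (y - u k) (2 ^+ k)^-1 by move=> i j; rewrite !mxE; exact: (hl (i, j)).
have yM : mxle y M.
  rewrite -(subrK (u 0%N) y); apply: mxleD; last by have [] := inv 0%N.
  by apply: mxleW (yu 0%N); rewrite expr0 invr1.
exists y; split.
  apply/eqP; rewrite -subr_eq0; apply/eqP/matrixP => i j; rewrite [RHS]mxE.
  apply: nm_eq0; apply: le0_small; first exact: nm_ge0.
  move=> c c0; have [k hk] := half_small (divr_gt0 c0 M0).
  have h2 : (2 ^+ k)^-1 * M <= c by move: hk; rewrite ler_pdivlMr.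
  have [uM ue] := inv k.
  suff : mxle (y *m y - y) c by [].
  have -> : y *m y - y = (y - u k) *m y + u k *m (y - u k) - (y - u k) +
      (u k *m u k - u k).
    rewrite mulmxBl mulmxBr; set a := y *m y; set b := u k *m y; set d := u k *m u k.
    by rewrite subrKA addrAC subrKA opprB subrKA.
  have p0 : 0 <= (2 ^+ k)^-1 :> R by rewrite invr_ge0 exprn_ge0.
  have M0' := ltW M0.
  apply: mxleD; last first.
    apply: mxleW ue; apply: le_trans h2; rewrite mulrC ler_wpM2l //.
    rewrite ler_pdivrMr ?mulr_gt0 //; apply: (@le_trans _ _ 1) => //.
    by nra.
  apply: mxleB; last by apply: mxleW (yu k); apply: le_trans h2; rewrite ler_peMr.
  apply: mxleD; apply: mxleW h2 _; first exact: mxleM.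
  by rewrite mulrC; apply: mxleM.
have us k : mxle (u k - x) s.
  elim: k => [|k ih]; first by move=> i j; rewrite /u /= subrr mxE nm0 ltW.
  rewrite -(subrK (u k) (u k.+1)) -addrA; apply: mxleD ih.
  by apply: mxleW (step k); rewrite ler_piMr ?half_pow_le1 // ltW.
have [k hk] := half_small s0; rewrite -(subrK (u k) y) -addrA.
by apply: mxleD (us k); exact: mxleW (yu k).
Qed.
End Basic.

(** Close idempotents are conjugate, and an idempotent of A is close to one that comes
    from T; so freeness descends along a directed union with dense image. *)
Theorem dense_projective_free (T A : nring K) (E : nat -> chom T A) :
  (forall m x, nm (E m x) = nm x) ->
  (forall a (c : R), 0 < c -> exists m0, forall m, (m0 <= m)%N ->
     exists x, nm (a - E m x) <= c) ->
  projective_free T -> projective_free A.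
Proof.
move=> iso dense pf N e ee.
have [M [M1 eM]] := mxle_bound e.
have M0 : 0 < M by exact: lt_le_trans M1.
pose s : R := (2 * M)^-1.
have s0 : 0 < s by rewrite invr_gt0 mulr_gt0.
have s1 : s <= 1 by rewrite invf_le1 ?mulr_gt0 //; lra.
have Ms : M * s = 2^-1 by rewrite /s; field; rewrite gt_eqF.
pose d : R := s / (2 * M) / M.
have d0 : 0 < d by rewrite !divr_gt0 ?mulr_gt0.
have dle : d <= s.
  rewrite /d ler_pdivrMr // ler_pdivrMr ?mulr_gt0 // -mulrA ler_peMr ?ltW //.
  by nra.
have [m0 hm0] := choice (fun ij : 'I_N * 'I_N => dense (e ij.1 ij.2) d d0).
pose m := (\max_ij m0 ij)%N.
have [x hx] := choice (fun ij : 'I_N * 'I_N => hm0 ij m (leq_bigmax ij)).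
pose e0 : 'M[T]_N := \matrix_(i, j) x (i, j).
pose f n k (Z : 'M[T]_(n, k)) := map_mx (E m) Z.
have fe : mxle (e - f _ _ e0) d by move=> i j; rewrite !mxE; exact: (hx (i, j)).
have fle n k (Z : 'M[T]_(n, k)) c : mxle (f _ _ Z) c <-> mxle Z c.
  by split=> h i j; have := h i j; rewrite mxE iso.
have e0M : mxle e0 M.
  apply/fle; rewrite -[f _ _ _](subKr e); apply: mxleB => //.
  by apply: mxleW fe; apply: le_trans dle _; lra.
have [|y [yy ye]] := @lift_idempotent T N e0 M s M1 s0 s1 e0M.
  apply/fle; rewrite /f map_mxB map_mxM -/(f _ _ e0).
  have -> : f _ _ e0 *m f _ _ e0 - f _ _ e0 =
     (f _ _ e0 - e) *m f _ _ e0 + e *m (f _ _ e0 - e) - (f _ _ e0 - e).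
    rewrite mulmxBl mulmxBr ee addrA subrK opprB addrA.
    by rewrite subrK.
  have fe' : mxle (f _ _ e0 - e) d by move=> i j; have := fe i j; rewrite !mxE nmBC.
  have dM : d * M = s / (2 * M) by rewrite /d divfK // gt_eqF.
  have d0' := ltW d0; have M0' := ltW M0.
  rewrite -dM; apply: mxleB; last by apply: mxleW fe'; rewrite ler_peMr.
  by apply: mxleD; [| rewrite mulrC]; apply: mxleM => //; exact/fle.
pose e' := f _ _ y; have ee' : e' *m e' = e' by rewrite /e' /f -map_mxM yy.
have close : mxle (e' - e) s.
  rewrite -(subrK (f _ _ e0) e') -addrA; apply: mxleD.
    by rewrite /e' /f -map_mxB; exact/fle.
  by move=> i j; have := mxleW dle fe i j; rewrite !mxE nmBC.
pose w := e *m e' + (1%:M - e) *m (1%:M - e').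
have ew : e *m w = w *m e'.
  have e1 : e *m (e *m e') = e *m e' by rewrite mulmxA ee.
  have e2 : e *m (1%:M - e) = 0 by rewrite mulmxBr mulmx1 ee subrr.
  have e3 : (1%:M - e') *m e' = 0 by rewrite mulmxBl mul1mx ee' subrr.
  have -> : e *m w = e *m e' by rewrite /w mulmxDr e1 mulmxA e2 mul0mx addr0.
  by rewrite /w mulmxDl -!mulmxA e3 mulmx0 addr0 ee'.
have [w' ww] : exists w', w *m w' = 1%:M.
  apply: (@near1_inv _ _ _ (2^-1)); first by lra.
  have -> : w - 1%:M = 2%:R *: (e *m (e' - e)) - (e' - e).
    rewrite /w [(1%:M - e) *m (1%:M - e')]mulmxBr mulmx1 [(1%:M - e) *m e']mulmxBl mul1mx.
    rewrite mulmxBr ee; set P := e *m e'.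
    by apply/matrixP => i j; rewrite !mxE; ring.
  rewrite -Ms; apply: mxleB; last by apply: mxleW close; rewrite ler_peMl // ltW.
  have h2 : mxle (e *m (e' - e)) (M * s) by apply: mxleM => //; exact: ltW.
  by rewrite scaler_nat mulr2n; exact: mxleD.
have [r [U [V [UV VU]]]] := pf _ y yy.
exists r, (w *m f _ _ U), (f _ _ V *m w'); split.
- rewrite !mulmxA -[w *m _ *m _]mulmxA -map_mxM UV -[map_mx _ _]/e' -ew -mulmxA ww.
  by rewrite mulmx1.
- rewrite !mulmxA -[f _ _ V *m w' *m w]mulmxA (mulmx1C ww) mulmx1 -map_mxM VU.
  by rewrite map_mx1.
Qed.
End MatrixNorm.

(** * The perfectoid Tate algebra as a normed ring *)

Lemma null_max (R : realType) (p : nat) (K : perfectoidField R p) (I : choiceType) (i0 : I)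
    (f : I -> K) : null_family f -> exists i, forall j, pf_abs (f j) <= pf_abs (f i).
Proof.
move=> nf; have [h|/existsNP [i1 /eqP h]] := pselect (forall i, f i = 0).
  by exists i0 => j; rewrite !h.
have [G [_ hG]] := null_seq nf (pf_abs_gt0 h).
have [i [iG hi]] : exists i, i \in G /\ forall j, j \in G -> pf_abs (f j) <= pf_abs (f i).
  have : i1 \in G by rewrite -hG.
  elim: (G) i1 {h hG} => // x s ih i1 _.
  have [s0|[y ys]] : s = [::] \/ exists y, y \in s.
  - by case: (s) => [|y t]; [left | right; exists y; rewrite mem_head].
  - by exists x; rewrite s0 mem_head; split=> // j; rewrite inE => /eqP ->.
  have [i [si hi]] := ih y ys.
  have [xi|ix] := leP (pf_abs (f x)) (pf_abs (f i)).
  - by exists i; rewrite inE si orbT; split=> // j; rewrite inE => /orP [/eqP ->|/hi].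
  - exists x; rewrite mem_head; split=> // j; rewrite inE => /orP [/eqP ->//|/hi hj].
    exact: le_trans hj (ltW ix).
exists i => j; have [/hi//|] := boolP (j \in G).
rewrite -hG -ltNge => /ltW hj; apply: le_trans hj _.
by apply: hi; rewrite -hG.
Qed.

Lemma nonroot (q : {poly rat}) : q != 0 -> exists t, ~~ root q t.
Proof.
move=> q0; apply: contrapT => /forallNP h.
pose s : seq rat := [seq i%:R | i <- iota 0 (size q)].
have us : uniq s by rewrite map_inj_uniq ?iota_uniq // => i j /eqP; rewrite eqr_nat => /eqP.
have rs : all (root q) s by apply/allP => t _; apply: contrapT => /negP; exact: h.
by have := max_poly_roots q0 rs us; rewrite size_map size_iota ltnn.
Qed.

(** A linear functional on Q^n separating the members of a finite set; it orders the
    exponents compatibly with addition, which makes leading terms multiplicative. *)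
Lemma separating_functional n (s : seq 'rV[rat]_n) : exists l : 'rV[rat]_n -> rat,
  (forall x y, l (x - y) = l x - l y) /\ {in s &, injective l}.
Proof.
pose q : {poly rat} := \prod_(x <- s) \prod_(y <- s | x != y) rVpoly (x - y).
have [|t ht] := @nonroot q.
  rewrite prodf_seq_neq0; apply/allP => x _ /=; rewrite prodf_seq_neq0.
  apply/allP => y _ /=; apply/implyP => xy; apply: contra xy => /eqP h.
  by rewrite -subr_eq0 -[x - y]rVpolyK h linear0.
exists (fun x => (rVpoly x).[t]); split=> [x y|x y xs ys h].
  by rewrite linearB hornerD hornerN.
apply/eqP; apply: contraNT ht => xy; rewrite /root /q horner_prod prodf_seq_eq0.
apply/hasP; exists x => //=; rewrite horner_prod prodf_seq_eq0.
by apply/hasP; exists y => //=; rewrite xy linearB hornerD hornerN h subrr eqxx.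
Qed.

Section PerfNorm.
Variables (R : realType) (p : nat) (K : perfectoidField R p) (n : nat).
Local Notation A := (perfTate K n).
Implicit Types (a b : A) (al be ga : 'rV[rat]_n).

Definition amax a : 'rV[rat]_n := projT1 (cid (null_max 0 (@tcoef_null _ _ _ _ a))).
Definition tnm a : R := pf_abs (a (amax a)).
Lemma tnm_coef a al : pf_abs (a al) <= tnm a.
Proof. exact: (projT2 (cid (null_max 0 (@tcoef_null _ _ _ _ a)))). Qed.
Lemma tnm_le a e : (forall al, pf_abs (a al) <= e) -> tnm a <= e. Proof. by apply. Qed.
Lemma tnm_attained a : exists al, pf_abs (a al) = tnm a. Proof. by exists (amax a). Qed.
Lemma tnm_ge0 a : 0 <= tnm a. Proof. exact: pf_abs_ge0. Qed.
Lemma tnm_eq0 a : tnm a = 0 -> a = 0.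
Proof.
move=> h; apply: tateP => al; have : pf_abs (a al) = 0.
  by apply/le_anti; rewrite -{1}h tnm_coef pf_abs_ge0.
by move/pf_abs_eq0 => ->; rewrite /= if_same.
Qed.
Lemma tnmD a b : tnm (a + b) <= Num.max (tnm a) (tnm b).
Proof.
apply: tnm_le => al; rewrite tcoefD; apply: le_trans (pf_absD _ _) _.
by rewrite ge_max !le_max !tnm_coef /= orbT.
Qed.

(** Among the terms of maximal size there are finitely many; those where a separating
    functional is maximal multiply to a term that no other product cancels. *)
Lemma tnmM a b : tnm (a * b) = tnm a * tnm b.
Proof.
have le : tnm (a * b) <= tnm a * tnm b.
  apply: tnm_le => ga; rewrite tcoefM; apply: nsum_le; first exact: tconv_inner_null.
    by rewrite mulr_ge0 ?tnm_ge0.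
  by move=> al; rewrite pf_absM; apply: ler_pM; rewrite ?pf_abs_ge0 ?tnm_coef.
apply/eqP; rewrite eq_le le /=.
have [a0|an] := eqVneq (tnm a) 0; first by rewrite a0 mul0r tnm_ge0.
have [b0|bn] := eqVneq (tnm b) 0; first by rewrite b0 mulr0 tnm_ge0.
have a0 : 0 < tnm a by rewrite lt_neqAle eq_sym an tnm_ge0.
have b0 : 0 < tnm b by rewrite lt_neqAle eq_sym bn tnm_ge0.
have [Sa [_ hSa]] := null_seq (@tcoef_null _ _ _ _ a) a0.
have [Sb [_ hSb]] := null_seq (@tcoef_null _ _ _ _ b) b0.
have [l [lB li]] := separating_functional Sa.
have mx (c : A) (S : seq 'rV[rat]_n) : (forall al, (tnm c <= pf_abs (c al)) = (al \in S)) ->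
    exists al, al \in S /\ forall be, be \in S -> l be <= l al.
  move=> hS; have : amax c \in S by rewrite -hS.
  elim: (S) (amax c) => // x s ih i1 _.
  have [s0|[y ys]] : s = [::] \/ exists y, y \in s.
  - by case: (s) => [|y t]; [left | right; exists y; rewrite mem_head].
  - by exists x; rewrite s0 mem_head; split=> // j; rewrite inE => /eqP ->.
  have [i [si hi]] := ih y ys; have [xi|ix] := leP (l x) (l i).
  - by exists i; rewrite inE si orbT; split=> // j; rewrite inE => /orP [/eqP ->|/hi].
  - exists x; rewrite mem_head; split=> // j; rewrite inE => /orP [/eqP ->//|/hi hj].
    exact: le_trans hj (ltW ix).
(* al and be are the leading exponents: al + be is not otherwise a sum of two
   maximal ones *)
have [al [alS hal]] := mx _ _ hSa; have [be [beS hbe]] := mx _ _ hSb.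
have na : pf_abs (a al) = tnm a by apply/le_anti; rewrite tnm_coef hSa.
have nb : pf_abs (b be) = tnm b by apply/le_anti; rewrite tnm_coef hSb.
have ab0 : 0 < tnm a * tnm b by exact: mulr_gt0.
apply: le_trans (tnm_coef (a * b) (al + be)); rewrite tcoefM.
pose f x := a x * b (al + be - x); pose g x := if x == al then f x else 0.
have nf : null_family f by exact: tconv_inner_null.
have ng : null_family g by apply: (@null_fin _ _ _ _ g [:: al]) => x; rewrite inE /g => /negPf ->.
have sg : nsum g = a al * b be.
  rewrite (@nsum_fin _ _ _ _ g [:: al]) // ?big_seq1 /g ?eqxx /f; first by rewrite addrC addKr.
  by move=> x; rewrite inE => /negPf ->.
have nh : null_family (fun x => f x - g x) by apply: nullD nf (nullN ng).
have -> : nsum f = nsum g + nsum (fun x => f x - g x).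
  by rewrite -nsumD //; congr nsum; apply/funext => x; rewrite addrC subrK.
have small : pf_abs (nsum (fun x => f x - g x)) < tnm a * tnm b.
  rewrite ltNge; apply/negP => /(nsum_ge_ex nh ab0) [x]; rewrite /g; case: eqP => [_|xal].
    by rewrite subrr pf_abs0 leNgt ab0.
  rewrite subr0 /f pf_absM => hx.
  have ha : x \in Sa.
    rewrite -hSa leNgt; apply/negP => lt; move: hx; rewrite leNgt => /negP; apply.
    apply: le_lt_trans (_ : pf_abs (a x) * tnm b < _); last by rewrite ltr_pM2r.
    by rewrite ler_wpM2l ?pf_abs_ge0 ?tnm_coef.
  have hb : al + be - x \in Sb.
    rewrite -hSb leNgt; apply/negP => lt; move: hx; rewrite leNgt => /negP; apply.
    apply: le_lt_trans (_ : tnm a * pf_abs (b (al + be - x)) < _); last by rewrite ltr_pM2l.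
    by rewrite ler_wpM2r ?pf_abs_ge0 ?tnm_coef.
  apply: xal; apply: li => //; apply/le_anti; rewrite hal //=.
  have := hbe _ hb; have := lB be (al + be - x).
  have -> : be - (al + be - x) = x - al by rewrite [al + be]addrC -addrA opprD addNKr opprB.
  by rewrite lB; move: (l be) (l al) (l x) (l _) => p1 p2 p3 p4; lra.
rewrite leNgt; apply/negP => lt.
have : pf_abs (nsum g) < tnm a * tnm b.
  rewrite -(addrK (nsum (fun x => f x - g x)) (nsum g)).
  by apply: pf_absD_lt => //; rewrite pf_absN.
by rewrite sg pf_absM na nb ltxx.
Qed.

HB.instance Definition _ := GRing.ComNzRing_hasMulInverse.Build A
  (@cmulVr _) (@cunitPl _) (@cinv_out _).
Fact perf_idomain a b : a * b = 0 -> (a == 0) || (b == 0).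
Proof.
move=> ab; have : tnm a * tnm b = 0.
  by rewrite -tnmM ab; apply/le_anti; rewrite tnm_ge0 andbT; apply: tnm_le => al; rewrite /= if_same pf_abs0.
by move/eqP; rewrite mulf_eq0 => /orP [/eqP/tnm_eq0 ->|/eqP/tnm_eq0 ->]; rewrite eqxx ?orbT.
Qed.
HB.instance Definition _ := GRing.ComUnitRing_isIntegral.Build A perf_idomain.

Fact tconst_zmod : zmod_morphism (tconst n : K -> A).
Proof. by move=> x y; apply: tateP => al; rewrite tcoefD tcoefN /=; case: eqP; rewrite ?subr0. Qed.
Fact tconst_monoid : monoid_morphism (tconst n : K -> A).
Proof. by split=> // x y; exact: tconstM. Qed.
HB.instance Definition _ := GRing.isZmodMorphism.Build K A (tconst n) tconst_zmod.
HB.instance Definition _ := GRing.isMonoidMorphism.Build K A (tconst n) tconst_monoid.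

(* The monomial is taken to be 0 when al is not an exponent. *)
Fact pmono_supp (c : K) al be :
  (if (be == al) && `[< pexponent p al >] then c else 0) != 0 -> pexponent p be.
Proof. by case: ifP; rewrite ?eqxx // => /andP [/eqP -> /asboolP]. Qed.
Fact pmono_null (c : K) al : null_family (fun be : 'rV[rat]_n =>
  if (be == al) && `[< pexponent p al >] then c else 0).
Proof. by apply: (@null_fin _ _ _ 'rV[rat]_n _ [:: al]) => be; rewrite inE => /negPf ->. Qed.
Definition pmono c al : A := PerfTate (@pmono_supp c al) (@pmono_null c al).

Lemma pmonoE c al be : pexponent p al -> pmono c al be = if be == al then c else 0.
Proof. by move=> h /=; case: asboolP => // _; rewrite andbT. Qed.

Lemma pmonoM_coef c al a be : pexponent p al -> (pmono c al * a) be = c * a (be - al).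
Proof.
move=> h; rewrite tcoefM (@nsum_fin _ _ _ 'rV[rat]_n _ [:: al]) ?big_seq1 //=.
- by rewrite eqxx; case: asboolP.
- by move=> ga; rewrite inE => /negPf ->; rewrite mul0r.
Qed.

Lemma pmonoM c d al be : pexponent p al -> pexponent p be ->
  pmono c al * pmono d be = pmono (c * d) (al + be).
Proof.
move=> hal hbe; apply: tateP => ga; rewrite pmonoM_coef // (pmonoE _ _ hbe) (pmonoE _ _ (@pexponentD R p K n _ _ hal hbe)).
by rewrite subr_eq [be + al]addrC; case: eqP; rewrite ?mulr0.
Qed.

Lemma pmono0 c : pmono c 0 = tconst n c.
Proof. by apply: tateP => al; rewrite pmonoE //; exact: pexponent0. Qed.

Fact perf_nm_kst (c : K) : tnm (tconst n c) = pf_abs c.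
Proof.
apply/le_anti/andP; split; last by have := tnm_coef (tconst n c) 0; rewrite /= eqxx.
by apply: tnm_le => al /=; case: eqP; rewrite ?pf_abs0 ?pf_abs_ge0.
Qed.

Fact perf_complete (u : nat -> A) : (forall k, tnm (u k.+1 - u k) <= (2 ^+ k)^-1) ->
  exists l, forall k, tnm (l - u k) <= (2 ^+ k)^-1.
Proof.
move=> hu.
have [l hl] := choice (fun al => @base_complete _ _ K (fun k => u k al)
   (fun k => le_trans (tnm_coef (u k.+1 - u k) al) (hu k))).
have sl al : l al != 0 -> pexponent p al.
  move=> l0; apply: contrapT => hal; case/eqP: l0; apply: (@nm_small _ _ _ (base K)) => k.
  have := hl al k; suff -> : u k al = 0 by rewrite subr0.
  by apply/eqP; apply: contrapT => /negP /tcoef_supp.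
have nl : null_family l.
  apply: null_of_seq => e e0; have e2 : 0 < e / 2 by lra.
  have [k hk] := half_small e2; have [G [_ hG]] := null_seq (@tcoef_null _ _ _ _ (u k)) e0.
  exists G => al; rewrite -hG; apply: contraTT; rewrite -!ltNge => h.
  rewrite -(subrK (u k al) (l al)); apply: pf_absD_lt => //.
  by apply: le_lt_trans (hl al k) _; apply: le_lt_trans hk _; lra.
by exists (PerfTate sl nl) => k; apply: tnm_le => al; exact: hl.
Qed.

Definition PT : nring K := @NRing R p K A tnm (tconst n : {rmorphism K -> A}) tnm_ge0 tnm_eq0
  tnmM tnmD perf_nm_kst (fun a => ex_intro _ _ erefl) perf_complete.

Lemma nm_pmono c al : pexponent p al -> nm (pmono c al : PT) = pf_abs c.
Proof.
move=> h; apply/le_anti/andP; split.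
  by apply: (tnm_le (a := pmono c al)) => be; rewrite pmonoE //; case: eqP; rewrite ?pf_abs0 ?pf_abs_ge0.
by have := tnm_coef (pmono c al) al; rewrite pmonoE // eqxx.
Qed.

Lemma tcoef_sum (I : Type) (s : seq I) (P : pred I) (F : I -> A) al :
  (\sum_(i <- s | P i) F i) al = \sum_(i <- s | P i) F i al.
Proof.
elim/big_rec2: _ => [|i x y _ <-]; first by rewrite /= if_same.
by [].
Qed.

Lemma perf_trunc a (c : R) : 0 < c -> exists s : seq 'rV[rat]_n,
  (forall al, al \in s -> a al != 0) /\ nm (a - \sum_(al <- s) pmono (a al) al : PT) <= c.
Proof.
move=> c0; have [G [uG hG]] := null_seq (@tcoef_null _ _ _ _ a) c0; exists G; split.
  move=> al; rewrite -hG; apply: contraTneq => ->; by rewrite pf_abs0 -ltNge.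
apply: (tnm_le (a := a - \sum_(al <- G) pmono (a al) al)) => al.
rewrite tcoefD tcoefN tcoef_sum; have [alG|alG] := boolP (al \in G); last first.
  rewrite big1_seq ?subr0; first by rewrite ltW // ltNge hG.
  move=> be /= beG; case: eqP => // e; by rewrite e beG in alG.
rewrite (bigD1_seq al) //= eqxx big1 => [|be bal]; last by rewrite eq_sym (negPf bal).
have al0 : a al != 0 by move: alG; rewrite -hG; apply: contraTneq => ->; rewrite pf_abs0 -ltNge.
by case: asboolP => [_|]; [rewrite addr0 subrr pf_abs0 ltW | move: al0 => /tcoef_supp].
Qed.

Definition pcoef (x : PT) al : K := tcoef (x : A) al.
Definition mono c al : PT := pmono c al.
Lemma pcoefP (x y : PT) : (forall al, pcoef x al = pcoef y al) -> x = y.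
Proof. exact: tateP. Qed.
Lemma pcoefB (x y : PT) al : pcoef (x - y) al = pcoef x al - pcoef y al. Proof. by []. Qed.
Lemma pcoef_sum (I : Type) (s : seq I) (P : pred I) (F : I -> PT) al :
  pcoef (\sum_(i <- s | P i) F i) al = \sum_(i <- s | P i) pcoef (F i) al.
Proof. exact: tcoef_sum. Qed.
Lemma pcoef_mono c al be : pexponent p al -> pcoef (mono c al) be = if be == al then c else 0.
Proof. exact: pmonoE. Qed.
Lemma pcoef_monoM c al x be : pexponent p al -> pcoef (mono c al * x) be = c * pcoef x (be - al).
Proof. exact: pmonoM_coef. Qed.
Lemma pcoef_le x al : pf_abs (pcoef x al) <= nm x. Proof. exact: tnm_coef. Qed.
Lemma nm_coef_le x e : (forall al, pf_abs (pcoef x al) <= e) -> nm x <= e.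
Proof. exact: tnm_le. Qed.
Lemma pcoef_attained x : exists al, pf_abs (pcoef x al) = nm x. Proof. exact: tnm_attained. Qed.
Lemma pcoef_exponent x al : pcoef x al != 0 -> pexponent p al. Proof. exact: tcoef_supp. Qed.
Lemma monoM c d al be : pexponent p al -> pexponent p be ->
  mono c al * mono d be = mono (c * d) (al + be).
Proof. exact: pmonoM. Qed.
Lemma mono0 c : mono c 0 = kst PT c. Proof. exact: pmono0. Qed.
Lemma nm_mono c al : pexponent p al -> nm (mono c al) = pf_abs c. Proof. exact: nm_pmono. Qed.
Lemma mono_trunc (x : PT) (c : R) : 0 < c -> exists s : seq 'rV[rat]_n,
  (forall al, al \in s -> pcoef x al != 0) /\ nm (x - \sum_(al <- s) mono (pcoef x al) al) <= c.
Proof. exact: perf_trunc. Qed.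
End PerfNorm.
Arguments pcoef : simpl never.
Arguments mono : simpl never.

(** * Finite levels of the perfectoid Tate algebra *)

Section Tower.
Variables (R : realType) (p : nat) (K : perfectoidField R p) (n : nat).
Local Notation A := (perfTate K n).
Implicit Types (a b : A) (al be : 'rV[rat]_n) (m k : nat).

Lemma pnz : p%:R != 0 :> rat.
Proof. by rewrite pnatr_eq0 -lt0n prime_gt0 // (pf_prime K). Qed.

Lemma pexponentMn al i : pexponent p al -> pexponent p (al *+ i).
Proof.
move=> h; elim: i => [|i ih]; first by rewrite mulr0n; exact: pexponent0.
by rewrite mulrS; exact: (@pexponentD R p K n).
Qed.

Lemma monoX al i : pexponent p al -> mono (1 : K) al ^+ i = mono (1 : K) (al *+ i).
Proof.
move=> h; elim: i => [|i ih]; first by rewrite expr0 mulr0n mono0 rmorph1.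
by rewrite exprS ih monoM ?mul1r ?mulrS //; exact: pexponentMn.
Qed.

Definition unit_exp m (i : nat) : 'rV[rat]_n :=
  \row_j (if j == i :> nat then (p%:R ^+ m)^-1 else 0).

Lemma unit_exp_pexponent m i : pexponent p (unit_exp m i).
Proof.
move=> j; rewrite mxE; case: eqP => _; first by exists 1%N, m; rewrite mul1r.
by exists 0%N, 0%N; rewrite mul0r.
Qed.

(** The variable X_i^(1/p^m). *)
Definition root_var m (i : nat) : PT K n := mono (1 : K) (unit_exp m i).
Fact root_var_le m i : nm (root_var m i) <= 1.
Proof. by rewrite nm_mono ?pf_abs1 //; exact: unit_exp_pexponent. Qed.

Fact levelk_key : unit. Proof. exact: tt. Qed.

(** The tower of subalgebras generated by the roots of order p^m of the first k
    variables. *)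
Definition levelk m k : chom (TA K k) (PT K n) := locked_with levelk_key (tev (root_var_le m) k).
Definition level m : chom (TA K n) (PT K n) := levelk m n.

Lemma levelk0 m x : levelk m 0 x = kst (PT K n) x. Proof. by rewrite /levelk unlock. Qed.
Lemma levelkC m k (a : TA K k) : levelk m k.+1 (sconst a) = levelk m k a.
Proof. by rewrite /levelk !unlock; exact: sev_const. Qed.
Lemma levelkX m k : levelk m k.+1 (sX (TA K k)) = root_var m k.
Proof. by rewrite /levelk unlock; exact: sev_X. Qed.
Lemma level_var m i : (i < n)%N -> level m (tvar K n i) = root_var m i.
Proof. by rewrite /level /levelk unlock; exact: tev_var. Qed.

Definition expk m k al := exists e : nat -> nat,
  al = \row_i ((if (i < k)%N then e i else 0%N)%:R / p%:R ^+ m).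

Lemma levelk_term m k (x : TA K k) i al :
  pcoef (levelk m k x * root_var m k ^+ i) al = pcoef (levelk m k x) (al - unit_exp m k *+ i).
Proof.
have h := unit_exp_pexponent m k.
by rewrite mulrC monoX // pcoef_monoM ?mul1r //; exact: pexponentMn.
Qed.

Lemma levelk_trunc m k (f : rser (TA K k)) N :
  levelk m k.+1 (strunc N f) = \sum_(i < N) levelk m k (f i) * root_var m k ^+ i.
Proof.
have -> : (strunc N f : rs (TA K k)) = \sum_(i < N) sconst (f i) * sX (TA K k) ^+ i.
  by apply: eq_bigr => i _; exact: smono_CX.
rewrite rmorph_sum; apply: eq_bigr => i _.
by rewrite [LHS]rmorphM rmorphXn levelkC levelkX.
Qed.

Lemma level_supp m k (x : TA K k) al : pcoef (levelk m k x) al != 0 -> expk m k al.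
Proof.
elim: k x al => [|k ih] x al.
  rewrite levelk0 -mono0 pcoef_mono; last exact: pexponent0.
  case: (eqVneq al 0) => [-> _|_]; last by rewrite eqxx.
  by exists (fun=> 0%N); apply/rowP => i; rewrite !mxE mul0r.
move=> h; have [N hN] := strunc_approx x (pf_abs_gt0 h).
have {hN} hN' : nm (levelk m k.+1 (x - (strunc N x : rs (TA K k)))) < pf_abs (pcoef (levelk m k.+1 x) al).
  exact: le_lt_trans (ch_le (levelk m k.+1) _) hN.
have : pcoef (levelk m k.+1 (strunc N x)) al != 0.
  apply/eqP => h0; move: hN'; rewrite ltNge => /negP; apply.
  by apply: le_trans (pcoef_le _ al); rewrite rmorphB pcoefB h0 subr0.
rewrite levelk_trunc pcoef_sum => /eqP hs.
have [i hi] : exists i : 'I_N, pcoef (levelk m k (x i)) (al - unit_exp m k *+ i) != 0.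
  apply: contrapT => /forallNP hn; apply: hs; rewrite big1 // => i _.
  by rewrite levelk_term; have /negP := hn i; rewrite negbK => /eqP.
have [e he] := ih _ _ hi; exists (fun j => if j == k then (i : nat) else e j).
have -> : al = al - unit_exp m k *+ i + unit_exp m k *+ i by rewrite subrK.
rewrite he; apply/rowP => j; rewrite mxE mulmxnE !mxE.
case: (ltngtP j k) => [jk|kj|jk].
- by rewrite ltnS (ltnW jk) mul0rn addr0.
- by rewrite ltnS leqNgt kj /= mul0rn addr0.
- by rewrite jk ltnS leqnn mul0r add0r mulr_natl.
Qed.

(** Different powers of the last variable contribute to different exponents, so no
    cancellation can occur. *)
Lemma levelk_iso m k (x : TA K k) : (k <= n)%N -> nm (levelk m k x) = nm x.
Proof.
elim: k x => [|k ih] x kn; first by rewrite levelk0 nm_kst.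
apply/le_anti/andP; split; first exact: ch_le.
apply: (rnm_le (f := x)) => j; rewrite leNgt; apply/negP => lt.
have r0 : 0 < nm (x j) by apply: le_lt_trans lt; exact: nm_ge0.
have [N hN] := strunc_approx x r0.
have jN : (j < N)%N.
  rewrite ltnNge; apply/negP => Nj; have := rnm_coef (x - strunc N x) j.
  by rewrite scoefB struncE ltnNge Nj /= subr0 leNgt hN.
have lt' : nm (levelk m k.+1 (strunc N x)) < nm (x j).
  have -> : (strunc N x : rs (TA K k)) = x - (x - (strunc N x : rs (TA K k))) by rewrite subKr.
  rewrite rmorphB; apply: nmD_lt => //; rewrite nmN.
  exact: le_lt_trans (ch_le (levelk m k.+1) _) hN.
have [be hbe] := pcoef_attained (levelk m k (x j)).
have e1 : pf_abs (pcoef (levelk m k (x j)) be) = nm (x j) by rewrite -(ih (x j) (ltnW kn)).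
have bn0 : pcoef (levelk m k (x j)) be != 0.
  by apply/eqP => h; move: r0; rewrite -e1 h pf_abs0 ltxx.
have [e he] := level_supp bn0.
have := pcoef_le (levelk m k.+1 (strunc N x)) (be + unit_exp m k *+ j).
have -> : pcoef (levelk m k.+1 (strunc N x)) (be + unit_exp m k *+ j) = pcoef (levelk m k (x j)) be.
  rewrite levelk_trunc pcoef_sum (bigD1 (Ordinal jN)) //= big1 => [|i ij].
    by rewrite addr0 levelk_term addrK.
  rewrite levelk_term; apply: contrapT => /eqP /level_supp [e' he'].
  move: he'; rewrite he => /rowP /(_ (Ordinal kn)); rewrite ![in LHS](mxE, mulmxnE) !mxE /=.
  rewrite eqxx ltnn !mul0r add0r => /eqP; rewrite subr_eq0.
  have pm : (p%:R ^+ m)^-1 != 0 :> rat by rewrite invr_eq0 expf_neq0 // pnz.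
  move=> /eqP /(mulrIn pm) ji.
  by case/eqP: ij; apply/val_inj.
by rewrite e1 leNgt lt'.
Qed.

Lemma level_iso m x : nm (level m x) = nm x. Proof. exact: levelk_iso. Qed.

(** The exponents with denominator dividing p^m. *)
Definition expm m al := exists e : 'I_n -> nat, forall i, al 0 i = (e i)%:R / p%:R ^+ m.

Lemma level_expm m x al : pcoef (level m x) al != 0 -> expm m al.
Proof.
by move=> /level_supp [e ->]; exists (fun i => e i) => i; rewrite mxE ltn_ord.
Qed.

Lemma expm_pexponent m al : expm m al -> pexponent p al.
Proof. by move=> [e he] i; exists (e i), m; rewrite he. Qed.

Lemma pexponent_expm (al : 'rV[rat]_n) : pexponent p al -> exists m0, forall m, (m0 <= m)%N -> expm m al.
Proof.
move=> h; have [f hf] := choice h; have [g hg] := choice hf.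
exists (\max_i g i) => m hm; exists (fun i => f i * p ^ (m - g i))%N => i.
rewrite hg natrM natrX; have gm : (g i <= m)%N by apply: leq_trans hm; exact: leq_bigmax.
have h0 k : p%:R ^+ k != 0 :> rat by rewrite expf_neq0 // pnz.
have -> : p%:R ^+ m = p%:R ^+ (m - g i) * p%:R ^+ g i :> rat by rewrite -exprD subnK.
by rewrite invfM mulrA (mulfK (h0 _)).
Qed.

Lemma level_mono m c al : expm m al -> exists x, level m x = mono c al.
Proof.
move=> [e he]; exists (kst (TA K n) c * \prod_(i < n) tvar K n i ^+ e i).
rewrite rmorphM rmorph_prod ch_kst.
have key (s : seq 'I_n) : \prod_(i <- s) level m (tvar K n i ^+ e i) =
    mono (1 : K) (\sum_(i <- s) unit_exp m i *+ e i) /\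
    pexponent p (\sum_(i <- s) unit_exp m i *+ e i).
  elim: s => [|i s [ih hs]]; first by rewrite !big_nil mono0 rmorph1; split=> //; exact: pexponent0.
  have hi : pexponent p (unit_exp m i *+ e i) by exact/pexponentMn/unit_exp_pexponent.
  have hu := unit_exp_pexponent m i.
  rewrite !big_cons ih rmorphXn level_var // monoX // monoM // mul1r.
  by split=> //; exact: (@pexponentD R p K n).
have [-> h] := key (index_enum 'I_n).
rewrite -mono0 monoM //; last exact: pexponent0.
rewrite mulr1 add0r; congr mono; apply/rowP => j; rewrite he summxE (bigD1 j) //=.
rewrite big1 ?addr0 => [|i ij]; last first.
  by rewrite mulmxnE mxE eq_sym (inj_eq val_inj) (negPf ij) mul0rn.
by rewrite mulmxnE mxE eqxx mulr_natl.
Qed.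

Lemma level_sum m (s : seq 'rV[rat]_n) (f : 'rV[rat]_n -> K) :
  (forall al, al \in s -> expm m al) ->
  exists x, level m x = \sum_(al <- s) mono (f al) al.
Proof.
elim: s => [|al s ih] h; first by exists 0; rewrite rmorph0 big_nil.
have [x hx] := ih (fun be hb => h be (@mem_behead _ (al :: s) be hb)).
have [y hy] := level_mono (f al) (h al (mem_head _ _)).
by exists (y + x); rewrite rmorphD hx hy big_cons.
Qed.

(** The exponents of a finite sum of monomials have a common denominator p^m. *)
Lemma level_dense (a : PT K n) (c : R) : 0 < c -> exists m0, forall m, (m0 <= m)%N ->
  exists x, nm (a - level m x) <= c.
Proof.
move=> c0; have [s [sa hs]] := mono_trunc a c0.
have [m0 hm0] : exists m0, forall m, (m0 <= m)%N -> forall al, al \in s -> expm m al.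
  elim: s sa {hs} => [|al s ih] sa; first by exists 0%N.
  have [m1 h1] := ih (fun be hb => sa be (@mem_behead _ (al :: s) be hb)).
  have [m2 h2] := pexponent_expm (pcoef_exponent (sa al (mem_head _ _))).
  exists (maxn m1 m2) => m; rewrite geq_max => /andP [hm1 hm2] be.
  by rewrite inE => /orP [/eqP -> | hb]; [exact: h2 | exact: h1].
exists m0 => m hm; have [x hx] := level_sum (pcoef a) (hm0 m hm).
by exists x; rewrite hx.
Qed.

(** The image of an isometry from a complete ring is closed, hence contains every series
    whose exponents have denominators dividing p^m. *)
Lemma level_image m (a : PT K n) : (forall al, pcoef a al != 0 -> expm m al) -> exists x, level m x = a.
Proof.
move=> ha; have [x hx] : exists x : nat -> TA K n, forall k,
    nm (a - level m (x k)) <= (2 ^+ k)^-1.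
  suff ex k : exists x, nm (a - level m x) <= (2 ^+ k)^-1 by have [x hx] := choice ex; exists x.
  have [s [sa hs]] := mono_trunc a (half_pow_gt0 R k).
  have [x hx] := level_sum (pcoef a) (fun al h => ha al (sa al h)).
  by exists x; rewrite hx.
have [|l hl] := @nm_complete _ _ _ _ x.
  move=> k; rewrite -(level_iso m) rmorphB.
  have -> : level m (x k.+1) - level m (x k) =
    (a - level m (x k)) - (a - level m (x k.+1)) by ring.
  by apply: nmB_le => //; apply: le_trans (hx _) (half_pow_decr _ _).
exists l; apply/eqP; rewrite -subr_eq0; apply/eqP; apply: (@nm_small _ _ _ (PT K n)) => k.
have -> : level m l - (a : PT K n) = level m (l - x k) - (a - level m (x k)).
  by rewrite rmorphB; ring.
by apply: nmB_le => //; rewrite level_iso.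
Qed.

(** Quillen-Suslin for Tate algebras passes to the completed union of the finite levels. *)
Theorem perf_projective_free : projective_free A.
Proof.
have := @dense_projective_free R p K (TA K n) (PT K n) level level_iso level_dense.
by move=> /(_ (@tate_projective_free R p K n)).
Qed.
End Tower.
Arguments level {R p K n} m.

Lemma projective_free_module (B : comNzRingType) (M : lmodType B) : projective_free B ->
  finite_module M -> projective_module M -> finite_free_module M.
Proof.
move=> pf [r [f fs]] pM; have [h hh] := pM _ _ f idfun fs.
have {}hh x : f (h x) = x by exact: hh.
pose e := lin1_mx (h \o f); have eE u : u *m e = h (f u) by rewrite mul_rV_lin1.
have ee : e *m e = e.
  apply/row_matrixP => i; rewrite row_mul.
  by have -> : row i e = h (f (delta_mx 0 i)); rewrite ?rowE eE ?hh.
have [k [U [V [UV VU]]]] := pf _ e ee.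
exists k, (f \o mulmxr V); exists (fun y => h y *m U) => [w|y] /=.
  by rewrite -eE -UV -!mulmxA VU mulmx1 VU mulmx1.
by rewrite -mulmxA UV eE hh.
Qed.

(** * Strict noetherianity of the Tate algebras *)

Section StrictNoetherian.
Variables (R : realType) (p : nat) (K : perfectoidField R p).

Definition submodule (B : nring K) s (M : set 'rV[B]_s) : Prop :=
  M 0 /\ forall a x y, M x -> M y -> M (a *: x + y).

(** Finite generation with control of the coefficients: this makes all ideals closed and all
    maps between finite modules strict. *)
Definition strict_noetherian (B : nring K) s := forall M : set 'rV[B]_s, submodule M ->
  exists r (G : 'M[B]_(r, s)) (C : R), [/\ 1 <= C, forall i, M (row i G) &
    forall x d, M x -> 0 <= d -> mxle x d -> exists c : 'rV_r, x = c *m G /\ mxle c (C * d)].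

Section Generalities.
Variable B : nring K.

Lemma submodule_mul s r (M : set 'rV[B]_s) (G : 'M[B]_(r, s)) c : submodule M ->
  (forall i, M (row i G)) -> M (c *m G).
Proof.
move=> [M0 ML] hG; rewrite mulmx_sum_row; elim/big_ind: _ => // [x y hx hy|i _].
- by rewrite -[x]scale1r; exact: ML.
- by rewrite -[_ *: _]addr0; exact: ML.
Qed.

(** The first coordinates of M form an ideal; what remains after subtracting a bounded
    combination lies in a submodule of rank s. *)
Lemma strict_noetherian_step s : strict_noetherian B 1 -> strict_noetherian B s ->
  strict_noetherian B s.+1.
Proof.
move=> h1 hs M; rewrite -[s.+1]/(1 + s)%N in M * => -[M0 ML].
have [|r1 [G1 [C1 [C11 hG1 gen1]]]] := h1 [set u | exists v, M (row_mx u v)].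
  split; first by exists 0; rewrite row_mx0.
  move=> a x y [v hv] [w hw]; exists (a *: v + w).
  by have := ML a _ _ hv hw; rewrite scale_row_mx add_row_mx.
have [V hV] := choice hG1; pose V1 : 'M[B]_(r1, s) := \matrix_(i, j) V i 0 j.
pose H1 := row_mx G1 V1.
have MH1 i : M (row i H1).
  rewrite row_row_mx; suff -> : row i V1 = V i by exact: hV.
  by apply/rowP => j; rewrite !mxE.
have [|r2 [G2 [C2 [C21 hG2 gen2]]]] := hs [set v | M (row_mx 0 v)].
  split; first by rewrite /= row_mx0.
  move=> a x y hx hy /=; have := ML a _ _ hx hy.
  by rewrite scale_row_mx add_row_mx scaler0 addr0.
have [b [b1 hb]] := mxle_bound H1.
have C10 : 0 <= C1 by exact: le_trans ler01 C11.
have C20 : 0 <= C2 by exact: le_trans ler01 C21.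
have b0 : 0 <= b by exact: le_trans ler01 b1.
exists (r1 + r2)%N, (col_mx H1 (row_mx 0 G2)), (C2 * (b * C1)); split.
- have h : 1 <= b * C1 by rewrite -[1]mulr1; apply: ler_pM.
  by rewrite -[1]mulr1; apply: ler_pM.
- move=> i; case: (split_ordP i) => j ->.
    by rewrite rowKu.
  by rewrite rowKd row_row_mx row0; exact: hG2.
move=> x d Mx d0 xd; rewrite -[x]hsubmxK.
have [||c1 [e1 n1]] := gen1 (lsubmx x) d _ d0.
- by exists (rsubmx x); rewrite hsubmxK.
- by move=> i j; rewrite mxE; exact: xd.
have D0 : 0 <= b * C1 * d by rewrite !mulr_ge0.
have le1 : d <= b * C1 * d.
  by rewrite -[X in X <= _]mul1r ler_wpM2r // -[1]mulr1; apply: ler_pM.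
have Mx' : M (x - c1 *m H1).
  have := ML (-1) _ _ (submodule_mul c1 (conj M0 ML) MH1) Mx.
  by rewrite scaleN1r addrC.
have nH : mxle (c1 *m H1) (b * C1 * d).
  by rewrite -mulrA mulrC; apply: mxleM => //; exact: mulr_ge0.
have e2 : x - c1 *m H1 = row_mx 0 (rsubmx x - c1 *m V1).
  rewrite -{1}[x]hsubmxK /H1 mul_mx_row opp_row_mx add_row_mx.
  by rewrite -e1 subrr.
have [||c2 [e3 n3]] := gen2 (rsubmx x - c1 *m V1) (b * C1 * d) _ D0.
- by rewrite /= -e2.
- have nx := mxleB (mxleW le1 xd) nH.
  by move=> i j; have := nx i (rshift 1 j); rewrite e2 row_mxEr.
exists (row_mx c1 c2); split.
  clearbody H1; rewrite mul_row_col mul_mx_row mulmx0 -e3 -[LHS](subrK (c1 *m H1)) hsubmxK e2.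
  by rewrite addrC.
have le2 : C1 * d <= C2 * (b * C1) * d.
  apply: ler_wpM2r => //; rewrite mulrA -[X in X <= _]mul1r ler_wpM2r //.
  by rewrite -[1]mulr1; apply: ler_pM.
move=> i j; case: (split_ordP j) => l ->; rewrite ?row_mxEl ?row_mxEr.
- exact: le_trans (n1 i l) le2.
- by rewrite -mulrA; exact: n3.
Qed.

Lemma strict_noetherian_rank : strict_noetherian B 1 -> forall s, strict_noetherian B s.
Proof.
move=> h1; elim=> [|s ih]; last exact: strict_noetherian_step.
move=> M [M0 _]; exists 0%N, 0, 1; split=> // [[] //|x d _ d0 _].
exists 0; split; first by rewrite [LHS]thinmx0 [RHS]thinmx0.
by move=> i [].
Qed.

Lemma strict_noetherian_zero (M : set 'rV[B]_1) : (forall x, M x -> x = 0) ->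
  exists r (G : 'M[B]_(r, 1)) (C : R), [/\ 1 <= C, forall i, M (row i G) &
    forall x d, M x -> 0 <= d -> mxle x d -> exists c : 'rV_r, x = c *m G /\ mxle c (C * d)].
Proof.
move=> h; exists 0%N, 0, 1; split=> // [[] //|x d /h -> d0 _].
by exists 0; split=> [|i []//]; rewrite mulmx0.
Qed.

Lemma mx11E (x : 'rV[B]_1) : x = (x 0 0)%:M. Proof. exact: mx11_scalar. Qed.
End Generalities.

(** Weierstrass division by a nonzero f in the ideal replaces an element by its
    remainder, without increasing the norm; the remainders form a submodule of a free
    module of finite rank over the Tate algebra in one variable less. *)
Theorem tate_strict_noetherian N s : strict_noetherian (TA K N) s.
Proof.
elim: N s => [|N ih] s; apply: strict_noetherian_rank => M hM.
  have [h|/existsNP [x /not_implyP [Mx x0]]] := pselect (forall x, M x -> x = 0).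
    exact: strict_noetherian_zero.
  have x00 : (x 0 0 : K) != 0.
    by apply/eqP => h; apply: x0; rewrite [x]mx11E h; apply/rowP => j; rewrite !mxE mul0rn.
  exists 1%N, 1%:M, 1; split=> // [i|y d _ d0 yd]; last by exists y; rewrite mulmx1 mul1r.
  have e1 : (x 0 0)^-1 * x 0 0 = 1 :> TA K 0 by exact: (@mulVf K).
  have ex : (x 0 0)^-1 *: x + 0 = 1%:M.
    by rewrite addr0; apply/rowP => j; rewrite !mxE (ord1 j) e1.
  have := hM.2 (x 0 0)^-1 _ _ Mx hM.1; rewrite ex; congr M.
  by apply/rowP => j; rewrite !mxE (ord1 i).
have [h|/existsNP [x /not_implyP [Mx x0]]] := pselect (forall x, M x -> x = 0).
  exact: strict_noetherian_zero.
set f := x 0 0; have f0 : f != 0.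
  by apply/eqP => h; apply: x0; rewrite [x]mx11E -/f h; apply/rowP => j; rewrite !mxE mul0rn.
have [sg [sg' [c [t [K1 K2 c0 df]]]]] := tate_coordinates f0.
pose I (a : TA K N.+1) := M a%:M.
have I0 : I 0 by rewrite /I; have -> : 0%:M = 0 :> 'rV[TA K N.+1]_1; [rewrite -scalemx1 scale0r | exact: hM.1].
have IL a u v : I u -> I v -> I (a * u + v).
  by move=> hu hv; rewrite /I raddfD /= -scale_scalar_mx; exact: hM.2.
have If : I f by rewrite /I -mx11E.
pose P (v : 'rV[TA K N]_t) : rs (TA K N) := \sum_(i < t) smono (v 0 i) i.
have PE v i : P v i = if insub i is Some j then v 0 j else 0.
  rewrite scoef_sum; case: insubP => [j _ ji|].
    by rewrite (bigD1 j) //= -ji eqxx big1 ?addr0 // => l lj; rewrite eq_sym (inj_eq val_inj) (negPf lj).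
  rewrite -leqNgt => ti; rewrite big1 // => j _ /=.
  by case: eqP => // ij; move: (ltn_ord j); rewrite -ij ltnNge ti.
have PL a u v : P (a *: u + v) = sconst a * P u + P v.
  apply: serP => i; rewrite scoefD sconstM_coef !PE; case: insub => [j|]; first by rewrite !mxE.
  by rewrite mulr0 addr0.
pose sgP v : TA K N.+1 := sg' (P v).
have [|r [G [C [C1 hG gen]]]] := ih t [set v | I (sgP v)].
  split=> [|a u v hu hv]; rewrite /= /sgP.
    have -> : P 0 = 0 by apply: serP => i; rewrite PE scoef0; case: insub => // j; rewrite mxE.
    by rewrite rmorph0.
  by rewrite PL rmorphD rmorphM; exact: IL.
pose F := kst (TA K N.+1) c * f.
exists (1 + r)%N, (col_mx F%:M (\col_i sgP (row i G))), C; split=> //.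
- move=> i; case: (split_ordP i) => j ->.
    rewrite rowKu (ord1 j) -[F]addr0; suff -> : row 0 (F + 0)%:M = (F + 0)%:M :> 'rV_1 by exact: IL.
    by apply/rowP => l; rewrite !mxE (ord1 l).
  rewrite rowKd; have := hG j; rewrite /= /I; congr M.
  by apply/rowP => l; rewrite !mxE (ord1 l).
move=> y d My d0 yd.
have [q [w [e nq nw hw]]] := weierstrass_division (sg (y 0 0)) df.
have ny : nm (sg (y 0 0)) <= d by apply: le_trans (ch_le sg _) (yd 0 0).
pose v : 'rV[TA K N]_t := \row_i w i.
have Pv : P v = w.
  apply: serP => i; rewrite PE; case: insubP => [j _ <-|]; first by rewrite mxE.
  by rewrite -leqNgt => /hw ->.
have ey : y 0 0 = sg' q * F + sgP v.
  have e' : sg (y 0 0) = q * sg F + P v by rewrite Pv.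
  transitivity (sg' (q * sg F + P v)); first by rewrite -e' K1.
  by rewrite rmorphD rmorphM; congr (_ * _ + _); exact: K1.
have [||c2 [ec nc]] := gen v d _ d0.
- rewrite /=; have -> : sgP v = - sg' q * kst (TA K N.+1) c * f + y 0 0 by rewrite ey /F; ring.
  by apply: IL => //; rewrite /I -mx11E.
- by move=> i j; rewrite mxE; apply: le_trans (rnm_coef w j) (le_trans nw ny).
exists (row_mx (sg' q)%:M (\row_i sg' (sconst (c2 0 i)))); split; last first.
  have dC : d <= C * d by rewrite ler_peMl.
  move=> i j; case: (split_ordP j) => l ->; rewrite ?row_mxEl ?row_mxEr mxE.
  - rewrite (ord1 i) (ord1 l) eqxx mulr1n; apply: le_trans (ch_le sg' q) _.
    exact: le_trans nq (le_trans ny dC).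
  - apply: le_trans (ch_le sg' _) _; rewrite nm_sconst; exact: nc.
rewrite mul_row_col -scalar_mxM [LHS]mx11E ey raddfD /=; congr (_ + _).
have -> : sgP v = \sum_i sg' (sconst (c2 0 i)) * sgP (row i G).
  rewrite {1}ec mulmx_sum_row /sgP.
  have PS (I' : Type) (s' : seq I') (g : I' -> TA K N) (h : I' -> 'rV[TA K N]_t) :
      P (\sum_(i <- s') g i *: h i) = \sum_(i <- s') sconst (g i) * P (h i).
    elim: s' => [|i s' ih']; last by rewrite !big_cons PL ih'.
    by rewrite !big_nil; apply: serP => i; rewrite PE scoef0; case: insub => // j; rewrite mxE.
  by rewrite PS rmorph_sum; apply: eq_bigr => i _; rewrite rmorphM.
apply/rowP => j; rewrite (ord1 j) !mxE eqxx mulr1n; apply: eq_bigr => i _.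
by rewrite !mxE.
Qed.

(** A quantitative open mapping theorem, for the map from coefficients to combinations. *)
Lemma strict_ideal N r s (G : 'M[TA K N]_(r, s)) : exists C : R, 1 <= C /\
  forall c d, 0 <= d -> mxle (c *m G) d -> exists c' : 'rV_r, c' *m G = c *m G /\ mxle c' (C * d).
Proof.
have [|r' [G' [C [C1 hG gen]]]] := @tate_strict_noetherian N s [set x | exists c, x = c *m G].
  split=> [|a x y [c ->] [c' ->]]; first by exists 0; rewrite mul0mx.
  by exists (a *: c + c'); rewrite mulmxDl scalemxAl.
have [E hE] := choice hG.
pose E' : 'M[TA K N]_(r', r) := \matrix_(i, j) E i 0 j.
have GE : G' = E' *m G.
  apply/row_matrixP => i; rewrite hE row_mul; congr (_ *m _).
  by apply/rowP => j; rewrite !mxE.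
have [b [b1 hb]] := mxle_bound E'.
have C0 : 0 <= C by exact: le_trans C1.
exists (C * b); split; first by rewrite -[1]mulr1; apply: ler_pM.
move=> c d d0 hd; have [|c' [e n]] := gen (c *m G) d _ d0 hd; first by exists c.
exists (c' *m E'); split; first by rewrite -mulmxA -GE -e.
by rewrite mulrAC; apply: mxleM => //; [exact: mulr_ge0 | exact: le_trans b1].
Qed.

(** The elements killed by a power of h modulo G form a submodule; finitely many
    generators are killed by a common power. *)
Lemma annihilator_stable N r s (G : 'M[TA K N]_(r, s)) (h : TA K N) : exists k0,
  forall (x : 'rV_s) k, (exists c, h ^+ k *: x = c *m G) -> exists c, h ^+ k0 *: x = c *m G.
Proof.
have up k l (x : 'rV_s) : (exists c, h ^+ k *: x = c *m G) ->
    exists c, h ^+ (l + k) *: x = c *m G.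
  by move=> [c e]; exists (h ^+ l *: c); rewrite exprD -scalerA e scalemxAl.
have [|r' [G' [C [C1 hG gen]]]] :=
  @tate_strict_noetherian N s [set x | exists k, exists c, h ^+ k *: x = c *m G].
  split=> [|a x y [k hk] [l hl]]; first by exists 0%N, 0; rewrite scaler0 mul0mx.
  have [c ec] := up _ l _ hk; have [c' ec'] := up _ k _ hl; rewrite addnC in ec'.
  exists (l + k)%N, (a *: c + c').
  by rewrite mulmxDl -scalemxAl -ec -ec' scalerDr !scalerA [a * _]mulrC.
have [k hk] := choice hG; exists (\max_i k i)%N => x l [c e].
have [b [b1 hb]] := mxle_bound x.
have [|c' [e' _]] := gen x b _ (le_trans ler01 b1) hb; first by exists l, c.
have hx i : exists c, h ^+ (\max_i k i) *: row i G' = c *m G.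
  by have := up _ (\max_i k i - k i)%N _ (hk i); rewrite subnK // leq_bigmax.
have [E hE] := choice hx; exists (\sum_i c' 0 i *: E i).
rewrite e' mulmx_sum_row scaler_sumr mulmx_suml; apply: eq_bigr => i _.
by rewrite -scalemxAl -hE !scalerA mulrC.
Qed.

End StrictNoetherian.

(** * Polynomials inside restricted power series *)

(** The dense subring of polynomials is used next to the Tate algebra because
    polynomials can be evaluated at unbounded elements. *)
Fixpoint npoly (B : comNzRingType) (k : nat) : comNzRingType :=
  if k is k'.+1 then {poly (npoly B k')} else B.

Section NestedPolynomials.
Variable B : comNzRingType.

Fixpoint nconst k : {rmorphism B -> npoly B k} :=
  match k return {rmorphism B -> npoly B k} with
  | 0 => idfun
  | k'.+1 => (@polyC (npoly B k') \o nconst k' : {rmorphism B -> {poly (npoly B k')}})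
  end.

Fixpoint nvar k (i : nat) : npoly B k :=
  match k return npoly B k with
  | 0 => 0
  | k'.+1 => if i == k' then 'X else (nvar k' i)%:P
  end.

Fixpoint neval (S : comNzRingType) (f : {rmorphism B -> S}) (y : nat -> S) k :
    {rmorphism npoly B k -> S} :=
  match k return {rmorphism npoly B k -> S} with
  | 0 => f
  | k'.+1 => (horner_morph (fun x => mulrC (y k') (neval f y k' x)) :
               {rmorphism {poly (npoly B k')} -> S})
  end.

Lemma neval_const (S : comNzRingType) (f : {rmorphism B -> S}) y k t :
  neval f y k (nconst k t) = f t.
Proof. by elim: k => [|k ih] //=; rewrite horner_morphC. Qed.

Lemma neval_var (S : comNzRingType) (f : {rmorphism B -> S}) y k i : (i < k)%N ->
  neval f y k (nvar k i) = y i.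
Proof.
elim: k => // k ih; rewrite ltnS leq_eqVlt => /orP [/eqP ->|h] /=.
  by rewrite eqxx horner_morphX.
by rewrite ltn_eqF // horner_morphC ih.
Qed.

Lemma npoly_ind k (S : npoly B k -> Prop) : (forall t, S (nconst k t)) ->
  (forall i, (i < k)%N -> S (nvar k i)) -> (forall x y, S x -> S y -> S (x + y)) ->
  (forall x y, S x -> S y -> S (x * y)) -> forall P, S P.
Proof.
elim: k S => [|k ih] S hc hv hD hM P; first exact: hc.
have hC (c : npoly B k) : S c%:P.
  apply: (ih (fun c => S c%:P)) => [t|i ik|x y hx hy|x y hx hy].
  - exact: hc.
  - by have := hv i (ltnW ik); rewrite /= ltn_eqF.
  - by rewrite polyCD; exact: hD.
  - by rewrite polyCM; exact: hM.
have hX : S 'X by have := hv k (ltnSn k); rewrite /= eqxx.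
elim/poly_ind: P => [|P c hP]; first by rewrite -polyC0.
by apply: hD (hC c); exact: hM.
Qed.
End NestedPolynomials.

Section PolynomialsInSeries.
Variables (R : realType) (p : nat) (K : perfectoidField R p) (B : nring K).

Fixpoint nser k : {rmorphism npoly B k -> tate B k} :=
  match k return {rmorphism npoly B k -> tate B k} with
  | 0 => idfun
  | k'.+1 =>
    (horner_morph (f := @sconst _ _ _ (tate B k') \o nser k')
        (fun x => mulrC (sX (tate B k')) (sconst (nser k' x))) :
      {rmorphism {poly (npoly B k')} -> rser (tate B k')})
  end.

Lemma nser_coef k (P : {poly (npoly B k)}) i : (nser k.+1 P : rser _) i = nser k P`_i.
Proof.
rewrite -[nser k.+1 P]/((map_poly (@sconst _ _ _ (tate B k) \o nser k) P).[sX (tate B k)]).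
by rewrite map_poly_comp ser_horner coef_map.
Qed.

Lemma nser_X k : nser k.+1 'X = sX (tate B k). Proof. exact: horner_morphX. Qed.
Lemma nser_C k c : nser k.+1 c%:P = sconst (nser k c). Proof. exact: horner_morphC. Qed.

Lemma nser_dense k (x : tate B k) e : 0 < e -> exists P, nm (x - nser k P) <= e.
Proof.
move=> e0; elim: k x => [|k ih] x; first by exists x; rewrite subrr nm0 ltW.
have [N hN] := strunc_approx x e0.
have [P hP] := choice (fun i => ih (x i)).
exists (\poly_(i < N) P i : {poly (npoly B k)}).
apply: rnm_le => i; rewrite scoefB nser_coef coef_poly; case: ltnP => [//|Ni].
rewrite rmorph0 subr0; have := le_lt_trans (rnm_coef (x - strunc N x) i) hN.
by rewrite scoefB struncE ltnNge Ni /= subr0 => /ltW.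
Qed.
End PolynomialsInSeries.

Lemma tate_tate (R : realType) (p : nat) (K : perfectoidField R p) (B : nring K) k n :
  tate (tate B n) k = tate B (k + n).
Proof. by elim: k => //= k ->. Qed.

(** * Strictness of the two-term covering complex at finite level *)

Section FiniteLevel.
Variables (R : realType) (p : nat) (K : perfectoidField R p) (n : nat).
Local Notation T := (TA K n).
Variables (L : fieldType) (phi : {rmorphism T -> L}).
Hypothesis phi_inj : injective phi.
Variables (k : nat) (f u : nat -> T) (g : T).
Hypotheses (g0 : g != 0) (fu : \sum_(l < k) u l * f l = 1).

Definition nfrac (l : nat) : L := phi (f l) / phi g.
Definition nev : {rmorphism npoly T k -> L} := neval phi nfrac k.
Let pg0 : phi g != 0. Proof. by rewrite -(rmorph0 phi) (inj_eq phi_inj). Qed.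

Let ginv : npoly T k := \sum_(l < k) nconst T k (u l) * nvar T k l.
Let rel (l : nat) : npoly T k := nconst T k g * nvar T k l - nconst T k (f l).
Let J (P : npoly T k) := exists q : 'I_k -> npoly T k, P = \sum_(l < k) rel l * q l.

Lemma nev_ginv : nev ginv = (phi g)^-1.
Proof.
rewrite rmorph_sum /= -[RHS]mul1r -(rmorph1 phi) -fu rmorph_sum mulr_suml.
apply: eq_bigr => l _; rewrite rmorphM /= [nev _]neval_const [nev _]neval_var //.
by rewrite rmorphM mulrA.
Qed.

Lemma nev_rel l : (l < k)%N -> nev (rel l) = 0.
Proof.
move=> lk; rewrite rmorphB rmorphM !neval_const neval_var // /nfrac mulrC divfK //.
by rewrite subrr.
Qed.

Let JD P Q : J P -> J Q -> J (P + Q).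
Proof.
move=> [q ->] [r ->]; exists (fun l => q l + r l); rewrite -big_split /=.
by apply: eq_bigr => l _; rewrite mulrDr.
Qed.
Let JM P Q : J P -> J (Q * P).
Proof.
by move=> [q ->]; exists (fun l => Q * q l); rewrite mulr_sumr; apply: eq_bigr => l _; rewrite mulrCA.
Qed.
Let J0 : J 0.
Proof. by exists (fun=> 0); rewrite big1 // => l _; rewrite mulr0. Qed.
Let Jrel (l : 'I_k) : J (rel l).
Proof.
exists (fun i => (i == l)%:R); rewrite (bigD1 l) //= eqxx mulr1 big1 ?addr0 // => i il.
by rewrite (negPf il) mulr0.
Qed.

Let Jg : J (nconst T k g * ginv - 1).
Proof.
rewrite -(rmorph1 (nconst T k)) -fu rmorph_sum mulr_sumr -sumrB.
elim/big_ind: _ => [|x y hx hy|l _]; [exact: J0 | exact: JD |].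
rewrite rmorphM mulrCA -mulrBr; exact/JM/Jrel.
Qed.

(** Every polynomial in the fractions is congruent to a single fraction, because the
    denominator becomes invertible modulo the relations. *)
Let single P : exists t d, J (P - nconst T k t * ginv ^+ d).
Proof.
have up t d e : J (nconst T k t * ginv ^+ d - nconst T k (t * g ^+ e) * ginv ^+ (d + e)).
  elim: e => [|e ih]; first by rewrite addn0 expr0 mulr1 subrr.
  rewrite -(subrKA (nconst T k (t * g ^+ e) * ginv ^+ (d + e))); apply: JD ih _.
  have -> : nconst T k (t * g ^+ e.+1) = nconst T k g * nconst T k (t * g ^+ e).
    by rewrite -rmorphM exprS mulrCA.
  rewrite addnS [ginv ^+ (_).+1]exprS; set a := nconst T k (t * _); set c := nconst T k g.
  have -> : a * ginv ^+ (d + e) - c * a * (ginv * ginv ^+ (d + e)) =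
     (- (a * ginv ^+ (d + e))) * (c * ginv - 1) by ring.
  exact: JM.
elim/npoly_ind: P => [t|l lk|x y [t [d h]] [t' [d' h']]|x y [t [d h]] [t' [d' h']]].
- by exists t, 0%N; rewrite expr0 mulr1 subrr.
- exists (f l), 1%N; rewrite expr1.
  have -> : nvar T k l - nconst T k (f l) * ginv =
    ginv * rel l + (- nvar T k l) * (nconst T k g * ginv - 1) by rewrite /rel; ring.
  by apply: JD; apply: JM => //; exact: (Jrel (Ordinal lk)).
- exists (t * g ^+ d' + t' * g ^+ d), (d + d')%N.
  have := JD (JD h (up t d d')) (JD h' (up t' d' d)); rewrite [(d' + d)%N]addnC.
  rewrite rmorphD; congr J; ring.
- exists (t * t'), (d + d')%N.
  have := JD (JM y h) (JM (nconst T k t * ginv ^+ d) h').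
  rewrite rmorphM exprD; congr J; ring.
Qed.

Lemma nev_frac P : exists t d, nev P = phi t / phi g ^+ d.
Proof.
have [t [d [q h]]] := single P; exists t, d.
have -> : P = nconst T k t * ginv ^+ d + \sum_(l < k) rel l * q l by rewrite -h addrC subrK.
rewrite rmorphD rmorph_sum /= big1 ?addr0 => [|l _].
  by rewrite rmorphM rmorphXn /= nev_ginv [nev _]neval_const exprVn.
by rewrite rmorphM /= nev_rel // mul0r.
Qed.

Lemma frac_nev t d : exists P, nev P = phi t / phi g ^+ d.
Proof.
exists (nconst T k t * ginv ^+ d).
by rewrite rmorphM rmorphXn /= nev_ginv [nev _]neval_const exprVn.
Qed.

Lemma nev_ker P : nev P = 0 -> J P.
Proof.
have [t [d h]] := single P; move=> e.
suff t0 : t = 0 by move: h; rewrite t0 rmorph0 mul0r subr0.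
have [q hq] := h; have : nev (P - nconst T k t * ginv ^+ d) = 0.
  by rewrite hq rmorph_sum big1 // => l _; rewrite rmorphM nev_rel // mul0r.
rewrite rmorphB e sub0r rmorphM rmorphXn nev_ginv [nev _]neval_const => /eqP.
rewrite oppr_eq0 mulf_eq0 expf_eq0 invr_eq0 (negPf pg0) andbF orbF.
by rewrite -(rmorph0 phi) (inj_eq phi_inj) => /eqP.
Qed.

(** The parameter C records the loss of norm in the estimates; for C = 1 it is the ring
    generated by the integral elements of T and the fractions f l / g. *)
Definition nlat (C : R) (x : L) := exists2 P, nm (nser T k P) <= C & nev P = x.

(** Multiplication by X - h on polynomials over T[1/g] has a bounded inverse.  Lifting to
    the Tate algebra in the fractions and X, this is strictness of the ideal generated by
    X - H and the relations; and X - H is a nonzerodivisor modulo the relations because the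
    annihilators of the powers of H stabilize. *)
Theorem finite_level_strict (H : npoly T k) : exists C : R, 1 <= C /\
  forall V : {poly L}, (forall i, exists t d, V`_i = phi t / phi g ^+ d) ->
  (forall i, nlat 1 ((('X - (nev H)%:P) * V)`_i)) -> forall i, nlat C V`_i.
Proof.
pose T1 := tate T k; pose T2 := tate T k.+1.
pose G1 : 'M[T1]_(k, 1) := \matrix_(l, j) nser T k (rel l).
pose Z : T2 := nser T k.+1 ('X - H%:P).
pose G2 : 'M[T2]_(1 + k, 1) := col_mx Z%:M (\matrix_(l, j) nser T k.+1 (rel l)%:P).
have [C [C1 strict]] : exists C : R, 1 <= C /\
    forall c d, 0 <= d -> mxle (c *m G2) d -> exists c' : 'rV_(1 + k), c' *m G2 = c *m G2 /\ mxle c' (C * d).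
  move: G2; rewrite /T2 tate_tate => G2; exact: strict_ideal.
have [k0 ann] : exists k0, forall (x : 'rV_1) i, (exists c, nser T k H ^+ i *: x = c *m G1) ->
    exists c, nser T k H ^+ k0 *: x = c *m G1.
  move: G1 (nser T k H); rewrite /T1 tate_tate => G1 h; exact: annihilator_stable.
pose J1 (x : T1) := exists c : 'rV_k, x%:M = c *m G1.
have J1D a x y : J1 x -> J1 y -> J1 (a * x + y).
  move=> [c e] [c' e']; exists (a *: c + c').
  by rewrite raddfD /= -scale_scalar_mx e e' mulmxDl scalemxAl.
have J1P P : J P -> J1 (nser T k P).
  move=> [q ->]; exists (\row_l nser T k (q l)); apply/rowP => j; rewrite (ord1 j) !mxE mulr1n rmorph_sum.
  by apply: eq_bigr => l _; rewrite !mxE rmorphM mulrC.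
exists C; split=> // V hV hr.
have [V' eV'] : exists V' : {poly (npoly T k)}, forall i, nev V'`_i = V`_i.
  have hP i : exists P, nev P = V`_i by have [t [d ->]] := hV i; exact: frac_nev.
  have [P hP'] := choice hP; exists (\poly_(i < size V) P i) => i.
  by rewrite coef_poly; case: ltnP => h; [exact: hP' | rewrite rmorph0 nth_default].
pose F := ('X - (nev H)%:P) * V.
have [W [nW eW]] : exists W : {poly (npoly T k)},
    (forall i, nm (nser T k W`_i) <= 1) /\ forall i, nev W`_i = F`_i.
  have hP i : exists P, nm (nser T k P) <= 1 /\ nev P = F`_i by have [P hP <-] := hr i; exists P.
  have [P hP'] := choice hP; exists (\poly_(i < size F) P i).
  split=> i; rewrite coef_poly; case: ltnP => h; rewrite ?rmorph0 ?nm0 //; try exact: (hP' i).1.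
  - exact: (hP' i).2.
  - by rewrite nth_default.
have FE i : F`_i = (if i is i'.+1 then V`_i' else 0) - nev H * V`_i.
  by rewrite /F mulrBl coefB coefCM coefXM; case: i.
pose D : {poly (npoly T k)} := ('X - H%:P) * V' - W.
have JDi i : J D`_i.
  apply: nev_ker; rewrite coefB rmorphB eW FE mulrBl coefB coefCM coefXM rmorphB rmorphM eV'.
  by case: i => [|i] /=; rewrite ?rmorph0 ?eV' subrr.
have [q hq] : exists q : 'I_k -> {poly (npoly T k)}, D = \sum_(l < k) (rel l)%:P * q l.
  have [q hq] := choice JDi; exists (fun l => \poly_(i < size D) q i l); apply/polyP => i.
  rewrite coef_sum; have [h|h] := ltnP i (size D).
    by rewrite hq; apply: eq_bigr => l _; rewrite coefCM coef_poly h.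
  by rewrite nth_default // big1 // => l _; rewrite coefCM coef_poly ltnNge h mulr0.
pose S (P : {poly (npoly T k)}) : T2 := nser T k.+1 P.
have eS : S W = S V' * Z + \sum_(l < k) (- S (q l)) * S (rel l)%:P.
  have -> : W = V' * ('X - H%:P) + \sum_(l < k) (- q l) * (rel l)%:P.
    transitivity (V' * ('X - H%:P) - D); first by rewrite /D; ring.
    rewrite hq; congr (_ + _); rewrite -sumrN; apply: eq_bigr => l _; ring.
  rewrite /S rmorphD rmorphM rmorph_sum; congr (_ + _); apply: eq_bigr => l _.
  by rewrite rmorphM rmorphN.
have mxE2 (c : 'rV[T2]_(1 + k)) : (c *m G2) 0 0 =
    c 0 (lshift k 0) * Z + \sum_(l < k) c 0 (rshift 1 l) * S (rel l)%:P.
  rewrite -[c in LHS]hsubmxK mul_row_col !mxE big_ord1 !mxE mulr1n; congr (_ + _).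
  by apply: eq_bigr => l _; rewrite !mxE.
pose c0 : 'rV[T2]_(1 + k) := row_mx (S V')%:M (\row_l (- S (q l))).
have ec0 : (c0 *m G2) 0 0 = S W.
  rewrite mxE2 eS row_mxEl mxE mulr1n; congr (_ + _).
  by apply: eq_bigr => l _; rewrite row_mxEr mxE.
have [||c [ec nc]] := strict c0 1; first exact: ler01.
  move=> i j; rewrite (ord1 i) (ord1 j) ec0; apply: rnm_le => l; rewrite nser_coef; exact: nW.
have := congr1 (fun M : 'rV_1 => M 0 0) ec; rewrite /= ec0 mxE2.
set v := c 0 (lshift k 0) => ev.
pose X : T2 := S V' - v.
have eX : X * Z = \sum_(l < k) (c 0 (rshift 1 l) + S (q l)) * S (rel l)%:P.
  rewrite mulrBl; have -> : S V' * Z = S W + \sum_(l < k) S (q l) * S (rel l)%:P.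
    by rewrite eS -addrA -big_split /= big1 ?addr0 // => l _; ring.
  rewrite -ev addrAC [v * Z + _]addrC addrK -big_split /=; apply: eq_bigr => l _; ring.
pose X' : rser T1 := X.
have coefJ i : J1 ((if i is i'.+1 then X' i' else 0) - nser T k H * X' i).
  have <- : (X * Z : rser T1) i = (if i is i'.+1 then X' i' else 0) - nser T k H * X' i.
    have -> : X * Z = sX T1 * X - sconst (nser T k H) * X.
      by rewrite /Z rmorphB nser_X nser_C; ring.
    rewrite scoefB sconstM_coef -[sX T1]expr1 sXn_coef; congr (_ - _); case: i => //= i.
    by rewrite subn1.
  rewrite eX; exists (\row_l (c 0 (rshift 1 l) + S (q l) : rser T1) i).
  apply/rowP => j; rewrite (ord1 j) !mxE mulr1n scoef_sum; apply: eq_bigr => l _.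
  by rewrite !mxE /S nser_C mulrC sconstM_coef mulrC.
have J10 : J1 0 by exists 0; rewrite mul0mx; apply/rowP => j; rewrite !mxE mul0rn.
(* the coefficients of X Z lie in the ideal of the relations; from the bottom,
   powers of H kill X *)
have kill i : J1 (nser T k H ^+ i.+1 * X' i).
  elim: i => [|i ih].
    by have := J1D (-1) _ _ (coefJ 0%N) J10; rewrite expr1 sub0r mulN1r opprK addr0.
  have := J1D (- nser T k H ^+ i.+1) _ _ (coefJ i.+1) ih; rewrite [_ ^+ i.+2]exprS.
  by congr J1; ring.
have kill0 i : J1 (nser T k H ^+ k0 * X' i).
  have [|c' ec'] := ann (X' i)%:M i.+1; first by have [c' e'] := kill i; exists c'; rewrite scale_scalar_mx.
  by exists c'; rewrite -ec' scale_scalar_mx.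
(* from the other end, X_i is congruent to H^j X_(i + j) for all j *)
have JX i : J1 (X' i).
  have low j : J1 (X' i - nser T k H ^+ j * X' (i + j)%N).
    elim: j => [|j ih]; first by rewrite expr0 mul1r addn0 subrr.
    have := J1D (nser T k H ^+ j) _ _ (coefJ (i + j).+1) ih; rewrite addnS exprSr.
    by congr J1; rewrite /=; ring.
  by have := J1D 1 _ _ (low k0) (kill0 (i + k0)%N); rewrite mul1r subrK.
move=> i; have [y ey] := JX i.
have [b [b1 hb]] := mxle_bound G1.
have b0 : 0 < b by exact: lt_le_trans b1.
have [P hP] := nser_dense (v i : T1) ltr01.
have bi0 : 0 < b^-1 by rewrite invr_gt0.
have [Q hQ] := choice (fun l : 'I_k => nser_dense (y 0 l) bi0).
(* P + E is congruent to the coefficient of V' modulo the relations and close to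
   the series v i *)
pose E := V'`_i - P - \sum_(l < k) Q l * rel l.
have nE : nm (nser T k E) <= 1.
  have -> : nser T k E = ((v : rser T1) i - nser T k P) + \sum_(l < k) (y 0 l - nser T k (Q l)) * G1 l 0.
    have e1 : nser T k V'`_i = X' i + (v : rser T1) i by rewrite /X' /X scoefB nser_coef subrK.
    have e2 : X' i = \sum_(l < k) y 0 l * G1 l 0.
      by have := congr1 (fun M : 'rV_1 => M 0 0) ey; rewrite /= mxE mulr1n mxE.
    have e3 : nser T k (\sum_(l < k) Q l * rel l) = \sum_(l < k) nser T k (Q l) * G1 l 0.
      by rewrite rmorph_sum; apply: eq_bigr => l _; rewrite rmorphM mxE.
    have e4 : \sum_(l < k) (y 0 l - nser T k (Q l)) * G1 l 0 =
        X' i - \sum_(l < k) nser T k (Q l) * G1 l 0.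
      by rewrite e2 -sumrB; apply: eq_bigr => l _; rewrite mulrBl.
    by rewrite /E !rmorphB e1 e3 e4; ring.
  apply: nmD_le => //; apply: nm_sum_le => // l _; rewrite nmM.
  rewrite -[1](mulVf (lt0r_neq0 b0)); apply: ler_pM; rewrite ?nm_ge0 //; exact: hb.
exists (P + E).
  rewrite rmorphD; apply: nmD_le; last exact: le_trans nE C1.
  rewrite -(subKr ((v : rser T1) i) (nser T k P)); apply: nmB_le; last exact: le_trans hP C1.
  by apply: le_trans (rnm_coef _ i) _; have := nc 0 (lshift k 0); rewrite mulr1.
rewrite rmorphD -eV' -rmorphD /E.
have -> : P + (V'`_i - P - \sum_(l < k) Q l * rel l) = V'`_i - \sum_(l < k) Q l * rel l by ring.
rewrite rmorphB rmorph_sum big1 ?subr0 // => l _.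
by rewrite rmorphM nev_rel // mulr0.
Qed.
End FiniteLevel.

(** * Slices: the perfectoid algebra as a completed sum over a finite level *)

Lemma int_small (z : int) (P : rat) : 0 < P -> - P^-1 < z%:~R / P < P^-1 -> z = 0.
Proof.
move=> P0; rewrite ltr_pdivrMr // mulVf ?gt_eqF // ltr_pdivlMr // mulNr mulVf ?gt_eqF //.
move=> /andP [h1 h2]; have a1 : -1 < z by rewrite -(ltr_int rat).
have a2 : z < 1 by rewrite -(ltr_int rat).
lia.
Qed.

Section Slices.
Variables (R : realType) (p : nat) (K : perfectoidField R p) (n m : nat).
Local Notation A := (PT K n).
Implicit Types (a b : A) (al be ga : 'rV[rat]_n).
Local Notation P := (p%:R ^+ m : rat).

Let P0 : 0 < P. Proof. by rewrite exprn_gt0 // ltr0n prime_gt0 // (pf_prime K). Qed.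

Definition expZ be := forall i, exists z : int, be 0 i = z%:~R / P.
Definition frac_exp al := pexponent p al /\ forall i, al 0 i < P^-1.

Lemma expZB al be : expZ al -> expZ be -> expZ (al - be).
Proof.
move=> h h' i; have [z hz] := h i; have [z' hz'] := h' i; exists (z - z').
by rewrite !mxE hz hz' intrB mulrBl.
Qed.

Lemma expm_expZ al : expm p m al -> expZ al.
Proof. by move=> [e he] i; exists (e i); rewrite he. Qed.

Lemma pexponent_ge0 al i : pexponent p al -> 0 <= al 0 i.
Proof. by move=> h; have [u [v ->]] := h i; rewrite divr_ge0 ?ler0n ?exprn_ge0. Qed.

Lemma frac_exp_unique al be : frac_exp al -> frac_exp be -> expZ (al - be) -> al = be.
Proof.
move=> [ha la] [hb lb] h; apply/rowP => i; apply/eqP; rewrite -subr_eq0.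
have [z] := h i; rewrite !mxE => hz.
have a0 := pexponent_ge0 i ha; have b0 := pexponent_ge0 i hb.
have h1 := la i; have h2 := lb i.
have z0 : z = 0.
  by apply: (int_small P0); rewrite -hz; apply/andP; split; lra.
by rewrite hz z0 mul0r.
Qed.

Lemma frac_exp_ex al : pexponent p al -> exists be, frac_exp be /\ expZ (al - be).
Proof.
move=> h; have [m0 hm0] := pexponent_expm K h.
have [e he] := hm0 _ (leq_maxl m0 m); set k := maxn m0 m in e he.
have mk : (m <= k)%N by exact: leq_maxr.
pose q := (p ^ (k - m))%N; have q0 : (0 < q)%N by rewrite expn_gt0 prime_gt0 // (pf_prime K).
have pk : p%:R ^+ k = q%:R * P by rewrite /q natrX -exprD subnK.
have qn : q%:R != 0 :> rat by rewrite pnatr_eq0 -lt0n.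
have Pn : P != 0 by rewrite gt_eqF.
exists (\row_i ((e i %% q)%N%:R / p%:R ^+ k)); split; first split.
- by move=> i; rewrite mxE; exists (e i %% q)%N, k.
- move=> i; rewrite mxE pk ltr_pdivrMr ?mulr_gt0 ?ltr0n // mulrCA mulVf // mulr1 ltr_nat.
  exact: ltn_pmod.
- move=> i; exists (e i %/ q)%N; rewrite !mxE he {1}(divn_eq (e i) q) natrD mulrDl addrK.
  by rewrite pk natrM; field; rewrite qn Pn.
Qed.

Fact slice_supp al a be :
  (if `[< expZ be /\ frac_exp al >] then pcoef a (be + al) else 0) != 0 -> expm p m be.
Proof.
case: asboolP => [[hb [ha la]] h|]; last by rewrite eqxx.
have hs := pcoef_exponent h; have [z hz] := choice hb.
exists (fun i => `|z i|%N) => i; rewrite hz; congr (_ / _).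
have h1 := pexponent_ge0 i hs; have h2 := la i; rewrite mxE hz in h1.
have : -1 < z i by rewrite -(ltr_int rat) -(ltr_pM2r (x := P^-1)) ?invr_gt0 //; move: h1 h2; rewrite mulN1r; lra.
by case: (z i) => [j|[|j]] //=; rewrite ?absz_nat.
Qed.

Fact slice_null al a : null_family (fun be =>
  if `[< expZ be /\ frac_exp al >] then pcoef a (be + al) else 0).
Proof.
apply: (@null_dom _ _ _ _ (fun be => pcoef a (be + al)) _ 1) => // [|be].
  apply: (@null_inj _ _ K _ _ (tcoef (a : perfTate K n)) (fun be => be + al)) => [x y /addIr //|].
  exact: tcoef_null.
by rewrite mulr1; case: asboolP => _ //; rewrite pf_abs0 pf_abs_ge0.
Qed.

(** The part of a with exponents in al + Z^n / p^m, divided by X^al. *)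
Definition slice al a : A :=
  PerfTate (fun be h => expm_pexponent (@slice_supp al a be h)) (@slice_null al a).

Lemma slice_coef al a be : frac_exp al ->
  pcoef (slice al a) be = if `[< expZ be >] then pcoef a (be + al) else 0.
Proof.
move=> h; rewrite /pcoef /=; case: asboolP => [[hb _]|hn]; case: asboolP => // hb.
by exfalso; exact: hn.
Qed.

Lemma slice_le al a : nm (slice al a) <= nm a.
Proof.
apply: nm_coef_le => be; rewrite /pcoef /=; case: asboolP => _; first exact: pcoef_le.
by rewrite pf_abs0 nm_ge0.
Qed.

Lemma sliceB al a b : slice al (a - b) = slice al a - slice al b.
Proof.
by apply: pcoefP => be; rewrite pcoefB /pcoef /=; case: asboolP => _; rewrite ?subr0.
Qed.
Lemma slice0 al : slice al 0 = 0. Proof. by have := sliceB al 0 0; rewrite !subrr. Qed.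
Lemma sliceN al a : slice al (- a) = - slice al a. Proof. by rewrite -sub0r sliceB slice0 sub0r. Qed.
Lemma sliceD al a b : slice al (a + b) = slice al a + slice al b.
Proof. by rewrite -{1}[b]opprK sliceB sliceN opprK. Qed.
Lemma slice_sum al (I : Type) (s : seq I) (F : I -> A) :
  slice al (\sum_(i <- s) F i) = \sum_(i <- s) slice al (F i).
Proof. by elim: s => [|i s ih]; rewrite ?big_nil ?slice0 // !big_cons sliceD ih. Qed.

Lemma slice_mono al c ga a : frac_exp al -> expm p m ga ->
  slice al (mono c ga * a) = mono c ga * slice al a.
Proof.
move=> hal hg; have pg := expm_pexponent hg; apply: pcoefP => be.
rewrite slice_coef // !pcoef_monoM // slice_coef // addrAC.
have hgZ := expm_expZ hg; case: asboolP => hb; case: asboolP => hb'; rewrite ?mulr0 //.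
- by exfalso; apply: hb'; exact: expZB.
- exfalso; apply: hb; have Z0 : expZ 0 by move=> i; exists 0; rewrite mxE mul0r.
  by have := expZB hb' (expZB Z0 hgZ); rewrite sub0r opprK subrK.
Qed.

Lemma slice_level al (t : TA K n) a : frac_exp al ->
  slice al (level m t * a) = level m t * slice al a.
Proof.
move=> hal; apply/eqP; rewrite -subr_eq0; apply/eqP/nm_small => k.
have e0 : 0 < (2 ^+ k)^-1 / (nm a + 1) :> R.
  by rewrite divr_gt0 ?half_pow_gt0 // ltr_wpDl ?nm_ge0.
have [s [hs ht]] := mono_trunc (level m t) e0.
set S := \sum_(be <- s) _ in ht.
have eS : slice al (S * a) = S * slice al a.
  rewrite !mulr_suml slice_sum big_seq [RHS]big_seq; apply: eq_bigr => be bs.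
  by apply: slice_mono => //; apply: level_expm (hs _ bs).
have -> : slice al (level m t * a) - level m t * slice al a =
   slice al ((level m t - S) * a) - (level m t - S) * slice al a.
  by rewrite !mulrBl sliceB eS; ring.
have le b : nm b <= nm a -> nm (level m t - S) * nm b <= (2 ^+ k)^-1.
  move=> hb; apply: (@le_trans _ _ ((2 ^+ k)^-1 / (nm a + 1) * (nm a + 1))).
    by apply: ler_pM; rewrite ?nm_ge0 //; apply: le_trans hb _; rewrite lerDl.
  by rewrite divfK // gt_eqF // ltr_wpDl ?nm_ge0.
apply: nmB_le; last by rewrite nmM; apply: le; exact: slice_le.
by apply: le_trans (slice_le _ _) _; rewrite nmM; exact: le.
Qed.

Lemma slice_image al a : exists t, level m t = slice al a.
Proof. by apply: level_image => be; exact: slice_supp. Qed.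

Lemma slice_approx a (e : R) : 0 < e -> exists s : seq 'rV[rat]_n,
  (forall al, al \in s -> frac_exp al) /\
  nm (a - \sum_(al <- s) mono 1 al * slice al a) <= e.
Proof.
move=> e0; have [s0 [hs0 hn]] := mono_trunc a e0.
have ex al : exists be, pexponent p al -> frac_exp be /\ expZ (al - be).
  have [h|h] := pselect (pexponent p al); last by exists 0.
  by have [be hb] := frac_exp_ex h; exists be.
have [F hF] := choice ex; pose s := undup (map F s0).
have sfr al : al \in s -> frac_exp al.
  by rewrite mem_undup => /mapP [be bs ->]; apply: (hF _ (pcoef_exponent (hs0 _ bs))).1.
exists s; split=> //; apply: nm_coef_le => al; rewrite pcoefB pcoef_sum.
have tm be : be \in s -> pcoef (mono 1 be * slice be a) al =
    if `[< expZ (al - be) >] then pcoef a al else 0.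
  move=> bs; have hb := sfr _ bs; rewrite pcoef_monoM ?mul1r ?slice_coef ?subrK //; exact: hb.1.
have [[be [bs hb]]|hno] := pselect (exists be, be \in s /\ expZ (al - be)).
  rewrite (bigD1_seq be) ?undup_uniq //= tm //; case: asboolP => // _.
  rewrite big1_seq ?addr0 ?subrr ?pf_abs0 ?ltW // => ga /andP [gb gs].
  rewrite tm //; case: asboolP => // hg; case/eqP: gb.
  apply: frac_exp_unique; [exact: sfr | exact: sfr |].
  by have := expZB hb hg; rewrite opprB addrC addrA subrK.
rewrite big1_seq => [|ga /andP [_ gs]]; last first.
  by rewrite tm //; case: asboolP => // hg; exfalso; apply: hno; exists ga.
rewrite subr0; have [as0|as0] := boolP (al \in s0).
  exfalso; apply: hno; exists (F al); split; first by rewrite mem_undup map_f.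
  exact: (hF _ (pcoef_exponent (hs0 _ as0))).2.
apply: le_trans hn; apply: le_trans (pcoef_le _ al).
rewrite pcoefB pcoef_sum big1_seq ?subr0 // => be /= bs.
rewrite pcoef_mono; last exact: (pcoef_exponent (hs0 _ bs)).
by case: (al =P be) => // e'; rewrite e' bs in as0.
Qed.
End Slices.

(** ** Rings generated by finitely many elements *)

Section Adjoin.
Variable L : fieldType.

Definition subring_set (S : set L) : Prop :=
  [/\ S 1, forall x y, S x -> S y -> S (x - y) & forall x y, S x -> S y -> S (x * y)].

Inductive adjoin (S Y : set L) : L -> Prop :=
| adjoin_base x : S x -> adjoin S Y x
| adjoin_gen x : Y x -> adjoin S Y x
| adjoin_add x y : adjoin S Y x -> adjoin S Y y -> adjoin S Y (x + y)
| adjoin_mul x y : adjoin S Y x -> adjoin S Y y -> adjoin S Y (x * y).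

Section Subring.
Variable S : set L.
Hypothesis hS : subring_set S.
Lemma subring0 : S 0. Proof. by rewrite -(subrr 1); case: hS => h1 hB _; exact: hB. Qed.
Lemma subringN x : S x -> S (- x).
Proof. by move=> h; rewrite -sub0r; case: hS => _ hB _; apply: hB => //; exact: subring0. Qed.
Lemma subringD x y : S x -> S y -> S (x + y).
Proof.
by move=> hx hy; rewrite -[y]opprK; case: hS => _ hB _; apply: hB => //; exact: subringN.
Qed.
Lemma subringX x k : S x -> S (x ^+ k).
Proof.
by move=> h; elim: k => [|k ih]; rewrite ?expr0 ?exprS; case: hS => // h1 _ hM; exact: hM.
Qed.
Lemma subring_sum (I : eqType) (s : seq I) (F : I -> L) : (forall i, i \in s -> S (F i)) ->
  S (\sum_(i <- s) F i).
Proof.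
by move=> h; rewrite big_seq; elim/big_ind: _ => //; [exact: subring0 | exact: subringD].
Qed.

Lemma adjoin_subring Y : subring_set (adjoin S Y).
Proof.
have [S1 SB SM] := hS; split=> [|x y hx hy|]; first exact: adjoin_base.
  rewrite -[y]mul1r -mulNr; apply: adjoin_add hx _; apply: adjoin_mul hy.
  by apply: adjoin_base; exact: subringN.
exact: adjoin_mul.
Qed.

Lemma adjoin_poly h x : adjoin S [set h] x -> exists s : {poly L}, (forall i, S s`_i) /\ x = s.[h].
Proof.
have [S1 SB SM] := hS; have S0 := subring0.
elim=> [{}x hx|{}x ->|{}x y _ [s [hs ->]] _ [t [ht ->]]|{}x y _ [s [hs ->]] _ [t [ht ->]]].
- by exists x%:P; split=> [i|]; rewrite ?hornerC // coefC; case: eqP.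
- by exists 'X; split=> [i|]; rewrite ?hornerX // coefX; case: eqP.
- by exists (s + t); split=> [i|]; rewrite ?hornerD // coefD; exact: subringD.
- exists (s * t); split=> [i|]; last by rewrite hornerM.
  rewrite coefM; elim/big_ind: _ => // [y' z|j _]; [exact: subringD | exact: SM].
Qed.
End Subring.

Lemma adjoin_sub (S Y S' : set L) : subring_set S' -> S `<=` S' -> Y `<=` S' -> adjoin S Y `<=` S'.
Proof.
move=> hS' SS YS x; elim=> [y /SS|y /YS|y z _ hy _ hz|y z _ hy _ hz] //; first exact: subringD.
by case: hS' => _ _; apply.
Qed.
End Adjoin.

(** * Strictness over the perfectoid algebra *)

Lemma nvar_le (R : realType) (p : nat) (K : perfectoidField R p) (B : nring K) k l :
  nm (nser B k (nvar B k l)) <= 1.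
Proof.
elim: k => [|k ih]; first by rewrite rmorph0 nm0 ler01.
rewrite [nvar _ _ _]/=; case: eqP => _; first by rewrite nser_X nm_sX.
by rewrite nser_C nm_sconst.
Qed.

Lemma nser_const (R : realType) (p : nat) (K : perfectoidField R p) (B : nring K) k t :
  nm (nser B k (nconst B k t)) = nm t.
Proof. by elim: k => [|k ih] //; rewrite nser_C nm_sconst. Qed.

Section Lift.
Variables (R : realType) (p : nat) (K : perfectoidField R p) (n m : nat).
Local Notation T := (TA K n).
Local Notation A := (PT K n).
Variables (L : fieldType) (fr : {rmorphism A -> L}).
Hypothesis fr_inj : injective fr.

Definition unit_ball : set L := [set fr a | a in [set a | nm a <= 1]].

Lemma unit_ball_subring : subring_set unit_ball.
Proof.
split; first by exists 1; rewrite ?rmorph1 //= nm1.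
- by move=> _ _ [a ha <-] [b hb <-]; exists (a - b); rewrite ?rmorphB //=; exact: nmB_le.
- by move=> _ _ [a ha <-] [b hb <-]; exists (a * b); rewrite ?rmorphM //=; exact: nmM_le1.
Qed.

Variables (k : nat) (f u : nat -> T) (g : T).
Hypotheses (g0 : g != 0) (fu : \sum_(l < k) u l * f l = 1).
Let phi : {rmorphism T -> L} := fr \o level m.
Let phi_inj : injective phi.
Proof. by move=> x y /fr_inj h; apply/eqP; rewrite -subr_eq0; apply/eqP/nm_eq0; rewrite -(level_iso (K := K) m) rmorphB h subrr nm0. Qed.
Local Notation nevk := (nev phi k f g).
Local Notation nlatC := (nlat phi k f g).

Definition lat : set L := adjoin unit_ball [set nfrac phi f g l | l in [set l | (l < k)%N]].

Lemma lat_subring : subring_set lat. Proof. exact/adjoin_subring/unit_ball_subring. Qed.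

Lemma nlat1_lat x : nlatC 1 x -> lat x.
Proof.
move=> [P nP <-]; have key j : (j <= k)%N -> forall Q : npoly T j, nm (nser T j Q) <= 1 ->
    lat (neval phi (nfrac phi f g) j Q).
  elim: j => [|j ih] jk Q nQ.
    by apply: adjoin_base; exists (level m Q); rewrite //= level_iso.
  have -> : neval phi (nfrac phi f g) j.+1 Q = \sum_(i < size (Q : {poly _}))
      neval phi (nfrac phi f g) j (Q : {poly _})`_i * nfrac phi f g j ^+ i.
    rewrite -[LHS]/((map_poly _ (Q : {poly (npoly T j)})).[_]).
    rewrite (@horner_coef_wide _ (size (Q : {poly _}))) ?size_poly //.
    by apply: eq_bigr => i _; rewrite coef_map.
  apply: (subring_sum lat_subring) => i _; apply: adjoin_mul.
    by apply: (ih (ltnW jk)); rewrite -nser_coef; apply: le_trans nQ; exact: rnm_coef.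
  by apply: (subringX lat_subring); apply: adjoin_gen; exists j.
exact: (key k (leqnn k)).
Qed.

Lemma nlat_scale C x (c : K) : pf_abs c * C <= 1 -> nlatC C x -> lat (fr (kst A c) * x).
Proof.
move=> cC [P nP <-]; apply: nlat1_lat; exists (nconst T k (kst T c) * P).
  rewrite rmorphM nmM nser_const nm_kst; apply: le_trans cC.
  by rewrite ler_wpM2l ?pf_abs_ge0.
by rewrite rmorphM [nevk _]neval_const /phi /= ch_kst.
Qed.

Lemma lat_decomp x : lat x -> exists s : seq (A * npoly T k),
  (forall i, i \in s -> nm i.1 <= 1 /\ nm (nser T k i.2) <= 1) /\
  x = \sum_(i <- s) fr i.1 * nevk i.2.
Proof.
elim=> [_ [a ha <-]|_ [l lk <-]|{}x y _ [s [hs ->]] _ [t [ht ->]]|{}x y _ [s [hs ->]] _ [t [ht ->]]].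
- exists [:: (a, 1)]; split=> [i|]; last by rewrite big_seq1 rmorph1 mulr1.
  by rewrite inE => /eqP ->; rewrite rmorph1 nm1.
- exists [:: (1, nvar T k l)]; split=> [i|]; last by rewrite big_seq1 rmorph1 mul1r [nevk _]neval_var.
  by rewrite inE => /eqP ->; rewrite nm1 nvar_le.
- exists (s ++ t); rewrite big_cat; split=> // i; rewrite mem_cat => /orP []; [exact: hs | exact: ht].
- exists [seq (i.1 * j.1, i.2 * j.2) | i <- s, j <- t]; split.
    move=> _ /allpairsP [[i j] /= [ins jt ->]] /=; have [h1 h2] := hs _ ins; have [h3 h4] := ht _ jt.
    by rewrite rmorphM; split; exact: nmM_le1.
  rewrite big_allpairs_dep mulr_suml; apply: eq_bigr => i _; rewrite mulr_sumr.
  by apply: eq_bigr => j _; rewrite /= !rmorphM; ring.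
Qed.

(** Slicing is linear over the finite level, hence over the fractions with finite-level
    numerator and denominator a power of g. *)
Lemma slice_relation al (s : seq (A * npoly T k)) : frac_exp p m al ->
  \sum_(i <- s) fr i.1 * nevk i.2 = 0 -> \sum_(i <- s) fr (slice m al i.1) * nevk i.2 = 0.
Proof.
move=> hal; have [tau ht] := choice (nev_frac phi_inj g0 fu).
have [del hd] := choice ht.
pose e := (\sum_(i <- s) del i.2)%N.
have pg0 : phi g != 0 by rewrite -(rmorph0 phi) (inj_eq phi_inj).
pose t P := tau P * g ^+ (e - del P).
have eP i : i \in s -> nevk i.2 = phi (t i.2) / phi g ^+ e.
  move=> ins; have de : (del i.2 <= e)%N by rewrite /e (big_rem i) //= leq_addr.
  rewrite hd /t rmorphM rmorphXn -{2}(subnK de) exprD invfM mulrA mulfK ?expf_neq0 //.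
have conv (F : A -> A) : \sum_(i <- s) fr (F i.1) * nevk i.2 =
    fr (\sum_(i <- s) level m (t i.2) * F i.1) / phi g ^+ e.
  rewrite rmorph_sum mulr_suml big_seq [RHS]big_seq; apply: eq_bigr => i ins.
  by rewrite eP // rmorphM -[phi (t _)]/(fr (level m (t i.2))); ring.
rewrite (conv id) (conv (slice m al)) => /eqP.
rewrite mulf_eq0 invr_eq0 expf_eq0 (negPf pg0) andbF orbF.
rewrite -(rmorph0 fr) (inj_eq fr_inj) => /eqP h; have := congr1 (slice m al) h.
rewrite slice0 slice_sum /= => h'.
have -> : \sum_(i <- s) level m (t i.2) * slice m al i.1 = 0.
  by rewrite -[RHS]h'; apply: eq_bigr => i _; rewrite slice_level.
by rewrite rmorph0 mul0r.
Qed.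

(** The estimate at finite level applies to each slice of V, because slicing is linear
    over that level, with a constant independent of the slice. The slices sum up to V
    apart from an error that can be made small enough to absorb the denominators. *)
Theorem strict_division (H : npoly T k) : exists c : K, [/\ c != 0, pf_abs c <= 1 &
  forall V : {poly L}, (forall i, exists N d, V`_i = fr N / phi g ^+ d) ->
  (forall i, lat ((('X - (nevk H)%:P) * V)`_i)) -> forall i, lat (fr (kst A c) * V`_i)].
Proof.
have [C [C1 key]] := finite_level_strict phi_inj g0 fu H.
have C0 : 0 < C by exact: lt_le_trans C1.
have [c [c0 c1 cC]] : exists c : K, [/\ c != 0, pf_abs c <= 1 & pf_abs c <= C^-1].
  by apply: pf_small; rewrite invr_gt0.
exists c; split=> // V hV hr i.
have frac1 d : exists P, nevk P = phi 1 / phi g ^+ d by exact: (frac_nev phi g fu 1 d).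
have [G hG] := choice frac1.
have [N hN] := choice hV; have [d hd] := choice hN.
have VE j : V`_j = fr (N j) * nevk (G (d j)) by rewrite hd hG rmorph1 mul1r.
set h := nevk H in hr.
have FE j : (('X - h%:P) * V)`_j = (if j is j'.+1 then V`_j' else 0) - h * V`_j.
  by rewrite mulrBl coefB coefCM coefXM; case: j.
have sl al : frac_exp p m al -> nlatC C (fr (slice m al (N i)) * nevk (G (d i))).
  move=> hal; pose v j := fr (slice m al (N j)) * nevk (G (d j)).
  have v0 j : V`_j = 0 -> v j = 0.
    rewrite VE => /eqP; rewrite mulf_eq0 => /orP [|/eqP hg]; last by rewrite /v hg mulr0.
    by rewrite -(rmorph0 fr) (inj_eq fr_inj) => /eqP hn; rewrite /v hn slice0 rmorph0 mul0r.
  pose Val : {poly L} := \poly_(j < size V) v j.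
  have ValE j : Val`_j = v j.
    by rewrite coef_poly; case: ltnP => // hj; rewrite v0 // nth_default.
  rewrite -/(v i) -ValE; apply: key => j.
    rewrite ValE; have [t ht] := slice_image m al (N j); exists t, (d j).
    by rewrite /v hG rmorph1 mul1r -ht.
  have -> : (('X - h%:P) * Val)`_j = (if j is j'.+1 then v j' else 0) - h * v j.
    by rewrite mulrBl coefB coefCM coefXM !ValE; case: j => //= j; rewrite ValE.
  have [s [hs es]] := lat_decomp (hr j).
  suff -> : (if j is j'.+1 then v j' else 0) - h * v j = \sum_(x <- s) fr (slice m al x.1) * nevk x.2.
    rewrite big_seq; elim/big_ind: _ => [|x y [P nP <-] [Q nQ <-]|x xs].
    - by exists 0; rewrite ?rmorph0 ?nm0 ?ler01.
    - by exists (P + Q); rewrite ?rmorphD //; exact: nmD_le.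
    - have [h1 h2] := hs _ xs; have [t ht] := slice_image m al x.1.
      exists (nconst T k t * x.2); last by rewrite rmorphM [nevk _]neval_const /phi /= ht.
      rewrite rmorphM; apply: nmM_le1 => //; rewrite nser_const -(level_iso m) ht.
      exact: le_trans (slice_le _ _ _) h1.
  pose prev := if j is j'.+1 then [:: (N j', G (d j'))] else [::].
  have prevE (F : A -> A) : \sum_(x <- prev) fr (F x.1) * nevk x.2 =
      if j is j'.+1 then fr (F (N j')) * nevk (G (d j')) else 0.
    by rewrite /prev; case: (j) => [|j']; rewrite ?big_nil ?big_seq1.
  have := @slice_relation al (prev ++ (N j, - H * G (d j)) :: [seq (- x.1, x.2) | x <- s]) hal.
  rewrite !big_cat !big_cons !big_map /= (prevE id) (prevE (slice m al)).
  have neg (F : A -> A) : (forall x, F (- x) = - F x) ->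
      \sum_(x <- s) fr (F (- x.1)) * nevk x.2 = - \sum_(x <- s) fr (F x.1) * nevk x.2.
    by move=> FN; rewrite -sumrN; apply: eq_bigr => x _; rewrite FN rmorphN mulNr.
  rewrite (neg id) // (neg (slice m al)) /=; last by move=> x; rewrite sliceN.
  have ph F' : F' * nevk (- H * G (d j)) = - (h * (F' * nevk (G (d j)))).
    by rewrite rmorphM rmorphN -/h; ring.
  rewrite !ph -/(v j) -VE -es FE => h1.
  have -> : (if j is j'.+1 then v j' else 0) - h * v j =
    (if j is j'.+1 then fr (slice m al (N j')) * nevk (G (d j')) else 0) +
    (- (h * v j) + - \sum_(x <- s) fr (slice m al x.1) * nevk x.2) +
    \sum_(x <- s) fr (slice m al x.1) * nevk x.2 by rewrite /v; case: (j) => [|j']; ring.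
  rewrite h1 ?add0r //; case: (j) => [|j']; rewrite -?VE; ring.
have cC' : pf_abs c * C <= 1 by rewrite -ler_pdivlMr // div1r.
have [lam [l0 l1 hl]] : exists lam : K, [/\ lam != 0, pf_abs lam <= 1 & lat (fr (kst A lam) * (phi g)^-1)].
  have e1 := hG 1%N; rewrite rmorph1 mul1r expr1 in e1.
  have n0 : 0 < nm (nser T k (G 1%N)) + 1 by rewrite ltr_wpDl ?nm_ge0.
  have [lam [l0 l1 hl]] : exists lam : K, [/\ lam != 0, pf_abs lam <= 1 & pf_abs lam <= (nm (nser T k (G 1%N)) + 1)^-1].
    by apply: pf_small; rewrite invr_gt0.
  exists lam; split=> //; apply: (nlat_scale (C := nm (nser T k (G 1%N)))); last by exists (G 1%N).
  rewrite -[1](mulVf (lt0r_neq0 n0)); apply: ler_pM; rewrite ?pf_abs_ge0 ?nm_ge0 //.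
  by rewrite lerDl.
have e0 : 0 < pf_abs lam ^+ d i by rewrite exprn_gt0 // pf_abs_gt0.
have [s [hs hn]] := slice_approx m (N i) e0.
set S := \sum_(al <- s) _ in hn; set eps := N i - S in hn.
have -> : fr (kst A c) * V`_i =
    \sum_(al <- s) fr (mono 1 al) * (fr (kst A c) * (fr (slice m al (N i)) * nevk (G (d i)))) +
    fr (kst A c * eps * kst A (lam^-1) ^+ d i) * (fr (kst A lam) * (phi g)^-1) ^+ d i.
  have ee : N i = S + eps by rewrite /eps addrC subrK.
  have lamE : fr (kst A (lam^-1)) * fr (kst A lam) = 1.
    by rewrite -!rmorphM mulVf // !rmorph1.
  have -> : fr (kst A c * eps * kst A lam^-1 ^+ d i) * (fr (kst A lam) / phi g) ^+ d i =
      fr (kst A c) * (fr eps * nevk (G (d i))).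
    rewrite hG rmorph1 mul1r !rmorphM rmorphXn exprMn exprVn.
    set a := fr (kst A lam^-1) in lamE *; set b := fr (kst A lam) in lamE *.
    transitivity (fr (kst A c) * fr eps * (a * b) ^+ d i / phi g ^+ d i); first by rewrite exprMn; ring.
    by rewrite lamE expr1n; ring.
  rewrite VE {1}ee rmorphD mulrDl mulrDr; congr (_ + _).
  rewrite /S rmorph_sum mulr_suml mulr_sumr; apply: eq_bigr => al _.
  by rewrite rmorphM; ring.
apply: adjoin_add.
  apply: (subring_sum lat_subring) => al als; have hal := hs _ als.
  apply: adjoin_mul; last by apply: nlat_scale (sl _ hal).
  by apply: adjoin_base; exists (mono 1 al); rewrite //= nm_mono ?pf_abs1 //; exact: hal.1.
apply: adjoin_mul; last exact: (subringX lat_subring).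
apply: adjoin_base; exists (kst A c * eps * kst A lam^-1 ^+ d i) => //=.
rewrite !nmM nmX !nm_kst pf_absV -[X in _ <= X](mulfV (lt0r_neq0 e0)) exprVn.
apply: ler_wpM2r; first by rewrite invr_ge0 ltW.
by rewrite -[X in _ <= X]mul1r; apply: ler_pM; rewrite ?pf_abs_ge0 ?nm_ge0.
Qed.

(** The representations of x as a polynomial in h and in 1/h glue to a polynomial
    vanishing at h; strict division by X - h bounds the quotient, one of whose
    coefficients is x up to lat. *)
Theorem strict_covering (H : npoly T k) : nevk H != 0 ->
  exists c : K, [/\ c != 0, pf_abs c <= 1 & forall x,
  adjoin lat [set nevk H] x -> adjoin lat [set (nevk H)^-1] x -> lat (fr (kst A c) * x)].
Proof.
move=> h0; have [c [c0 c1 key]] := strict_division H; exists c; split=> // x.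
set h := nevk H in h0 key *.
move=> /(adjoin_poly lat_subring) [s [hs es]] /(adjoin_poly lat_subring) [t [ht et]].
have [_ _ latM] := lat_subring.
pose e := size t.
pose tr : {poly L} := \sum_(j < e) t`_j *: 'X^(e - j).
have trh : tr.[h] = h ^+ e * x.
  rewrite /tr horner_sum et (@horner_coef_wide _ e) // mulr_sumr; apply: eq_bigr => j _.
  rewrite hornerZ hornerXn mulrCA; congr (_ * _); rewrite exprVn.
  have -> : h ^+ e = h ^+ (e - j) * h ^+ j by rewrite -exprD subnK // ltnW.
  by rewrite mulfK // expf_neq0.
have tri i : tr`_i = if (0 < i <= e)%N then t`_(e - i) else 0.
  rewrite coef_sum; case: ifP => hi.
    have ie : (e - i < e)%N by move: hi; case: (e) => [|e']; lia.
    rewrite (bigD1 (Ordinal ie)) //= coefZ coefXn; have -> : (i == e - (e - i))%N by lia.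
    rewrite mulr1 big1 ?addr0 // => j jn; rewrite coefZ coefXn.
    have -> : (i == e - j)%N = false; last by rewrite mulr0.
    by apply/negP => /eqP ij; case/eqP: jn; apply/val_inj => /=; have := ltn_ord j; lia.
  rewrite big1 // => j _; rewrite coefZ coefXn.
  have -> : (i == e - j)%N = false by have := ltn_ord j; lia.
  by rewrite mulr0.
have r1 : root (s - x%:P) h by rewrite /root hornerD hornerN hornerC -es subrr.
have r2 : root (x *: 'X^e - tr) h by rewrite /root hornerD hornerN hornerZ hornerXn trh mulrC subrr.
have [S eS] := factor_theorem _ _ r1; have [Q eQ] := factor_theorem _ _ r2.
(* s and tr / X^e both represent x at X = h; the quotient V of X^e s - tr by X - h
   has x - t_0 as a coefficient *)
pose V := 'X^e * S + Q.
have FV : ('X - h%:P) * V = 'X^e * s - tr.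
  rewrite mulrDr [_ * Q]mulrC -eQ mulrCA [_ * S]mulrC -eS mulrBr [_ * x%:P]mulrC mul_polyC.
  by rewrite addrA subrK.
have latF i : lat ((('X - h%:P) * V)`_i).
  rewrite FV coefB coefXnM tri; case: lat_subring => _ latB _; apply: latB.
    by case: ifP => _; [exact: (subring0 lat_subring) | exact: hs].
  by case: ifP => _; [exact: ht | exact: (subring0 lat_subring)].
have FE j : (('X - h%:P) * V)`_j = (if j is j'.+1 then V`_j' else 0) - h * V`_j.
  by rewrite mulrBl coefB coefCM coefXM; case: j.
pose LD : set L := [set y | exists N d, y = fr N / phi g ^+ d].
have pg0 : phi g != 0 by rewrite -(rmorph0 phi) (inj_eq phi_inj).
have LDs : subring_set LD.
  split; first by exists 1, 0%N; rewrite rmorph1 expr0 divr1.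
  - move=> _ _ [N [d ->]] [N' [d' ->]].
    exists (N * level m g ^+ d' - N' * level m g ^+ d), (d + d')%N.
    rewrite rmorphB !rmorphM !rmorphXn exprD -[fr (level m g)]/(phi g).
    by field; rewrite !expf_neq0.
  - move=> _ _ [N [d ->]] [N' [d' ->]]; exists (N * N'), (d + d')%N.
    by rewrite rmorphM exprD; field; rewrite !expf_neq0.
have latLD y : lat y -> LD y.
  move: y; apply: adjoin_sub => //; first by move=> _ [a _ <-]; exists a, 0%N; rewrite expr0 divr1.
  by move=> _ [l _ <-]; exists (level m (f l)), 1%N; rewrite expr1.
have hLD : LD h.
  by rewrite /h; have [t' [d' ->]] := nev_frac phi_inj g0 fu H; exists (level m t'), d'.
(* from the top down, each coefficient of V is determined by the next one *)
have VLD i : LD V`_i.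
  have [j hj] : exists j, (size V <= i + j)%N by exists (size V); rewrite leq_addl.
  elim: j i hj => [|j ih] i hj.
    by rewrite nth_default; [exact: (subring0 LDs) | rewrite addn0 in hj].
  have -> : V`_i = (('X - h%:P) * V)`_i.+1 + h * V`_i.+1 by rewrite FE subrK.
  apply: (subringD LDs); first exact: latLD.
  by case: LDs => _ _; apply=> //; apply: ih; rewrite addSnnS.
have latV := key V VLD latF.
have [e0|ep] := posnP e.
  have -> : x = 0 by rewrite et; have -> : t = 0 by [apply/eqP; rewrite -size_poly_eq0 -/e e0]; rewrite horner0.
  by rewrite mulr0; exact: (subring0 lat_subring).
have sQ : (size Q <= e)%N.
  have [->|Q0] := eqVneq Q 0; first by rewrite size_poly0.
  have : (size (Q * ('X - h%:P) : {poly L})%R <= e.+1)%N.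
    rewrite -eQ; apply/leq_sizeP => i hi; rewrite coefB coefZ coefXn tri.
    rewrite (gtn_eqF hi).
    by rewrite mulr0 sub0r [(i <= e)%N]leqNgt hi andbF oppr0.
  by rewrite size_Mmonic ?monicXsubC // size_XsubC addn2.
have eV : V`_e.-1 = x - t`_0.
  have -> : V`_e.-1 = Q`_e.-1 by rewrite /V coefD coefXnM prednK // leqnn add0r.
  have h1 : (x *: 'X^e - tr)`_e = Q`_e.-1.
    rewrite eQ mulrBr coefB coefMX coefMC [Q`_e]nth_default // mul0r subr0.
    by have -> : (e == 0)%N = false by lia.
  rewrite -h1 coefB coefZ coefXn eqxx mulr1 tri subnn.
  by have -> : (0 < e <= e)%N by lia.
have latc : lat (fr (kst A c)) by apply: adjoin_base; exists (kst A c); rewrite //= nm_kst.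
have := latV e.-1; rewrite eV => h1.
have -> : fr (kst A c) * x = fr (kst A c) * (x - t`_0) + fr (kst A c) * t`_0 by ring.
by apply: (subringD lat_subring) => //; apply: latM.
Qed.
End Lift.

(** * Complete adic rings and factorization of matrices *)

Section Uniformizer.
Variables (R : realType) (p : nat) (K : perfectoidField R p).
Fact topnil_ex : exists c : K, [/\ c != 0, pf_abs c <= 1 & pf_abs c <= 2^-1].
Proof. by apply: pf_small; rewrite invr_gt0. Qed.
Definition topnil : K := projT1 (cid topnil_ex).
Lemma topnil0 : topnil != 0. Proof. by rewrite /topnil; case: cid => c []. Qed.
Lemma topnil_half : pf_abs topnil <= 2^-1. Proof. by rewrite /topnil; case: cid => c []. Qed.
Lemma topnil_le k : pf_abs (topnil ^+ k) <= (2 ^+ k)^-1.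
Proof. by rewrite pf_absX -exprVn lerXn2r ?nnegrE ?pf_abs_ge0 ?invr_ge0 // topnil_half. Qed.
Lemma topnil_le1 k : pf_abs (topnil ^+ k) <= 1.
Proof. by apply: le_trans (topnil_le k) _; exact: half_pow_le1. Qed.
Lemma topnilX0 k : topnil ^+ k != 0. Proof. by rewrite expf_neq0 // topnil0. Qed.
Lemma topnil_small (e : R) : 0 < e -> exists k, pf_abs (topnil ^+ k) <= e.
Proof. by move=> /half_small [k hk]; exists k; exact: le_trans (topnil_le k) hk. Qed.
End Uniformizer.
Arguments topnil {R p} K.

(** A topological ring is recorded by a ring of definition ao for which the powers of a
    topologically nilpotent unit of K define the topology; completeness means that power
    series in this unit converge. The zero ring is allowed, since the rational subset
    may be empty. *)
Record adic (R : realType) (p : nat) (K : perfectoidField R p) := Adic {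
  aq :> comPzRingType;
  ao : set aq;
  ak : {rmorphism K -> aq};
  ao1 : ao 1;
  aoB : forall x y, ao x -> ao y -> ao (x - y);
  aoM : forall x y, ao x -> ao y -> ao (x * y);
  ao_ak : forall c, pf_abs c <= 1 -> ao (ak c);
  ao_absorb : forall x, exists k, ao (ak (topnil K ^+ k) * x);
  ao_sep : forall x, (forall k, exists z, ao z /\ x = ak (topnil K ^+ k) * z) -> x = 0;
  ao_complete : forall y : nat -> aq, (forall k, ao (y k)) -> exists s, forall N,
    exists z, ao z /\ s - \sum_(k < N) ak (topnil K ^+ k) * y k = ak (topnil K ^+ N) * z }.

Section AdicRing.
Variables (R : realType) (p : nat) (K : perfectoidField R p).
Section Levels.
Variable Q : adic K.
Implicit Types x y z : Q.
Local Notation w := (topnil K).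

Definition lev k x := exists z, ao z /\ x = ak Q (w ^+ k) * z.

Lemma ao0 : ao (0 : Q). Proof. by rewrite -(subrr 1); apply: aoB; exact: ao1. Qed.
Lemma aoN x : ao x -> ao (- x). Proof. by rewrite -sub0r; apply: aoB; exact: ao0. Qed.
Lemma aoD x y : ao x -> ao y -> ao (x + y).
Proof. by move=> hx hy; rewrite -[y]opprK; apply: aoB => //; exact: aoN. Qed.
Lemma aoX x k : ao x -> ao (x ^+ k).
Proof. by move=> h; elim: k => [|k ih]; rewrite ?expr0 ?exprS; [exact: ao1 | exact: aoM]. Qed.
Lemma ao_sum (I : eqType) (s : seq I) (F : I -> Q) : (forall i, i \in s -> ao (F i)) ->
  ao (\sum_(i <- s) F i).
Proof. by move=> h; rewrite big_seq; elim/big_ind: _ => //; [exact: ao0 | exact: aoD]. Qed.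

Lemma akV k : ak Q (w ^- k) * ak Q (w ^+ k) = 1.
Proof. by rewrite -rmorphM mulVf ?rmorph1 // topnilX0. Qed.
Lemma levE k x : lev k x <-> ao (ak Q (w ^- k) * x).
Proof.
split=> [[z [hz ->]]|h]; first by rewrite mulrA akV mul1r.
by exists (ak Q (w ^- k) * x); rewrite mulrA [ak _ _ * ak _ _]mulrC akV mul1r.
Qed.
Lemma lev0E x : lev 0 x <-> ao x.
Proof. by rewrite levE expr0 invr1 rmorph1 mul1r. Qed.
Lemma lev_zero k : lev k 0. Proof. by apply/levE; rewrite mulr0; exact: ao0. Qed.
Lemma levB k x y : lev k x -> lev k y -> lev k (x - y).
Proof. by rewrite !levE mulrBr; exact: aoB. Qed.
Lemma levD k x y : lev k x -> lev k y -> lev k (x + y).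
Proof. by rewrite !levE mulrDr; exact: aoD. Qed.
Lemma levN k x : lev k x -> lev k (- x). Proof. by rewrite !levE mulrN; exact: aoN. Qed.
Lemma levM i j x y : lev i x -> lev j y -> lev (i + j) (x * y).
Proof.
by move=> [z [hz ->]] [t [ht ->]]; exists (z * t); rewrite exprD rmorphM mulrACA; split=> //; exact: aoM.
Qed.
Lemma lev_mull k x y : ao x -> lev k y -> lev k (x * y).
Proof. by move=> /lev0E hx hy; have := levM hx hy. Qed.
Lemma lev_decr i j x : (i <= j)%N -> lev j x -> lev i x.
Proof.
move=> ij [z [hz ->]]; exists (ak Q (w ^+ (j - i)) * z); split.
  by apply: aoM => //; apply: ao_ak; exact: topnil_le1.
by rewrite mulrA -rmorphM -exprD subnKC.
Qed.
Lemma lev_ao k x : lev k x -> ao x. Proof. by move=> /(lev_decr (leq0n k))/lev0E. Qed.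
Lemma lev_sep x : (forall k, lev k x) -> x = 0. Proof. exact: ao_sep. Qed.
Lemma lev_shift i k x : ao (ak Q (w ^+ i) * x) -> forall y, lev (k + i) y -> lev k (x * y).
Proof.
move=> hx y [z [hz ->]]; exists (ak Q (w ^+ i) * x * z); split; first exact: aoM.
by rewrite exprD rmorphM; ring.
Qed.
Lemma absorb_mono i j x : (i <= j)%N -> ao (ak Q (w ^+ i) * x) -> ao (ak Q (w ^+ j) * x).
Proof.
move=> ij h; rewrite -(subnK ij) exprD rmorphM -mulrA; apply: aoM => //.
by apply: ao_ak; exact: topnil_le1.
Qed.
Lemma lev_absorb x : exists j, forall k y, lev (k + j) y -> lev k (x * y).
Proof. by have [j hj] := ao_absorb x; exists j => k; exact: lev_shift. Qed.

Lemma lev_limit (u : nat -> Q) : (forall k, lev k (u k.+1 - u k)) ->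
  exists s, forall k, lev k (s - u k).
Proof.
move=> h; have [y hy] := choice h.
have [|s hs] := ao_complete (y := y); first by move=> k; have [] := hy k.
exists (s + u 0%N) => k; have [z [hz e]] := hs k; exists z; split=> //; rewrite -e.
have -> : u k = u 0%N + \sum_(i < k) ak Q (w ^+ i) * y i.
  elim: k {z hz e} => [|k ih]; first by rewrite big_ord0 addr0.
  by rewrite big_ord_recr /= addrA -ih -(hy k).2 addrC subrK.
by rewrite opprD addrA addrK.
Qed.

(** The geometric series. *)
Lemma lev1_unit x : lev 1 (x - 1) -> exists2 y, ao y & x * y = 1.
Proof.
move=> h; have {h}[z [hz e]] := levN h; rewrite opprB in e.
pose u k := \sum_(i < k) (1 - x) ^+ i.
have lx k : lev k ((1 - x) ^+ k).
  exists (z ^+ k); split; first exact: aoX.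
  by rewrite e exprMn expr1 rmorphXn.
have [|s hs] := lev_limit (u := u); first by move=> k; rewrite /u big_ord_recr addrC addKr.
exists s; first by apply/lev0E; have := hs 0%N; rewrite /u big_ord0 subr0.
apply/eqP; rewrite -subr_eq0; apply/eqP/lev_sep => k.
have xo : ao x.
  by rewrite -[x](subKr 1) e; apply: aoB; [exact: ao1 | apply: aoM => //; apply: ao_ak; exact: topnil_le1].
have geo : x * u k = 1 - (1 - x) ^+ k.
  rewrite /u; elim: (k) => [|j ih]; first by rewrite big_ord0 mulr0 expr0 subrr.
  by rewrite big_ord_recr mulrDr ih /= exprS; ring.
have -> : x * s - 1 = x * (s - u k) - (1 - x) ^+ k by rewrite mulrBr geo; ring.
by apply: levB => //; exact: lev_mull.
Qed.

Definition levmx k m n (M : 'M[Q]_(m, n)) := forall i j, lev k (M i j).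

Lemma levmxB k m n (M N : 'M[Q]_(m, n)) : levmx k M -> levmx k N -> levmx k (M - N).
Proof. by move=> h h' i j; rewrite !mxE; exact: levB. Qed.
Lemma levmxD k m n (M N : 'M[Q]_(m, n)) : levmx k M -> levmx k N -> levmx k (M + N).
Proof. by move=> h h' i j; rewrite !mxE; exact: levD. Qed.
Lemma levmxN k m n (M : 'M[Q]_(m, n)) : levmx k M -> levmx k (- M).
Proof. by move=> h i j; rewrite !mxE; exact: levN. Qed.
Lemma levmxM i j m n r (M : 'M[Q]_(m, n)) (N : 'M[Q]_(n, r)) : levmx i M -> levmx j N ->
  levmx (i + j) (M *m N).
Proof.
move=> h h' a b; rewrite mxE; elim/big_ind: _ => [|x y|l _]; [exact: lev_zero | exact: levD |].
exact: levM.
Qed.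
Lemma levmx_sep m n (M : 'M[Q]_(m, n)) : (forall k, levmx k M) -> M = 0.
Proof. by move=> h; apply/matrixP => i j; rewrite [RHS]mxE; apply: lev_sep => k; exact: h. Qed.
Lemma levmx_decr i j m n (M : 'M[Q]_(m, n)) : (i <= j)%N -> levmx j M -> levmx i M.
Proof. by move=> ij h a b; exact: lev_decr ij (h a b). Qed.
Lemma levmx_bound m n (M : 'M[Q]_(m, n)) : exists c, forall i j, ao (ak Q (w ^+ c) * M i j).
Proof.
have [c hc] := choice (fun ij : 'I_m * 'I_n => ao_absorb (M ij.1 ij.2)).
exists (\max_ij c ij) => i j; apply: absorb_mono (hc (i, j)).
exact: (leq_bigmax (i, j)).
Qed.
Lemma levmx_absorb m n (M : 'M[Q]_(m, n)) : exists c,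
  (forall k r (N : 'M[Q]_(n, r)), levmx (k + c) N -> levmx k (M *m N)) /\
  (forall k r (N : 'M[Q]_(r, m)), levmx (k + c) N -> levmx k (N *m M)).
Proof.
have [c hc] := levmx_bound M; exists c; split=> k r N h i j; rewrite mxE;
  elim/big_ind: _ => [|x y|l _]; try exact: lev_zero; try exact: levD.
- by apply: lev_shift (hc i l) _ _.
- by rewrite mulrC; apply: lev_shift (hc l j) _ _.
Qed.
Lemma levmx_limit m n (u : nat -> 'M[Q]_(m, n)) : (forall k, levmx k (u k.+1 - u k)) ->
  exists s, forall k, levmx k (s - u k).
Proof.
move=> h; have ex (ij : 'I_m * 'I_n) : exists s, forall k, lev k (s - u k ij.1 ij.2).
  by apply: lev_limit => k; have := h k ij.1 ij.2; rewrite !mxE.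
have [s hs] := choice ex; exists (\matrix_(i, j) s (i, j)) => k i j; rewrite !mxE.
exact: (hs (i, j) k).
Qed.

Lemma levmx_inv n (M : 'M[Q]_n) : levmx 1 (M - 1%:M) -> exists M', M *m M' = 1%:M.
Proof.
move=> h; have oM i j : ao (M i j).
  have := lev_ao (h i j); rewrite !mxE => h1; rewrite -(subrK (i == j)%:R (M i j)).
  by apply: aoD h1 _; case: eqP => _; [exact: ao1 | exact: ao0].
have [|y _ hy] := @lev1_unit (\det M).
  have P := @det_close Q (@ao _ _ _ Q) (lev 1).
  have e1 : \det (1%:M : 'M[Q]_n) = 1 by rewrite det1.
  rewrite -e1; apply: (P _ _ _ _ _ _ n M 1%:M) => //.
  - exact: ao1. - exact: aoM. - exact: aoN. - exact: lev_zero. - exact: levD. - exact: lev_mull.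
  - by move=> i j; rewrite mxE; case: eqP => _; [exact: ao1 | exact: ao0].
  - by move=> i j; have := h i j; rewrite !mxE.
exists (y *: \adj M); rewrite -scalemxAr mul_mx_adj scale_scalar_mx mulrC hy.
by [].
Qed.
End Levels.

Section Cartan.
Variables (Q1 Q2 Q12 : adic K) (r1 : {rmorphism Q1 -> Q12}) (r2 : {rmorphism Q2 -> Q12}).
Hypotheses (r1_lev : forall k x, lev k x -> lev k (r1 x)) (r2_lev : forall k x, lev k x -> lev k (r2 x)).
Hypothesis splitting : forall z, ao z -> exists z1 z2, [/\ ao z1, ao z2 & z = r1 z1 + r2 z2].
Hypothesis r12_ak : forall c, r1 (ak Q1 c) = ak Q12 c /\ r2 (ak Q2 c) = ak Q12 c.
Hypothesis dense2 : forall z k, exists y, lev k (z - r2 y).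

(** The equation u1 (1 + d) = u2 is linear in (u1, u2): starting from u1 = u2 = 1, the
    additive splitting of the defect multiplies it by d. *)
Lemma cartan_near N (d : 'M[Q12]_N) : levmx 1 d -> exists (u1 u1' : 'M_N) (u2 u2' : 'M_N),
  [/\ u1 *m u1' = 1%:M, u2 *m u2' = 1%:M & map_mx r1 u1 *m (1%:M + d) = map_mx r2 u2].
Proof.
move=> hd; have ex (kz : nat * Q12) : exists q : Q1 * Q2, lev kz.1 kz.2 ->
    [/\ lev kz.1 q.1, lev kz.1 q.2 & kz.2 = r1 q.1 + r2 q.2].
  have [[y [hy ->]]|h] := pselect (lev kz.1 kz.2); last by exists (0, 0).
  have [z1 [z2 [h1 h2 ->]]] := splitting hy; set k := kz.1.
  exists (ak Q1 (topnil K ^+ k) * z1, ak Q2 (topnil K ^+ k) * z2) => _ /=.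
  split; [by exists z1 | by exists z2 |].
  by rewrite !rmorphM (r12_ak _).1 (r12_ak _).2 mulrDr.
have [q hq] := choice ex.
pose E := fix E k : 'M[Q12]_N := if k is k'.+1 then
  - (map_mx r1 (map_mx (fun z => (q (k'.+1, z)).1) (E k')) *m d) else d.
pose Z1 k := map_mx (fun z => (q (k.+1, z)).1) (E k).
pose Z2 k := map_mx (fun z => (q (k.+1, z)).2) (E k).
have lE k : levmx k.+1 (E k).
  elim: k => [|k ih] //=; apply: levmxN; rewrite -(addn1 k.+1); apply: levmxM => // i j.
  by rewrite !mxE; apply: r1_lev; have [] := hq (k.+1, E k i j) (ih i j).
have lZ1 k : levmx k.+1 (Z1 k) by move=> i j; rewrite mxE; have [] := hq (k.+1, E k i j) (lE k i j).
have lZ2 k : levmx k.+1 (Z2 k) by move=> i j; rewrite mxE; have [] := hq (k.+1, E k i j) (lE k i j).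
have eE k : E k = map_mx r1 (Z1 k) + map_mx r2 (Z2 k).
  by apply/matrixP => i j; rewrite !mxE; have [_ _ <-] := hq (k.+1, E k i j) (lE k i j).
pose X1 k := - \sum_(i < k) Z1 i; pose X2 k := \sum_(i < k) Z2 i.
(* F A B is the defect of the pair (1 + A, 1 + B) *)
pose F A B := d + map_mx r1 A + map_mx r1 A *m d - map_mx r2 B.
have FE k : F (X1 k) (X2 k) = E k.
  elim: k => [|k ih]; first by rewrite /F /X1 /X2 !big_ord0 oppr0 !map_mx0 mul0mx !addr0 subr0.
  have gen (s a b sd ad s2 : 'M[Q12]_N) : d - s - sd - s2 = a + b ->
      d + (- s - a) + (- sd - ad) - (s2 + b) = - ad.
    move=> h; apply/matrixP => i j; have := congr1 (fun M : 'M_N => M i j) h.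
    by rewrite /= !mxE => h0; apply: (addIr (a i j + b i j)); rewrite -[in RHS]h0; ring.
  rewrite /F /X1 /X2 !big_ord_recr opprD !map_mxD !map_mxN mulmxDl !mulNmx.
  by apply: gen; have := ih; rewrite /F /X1 /X2 eE !map_mxN mulNmx.
have [|S1 hS1] := levmx_limit (u := X1).
  by move=> k; rewrite /X1 big_ord_recr opprD addrC addKr; apply/levmxN/(levmx_decr (leqnSn k)).
have [|S2 hS2] := levmx_limit (u := X2).
  by move=> k; rewrite /X2 big_ord_recr addrC addKr; apply: (levmx_decr (leqnSn k)).
have F0 : F S1 S2 = 0.
  apply: levmx_sep => k.
  have -> : F S1 S2 = E k + map_mx r1 (S1 - X1 k) + map_mx r1 (S1 - X1 k) *m d - map_mx r2 (S2 - X2 k).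
    rewrite -FE /F !map_mxB mulmxBl; apply/matrixP => i j; rewrite !mxE.
    set b1 := \sum_j0 _; set b2 := \sum_j0 _; ring.
  have l1 : levmx k (map_mx r1 (S1 - X1 k)) by move=> i j; rewrite mxE; apply: r1_lev; exact: hS1.
  have l2 : levmx k (map_mx r2 (S2 - X2 k)) by move=> i j; rewrite mxE; apply: r2_lev; exact: hS2.
  apply: levmxB l2; apply: levmxD; last by apply: (levmx_decr (leq_addr 1 k)); exact: levmxM l1 hd.
  by apply: levmxD l1; apply: levmx_decr (lE k).
have one (Q : adic K) (S : 'M[Q]_N) : levmx 1 S -> exists M', (1%:M + S) *m M' = 1%:M.
  by move=> h; apply: levmx_inv; rewrite addrC addKr.
have [|u1' e1] := one _ S1.
  rewrite -(subrK (X1 1%N) S1); apply: levmxD; first exact: hS1.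
  by rewrite /X1 big_ord1; apply: levmxN; exact: lZ1.
have [|u2' e2] := one _ S2.
  rewrite -(subrK (X2 1%N) S2); apply: levmxD; first exact: hS2.
  by rewrite /X2 big_ord1; exact: lZ2.
exists (1%:M + S1), u1', (1%:M + S2), u2'; split=> //.
rewrite !map_mxD !map_mx1 mulmxDl mul1mx mulmxDr mulmx1 -addrA; congr (_ + _).
by apply/eqP; rewrite -subr_eq0 addrA; apply/eqP.
Qed.

(** Approximation from one side reduces the factorization to matrices close to 1, to
    which the iteration applies. *)
Definition approximable N (G Gi : 'M[Q12]_N) := G *m Gi = 1%:M /\ forall k, exists G' Gi',
  [/\ G' *m Gi' = 1%:M, levmx k (G - map_mx r2 G') & levmx k (Gi - map_mx r2 Gi')].

Lemma approximable_mul N (G Gi H Hi : 'M[Q12]_N) : approximable G Gi -> approximable H Hi ->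
  approximable (G *m H) (Hi *m Gi).
Proof.
move=> [eG aG] [eH aH]; split; first by rewrite !mulmxA -[G *m H *m Hi]mulmxA eH mulmx1.
have close (M N' M' N'' : 'M[Q12]_N) : exists c, forall k (A B : 'M[Q12]_N),
    levmx (k + c) (M - A) -> levmx (k + c) (N' - B) -> levmx k (M *m N' - A *m B).
  have [c1 [_ h1]] := levmx_absorb N'; have [c2 [h2 _]] := levmx_absorb M.
  exists (c1 + c2)%N => k A B hA hB.
  have -> : M *m N' - A *m B = (M - A) *m N' + M *m (N' - B) - (M - A) *m (N' - B).
    rewrite !mulmxBl !mulmxBr.
    move: (M *m N') (A *m B) (A *m N') (M *m B) => e1 e2 e3 e4.
    by apply/matrixP => i j; rewrite !mxE; ring.
  apply: levmxB; first apply: levmxD.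
  - by apply: h1; apply: levmx_decr hA; lia.
  - by apply: h2; apply: levmx_decr hB; lia.
  - by apply: (levmx_decr (leq_addr (k + (c1 + c2)) k)); apply: levmxM => //; apply: levmx_decr hA; lia.
have [c1 h1] := close G H G H; have [c2 h2] := close Hi Gi Hi Gi => k.
have [G' [Gi' [e1 g1 g2]]] := aG (k + (c1 + c2))%N.
have [H' [Hi' [e2 g3 g4]]] := aH (k + (c1 + c2))%N.
exists (G' *m H'), (Hi' *m Gi'); split; first by rewrite !mulmxA -[G' *m H' *m Hi']mulmxA e2 mulmx1.
- by rewrite map_mxM; apply: h1; [apply: levmx_decr g1 | apply: levmx_decr g3]; lia.
- by rewrite map_mxM; apply: h2; [apply: levmx_decr g4 | apply: levmx_decr g2]; lia.
Qed.

(** Elementary matrices are linear in their entry, so density of the entries suffices;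
    the same holds for lower ones and for products. *)
Lemma approximable_upper N1 N2 (b : 'M[Q12]_(N1, N2)) :
  approximable (block_mx 1%:M b 0 1%:M) (block_mx 1%:M (- b) 0 1%:M).
Proof.
have mulE (Q : comPzRingType) (x y : 'M[Q]_(N1, N2)) :
    block_mx 1%:M x 0 1%:M *m block_mx 1%:M y 0 1%:M = block_mx 1%:M (x + y) 0 1%:M.
  by rewrite mulmx_block !mul1mx !mulmx1 !mulmx0 !mul0mx !addr0 !add0r addrC.
split=> [|k]; first by rewrite mulE subrr -scalar_mx_block.
have [y hy] := choice (fun ij : 'I_N1 * 'I_N2 => dense2 (b ij.1 ij.2) k).
pose b' : 'M[Q2]_(N1, N2) := \matrix_(i, j) y (i, j).
have hb : levmx k (b - map_mx r2 b') by move=> i j; rewrite !mxE; exact: (hy (i, j)).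
have bl (x y' : 'M[Q12]_(N1, N2)) : levmx k (x - y') ->
    levmx k (block_mx 1%:M x 0 1%:M - block_mx 1%:M y' 0 1%:M).
  move=> h; rewrite opp_block_mx add_block_mx !subrr => i j.
  case: (split_ordP i) => i' ->; case: (split_ordP j) => j' ->;
    rewrite ?(block_mxEul, block_mxEur, block_mxEdl, block_mxEdr) ?mxE; try exact: lev_zero.
  by have := h i' j'; rewrite !mxE.
exists (block_mx 1%:M b' 0 1%:M), (block_mx 1%:M (- b') 0 1%:M); split.
- by rewrite mulE subrr -scalar_mx_block.
- by rewrite map_block_mx !map_mx1 map_mx0; exact: bl.
- rewrite map_block_mx !map_mx1 map_mx0 map_mxN; apply: bl; rewrite -opprD; exact: levmxN.
Qed.

Lemma approximable_lower N1 N2 (b : 'M[Q12]_(N2, N1)) :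
  approximable (block_mx 1%:M 0 b 1%:M) (block_mx 1%:M 0 (- b) 1%:M).
Proof.
have mulE (Q : comPzRingType) (x y : 'M[Q]_(N2, N1)) :
    block_mx 1%:M 0 x 1%:M *m block_mx 1%:M 0 y 1%:M = block_mx 1%:M 0 (x + y) 1%:M.
  by rewrite mulmx_block !mul1mx !mulmx1 !mulmx0 !mul0mx !addr0 !add0r.
split=> [|k]; first by rewrite mulE subrr -scalar_mx_block.
have [y hy] := choice (fun ij : 'I_N2 * 'I_N1 => dense2 (b ij.1 ij.2) k).
pose b' : 'M[Q2]_(N2, N1) := \matrix_(i, j) y (i, j).
have hb : levmx k (b - map_mx r2 b') by move=> i j; rewrite !mxE; exact: (hy (i, j)).
have bl (x y' : 'M[Q12]_(N2, N1)) : levmx k (x - y') ->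
    levmx k (block_mx 1%:M 0 x 1%:M - block_mx 1%:M 0 y' 1%:M).
  move=> h; rewrite opp_block_mx add_block_mx !subrr => i j.
  case: (split_ordP i) => i' ->; case: (split_ordP j) => j' ->;
    rewrite ?(block_mxEul, block_mxEur, block_mxEdl, block_mxEdr) ?mxE; try exact: lev_zero.
  by have := h i' j'; rewrite !mxE.
exists (block_mx 1%:M 0 b' 1%:M), (block_mx 1%:M 0 (- b') 1%:M); split.
- by rewrite mulE subrr -scalar_mx_block.
- by rewrite map_block_mx !map_mx1 map_mx0; exact: bl.
- rewrite map_block_mx !map_mx1 map_mx0 map_mxN; apply: bl; rewrite -opprD; exact: levmxN.
Qed.

(** An approximation G' coming from Q2 is moved to the other side: the inverse of G
    times G' is close to 1. *)
Lemma cartan N (G Gi : 'M[Q12]_N) : approximable G Gi -> exists (v1 v1' : 'M_N) (v2 v2' : 'M_N),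
  [/\ v1 *m v1' = 1%:M, v2 *m v2' = 1%:M & map_mx r1 v1 = map_mx r2 v2 *m G].
Proof.
move=> [eG aG]; have [c [hc _]] := levmx_absorb Gi.
have [G' [Gi' [e1 g1 g2]]] := aG (1 + c)%N.
pose d := Gi *m (map_mx r2 G' - G).
have ld : levmx 1 d by apply: hc; rewrite -opprB; exact: levmxN.
have [u1 [u1' [u2 [u2' [h1 h2 h3]]]]] := cartan_near ld.
exists u1, u1', (u2 *m Gi'), (G' *m u2'); split=> //.
  by rewrite !mulmxA -[u2 *m Gi' *m G']mulmxA (mulmx1C e1) mulmx1.
have e : 1%:M + d = Gi *m map_mx r2 G'.
  by rewrite /d mulmxBr (mulmx1C eG) addrC subrK.
rewrite e in h3; rewrite map_mxM -h3 !mulmxA -[_ *m map_mx r2 G' *m _]mulmxA -map_mxM e1 map_mx1.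
by rewrite mulmx1 -mulmxA (mulmx1C eG) mulmx1.
Qed.
End Cartan.
End AdicRing.

(** * Points of the perfectoid disk *)

Section Points.
Variables (R : realType) (p : nat) (K : perfectoidField R p) (n : nat).
Local Notation A := (PT K n).
Local Notation X := (perfDisk K n).
Implicit Types (a b c : A).

Lemma gauss_normE a : gauss_norm (a : perfTate K n) = nm a.
Proof.
have ub : ubound (range (fun al => pf_abs (tcoef (a : perfTate K n) al))) (nm a).
  by move=> _ [al _ <-]; exact: pcoef_le.
apply/le_anti/andP; split; first by apply: ge_sup ub; exists (pf_abs (tcoef (a : perfTate K n) 0)), 0.
have [al <-] := pcoef_attained a.
by apply: (ub_le_sup (E := range _)); [exists (nm a) | exists al].
Qed.

Lemma tate_intE a : tate_int (a : perfTate K n) <-> nm a <= 1.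
Proof.
split=> [h|h al]; first by apply: nm_coef_le => al; exact: h.
exact: le_trans (pcoef_le a al) h.
Qed.

Definition wA N : A := kst A (topnil K ^+ N).
Lemma wA_le N : nm (wA N) <= 1. Proof. by rewrite nm_kst; exact: topnil_le1. Qed.
Lemma wA0 : wA 0 = 1. Proof. by rewrite /wA expr0 rmorph1. Qed.
Lemma wAD M N : wA (M + N) = wA M * wA N. Proof. by rewrite /wA exprD rmorphM. Qed.
Lemma wA_absorb a : exists M, nm (wA M * a) <= 1.
Proof.
have h0 : 0 < nm a + 1 by rewrite ltr_wpDl ?nm_ge0.
have [|M hM] := @topnil_small _ _ K (nm a + 1)^-1; first by rewrite invr_gt0.
exists M; rewrite nmM nm_kst -(mulVf (lt0r_neq0 h0)); apply: ler_pM; rewrite ?pf_abs_ge0 ?nm_ge0 //.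
by rewrite lerDl.
Qed.
Lemma wA_div N a : nm a <= pf_abs (topnil K ^+ N) -> exists2 z, nm z <= 1 & a = wA N * z.
Proof.
move=> h; exists (kst A (topnil K ^- N) * a); last first.
  by rewrite mulrA -rmorphM mulfV ?topnilX0 // rmorph1 mul1r.
rewrite nmM nm_kst pf_absV mulrC ler_pdivrMr ?mul1r // pf_abs_gt0 //; exact: topnilX0.
Qed.

(** Limits of points along an ultrafilter and the valuations of Chevalley are of this
    kind; continuity is restored afterwards by the retraction. *)
Record preval (le : A -> A -> Prop) : Prop := Preval {
  pv_total : forall a b, le a b \/ le b a;
  pv_trans : forall b a c, le a b -> le b c -> le a c;
  pv_mul : forall a b c, le a b -> le (a * c) (b * c);
  pv_cancel : forall a b c, ~ le c 0 -> le (a * c) (b * c) -> le a b;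
  pv_add : forall a b c, le a c -> le b c -> le (a + b) c;
  pv_one : ~ le 1 0;
  pv_int : forall a, nm a <= 1 -> le a 1 }.

Lemma point_preval (x : X) : preval (val_le x).
Proof.
split.
- exact: val_total.
- exact: val_trans.
- exact: val_mul.
- exact: val_cancel.
- exact: val_add.
- exact: val_one.
- by move=> a h; apply: val_integral; exact/tate_intE.
Qed.

Section Preval.
Variable le : A -> A -> Prop.
Hypothesis pv : preval le.

Lemma pv_refl a : le a a. Proof. by have [] := pv_total pv a a. Qed.
Lemma pv_mull a b c : le a b -> le (c * a) (c * b).
Proof. by rewrite ![c * _]mulrC; exact: pv_mul. Qed.
Lemma pv_intl a b : nm a <= 1 -> le (a * b) b.
Proof. by move=> h; have := pv_mul pv b (pv_int pv h); rewrite mul1r. Qed.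
Lemma pv_wA N : ~ le (wA N) 0.
Proof.
move=> h; apply: (pv_one pv); have := pv_mul pv (kst A (topnil K ^- N)) h.
by rewrite mul0r -rmorphM mulfV ?topnilX0 // rmorph1.
Qed.
Lemma pv_wA_decr M N : (M <= N)%N -> le (wA N) (wA M).
Proof. by move=> h; rewrite -(subnK h) wAD; apply: pv_intl; exact: wA_le. Qed.
Lemma pv_mul2 a b c d : le a b -> le c d -> le (a * c) (b * d).
Proof. by move=> h h'; apply: (pv_trans pv (b := b * c)); [exact: pv_mul | exact: pv_mull]. Qed.
Lemma pv_0 a b : ~ le a 0 -> le a b -> ~ le b 0.
Proof. by move=> h ab b0; apply: h; exact: (pv_trans pv ab). Qed.

(** The unit relation bounds the maximum of the f i from below. *)
Lemma unit_bound k (f u : 'I_k -> A) : \sum_i u i * f i = 1 -> exists M, forall (le' : A -> A -> Prop) g,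
  preval le' -> (forall i, le' (f i) g) -> le' (wA M) g.
Proof.
move=> e; have [M hM] := choice (fun i => wA_absorb (u i)).
exists (\max_i M i) => le' g pv' h.
rewrite -[wA _]mulr1 -e mulr_sumr.
have sum (s : seq 'I_k) (F : 'I_k -> A) : (forall i, le' (F i) g) -> le' (\sum_(i <- s) F i) g.
  move=> hF; elim/big_ind: _ => // [|x y hx hy]; last exact: (pv_add pv').
  by have := pv_mul pv' g (pv_int pv' (_ : nm 0 <= 1)); rewrite mul0r mul1r; apply; rewrite nm0 ler01.
apply: sum => i; rewrite mulrA.
have hi : (M i <= \max_i M i)%N by exact: leq_bigmax.
apply: (pv_trans pv' _ (h i)); have := pv_mul pv' (f i) (pv_int pv' (a := wA (\max_i0 M i0) * u i) _).
rewrite mul1r; apply; rewrite -(subnK hi) wAD -mulrA; apply: nmM_le1; [exact: wA_le | exact: hM].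
Qed.

(** Elements smaller than all powers of the topologically nilpotent unit are collapsed to
    0: this makes a valuation continuous. *)
Definition infinitesimal a := forall N, le a (wA N).
Definition retract a b := le a b \/ infinitesimal a.

Lemma inf_le a b : le b a -> infinitesimal a -> infinitesimal b.
Proof. by move=> h ha N; exact: (pv_trans pv h (ha N)). Qed.
Lemma inf_mul a c : infinitesimal a -> infinitesimal (a * c).
Proof.
move=> h N; have [M hM] := wA_absorb c.
apply: (pv_trans pv (pv_mul pv c (h (N + M)%N))); rewrite wAD -mulrA [wA N * _]mulrC.
exact: pv_intl.
Qed.
Lemma inf_add a b : infinitesimal a -> infinitesimal b -> infinitesimal (a + b).
Proof. by move=> ha hb N; exact: pv_add. Qed.

Hypothesis small : ~ le 1 (wA 1).

Lemma wA_strict N : ~ le (wA N) (wA N.+1).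
Proof.
rewrite -addn1 wAD mulrC -{1}[wA N]mul1r => h; apply: small.
exact: (pv_cancel pv (@pv_wA N) h).
Qed.

Lemma retract_preval : preval retract.
Proof.
split.
- by move=> a b; have [h|h] := pv_total pv a b; [left|right]; left.
- move=> b a c [ab|ia]; last by right.
  by case=> [bc|ib]; [left; exact: (pv_trans pv ab bc) | right; exact: inf_le ib].
- by move=> a b c [ab|ia]; [left; exact: pv_mul | right; exact: inf_mul].
- move=> a b c hc [h|h].
    by left; apply: (pv_cancel pv _ h) => c0; apply: hc; left.
  right => N; have /existsNP [M hM] : ~ infinitesimal c by move=> ic; apply: hc; right.
  have hcM : le (wA M) c by have [] := pv_total pv c (wA M).
  apply: (pv_cancel pv (@pv_wA M)); apply: (pv_trans pv (pv_mull a hcM)).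
  by rewrite -wAD; exact: h.
- move=> a b c ha hb.
  have key a' b' : le a' c -> infinitesimal b' -> retract (a' + b') c.
    move=> ha' ib; have [h|h] := pv_total pv b' c; first by left; exact: pv_add.
    right; apply: inf_add => //; exact: inf_le (pv_trans pv ha' h) ib.
  case: ha hb => [ha|ia] [hb|ib].
  + by left; exact: pv_add.
  + exact: key.
  + by rewrite addrC; exact: key.
  + by right; exact: inf_add.
- case=> [|h]; first exact: pv_one.
  exact: small (h 1%N).
- by move=> a h; left; exact: pv_int.
Qed.

Lemma retract_continuous a b : ~ retract a 0 -> ~ retract b 0 ->
  tate_open [set x : perfTate K n | ~ retract a ((x : A) * b)].
Proof.
move=> ha hb x hx; have pv' := retract_preval.
have /existsNP [M hM] : ~ infinitesimal a by move=> h; apply: ha; right.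
have aM : retract (wA M) a by left; have [] := pv_total pv a (wA M).
have [M' hM'] := wA_absorb b.
exists (pf_abs (topnil K ^+ (M.+1 + M'))); first by rewrite pf_abs_gt0 // topnilX0.
move=> y; rewrite gauss_normE => /ltW /wA_div [z hz e] hy; apply: hx.
have sm : retract (((y : A) - x) * b) (wA M.+1).
  have z1 : nm (wA M' * (z * b)) <= 1 by rewrite mulrCA; exact: nmM_le1.
  by rewrite e wAD -!mulrA; left; have := pv_mull (wA M.+1) (pv_int pv z1); rewrite mulr1.
have ey : (y : A) * b = (x : A) * b + ((y : A) - x) * b by ring.
have [h|h] := pv_total pv' (((y : A) - x) * b) ((x : A) * b).
  apply: (pv_trans pv' hy); rewrite ey; apply: (pv_add pv') => //.
  by left; exact: pv_refl.
exfalso; have : retract (wA M) (wA M.+1).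
  apply: (pv_trans pv' aM); apply: (pv_trans pv' hy); apply: (pv_trans pv' _ sm).
  by rewrite ey; apply: (pv_add pv') => //; left; exact: pv_refl.
case=> [|h']; first exact: wA_strict.
exact: (@wA_strict M (h' M.+1)).
Qed.

Lemma retract_integral a : tate_int (a : perfTate K n) -> retract a 1.
Proof. by move=> /tate_intE h; left; exact: pv_int. Qed.

Definition retract_point : X := PerfDisk (pv_total retract_preval) (pv_trans retract_preval)
  (pv_mul retract_preval) (pv_cancel retract_preval) (pv_add retract_preval)
  (pv_one retract_preval) retract_continuous retract_integral.
End Preval.

(** Continuity of x: elements of small norm have value less than that of a, and some
    power of the topologically nilpotent unit is one of them. *)
Lemma point_arch (x : X) a : ~ val_le x a 0 -> exists N, val_le x (wA N) a.
Proof.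
move=> ha; have pv := point_preval x.
have := @val_continuous _ _ _ _ x a 1 ha (pv_one pv) 0; case.
  by move=> h; apply: ha; move: h; rewrite mul0r.
move=> e e0 h; have [|N hN] := @topnil_small _ _ K (e / 2); first by rewrite divr_gt0.
exists N; have [//|h'] := pv_total pv (wA N) a.
have : ~ val_le x a ((wA N : perfTate K n) * 1).
  apply: h; rewrite subr0 gauss_normE nm_kst; apply: le_lt_trans hN _.
  by rewrite ltr_pdivrMr // ltr_pMr // ltr1n.
by rewrite mulr1.
Qed.

Lemma point_small (x : X) : ~ val_le x 1 (wA 1).
Proof.
have pv := point_preval x.
have := @val_continuous _ _ _ _ x 1 1 (pv_one pv) (pv_one pv) 0; case.
  by rewrite /= mul0r; exact: (pv_one pv).
move=> e e0 h; have [|N hN] := @topnil_small _ _ K (e / 2); first by rewrite divr_gt0.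
have hn : ~ val_le x 1 ((wA N : perfTate K n) * 1).
  apply: h; rewrite subr0 gauss_normE nm_kst; apply: le_lt_trans hN _.
  by rewrite ltr_pdivrMr // ltr_pMr // ltr1n.
move=> h1; apply: hn; rewrite mulr1; elim: N {hN} => [|N ih].
  by rewrite /wA expr0 rmorph1; exact: (pv_refl pv).
by have := pv_mul2 pv ih h1; rewrite mulr1 -wAD addn1.
Qed.

(** ** Quasi-compactness *)

Lemma rat_bound (D : ratDatum K n) : exists M, forall (le : A -> A -> Prop), preval le ->
  (forall i, le (rat_num (r := D) i) (rat_den D)) -> le (wA M) (rat_den D).
Proof.
have [u hu] := rat_unit D; have [M hM] := @unit_bound _ (@rat_num _ _ _ _ D) u hu.
by exists M => le pv h; exact: hM.
Qed.

(** If there were no finite subcover, the limit of the points along an ultrafilter avoiding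
    all finite unions, made continuous by the retraction, would be a point of the rational
    subset outside the cover. *)
Theorem rational_compact (D : ratDatum K n) (I : Type) (V : I -> ratDatum K n) :
  rat_subset D `<=` \bigcup_i rat_subset (V i) ->
  exists k (j : 'I_k -> I), rat_subset D `<=` \bigcup_l rat_subset (V (j l)).
Proof.
move=> cov; apply: contrapT => hno.
(* generated by the complements of the finite unions in the rational subset *)
pose F : set_system X := [set S | exists k (j : 'I_k -> I),
  rat_subset D `\` \bigcup_l rat_subset (V (j l)) `<=` S].
have FF : ProperFilter F.
  apply: Build_ProperFilter => [[k [j h]]|].
    by apply: hno; exists k, j => x Dx; apply: contrapT => hx; exact: (h x).
  split.
  - by exists 0%N, (fun i : 'I_0 => False_rect I (notF (ltn_ord i))).
  - move=> S T [k [j h]] [k' [j' h']]; exists (k + k')%N.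
    exists (fun i : 'I_(k + k')%N => sum_rect (fun=> I) j j' (fintype.split i)) => x [Dx hx].
    split; [apply: h | apply: h']; split=> // -[l _ hl]; apply: hx.
    + by exists (lshift k' l) => //; have := unsplitK (inl l : 'I_k + 'I_k'); rewrite /= => ->.
    + by exists (rshift k l) => //; have := unsplitK (inr l : 'I_k + 'I_k'); rewrite /= => ->.
  - by move=> S T ST [k [j h]]; exists k, j => x /h /ST.
have [U [UU FU]] := ultraFilterLemma FF.
pose le a b := U [set x : X | val_le x a b].
have Uno S : ~ U S -> U (~` S) by move=> h; have [] := in_ultra_setVsetC S UU.
have U0 : ~ U set0 by exact: filter_not_empty.
have pv : preval le.
  split.
  - move=> a b; have [|h] := pselect (le a b); [by left | right].
    by apply: filterS (Uno _ h) => x hx; have [/hx|] := val_total x a b.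
  - by move=> b a c h h'; apply: filterS (filterI h h') => x [hx hx']; exact: val_trans hx hx'.
  - by move=> a b c h; apply: filterS h => x hx; exact: val_mul.
  - move=> a b c hc h; apply: filterS (filterI (Uno _ hc) h) => x [hx hx'].
    exact: val_cancel hx'.
  - by move=> a b c h h'; apply: filterS (filterI h h') => x [hx hx']; exact: val_add.
  - by move=> h; apply: U0; apply: filterS h => x hx; exact: (@val_one _ _ _ _ x).
  - by move=> a h; apply: filterS filterT => x _; exact: (pv_int (point_preval x)).
have sm : ~ le 1 (wA 1).
  by move=> h; apply: U0; apply: filterS h => x hx; exact: (@point_small x).
have UD : U (rat_subset D).
  by apply: FU; exists 0%N, (fun i : 'I_0 => False_rect I (notF (ltn_ord i))) => x [].
pose x0 := retract_point pv sm.
have hD i : le (rat_num (r := D) i) (rat_den D) by apply: filterS UD => x [h _]; exact: h.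
have nz g M : le (wA M) g -> ~ retract le g 0.
  move=> h [h0|h0]; first exact: (pv_wA pv (pv_trans pv h h0)).
  exact: (wA_strict pv sm (pv_trans pv h (h0 M.+1))).
have [M hM] := rat_bound D.
have [|i _ [hn hd]] := cov x0.
  by split=> [i|]; [left; exact: hD | exact: nz (hM _ pv hD)].
have /existsNP [N hN] : ~ infinitesimal le (rat_den (V i)) by move=> h; apply: hd; right.
have gN : le (wA N) (rat_den (V i)) by have [] := pv_total pv (rat_den (V i)) (wA N).
have UV : U (rat_subset (V i)).
  have hn' l : le (rat_num (r := V i) l) (rat_den (V i)).
    by have [//|h] := hn l; exact: (pv_trans pv (h N) gN).
  have : U [set x : X | forall l, val_le x (rat_num (r := V i) l) (rat_den (V i))].
    exact: filter_forall hn'.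
  move=> h; apply: filterS (filterI h gN) => x [hx gx]; split=> [l|]; first exact: hx.
  exact: (pv_0 (point_preval x) (pv_wA (point_preval x) (N := N)) gx).
have UnV : U (~` rat_subset (V i)).
  by apply: FU; exists 1%N, (fun=> i) => x [_ hx] h; apply: hx; exists ord0.
by apply: U0; apply: filterS (filterI UV UnV) => x [].
Qed.

(** ** Existence of points *)

Section Chevalley.
Variables (L : fieldType) (fr : {rmorphism A -> L}).
Hypothesis fr_inj : injective fr.

Definition coprime_pair (y1 y2 : L) (S : set L) :=
  exists s1 s2, [/\ S s1, S s2 & 1 = s1 * y1 + s2 * y2].

(** Chevalley's theorem: a subring maximal among those in which y1 and y2 do not generate
    the unit ideal is a valuation ring. *)
Lemma chevalley (S : set L) y1 y2 : subring_set S -> S y1 -> S y2 -> ~ coprime_pair y1 y2 S ->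
  exists V, [/\ subring_set V, S `<=` V, forall x, V x \/ V x^-1 &
    forall y, y = y1 \/ y = y2 -> y != 0 -> ~ V y^-1].
Proof.
move=> hS Sy1 Sy2 hp.
have [|F [V0 FV0] FP tot|V [SV [hV hVp] maxV]] :=
  @Zorn_above L (fun S => subring_set S /\ ~ coprime_pair y1 y2 S) S; first by [].
- have two x y : (\bigcup_(X in F) X) x -> (\bigcup_(X in F) X) y -> exists Z, [/\ F Z, Z x & Z y].
    move=> [Y FY Yx] [Z FZ Zy]; have [h|h] := tot _ _ FY FZ.
    + by exists Z; split=> //; exact: h.
    + by exists Y; split=> //; exact: h.
  split; first split.
  + by exists V0 => //; have [[] ] := FP _ FV0.
  + move=> x y hx hy; have [Z [FZ Zx Zy]] := two _ _ hx hy.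
    by exists Z => //; have [[_ hB _] _] := FP _ FZ; exact: hB.
  + move=> x y hx hy; have [Z [FZ Zx Zy]] := two _ _ hx hy.
    by exists Z => //; have [[_ _ hM] _] := FP _ FZ; exact: hM.
  + move=> [s1 [s2 [hx hy e]]]; have [Z [FZ Zx Zy]] := two _ _ hx hy.
    by have [_] := FP _ FZ; apply; exists s1, s2.
have [V1 VB VM] := hV; have V0' := subring0 hV.
have VD := subringD hV; have VN := subringN hV.
have Vy1 := SV _ Sy1; have Vy2 := SV _ Sy2.
pose I (b : L) := exists s1 s2 : L, [/\ V s1, V s2 & b = s1 * y1 + s2 * y2].
have IV (b : L) : I b -> V b by move=> [s1 [s2 [h1 h2 ->]]]; apply: VD; exact: VM.
have I0 : I 0 by exists 0, 0; rewrite !mul0r addr0.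
have IL (a b c : L) : V a -> I b -> I c -> I (a * b + c).
  move=> ha [s1 [s2 [h1 h2 ->]]] [t1 [t2 [h3 h4 ->]]]; exists (a * s1 + t1), (a * s2 + t2).
  by split; [exact: VD (VM _ _ ha h1) h3 | exact: VD (VM _ _ ha h2) h4 | ring].
have ID (b c : L) : I b -> I c -> I (b + c) by rewrite -{2}[b]mul1r; exact: IL.
have IM (a b : L) : V a -> I b -> I (a * b) by rewrite -[a * b]addr0 => ha hb; exact: IL.
have I1 : ~ I 1 by move=> [s1 [s2 h]]; apply: hVp; exists s1, s2.
have ext x : ~ V x -> exists q : {poly L}, (forall i, I q`_i) /\ q.[x] = 1.
  move=> Vx; apply: contrapT => hq; apply: Vx.
  have -> : V = adjoin V [set x].
    symmetry; apply: maxV; last by move=> y; exact: adjoin_base.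
    split; first exact: adjoin_subring.
    move=> [s1 [s2 [/(adjoin_poly hV) [q1 [h1 ->]] /(adjoin_poly hV) [q2 [h2 ->]] e]]].
    apply: hq; exists (y1 *: q1 + y2 *: q2); split; last by rewrite hornerD !hornerZ e; ring.
    by move=> i; rewrite coefD !coefZ; exists q1`_i, q2`_i; split=> //; ring.
  exact: adjoin_gen.
(* V is local with maximal ideal I: 1 + I consists of units *)
have unit1 (b : L) : I b -> V (1 - b)^-1.
  move=> Ib; have b1 : 1 - b != 0 by apply/eqP => /subr0_eq e; apply: I1; rewrite e.
  apply: contrapT => /ext [q [hq e]].
  (* clearing denominators in the relation *)
  pose N := size q.
  have h1 : (1 - b) ^+ N = \sum_(i < N) (1 - b) ^+ (N - i) * q`_i.
    transitivity ((1 - b) ^+ N * q.[(1 - b)^-1]); first by rewrite e mulr1.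
    rewrite horner_coef mulr_sumr; apply: eq_bigr => i _; rewrite exprVn.
    have -> : (1 - b) ^+ N = (1 - b) ^+ (N - i) * (1 - b) ^+ i by rewrite -exprD subnK // ltnW.
    by rewrite mulrACA mulfV ?mulr1 // expf_neq0.
  have V1b : V (1 - b) by apply: VB => //; exact: IV.
  have IN : I ((1 - b) ^+ N).
    rewrite h1; elim/big_ind: _ => // i _; apply: IM => //; exact: subringX.
  have pw k : I (1 - (1 - b) ^+ k).
    elim: k => [|k ih]; first by rewrite expr0 subrr.
    have -> : 1 - (1 - b) ^+ k.+1 = (1 - b) * (1 - (1 - b) ^+ k) + b by rewrite exprS; ring.
    exact: IL.
  by apply: I1; have := ID _ _ (pw N) IN; rewrite subrK.
exists V; split=> //; last first.
  move=> y hy y0 hV'; apply: I1; rewrite -(mulVf y0); apply: IM => //.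
  case: hy => ->; first by exists 1, 0; rewrite mul1r mul0r addr0.
  by exists 0, 1; rewrite mul1r mul0r add0r.
move=> x; apply: contrapT => /not_orP [Vx Vx'].
have x0 : x != 0 by apply/eqP => h; apply: Vx; rewrite h.
(* a relation of minimal degree for x or 1/x can be shortened with a relation for the other *)
have key N : forall (q q' : {poly L}) z, z != 0 -> (size q + size q' <= N)%N ->
    (forall i, I q`_i) -> (forall i, I q'`_i) -> q.[z] = 1 -> q'.[z^-1] = 1 -> False.
  elim: N => [|N ih] q q' z z0 hN hq hq' e e'.
    move: hN; rewrite leqn0 addn_eq0 => /andP [/eqP h _]; move: e.
    have -> : q = 0 by apply/eqP; rewrite -size_poly_eq0 h.
    by rewrite horner0 => /esym/eqP; rewrite oner_eq0.
  wlog le : q q' z z0 hN hq hq' e e' / (size q' <= size q)%N.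
    move=> w; have [h|h] := leqP (size q') (size q); first exact: (w q q' z).
    by apply: (w q' q z^-1); rewrite ?invr_eq0 ?invrK // 1?addnC // ltnW.
  have nz (r : {poly L}) y : r.[y] = 1 -> (0 < size r)%N.
    by move=> h; rewrite lt0n size_poly_eq0; apply/eqP => r0; move: h; rewrite r0 horner0 => /esym/eqP; rewrite oner_eq0.
  have sq := nz _ _ e; have sq' := nz _ _ e'.
  have iv := unit1 _ (hq' 0%N); set v := (1 - q'`_0)^-1 in iv.
  have b1 : 1 - q'`_0 != 0 by apply/eqP => /subr0_eq h; apply: I1; rewrite h.
  pose m := (size q).-1; pose l := (size q').-1.
  (* q'' = q - lead * (X^m - v * sum_(j >= 1) q'_j X^(m - j)) *)
  pose t : {poly L} := \sum_(j < l) (v * q'`_j.+1) *: 'X^(m - j.+1).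
  have tz : t.[z] = z ^+ m.
    have lm : (l <= m)%N by rewrite /l /m; lia.
    have : q'.[z^-1] - q'`_0 = \sum_(j < l) q'`_j.+1 * z ^- j.+1.
      rewrite horner_coef -(prednK sq') big_ord_recl expr0 mulr1 addrC addKr.
      by apply: eq_bigr => j _; rewrite /= /bump exprVn.
    rewrite e'.
    move=> h; rewrite horner_sum -[RHS]mul1r -(mulVf b1) -/v {1}h mulr_sumr mulr_suml.
    apply: eq_bigr => j _; rewrite hornerZ hornerXn -!mulrA; congr (_ * (_ * _)).
    have jm : (j.+1 <= m)%N by exact: leq_trans (ltn_ord j) lm.
    by rewrite -{2}(subnK jm) exprD mulrC mulfK // expf_neq0.
  pose q2 := q - q`_m *: 'X^m + q`_m *: t.
  have m0 : (0 < m)%N.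
    rewrite lt0n; apply/eqP => mz; apply: I1.
    have : (size q <= 1)%N by rewrite -(prednK sq) -/m mz.
    by move=> /size1_polyC h; move: e; rewrite h hornerC => <-.
  have It i : I t`_i.
    rewrite coef_sum; elim/big_ind: _ => // j _; rewrite coefZ coefXn mulrC.
    apply: (IM); last exact: IM.
    by case: eqP => _; [exact: V1 | exact: V0'].
  apply: (ih q2 q' z z0) => //.
  - suff : (size q2 <= m)%N by rewrite /m; lia.
    apply/leq_sizeP => i hi; rewrite !coefD coefN !coefZ coefXn.
    have -> : t`_i = 0.
      rewrite coef_sum big1 // => j _; rewrite coefZ coefXn.
      by have -> : (i == m - j.+1)%N = false by [lia | apply/negP => /eqP hh; move: hi; rewrite hh; move: (ltn_ord j) m0; lia]; rewrite mulr0.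
    rewrite mulr0 addr0; case: eqP => [->|/eqP im]; first by rewrite mulr1 subrr.
    by rewrite mulr0 subr0 nth_default // -(prednK sq) -/m ltn_neqAle eq_sym im.
  - move=> i; rewrite !coefD coefN !coefZ coefXn.
    apply: (ID); last by apply: (IM) => //; exact: IV.
    apply: (ID) => //; rewrite -mulrN mulrC; apply: (IM) => //.
    by case: eqP => _; [exact: VN | rewrite oppr0].
  - by rewrite !hornerD hornerN !hornerZ hornerXn tz e subrK.
have [q [hq e]] := ext _ Vx; have [q' [hq' e']] := ext _ Vx'.
exact: (key (size q + size q')%N q q' x).
Qed.

(** The valuation of a dominating valuation ring, made continuous. As the topologically
    nilpotent unit is not invertible in that ring, the retraction is a point; as y is
    not invertible there either, the value of y is less than 1. *)
Lemma chevalley_point (S : set L) y : subring_set S -> unit_ball fr `<=` S -> S y ->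
  ~ coprime_pair (fr (wA 1)) y S -> exists x : X,
  (forall a b s, S s -> fr a = s * fr b -> val_le x a b) /\
  (forall a b, fr a = y * fr b -> ~ val_le x b 0 -> ~ val_le x b a).
Proof.
move=> hS uS Sy hp.
have Sw : S (fr (wA 1)) by apply: uS; exists (wA 1) => //; exact: wA_le.
have [V [hV SV val mV]] := chevalley hS Sw Sy hp.
have [V1 VB VM] := hV; have VD := subringD hV.
pose le a b := exists2 v, V v & fr a = v * fr b.
have fr0 a : fr a = 0 -> a = 0 by rewrite -(rmorph0 fr) => /fr_inj.
have pv : preval le.
  split.
  - move=> a b; have [->|a0] := eqVneq a 0; first by left; exists 0; rewrite ?rmorph0 ?mul0r //; exact: subring0.
    have [->|b0] := eqVneq b 0; first by right; exists 0; rewrite ?rmorph0 ?mul0r //; exact: subring0.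
    have fa : fr a != 0 by apply: contra a0 => /eqP /fr0 ->.
    have fb : fr b != 0 by apply: contra b0 => /eqP /fr0 ->.
    have [h|h] := val (fr a / fr b); [left|right].
    + by exists (fr a / fr b); rewrite ?divfK.
    + by exists (fr b / fr a); rewrite ?divfK // -invf_div.
  - by move=> b a c [v hv e] [v' hv' e']; exists (v * v'); [exact: VM | rewrite e e' mulrA].
  - by move=> a b c [v hv e]; exists v; rewrite // !rmorphM e mulrA.
  - move=> a b c hc [v hv e]; exists v => //.
    have fc : fr c != 0.
      by apply/eqP => h; apply: hc; exists 0; rewrite ?h ?mul0r //; exact: subring0.
    by apply: (mulIf fc); rewrite -mulrA -!rmorphM.
  - by move=> a b c [v hv e] [v' hv' e']; exists (v + v'); rewrite ?rmorphD ?e ?e' ?mulrDl //; exact: VD.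
  - by move=> [v _]; rewrite rmorph0 mulr0 rmorph1 => /eqP; rewrite oner_eq0.
  - by move=> a h; exists (fr a); rewrite ?rmorph1 ?mulr1 //; apply/SV/uS; exists a.
have frw : fr (wA 1) != 0.
  by apply/eqP => /fr0 h; have := nm_kst A (topnil K ^+ 1); rewrite -/(wA 1) h nm0 => /esym/pf_abs_eq0/eqP; rewrite (negPf (topnilX0 _ _)).
have sm : ~ le 1 (wA 1).
  move=> [v hv]; rewrite rmorph1 => e; apply: (mV (fr (wA 1))) => //; first by left.
  suff -> : (fr (wA 1))^-1 = v by [].
  by apply: (mulIf frw); rewrite mulVf.
exists (retract_point pv sm); split=> [a b s hs e|a b e hb].
  by left; exists s => //; exact: SV.
case=> [[v hv e']|ib]; last by apply: hb; right.
have [b0|b0] := eqVneq (fr b) 0.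
  by apply: hb; left; exists 0; rewrite ?b0 ?mul0r //; exact: subring0.
have vy : v * y = 1 by apply: (mulIf b0); rewrite mul1r -mulrA -e.
have y0 : y != 0 by apply: contra_eq_neq vy => ->; rewrite mulr0 eq_sym oner_eq0.
apply: (mV y) => //; first by right.
suff -> : y^-1 = v by [].
by apply: (mulIf y0); rewrite mulVf.
Qed.
End Chevalley.
End Points.

(** * Rational localizations as adic rings *)

Section CompletionFacts.
Variables (B : comPzRingType) (N : linTopology B).
Local Notation Q := (completion N).
Implicit Types (x y : Q) (b : B).

Definition iota b : Q := cs_class (cs_const N b).

Fact iota_zmod : zmod_morphism iota.
Proof.
move=> a b; rewrite /iota -[RHS]/(cadd (cs_class (cs_const N a)) (copp (cs_class (cs_const N b)))).
by rewrite coppE caddE; apply: cs_class_eq.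
Qed.
Fact iota_monoid : monoid_morphism iota.
Proof.
split=> // a b; rewrite /iota -[RHS]/(cmul (cs_class (cs_const N a)) (cs_class (cs_const N b))).
by rewrite cmulE; apply: cs_class_eq.
Qed.
HB.instance Definition _ := GRing.isZmodMorphism.Build B Q iota iota_zmod.
HB.instance Definition _ := GRing.isMonoidMorphism.Build B Q iota iota_monoid.

Lemma class_sub (u v : cauchySeq N) (w : cauchySeq N) : (forall m, w m = u m - v m) ->
  cs_class w = cs_class u - cs_class v.
Proof.
move=> h; rewrite -[RHS]/(cadd (cs_class u) (copp (cs_class v))) coppE caddE.
exact: cs_class_eq.
Qed.
Lemma class_mul (u v : cauchySeq N) (w : cauchySeq N) : (forall m, w m = u m * v m) ->
  cs_class w = cs_class u * cs_class v.
Proof. by move=> h; rewrite -[RHS]/(cmul (cs_class u) (cs_class v)) cmulE; exact: cs_class_eq. Qed.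

Lemma nbh_iota j b : completion_nbh j (iota b) <-> N j b.
Proof.
split=> [[u e hu]|h]; last by exists (cs_const N b).
have /cs_classP /(_ j) [M hM] := e; have := lt_nbhB (hu M) (hM M (leqnn M)).
by rewrite /= subKr.
Qed.

Lemma nbhB j x y : completion_nbh j x -> completion_nbh j y -> completion_nbh j (x - y).
Proof.
move=> [u <- hu] [v <- hv]; exists (cs_add u (cs_opp v)).
  by apply: class_sub.
by move=> m; apply: lt_nbhB; [exact: hu | exact: hv].
Qed.
Lemma nbh0 j : completion_nbh j (0 : Q).
Proof. by rewrite -(rmorph0 iota); apply/nbh_iota; exact: lt_nbh0. Qed.
Lemma nbhD j x y : completion_nbh j x -> completion_nbh j y -> completion_nbh j (x + y).
Proof.
by move=> hx hy; rewrite -[y]opprK -[- y]sub0r; apply: nbhB => //; apply: nbhB => //; exact: nbh0.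
Qed.
Lemma nbhM j x y : completion_nbh j x -> completion_nbh j y -> completion_nbh j (x * y).
Proof.
move=> [u <- hu] [v <- hv]; exists (cs_mul u v); first exact: class_mul.
by move=> m; apply: lt_nbhM; [exact: hu | exact: hv].
Qed.
Lemma nbh_decr i j x : (i <= j)%N -> completion_nbh j x -> completion_nbh i x.
Proof. by move=> ij [u <- hu]; exists u => // m; exact: lt_nbh_decr ij _ (hu m). Qed.

Lemma nbh_dense x j : exists b, completion_nbh j (x - iota b).
Proof.
move: x; apply: completion_ind => u; have [M hM] := cs_cauchy u j; exists (u M).
have cv i : exists M', forall m m', (M' <= m)%N -> (M' <= m')%N ->
    N i (u (m + M)%N - u M - (u (m' + M)%N - u M)).
  have [M' h] := cs_cauchy u i; exists M' => m m' hm hm'.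
  by rewrite opprD addrACA subrr addr0; apply: h; [exact: leq_trans hm (leq_addr _ _)|exact: leq_trans hm' (leq_addr _ _)].
exists (CauchySeq cv); last by move=> m /=; apply: hM; [exact: leq_addl | exact: leqnn].
have -> : cs_class u - iota (u M) = cs_class (cs_add u (cs_opp (cs_const N (u M)))).
  by symmetry; apply: class_sub.
apply/cs_classP => i; have [M' h] := cs_cauchy u i; exists M' => m hm /=.
rewrite opprD addrACA subrr addr0; apply: h => //; exact: leq_trans hm (leq_addr _ _).
Qed.

Lemma nbh_separated x : (forall j, completion_nbh j x) -> x = 0.
Proof.
move: x; apply: completion_ind => u h; rewrite -(rmorph0 iota); apply/cs_classP => j.
have [v /cs_classP /(_ j) [M hM] hv] := h j; exists M => m Mm.
by rewrite /= subr0 -[u m](subKr (v m)); apply: lt_nbhB; [exact: hv | exact: hM].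
Qed.

Lemma nbh_complete (x : nat -> Q) : (forall j, completion_nbh j (x j.+1 - x j)) ->
  exists s, forall j, completion_nbh j (s - x j).
Proof.
move=> h; have [b hb] := choice (fun j => nbh_dense (x j) j).
have bS j : N j (b j.+1 - b j).
  apply/nbh_iota; rewrite rmorphB.
  have -> : iota (b j.+1) - iota (b j) = (x j.+1 - x j) - ((x j.+1 - iota (b j.+1)) - (x j - iota (b j))).
    by ring.
  apply: nbhB => //; apply: nbhB => //; exact: nbh_decr (leqnSn j) (hb _).
have bm j m : (j <= m)%N -> N j (b m - b j).
  elim: m => [|m ih]; first by rewrite leqn0 => /eqP ->; rewrite subrr; exact: lt_nbh0.
  rewrite leq_eqVlt => /orP [/eqP ->|]; first by rewrite subrr; exact: lt_nbh0.
  rewrite ltnS => jm; rewrite -(subrKA (b m)); apply: lt_nbhD; last exact: ih.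
  exact: lt_nbh_decr jm _ (bS m).
have cb j : exists M, forall m m', (M <= m)%N -> (M <= m')%N -> N j (b m - b m').
  exists j => m m' hm hm'; rewrite -(subrKA (b j)) -[b j - b m']opprB.
  by apply: lt_nbhB; exact: bm.
exists (cs_class (CauchySeq cb)) => j.
rewrite -(subrKA (iota (b j))) -[iota _ - x j]opprB; apply: nbhB => //.
have cv i : exists M', forall m m', (M' <= m)%N -> (M' <= m')%N ->
    N i (b (m + j)%N - b j - (b (m' + j)%N - b j)).
  have [M' h'] := cb i; exists M' => m m' hm hm'.
  by rewrite opprD addrACA subrr addr0; apply: h'; [exact: leq_trans hm (leq_addr _ _)|exact: leq_trans hm' (leq_addr _ _)].
exists (CauchySeq cv); last by move=> m /=; apply: bm; exact: leq_addl.
have -> : cs_class (CauchySeq cb) - iota (b j) = cs_class (cs_add (CauchySeq cb) (cs_opp (cs_const N (b j)))).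
  by symmetry; apply: class_sub.
apply/cs_classP => i; have [M' h'] := cb i; exists M' => m hm /=.
rewrite opprD addrACA subrr addr0; apply: h' => //; exact: leq_trans hm (leq_addr _ _).
Qed.
End CompletionFacts.

Section RationalAdic.
Variables (R : realType) (p : nat) (K : perfectoidField R p) (n : nat).
Local Notation A := (PT K n).
Variable D : ratDatum K n.
Local Notation RI := (@rat_int R p K n D).
Local Notation N := (rat_topology D).
Local Notation w := (topnil K).
Let cP (c : K) : {poly A} := (kst A c)%:P.

Lemma rat_int1 : RI 1.
Proof. by rewrite -polyC1; apply: rat_int_const; apply/(tate_intE (1 : A)); rewrite nm1. Qed.
Lemma rat_intc (c : K) : pf_abs c <= 1 -> RI (cP c).
Proof. by move=> h; apply: rat_int_const; apply/(tate_intE (kst A c)); rewrite nm_kst. Qed.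
Lemma nbh0_int q : N 0%N q <-> RI q.
Proof.
split; first exact: rat_nbh_int.
by move=> h; exists 1, q; rewrite pf_abs1 expr0 invr1 tconst1 mul1r.
Qed.

Definition oR : set (rat_ring D) := @completion_nbh _ N 0.
Definition kR : {rmorphism K -> rat_ring D} := (iota N \o polyC) \o kst A.

Lemma kRE c : kR c = iota N (cP c). Proof. by []. Qed.

Lemma nbh_pow k : exists j, forall x : rat_ring D, completion_nbh j x -> oR (kR (w ^- k) * x).
Proof.
have [j hj] := half_small (pf_abs_gt0 (topnilX0 K k)); exists j => _ [u <- hu].
have hv m : RI (cP (w ^- k) * u m).
  have [c [r [hc hr ->]]] := hu m; rewrite mulrA -[(tconst n c)%:P]/(cP c) /cP -polyCM -rmorphM.
  apply: rat_int_mul hr; apply: rat_intc; rewrite pf_absM pf_absV ler_pdivrMl ?mulr1; last first.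
    exact: pf_abs_gt0 (topnilX0 _ _).
  exact: le_trans hc hj.
exists (cs_mul (cs_const N (cP (w ^- k))) u); first by exact: class_mul.
by move=> m; apply/nbh0_int; exact: hv.
Qed.

Lemma pow_nbh k x : oR x -> completion_nbh k (kR (w ^+ k) * x).
Proof.
move=> [u <- hu]; exists (cs_mul (cs_const N (cP (w ^+ k))) u); first by exact: class_mul.
by move=> m; exists (w ^+ k), (u m); split=> //; [exact: topnil_le | apply/nbh0_int; exact: hu].
Qed.

Lemma kRV k : kR (w ^+ k) * kR (w ^- k) = 1.
Proof. by rewrite -rmorphM mulfV ?rmorph1 // topnilX0. Qed.

Lemma kRK k (x : rat_ring D) : x = kR (w ^+ k) * (kR (w ^- k) * x).
Proof. by rewrite mulrA (kRV k) mul1r. Qed.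

Lemma lev_nbh k : exists j, forall x : rat_ring D, completion_nbh j x ->
  exists z, oR z /\ x = kR (w ^+ k) * z.
Proof.
have [j hj] := nbh_pow k; exists j => x /hj h; exists (kR (w ^- k) * x).
by split; [exact: h | exact: kRK].
Qed.

Fact rat_absorb (x : rat_ring D) : exists k, oR (kR (w ^+ k) * x).
Proof.
have [q hq] := nbh_dense x 0; have [c [c0 c1 hc]] := rat_absorbed_all D q.
have [k hk] := topnil_small K (pf_abs_gt0 c0); exists k.
rewrite -[x](subrK (iota N q)) mulrDr; apply: nbhD.
  apply: nbhM => //; apply/nbh_iota/nbh0_int/rat_intc; exact: topnil_le1.
rewrite kRE -rmorphM; apply/nbh_iota/nbh0_int.
have -> : cP (w ^+ k) * q = cP (w ^+ k / c) * ((tconst n c)%:P * q).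
  by rewrite mulrA -[(tconst n c)%:P]/(cP c) /cP -polyCM -rmorphM divfK.
apply: rat_int_mul hc; apply: rat_intc.
by rewrite pf_absM pf_absV ler_pdivrMr ?mul1r // pf_abs_gt0.
Qed.

Fact rat_sep (x : rat_ring D) : (forall k, exists z, oR z /\ x = kR (w ^+ k) * z) -> x = 0.
Proof. by move=> h; apply: nbh_separated => j; have [z [hz ->]] := h j; exact: pow_nbh. Qed.

Fact rat_complete (y : nat -> rat_ring D) : (forall k, oR (y k)) -> exists s, forall N0,
  exists z, oR z /\ s - \sum_(k < N0) kR (w ^+ k) * y k = kR (w ^+ N0) * z.
Proof.
move=> hy; pose x m := \sum_(k < m) kR (w ^+ k) * y k.
have [|s hs] := @nbh_complete _ N x.
  by move=> j; rewrite /x big_ord_recr addrC addKr; exact: pow_nbh.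
exists s => m; exists (kR (w ^- m) * (s - x m)); split; last exact: kRK.
have [j hj] := nbh_pow m; pose M := maxn j m.
rewrite -(subrKA (x M)) mulrDr; apply: nbhD; first by apply: hj; apply: nbh_decr (hs M); exact: leq_maxl.
have : (m <= M)%N by exact: leq_maxr.
elim: M => [|M ih]; first by rewrite leqn0 => /eqP ->; rewrite subrr mulr0; exact: nbh0.
rewrite leq_eqVlt => /orP [/eqP ->|]; first by rewrite subrr mulr0; exact: nbh0.
rewrite ltnS => mM; rewrite -(subrKA (x M)) mulrDr; apply: nbhD (ih mM).
have kRM c d : kR (c * d) = kR c * kR d by exact: rmorphM.
have -> : kR (w ^- m) * (x M.+1 - x M) = kR (w ^+ (M - m)) * y M.
  rewrite /x big_ord_recr addrC addKr /= mulrA -kRM; congr (kR _ * _).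
  by rewrite -{1}(subnK mM) exprD mulrC mulfK // topnilX0.
apply: nbhM; last exact: hy.
by apply/nbh_iota/nbh0_int/rat_intc; exact: topnil_le1.
Qed.

Fact rat_o1 : oR 1. Proof. by rewrite -(rmorph1 (iota N)); apply/nbh_iota/nbh0_int/rat_int1. Qed.
Fact rat_ok (c : K) : pf_abs c <= 1 -> oR (kR c).
Proof. by move=> h; apply/nbh_iota/nbh0_int/rat_intc. Qed.

(** The topology of the completed localization is defined by the ring of definition oR,
    because its multiples by the powers of a topologically nilpotent unit are a basis of
    neighbourhoods of 0. *)
Definition QD : adic K := @Adic R p K (rat_ring D) oR kR rat_o1 (@nbhB _ N 0) (@nbhM _ N 0) rat_ok
  rat_absorb rat_sep rat_complete.

Definition io : {rmorphism {poly A} -> QD} := iota N.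
Definition can : {rmorphism A -> QD} := io \o polyC.
Local Notation g := (rat_den D : A).
Local Notation f i := (rat_num (r := D) i : A).

Lemma ao_io q : ao (io q) <-> RI q. Proof. by rewrite -nbh0_int; exact: nbh_iota. Qed.
Lemma io_dense (x : QD) k : exists q, lev k (x - io q).
Proof. by have [j hj] := lev_nbh k; have [q hq] := nbh_dense x j; exists q; exact: hj. Qed.
Lemma io_gX : can g * io 'X = 1.
Proof.
apply/eqP; rewrite -subr_eq0; apply/eqP/lev_sep => k; apply/levE.
have -> : ak QD (w ^- k) * (can g * io 'X - 1) = io ((g%:P * 'X - 1) * cP (w ^- k)).
  by rewrite rmorphM rmorphB rmorphM rmorph1 mulrC.
by apply/ao_io; exact: rat_int_ideal.
Qed.
Lemma zero_den : g = 0 -> forall x : QD, x = 0.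
Proof. by move=> g0 x; rewrite -[x]mul1r -io_gX g0 rmorph0 !mul0r. Qed.

Lemma io_ideal s : io ((g%:P * 'X - 1) * s) = 0.
Proof. by rewrite rmorphM rmorphB rmorphM rmorph1 -[io g%:P]/(can g) io_gX subrr mul0r. Qed.

(** Modulo g X - 1 a constant c equals c (g X)^d, so that all coefficients can be
    brought to the same power of X. *)
Lemma single_fraction q : exists a d s, q = a%:P * 'X^d + (g%:P * 'X - 1) * s.
Proof.
elim/poly_ind: q => [|q c [a [d [s ->]]]].
  by exists 0, 0%N, 0; rewrite polyC0 mul0r mulr0 addr0.
have [t ht] : exists t, 1 = (g%:P * 'X) ^+ d.+1 + (g%:P * 'X - 1) * t.
  exists (- \sum_(i < d.+1) (g%:P * 'X) ^+ i).
  by rewrite mulrN -subrX1; ring.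
exists (a + c * g ^+ d.+1), d.+1, (s * 'X + c%:P * t).
have hc : c%:P = c%:P * ((g%:P * 'X) ^+ d.+1 + (g%:P * 'X - 1) * t) by rewrite -ht mulr1.
rewrite {1}hc.
have -> : (a + c * g ^+ d.+1)%:P = a%:P + c%:P * g%:P ^+ d.+1.
  by rewrite polyCD polyCM polyC_exp.
have e1 : (g%:P * 'X) ^+ d.+1 = g%:P ^+ d.+1 * ('X^d * 'X) by rewrite exprMn [in RHS]mulrC -exprSr mulrC.
have e2 : 'X^(d.+1) = 'X^d * 'X :> {poly A} by exact: exprSr.
by rewrite e1 e2; ring.
Qed.
Lemma canP a : can a = io a%:P. Proof. by []. Qed.
Lemma akP c : ak QD c = can (kst A c). Proof. by []. Qed.
End RationalAdic.
#[global] Opaque QD io can.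
Arguments oR {R p K n} D.

(** ** The ring of definition inside the fraction field *)

Section FractionField.
Variables (R : realType) (p : nat) (K : perfectoidField R p) (n : nat).
Local Notation A := (PT K n).
Definition FF : fieldType := {fraction A}.
Definition fr : {rmorphism A -> FF} := @tofrac A.
Lemma fr_inj : injective fr. Proof. by move=> x y /eqP; rewrite tofrac_eq => /eqP. Qed.
Opaque FF fr.
Lemma fr_neq0 (a : A) : a != 0 -> fr a != 0.
Proof. by rewrite -(inj_eq fr_inj) rmorph0. Qed.
Lemma fr_eq0 (a : A) : fr a = 0 -> a = 0.
Proof. by rewrite -(rmorph0 fr) => /fr_inj. Qed.

Variable D : ratDatum K n.
Local Notation g := (rat_den D : A).
Local Notation f i := (rat_num (r := D) i : A).
Local Notation RI := (@rat_int R p K n D).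

Definition ev : {rmorphism {poly A} -> FF} :=
  horner_morph (fun x => mulrC (fr g)^-1 (fr x)).
Lemma evC a : ev a%:P = fr a. Proof. exact: horner_morphC. Qed.
Lemma evX : ev 'X = (fr g)^-1. Proof. exact: horner_morphX. Qed.

Definition sl : set FF := adjoin (unit_ball fr) [set fr (f i) / fr g | i in setT].
Lemma sl_subring : subring_set sl. Proof. exact/adjoin_subring/unit_ball_subring. Qed.
Lemma sl_ball a : nm a <= 1 -> sl (fr a).
Proof. by move=> h; apply: adjoin_base; exists a. Qed.

Hypothesis g0 : g != 0.

Lemma ev_ideal s : ev ((g%:P * 'X - 1) * s) = 0.
Proof. by rewrite rmorphM rmorphB rmorphM rmorph1 evC evX mulfV ?subrr ?mul0r // fr_neq0. Qed.

Lemma ev_ker q : ev q = 0 -> exists s, q = (g%:P * 'X - 1) * s.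
Proof.
have [a [d [s ->]]] := single_fraction D q.
rewrite rmorphD ev_ideal addr0 rmorphM rmorphXn evC evX => /eqP.
rewrite mulf_eq0 expf_eq0 invr_eq0 (negPf (fr_neq0 g0)) andbF orbF => /eqP /fr_eq0 ->.
by exists s; rewrite polyC0 mul0r add0r.
Qed.

Lemma ev_eq q r : ev q = ev r -> io D q = io D r.
Proof.
move=> e; have [|s hs] := @ev_ker (q - r); first by rewrite rmorphB e subrr.
by apply/eqP; rewrite -subr_eq0 -rmorphB hs io_ideal.
Qed.

Lemma sl_ev x : sl x -> exists2 r, RI r & ev r = x.
Proof.
elim=> [_ [a ha <-]|_ [i _ <-]|{}x y _ [q hq <-] _ [r hr <-]|{}x y _ [q hq <-] _ [r hr <-]].
- by exists a%:P; [apply: rat_int_const; exact/(tate_intE a) | exact: evC].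
- by exists ((f i)%:P * 'X); [exact: rat_int_frac | rewrite rmorphM evC evX].
- by exists (q + r); rewrite ?rmorphD //; exact: rat_int_add.
- by exists (q * r); rewrite ?rmorphM //; exact: rat_int_mul.
Qed.

Lemma rat_intE q : RI q <-> sl (ev q).
Proof.
split.
  elim=> [a /(tate_intE (a : A)) h|i|r|{}q r _ hq _ hr|{}q r _ hq _ hr].
  - by rewrite evC; exact: sl_ball.
  - by rewrite rmorphM evC evX; apply: adjoin_gen; exists i.
  - by rewrite ev_ideal; exact: (subring0 sl_subring).
  - by rewrite rmorphD; exact: adjoin_add.
  - by rewrite rmorphM; exact: adjoin_mul.
move=> /sl_ev [r hr e]; have [|s hs] := @ev_ker (q - r); first by rewrite rmorphB e subrr.
by rewrite -(subrK r q) hs; apply: rat_int_add => //; exact: rat_int_ideal.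
Qed.

(** Polynomials with the same value in the fraction field agree modulo g X - 1. So the
    ring of definition can be studied inside a field, where integrality arguments take
    place. *)
Lemma ao_sl q : ao (io D q) <-> sl (ev q).
Proof. by rewrite ao_io; exact: rat_intE. Qed.

End FractionField.
#[global] Opaque FF fr ev.

(** * Restriction maps between rational localizations *)

Section ZeroRing.
Variable Q : comPzRingType.
Implicit Types a y z : Q.
Lemma inverse_relation a y z : a * y = 1 -> (a * y - 1) * z = 0.
Proof. by move=> ->; rewrite subrr mul0r. Qed.
Lemma zero_invertible a y : a = 0 -> a * y = 1 -> (1 : Q) = 0.
Proof. by move=> -> <-; rewrite mul0r. Qed.
Lemma zero_ring z : (1 : Q) = 0 -> z = 0.
Proof. by move=> h; rewrite -[z]mul1r h mul0r. Qed.
Lemma mul_pull a y z t : a * (y * (z * t)) = z * (a * (y * t)).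
Proof. by ring. Qed.
Lemma inverse_power a y F z j : a * y = 1 -> F * z = a ^+ j * F * (z * y ^+ j).
Proof.
move=> e; have -> : a ^+ j * F * (z * y ^+ j) = F * z * (a * y) ^+ j by rewrite exprMn; ring.
by rewrite e expr1n mulr1.
Qed.
End ZeroRing.

Lemma clear_power (L : fieldType) (e g F f : L) : f != 0 -> e * (g * F) = F * f * (e * (g / f)).
Proof. by move=> f0; field. Qed.

Section GraphMorphism.
Variables (Q Q' : comPzRingType) (G : Q -> Q' -> Prop).
Hypotheses (tot : forall x, exists y, G x y) (fn : forall x y z, G x y -> G x z -> y = z).
Hypotheses (GB : forall x x' y y', G x y -> G x' y' -> G (x - x') (y - y')).
Hypotheses (GM : forall x x' y y', G x y -> G x' y' -> G (x * x') (y * y')).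
Hypothesis (G1 : G 1 1).
Definition graph_fun x : Q' := projT1 (cid (tot x)).
Lemma graph_funP x : G x (graph_fun x). Proof. by rewrite /graph_fun; case: cid. Qed.
Fact graph_zmod : zmod_morphism graph_fun.
Proof. by move=> x y; apply: (fn (graph_funP _)); apply: GB; exact: graph_funP. Qed.
Fact graph_monoid : monoid_morphism graph_fun.
Proof.
split=> [|x y]; first exact: fn (graph_funP _) G1.
by apply: (fn (graph_funP _)); apply: GM; exact: graph_funP.
Qed.
HB.instance Definition _ := GRing.isZmodMorphism.Build Q Q' graph_fun graph_zmod.
HB.instance Definition _ := GRing.isMonoidMorphism.Build Q Q' graph_fun graph_monoid.
Lemma graph_hom : exists phi : {rmorphism Q -> Q'}, forall x, G x (phi x).
Proof. by exists (graph_fun : {rmorphism Q -> Q'}); exact: graph_funP. Qed.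
End GraphMorphism.

(** The target of the evaluation may be the zero ring, as rational subsets may be empty. *)
Section Evaluation.
Variables (B : comNzRingType) (Q : comPzRingType) (f : {rmorphism B -> Q}) (y : Q).
Definition hev (q : {poly B}) : Q := \sum_(i < size q) f q`_i * y ^+ i.
Lemma hev_wide d (q : {poly B}) : (size q <= d)%N -> hev q = \sum_(i < d) f q`_i * y ^+ i.
Proof.
move=> h; rewrite /hev (big_ord_widen d (fun i => f q`_i * y ^+ i) h) big_mkcond.
apply: eq_bigr => i _; case: ltnP => // hi; by rewrite nth_default // rmorph0 mul0r.
Qed.
Fact hev_zmod : zmod_morphism hev.
Proof.
move=> q r; pose d := maxn (size q) (size r).
have h : (size (q - r)%R <= d)%N by apply: leq_trans (size_polyD _ _) _; rewrite size_polyN.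
rewrite (hev_wide h) (hev_wide (leq_maxl (size q) (size r))) (hev_wide (leq_maxr (size q) (size r))).
by rewrite -sumrB; apply: eq_bigr => i _; rewrite coefB -mulrBl; congr (_ * _); exact: rmorphB.
Qed.
HB.instance Definition _ := GRing.isZmodMorphism.Build {poly B} Q hev hev_zmod.
Lemma hevC c : hev c%:P = f c.
Proof. by rewrite (hev_wide (size_polyC_leq1 c)) big_ord1 coefC eqxx expr0 mulr1. Qed.
Lemma hevCM c q : hev (c%:P * q) = f c * hev q.
Proof.
have h : (size (c%:P * q)%R <= size q)%N by rewrite mul_polyC; exact: size_scale_leq.
rewrite (hev_wide h) /hev mulr_sumr; apply: eq_bigr => i _.
by rewrite coefCM rmorphM mulrA.
Qed.
Lemma hevXM q : hev (q * 'X) = hev q * y.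
Proof.
have h : (size (q * 'X)%R <= (size q).+1)%N by apply: leq_trans (size_polyMleq _ _) _; rewrite size_polyX addn2.
rewrite (hev_wide h) big_ord_recl coefMX eqxx rmorph0 mul0r add0r /hev mulr_suml.
by apply: eq_bigr => i _; rewrite coefMX /= exprSr mulrA.
Qed.
Fact hev_monoid : monoid_morphism hev.
Proof.
split=> [|q r]; first by rewrite hevC rmorph1.
elim/poly_ind: q => [|q c ih]; first by rewrite mul0r !raddf0 mul0r.
by rewrite mulrDl !raddfD /= -mulrA ['X * r]mulrC mulrA !hevXM ih hevCM hevC mulrDl; ring.
Qed.
HB.instance Definition _ := GRing.isMonoidMorphism.Build {poly B} Q hev hev_monoid.
Lemma hevX : hev 'X = y.
Proof. by rewrite -['X]mul1r hevXM rmorph1 mul1r. Qed.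
End Evaluation.

Section Data.
Variables (R : realType) (p : nat) (K : perfectoidField R p) (n : nat).
Local Notation A := (PT K n).
Local Notation X := (perfDisk K n).

Definition std_num (s : seq A) M (i : 'I_(size s).+1) : perfTate K n := nth 0 (wA K n M :: s) i.
Arguments std_num : clear implicits.
Fact std_unit s M : exists a, \sum_i a i * std_num s M i = 1.
Proof.
exists (fun i => if i == ord0 then (kst A (topnil K ^- M) : perfTate K n) else 0).
rewrite (bigD1 ord0) //= big1 ?addr0 => [|i /negPf ->]; last by rewrite mul0r.
have h : kst A (topnil K ^- M) * wA K n M = 1 by rewrite -rmorphM mulVf ?rmorph1 // topnilX0.
exact: h.
Qed.

(** The rational subset where all elements of s and the constant w^M are at most g; the
    unit relation is automatic. *)
Definition std s M g : ratDatum K n := RatDatum (g : perfTate K n) (std_unit s M).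

Lemma stdP s M (g : A) (x : X) :
  rat_subset (std s M g) x <-> (forall a, a \in s -> val_le x a g) /\ val_le x (wA K n M) g.
Proof.
have pv := point_preval x; split=> [[h1 h2]|[h1 h2]].
  split=> [a /(nthP 0) [i hi <-]|]; last exact: (h1 ord0).
  by have := h1 (Ordinal (hi : (i.+1 < (size s).+1)%N)).
split; last exact: (pv_0 pv (pv_wA pv (N := M)) h2).
by move=> [[|i] hi]; [exact: h2 | apply: h1; exact: mem_nth].
Qed.

Definition den (D : ratDatum K n) : A := rat_den D.
Definition nums (D : ratDatum K n) : seq A := [seq (rat_num (r := D) i : A) | i : 'I_(rat_size D)].

Lemma nums_mem D i : (rat_num (r := D) i : A) \in nums D. Proof. by apply/mapP; exists i => //; rewrite mem_enum. Qed.

(** The denominator of a rational subset is bounded below, so a small constant may be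
    added to the numerators. *)
Lemma std_ex (D : ratDatum K n) : exists M, rat_subset (std (nums D) M (den D)) = rat_subset D.
Proof.
have [M hM] := rat_bound D; exists M; apply/seteqP; split=> x; rewrite stdP.
  move=> [h1 h2]; split; last exact: (pv_0 (point_preval x) (pv_wA (point_preval x) (N := M)) h2).
  by move=> i; apply: h1; exact: nums_mem.
move=> [h1 h2]; split; last exact: hM (point_preval x) h1.
by move=> a /mapP [i _ ->]; exact: h1.
Qed.

(** The rational subset is covered by the increasing sequence of sets w^N <= a, hence
    contained in one of them by compactness. *)
Lemma den_bound (D : ratDatum K n) (a : A) : (forall x, rat_subset D x -> ~ val_le x a 0) ->
  exists N, forall x, rat_subset D x -> val_le x (wA K n N) a.
Proof.
move=> h; have [x Dx|k [j cov]] := @rational_compact R p K n D nat (fun N => std [::] N a).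
  by have [N hN] := point_arch (h x Dx); exists N => //; apply/stdP.
exists (\max_l j l) => x /cov [l _ /stdP [_ hl]].
apply: (pv_trans (point_preval x) _ hl); apply: (pv_wA_decr (point_preval x)).
exact: leq_bigmax.
Qed.
End Data.
Arguments std {R p K n}.

Section Restriction.
Variables (R : realType) (p : nat) (K : perfectoidField R p) (n : nat).
Local Notation A := (PT K n).
Local Notation X := (perfDisk K n).
Local Notation w := (topnil K).
Local Notation fr := (@fr R p K n).
Local Notation wA := (wA K n).

Section Pair.
Variables (D D' : ratDatum K n).
Hypothesis sub : rat_subset D' `<=` rat_subset D.
Local Notation g := (rat_den D : A).
Local Notation g' := (rat_den D' : A).
Local Notation f i := (rat_num (r := D) i : A).
Local Notation Q := (QD D).
Local Notation Q' := (QD D').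

(** The subring supplies a point where the fractions defining D' are integral. *)
Lemma sl_point (S : set (FF K n)) y : g' != 0 -> subring_set S -> sl D' `<=` S -> S y ->
  ~ coprime_pair (fr (wA 1)) y S -> exists x : X, [/\ rat_subset D' x,
  (forall a b, fr a = y * fr b -> val_le x a b) &
  (forall a b, fr a = y * fr b -> ~ val_le x b 0 -> ~ val_le x b a)].
Proof.
move=> g0 hS sS Sy hp.
have uS : unit_ball fr `<=` S by move=> _ [a ha <-]; apply: sS; exact: sl_ball.
have [x [h1 h2]] := chevalley_point (@fr_inj R p K n) hS uS Sy hp; exists x.
split=> // [|a b e]; last exact: h1 e.
have hn i : val_le x (rat_num (r := D') i) g'.
  apply: (h1 _ _ (fr (rat_num (r := D') i : A) / fr g')); first by apply: sS; apply: adjoin_gen; exists i.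
  by rewrite divfK // fr_neq0.
have [M hM] := rat_bound D'; split=> //.
exact: (pv_0 (point_preval x) (pv_wA (point_preval x) (N := M)) (hM _ (point_preval x) hn)).
Qed.

(** As g is bounded below on D', no point has g smaller than w^(N+1). So g / w^(N+1) and
    w generate the unit ideal after adjunction of the former, and 1 - w r is a multiple
    of g for some r in the ring of definition; but 1 - w r is invertible by
    completeness. *)
Lemma den_unit : exists y : Q', can D' g * y = 1.
Proof.
have [g0|g0] := eqVneq g' 0; first by exists 0; rewrite [LHS](zero_den g0) [RHS](zero_den g0).
have [N hN] : exists N, forall x, rat_subset D' x -> val_le x (wA N) g.
  by apply: den_bound => x /sub [].
pose t := fr g / fr (wA N.+1); have w0 : fr (wA N.+1) != 0.
  by apply: fr_neq0; apply/eqP => h; have := nm_kst A (w ^+ N.+1); rewrite -/(wA N.+1) h nm0 => /esym/pf_abs_eq0/eqP; rewrite (negPf (topnilX0 _ _)).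
pose S := adjoin (sl D') [set t].
have hS : subring_set S by exact/adjoin_subring/sl_subring.
have St : S t by exact: adjoin_gen.
have [[s1 [s2 [h1 h2 e]]]|hp] := pselect (coprime_pair (fr (wA 1)) t S); last first.
  have [x [Dx _ hx]] := sl_point g0 hS (@adjoin_base _ _ _) St hp.
  have pv := point_preval x; case: (hx g (wA N.+1)); first by rewrite divfK.
    exact: (pv_wA pv).
  by apply: (pv_trans pv _ (hN x Dx)); exact: (pv_wA_decr pv).
have dec s : S s -> exists r q, [/\ rat_int D' r & s = ev D' r + fr g * ev D' q].
  elim=> [{}s hs|_ ->|{}s s' _ [r [q [hr ->]]] _ [r' [q' [hr' ->]]]|{}s s' _ [r [q [hr ->]]] _ [r' [q' [hr' ->]]]].
  - by have [r hr <-] := sl_ev hs; exists r, 0; split; rewrite // rmorph0 mulr0 addr0.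
  - exists 0, (kst A (w ^- N.+1))%:P; split; first exact: rat_int0.
    rewrite rmorph0 add0r evC /t; congr (_ * _).
    by apply: (mulIf w0); rewrite mulVf // -rmorphM /= -rmorphM mulVf ?topnilX0 // !rmorph1.
  - by exists (r + r'), (q + q'); split; [exact: rat_int_add | rewrite !rmorphD; ring].
  - exists (r * r'), (q * r' + r * q' + g%:P * q * q'); split; first exact: rat_int_mul.
    by rewrite !rmorphD !rmorphM evC; ring.
have [r1 [q1 [hr1 e1]]] := dec _ h1; have [r2 [q2 [hr2 e2]]] := dec _ h2.
pose q := q1 * (wA 1)%:P + (r2 + g%:P * q2) * (kst A (w ^- N.+1))%:P.
have tE : t = fr g * fr (kst A (w ^- N.+1)).
  rewrite /t; congr (_ * _).
  by apply: (mulIf w0); rewrite mulVf // -rmorphM /= -rmorphM mulVf ?topnilX0 // !rmorph1.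
have eq1 : io D' (1 - (wA 1)%:P * r1) = io D' (g%:P * q).
  apply: (ev_eq g0); rewrite !rmorphB !rmorphM !rmorphD !rmorphM !rmorphD !rmorphM !evC rmorph1 {1}e e1 e2 tE.
  by ring.
have [|y _ hy] := @lev1_unit R p K Q' (io D' (1 - (wA 1)%:P * r1)).
  rewrite rmorphB rmorph1 addrC addKr rmorphM; apply: levN.
  by exists (io D' r1); split=> //; exact/ao_io.
exists (io D' q * y); rewrite mulrA; move: hy; rewrite eq1 rmorphM.
by [].
Qed.

Variable y : Q'.
Hypothesis yV : can D' g * y = 1.

(** Put v = g / f_i. If w and v generated a proper ideal in the ring generated by v over
    the ring of definition of D', there would be a point of D' with g less than f_i. So
    they generate the unit ideal, and the relation between them says that h = f_i / g is
    a root of a polynomial over the ring of definition whose leading coefficient is 1 up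
    to a multiple of w, hence a unit; so all powers of h are combinations of finitely
    many of them. *)
Lemma frac_bounded i : exists C, forall e, ao (ak Q' (w ^+ C) * (can D' (f i) * y) ^+ e).
Proof.
have triv : (1 : Q') = 0 -> exists C, forall e, ao (ak Q' (w ^+ C) * (can D' (f i) * y) ^+ e).
  by move=> h; exists 0%N => e; rewrite [X in ao X](zero_ring _ h); exact: ao0.
have [g'0|g'0] := eqVneq g' 0; first by apply: triv; exact: zero_den.
have [g0|g0] := eqVneq g 0; first (apply: triv).
  have e0 : can D' g = 0.
    rewrite g0.
    exact: rmorph0.
  exact: zero_invertible e0 yV.
have [f0|f0] := eqVneq (f i) 0.
  have e0 : can D' (f i) * y = 0 by rewrite f0 [can D' _]rmorph0; exact: mul0r.
  exists 0%N => e; rewrite e0 expr0n; apply: aoM; first exact: ao_ak (topnil_le1 _ _).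
  by case: (e == 0)%N; [exact: ao1 | exact: ao0].
set h := can D' (f i) * y; pose v : FF K n := fr g / fr (f i).
have fg := fr_neq0 g0; have ff := fr_neq0 f0.
pose S := adjoin (sl D') [set v].
have hS : subring_set S by exact/adjoin_subring/sl_subring.
have Sv : S v by exact: adjoin_gen.
have [[s1 [s2 [h1 h2 e]]]|hp] := pselect (coprime_pair (fr (wA 1)) v S); last first.
  have [x [Dx hx1 hx2]] := sl_point g'0 hS (@adjoin_base _ _ _) Sv hp.
  have ev1 : fr g = v * fr (f i) by rewrite divfK.
  have [hn hg] := sub Dx; case: (hx2 _ _ ev1) => //.
  by apply: (pv_0 (point_preval x) hg); exact: hx1.
have [p1 [hp1 e1]] := adjoin_poly (sl_subring D') h1.
have [p2 [hp2 e2]] := adjoin_poly (sl_subring D') h2.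
have [l1 hl1] := choice (fun j => let: ex_intro2 r a b := sl_ev (hp1 j) in ex_intro (fun r => rat_int D' r /\ ev D' r = _) r (conj a b)).
have [l2 hl2] := choice (fun j => let: ex_intro2 r a b := sl_ev (hp2 j) in ex_intro (fun r => rat_int D' r /\ ev D' r = _) r (conj a b)).
pose d := maxn (size p1) (size p2).+1.
(* the relation e, with coefficients collected by powers of v = g / f_i; its
   constant term is divisible by w *)
pose rho j : {poly A} := (wA 1)%:P * l1 j + (if j is j'.+1 then l2 j' else 0).
have rel : \sum_(j < d) ev D' (rho j) * v ^+ j = 1.
  have d1 : (size p1 <= d)%N by exact: leq_maxl.
  have d2 : (size ('X * p2 : {poly FF K n})%R <= d)%N.
    by apply: leq_trans (size_polyMleq _ _) _; rewrite size_polyX addSn /=; exact: leq_maxr.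
  transitivity (fr (wA 1) * p1.[v] + ('X * p2).[v]); last first.
    by rewrite hornerM hornerX e e1 e2 mulrC [v * _]mulrC.
  rewrite (horner_coef_wide _ d1) (horner_coef_wide _ d2) mulr_sumr -big_split.
  apply: eq_bigr => j _ /=; rewrite rmorphD rmorphM evC (hl1 _).2 coefXM mulrDl mulrA.
  by case: (j : nat) => [|j'] /=; rewrite ?rmorph0 // (hl2 _).2.
have relQ : \sum_(j < d) io D' (rho j) * h ^+ (d - j) = h ^+ d.
  have : io D' (\sum_(j < d) rho j * (g ^+ j * f i ^+ (d - j))%:P) = can D' (f i ^+ d).
    apply: (ev_eq g'0); rewrite rmorph_sum evC rmorphXn -[RHS]mulr1 -rel mulr_sumr.
    apply: eq_bigr => j _; rewrite rmorphM evC rmorphM !rmorphXn expr_div_n.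
    have -> : fr (f i) ^+ d = fr (f i) ^+ (d - j) * fr (f i) ^+ j by rewrite -exprD subnK // ltnW.
    by apply: clear_power; rewrite expf_neq0.
  rewrite rmorph_sum => /(congr1 (fun z => z * y ^+ d)); rewrite rmorphXn -exprMn -/h => <-.
  rewrite mulr_suml; apply: eq_bigr => j _; rewrite rmorphM -mulrA; congr (_ * _).
  rewrite -canP rmorphM !rmorphXn /h exprMn.
  have -> : y ^+ d = y ^+ (d - j) * y ^+ j by rewrite -exprD subnK // ltnW.
  exact: inverse_power.
have dp : (0 < d)%N by rewrite /d leq_max orbT.
have aor j : ao (io D' (rho j)).
  apply/ao_io; apply: rat_int_add; last by case: j => [|j]; [exact: rat_int0 | exact: (hl2 _).1].
  by apply: rat_int_mul (hl1 _).1; exact: rat_intc (topnil_le1 _ _).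
(* so 1 minus the constant term is a unit, and h^d is an integral combination of
   lower powers *)
have [|u hu uV] := @lev1_unit R p K Q' (1 - io D' (rho 0%N)).
  rewrite addrC addKr; apply: levN; exists (io D' (l1 0%N)); split; first by apply/ao_io; exact: (hl1 _).1.
  by rewrite /rho addr0 rmorphM.
have [C hC] : exists C, forall e, (e < d)%N -> ao (ak Q' (w ^+ C) * h ^+ e).
  have [c hc] := choice (fun e : 'I_d => ao_absorb (h ^+ e)).
  exists (\max_e c e) => e0 he; apply: absorb_mono (hc (Ordinal he)); exact: (leq_bigmax (Ordinal he)).
exists C => e0; have [k] := ubnP e0; elim: k e0 => // k ih e0 ek.
have [/hC //|de] := ltnP e0 d.
have step : h ^+ d = \sum_(j < d.-1) u * io D' (rho j.+1) * h ^+ (d - j.+1).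
  pose F j := io D' (rho j) * h ^+ (d - j).
  have eF : \sum_(j < d) F j = F 0%N + \sum_(j < d.-1) F j.+1.
    by move: (F) dp; case: (d) => // d' F' _; rewrite big_ord_recl.
  rewrite -[LHS]mul1r -uV [_ * u]mulrC -mulrA mulrBl mul1r -{1}relQ -/(F _) eF /F subn0 addrC addKr.
  by rewrite mulr_sumr; apply: eq_bigr => j _; rewrite mulrA.
rewrite -(subnK de) exprD step !mulr_sumr; apply: ao_sum => j _.
have -> : ak Q' (w ^+ C) * (h ^+ (e0 - d) * (u * io D' (rho j.+1) * h ^+ (d - j.+1))) =
  u * io D' (rho j.+1) * (ak Q' (w ^+ C) * h ^+ (e0 - d + (d - j.+1))) by rewrite exprD; exact: mul_pull.
apply: aoM; first exact: aoM.
by apply: ih; have := ltn_ord j; lia.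
Qed.

Definition psi : {rmorphism {poly A} -> Q'} := hev (can D') y.
Lemma psiC a : psi a%:P = can D' a. Proof. exact: hevC. Qed.
Lemma psiX : psi 'X = y. Proof. exact: hevX. Qed.
Lemma psi_ideal s : psi ((g%:P * 'X - 1) * s) = 0.
Proof. by rewrite rmorphM rmorphB rmorphM rmorph1 psiC psiX; exact: inverse_relation. Qed.

(** The monomials in the finitely many power bounded f_i / g are bounded uniformly in
    the exponents. *)
Lemma psi_bounded : exists C, forall q, rat_int D q -> ao (ak Q' (w ^+ C) * psi q).
Proof.
have [c hc] := choice frac_bounded; pose C := (\sum_i c i)%N; exists C => q hq.
pose h i := can D' (f i) * y.
pose M z := forall e : 'I_(rat_size D) -> nat, ao (ak Q' (w ^+ C) * z * \prod_i h i ^+ e i).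
suff key z : M z -> M (psi q * z).
  have /key h1 : M 1; last by have := h1 (fun=> 0%N); rewrite mulr1 big1 ?mulr1.
  move=> e; rewrite mulr1 /C.
  have -> : ak Q' (w ^+ (\sum_i c i)) = \prod_i ak Q' (w ^+ c i).
    have pw (s : seq 'I_(rat_size D)) : w ^+ (\sum_(i <- s) c i) = \prod_(i <- s) w ^+ c i.
      by elim: s => [|i s ih]; rewrite ?big_nil ?big_cons ?expr0 // exprD ih.
    by rewrite pw rmorph_prod.
  rewrite -big_split /=; elim/big_ind: _ => [|a b|i _]; [exact: ao1 | exact: aoM | exact: hc].
elim: hq z => [a ha|i|s|{}q r _ hq _ hr|{}q r _ hq _ hr] z hz e.
- have -> : ak Q' (w ^+ C) * (psi a%:P * z) * \prod_i h i ^+ e i =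
    can D' a * (ak Q' (w ^+ C) * z * \prod_i h i ^+ e i) by rewrite psiC; ring.
  by apply: aoM (hz e); apply/ao_io; exact: rat_int_const.
- have := hz (fun j => (j == i) + e j)%N; congr ao.
  have -> : \prod_j h j ^+ ((j == i) + e j) = h i * \prod_j h j ^+ e j.
    rewrite (bigD1 i) //= [in RHS](bigD1 i) //= eqxx exprD mulrA; congr (_ * _).
    by apply: eq_bigr => j /negPf ->.
  by rewrite rmorphM psiC psiX -/(h i); ring.
- by rewrite psi_ideal mul0r mulr0 mul0r; exact: ao0.
- by rewrite rmorphD mulrDl mulrDr mulrDl; apply: aoD; [exact: hq | exact: hr].
- have -> : psi (q * r) * z = psi q * (psi r * z) by rewrite mulrA; congr (_ * _); exact: rmorphM.
  exact: (hq _ (hr _ hz)).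
Qed.

(** A bounded map on a dense subring extends to the completion; its graph is the closure
    of the graph on the subring. *)
Lemma restriction_ex_aux : exists phi : {rmorphism Q -> Q'}, (forall q, phi (io D q) = psi q) /\
  exists C, forall k x, lev (k + C) x -> lev k (phi x).
Proof.
have [C hC] := psi_bounded.
have psl k q : lev (k + C) (io D q) -> lev k (psi q).
  move=> /levE; rewrite akP canP -rmorphM => /ao_io /hC; rewrite rmorphM psiC => h.
  apply/levE; move: h; rewrite mulrA -akP -rmorphM; congr (ao (ak Q' _ * _)).
  by rewrite exprD invfM mulrCA mulfV ?mulr1 // topnilX0.
pose G x z := forall k, exists q, lev (k + C) (x - io D q) /\ lev k (z - psi q).
have Gio q : G (io D q) (psi q) by move=> k; exists q; rewrite !subrr; split; exact: lev_zero.
have [phi hphi] : exists phi : {rmorphism Q -> Q'}, forall x, G x (phi x).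
  apply: graph_hom.
  - move=> x; have [q hq] := choice (fun k => io_dense x (k + C)).
    have [|s hs] := lev_limit (u := fun k => psi (q k)).
      move=> k; rewrite -rmorphB; apply: psl; rewrite rmorphB.
      have -> : io D (q k.+1) - io D (q k) = (x - io D (q k)) - (x - io D (q k.+1)) by ring.
      by apply: levB => //; apply: lev_decr (hq k.+1); lia.
    by exists s => k; exists (q k).
  - move=> x z z' h h'; apply/eqP; rewrite -subr_eq0; apply/eqP/lev_sep => k.
    have [q [h1 h2]] := h k; have [q' [h3 h4]] := h' k.
    have -> : z - z' = (z - psi q) - (z' - psi q') + psi (q - q') by rewrite rmorphB; ring.
    apply: levD; first exact: levB.
    apply: psl; rewrite rmorphB.
    have -> : io D q - io D q' = (x - io D q') - (x - io D q) by ring.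
    exact: levB.
  - move=> x x' z z' h h' k; have [q [h1 h2]] := h k; have [q' [h3 h4]] := h' k.
    by exists (q - q'); rewrite !rmorphB !opprB !addrA ![_ + io D q' - _]addrAC; split; [have := levB h1 h3 | have := levB h2 h4]; congr lev; ring.
  - move=> x x' z z' h h' k.
    have [j1 a1] := lev_absorb x; have [j2 a2] := lev_absorb x'.
    have [j3 a3] := lev_absorb z; have [j4 a4] := lev_absorb z'.
    pose j := (j1 + j2 + j3 + j4)%N.
    have [q [h1 h2]] := h (k + j)%N; have [q' [h3 h4]] := h' (k + j)%N.
    have gen (B : adic K) (u u' v v' : B) l : (forall i (y0 : B), lev (i + j) y0 -> lev i (u * y0)) ->
        (forall i (y0 : B), lev (i + j) y0 -> lev i (u' * y0)) -> lev (l + j) (u - v) -> lev (l + j) (u' - v') -> lev l (u * u' - v * v').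
      move=> b1 b2 b3 b4; have -> : u * u' - v * v' = u * (u' - v') + u' * (u - v) - (u - v) * (u' - v') by ring.
      apply: levB; first by apply: levD; [exact: b1 | exact: b2].
      by apply: (lev_decr (leq_addr (j + (l + j)) l)); rewrite addnA; exact: levM.
    exists (q * q'); rewrite !rmorphM; split; apply: gen.
    + by move=> i y0 h0; apply: a1; apply: lev_decr h0; rewrite /j; lia.
    + by move=> i y0 h0; apply: a2; apply: lev_decr h0; rewrite /j; lia.
    + by apply: lev_decr h1; lia.
    + by apply: lev_decr h3; lia.
    + by move=> i y0 h0; apply: a3; apply: lev_decr h0; rewrite /j; lia.
    + by move=> i y0 h0; apply: a4; apply: lev_decr h0; rewrite /j; lia.
    + by [].
    + by [].
  - by have := Gio 1; rewrite !rmorph1.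
exists phi; split.
  move=> q; apply/eqP; rewrite -subr_eq0; apply/eqP/lev_sep => k.
  have [q' [h1 h2]] := hphi (io D q) k.
  have -> : phi (io D q) - psi q = (phi (io D q) - psi q') - psi (q - q') by rewrite rmorphB; ring.
  by apply: levB => //; apply: psl; rewrite rmorphB.
exists C => k x hx; have [q [h1 h2]] := hphi x k.
rewrite -(subrK (psi q) (phi x)); apply: levD => //; apply: psl.
by rewrite -[io D q](subKr x); exact: levB.
Qed.
End Pair.

Definition cont_res (D D' : ratDatum K n) (phi : {rmorphism QD D -> QD D'}) :=
  (forall a, phi (can D a) = can D' a) /\
  (forall k, exists i, forall x, lev i x -> lev k (phi x)).

Lemma restriction_ex (D D' : ratDatum K n) : rat_subset D' `<=` rat_subset D ->
  exists phi : {rmorphism QD D -> QD D'}, cont_res phi.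
Proof.
move=> sub; have [y yV] := den_unit sub; have [phi [h1 [C hC]]] := restriction_ex_aux sub yV.
exists phi; split=> [a|k]; first by rewrite canP h1 psiC.
by exists (k + C)%N => x; exact: hC.
Qed.

(** A continuous homomorphism is determined on A, then on 1 / g, which is an inverse,
    then on the closure of the subring generated by them. *)
Lemma restriction_unique (D D' : ratDatum K n) (phi phi' : {rmorphism QD D -> QD D'}) :
  cont_res phi -> cont_res phi' -> phi =1 phi'.
Proof.
move=> [h1 h2] [h1' h2'].
have hc a : phi (can D a) = phi' (can D a) by rewrite h1 h1'.
have hX : phi (io D 'X) = phi' (io D 'X).
  have e1 : phi (can D (rat_den D)) * phi (io D 'X) = 1 by rewrite -rmorphM io_gX rmorph1.
  have e2 : phi (can D (rat_den D)) * phi' (io D 'X) = 1 by rewrite hc -rmorphM io_gX rmorph1.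
  by rewrite -[LHS]mulr1 -e2 mulrA [phi _ * _]mulrC e1 mul1r.
have hp q : phi (io D q) = phi' (io D q).
  elim/poly_ind: q => [|q c ih]; first by rewrite !rmorph0.
  by rewrite !(rmorphD, rmorphM) ih hX -canP hc.
move=> x; apply/eqP; rewrite -subr_eq0; apply/eqP/lev_sep => k.
have [i hi] := h2 k; have [i' hi'] := h2' k; have [q hq] := io_dense x (maxn i i').
have -> : phi x - phi' x = phi (x - io D q) - phi' (x - io D q) by rewrite !rmorphB hp; ring.
by apply: levB; [apply: hi; apply: lev_decr hq; exact: leq_maxl | apply: hi'; apply: lev_decr hq; exact: leq_maxr].
Qed.

Section Res.
Variables (D D' : ratDatum K n).
Hypothesis sub : rat_subset D' `<=` rat_subset D.
Definition res : {rmorphism QD D -> QD D'} := projT1 (cid (restriction_ex sub)).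
Lemma resP : cont_res res. Proof. by rewrite /res; case: cid. Qed.
Lemma res_can a : res (can D a) = can D' a. Proof. exact: resP.1. Qed.
Lemma res_ak c : res (ak _ c) = ak _ c. Proof. by rewrite !akP res_can. Qed.
Lemma res_cont k : exists i, forall x, lev i x -> lev k (res x).
Proof. by have [_] := resP; apply. Qed.

Hypotheses (g0 : (rat_den D : A) != 0) (g0' : (rat_den D' : A) != 0).
Lemma res_io q q' : ev D q = ev D' q' -> res (io D q) = io D' q'.
Proof.
have [a [d [s hs]]] := single_fraction D q.
rewrite hs rmorphD ev_ideal // addr0 rmorphM rmorphXn evC evX => e.
rewrite !rmorphD io_ideal rmorph0 addr0 !rmorphM !rmorphXn.
have g1 : can D' (rat_den D) * res (io D 'X) = 1 by rewrite -res_can -rmorphM io_gX rmorph1.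
rewrite -canP res_can canP.
have <- : io D' (q' * (rat_den D : A)%:P ^+ d) = io D' a%:P.
  apply: (ev_eq g0'); rewrite rmorphM rmorphXn !evC -e exprVn divfK //.
  by rewrite expf_neq0 // fr_neq0.
by rewrite rmorphM rmorphXn -mulrA -exprMn -canP g1 expr1n mulr1.
Qed.

Lemma res_lev : sl D `<=` sl D' -> forall k x, lev k x -> lev k (res x).
Proof.
move=> ss k x hx; have [i hi] := res_cont k; have [q hq] := io_dense x (maxn i k).
rewrite -(subrK (io D q) x) rmorphD; apply: levD; first by apply: hi; apply: lev_decr hq; exact: leq_maxl.
have : lev k (io D q) by rewrite -[io D q](subKr x); apply: levB => //; apply: lev_decr hq; exact: leq_maxr.
move=> /levE h; apply/levE; move: h.
rewrite akP canP -rmorphM => /(ao_sl g0) /ss /sl_ev [r hr e].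
by rewrite -res_ak -rmorphM akP canP -rmorphM (res_io (esym e)); apply/ao_io.
Qed.
End Res.
End Restriction.

(** * Gluing over a two-term covering *)

Section Differences.
Variable Q : comPzRingType.
Lemma sub_common (x a b : Q) : a - b = (x - b) - (x - a). Proof. by ring. Qed.
Lemma sub_shuffle (c u1 u2 v1 v2 : Q) : v1 + v2 + c - (u1 + u2) = c - (u1 - v1) - (u2 - v2).
Proof. by ring. Qed.
End Differences.

Section Fractions.
Variable L : fieldType.
Implicit Types a b g h x y z : L.
Lemma mulf_div_eq a b g h : (a * b) / (g * h) = (a / g) * (b / h).
Proof. by rewrite mulf_div. Qed.
Lemma mulf_cancelr a g h : h != 0 -> (a * h) / (g * h) = a / g.
Proof. by move=> h0; rewrite mulf_div_eq divff // mulr1. Qed.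
Lemma mulf_cancell b g h : g != 0 -> (g * b) / (g * h) = b / h.
Proof. by move=> g0; rewrite mulf_div_eq divff // mul1r. Qed.
Lemma frac_trans a b g : b != 0 -> a / b * (b / g) = a / g.
Proof. by move=> b0; rewrite mulrA divfK. Qed.
Lemma inv_cancel_r x y : y != 0 -> y * (x * y)^-1 = x^-1.
Proof. by move=> y0; rewrite invfM mulrCA mulfV // mulr1. Qed.
Lemma inv_cancel_l x y : x != 0 -> x * (x * y)^-1 = y^-1.
Proof. by move=> x0; rewrite invfM mulrA mulfV // mul1r. Qed.
End Fractions.

Lemma set_eq (L : Type) (S S' : set L) : S `<=` S' -> S' `<=` S -> S = S'.
Proof. by move=> h h'; apply/seteqP. Qed.

(** A Laurent polynomial in h is a polynomial in h plus a polynomial in 1/h. *)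
Lemma adjoin_two (L : fieldType) (S : set L) h x : subring_set S -> h != 0 ->
  adjoin (adjoin S [set h]) [set h^-1] x ->
  exists x1 x2, [/\ adjoin S [set h] x1, adjoin S [set h^-1] x2 & x = x1 + x2].
Proof.
move=> hS h0; pose P x := exists x1 x2, [/\ adjoin S [set h] x1, adjoin S [set h^-1] x2 & x = x1 + x2].
have S1 := adjoin_subring hS [set h]; have S2 := adjoin_subring hS [set h^-1].
have PD x' y' : P x' -> P y' -> P (x' + y').
  move=> [a1 [a2 [h1 h2 ->]]] [b1 [b2 [h3 h4 ->]]]; exists (a1 + b1), (a2 + b2).
  by split; [exact: adjoin_add | exact: adjoin_add | rewrite addrACA].
have PS s x' : S s -> P x' -> P (s * x').
  move=> hs [a1 [a2 [h1 h2 ->]]]; exists (s * a1), (s * a2).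
  by split; [apply: adjoin_mul => //; exact: adjoin_base | apply: adjoin_mul => //; exact: adjoin_base | rewrite mulrDr].
(* one step of division by h or by its inverse *)
have div u v x' : u * v = 1 -> adjoin S [set v] x' ->
    exists s y, [/\ S s, adjoin S [set v] y & u * x' = u * s + y].
  move=> uv /(adjoin_poly hS) [q [hq ->]]; elim/poly_ind: q hq => [|q c ih] hq.
    by exists 0, 0; rewrite horner0 !mulr0 addr0; split=> //; [exact: subring0 | apply: adjoin_base; exact: subring0].
  exists c, q.[v]; split.
  - by have := hq 0%N; rewrite coefD coefMX coefC eqxx add0r.
  - rewrite horner_coef; apply: (subring_sum (adjoin_subring hS _)) => i _.
    apply: adjoin_mul; last by apply: (subringX (adjoin_subring hS _)); exact: adjoin_gen.
    by apply: adjoin_base; have := hq i.+1; rewrite coefD coefMX coefC addr0.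
  - by rewrite hornerMXaddC mulrDr addrC; congr (_ + _); rewrite mulrCA uv mulr1.
have Ph x' : P x' -> P (h * x').
  move=> [a1 [a2 [h1 h2 ->]]]; have [s [y [hs hy e]]] := div h h^-1 a2 (mulfV h0) h2.
  exists (h * a1 + h * s), y; split=> //; last by rewrite mulrDr e addrA.
  by apply: adjoin_add; apply: adjoin_mul => //; [exact: adjoin_gen | exact: adjoin_gen | exact: adjoin_base].
have Pi x' : P x' -> P (h^-1 * x').
  move=> [a1 [a2 [h1 h2 ->]]]; have [s [y [hs hy e]]] := div h^-1 h a1 (mulVf h0) h1.
  exists y, (h^-1 * s + h^-1 * a2); split=> //; last by rewrite mulrDr e [h^-1 * s + y]addrC addrA.
  by apply: adjoin_add; apply: adjoin_mul => //; [exact: adjoin_gen | exact: adjoin_base | exact: adjoin_gen].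
have P1 : P 1.
  exists 1, 0; rewrite addr0; split=> //; apply: adjoin_base; first by case: hS.
  exact: subring0.
have key1 y : adjoin S [set h] y -> forall x', P x' -> P (y * x').
  elim=> [{}y hy|_ ->|y1 y2 _ ih1 _ ih2|y1 y2 _ ih1 _ ih2] x' hx'.
  - exact: PS. - exact: Ph. - by rewrite mulrDl; apply: PD; [exact: ih1 | exact: ih2].
  - by rewrite -mulrA; apply: ih1; exact: ih2.
move=> hx; rewrite -[x]mulr1; move: (1) P1.
elim: hx => [y hy|_ ->|y1 y2 _ ih1 _ ih2|y1 y2 _ ih1 _ ih2] x' hx'.
- exact: key1. - exact: Pi. - by rewrite mulrDl; apply: PD; [exact: ih1 | exact: ih2].
- by rewrite -mulrA; apply: ih1; exact: ih2.
Qed.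

Section Covering.
Variables (R : realType) (p : nat) (K : perfectoidField R p) (n : nat).
Local Notation A := (PT K n).
Local Notation X := (perfDisk K n).
Local Notation w := (topnil K).
Local Notation fr := (@fr R p K n).
Local Notation wA := (wA K n).

Definition ev_sub (D D' : ratDatum K n) := forall q, exists q', ev D' q' = ev D q.

(** The properties that make D1 and D2 an acyclic covering of D0: they are algebraic
    conditions on the rings of definition in the fraction field, before completion. The
    conditions cov_ev' say that D1 arises from D0, and D12 from D2, without inverting
    new elements; so the fractions over D0 are dense in the sections over D1. *)
Record covering (D0 D1 D2 D12 : ratDatum K n) : Prop := Covering {
  cov_den : [/\ (rat_den D0 : A) != 0, (rat_den D1 : A) != 0, (rat_den D2 : A) != 0 &
    (rat_den D12 : A) != 0];
  cov1 : rat_subset D1 `<=` rat_subset D0;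
  cov2 : rat_subset D2 `<=` rat_subset D0;
  cov112 : rat_subset D12 `<=` rat_subset D1;
  cov212 : rat_subset D12 `<=` rat_subset D2;
  cov_sl : [/\ sl D0 `<=` sl D1, sl D0 `<=` sl D2, sl D1 `<=` sl D12 & sl D2 `<=` sl D12];
  cov_ev : [/\ ev_sub D0 D1, ev_sub D0 D2, ev_sub D1 D12 & ev_sub D2 D12];
  cov_ev' : ev_sub D1 D0 /\ ev_sub D12 D2;
  cov_sum : forall x, sl D12 x -> exists x1 x2, [/\ sl D1 x1, sl D2 x2 & x = x1 + x2];
  cov_strict : exists C, forall x, sl D1 x -> sl D2 x -> sl D0 (fr (wA C) * x) }.

Lemma lev_io (D : ratDatum K n) k q : (rat_den D : A) != 0 ->
  lev k (io D q) <-> sl D (fr (kst A (w ^- k)) * ev D q).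
Proof. by move=> g0; rewrite levE akP canP -rmorphM (ao_sl g0) rmorphM evC. Qed.

Lemma lev_kst (D : ratDatum K n) k q : ao (io D q) -> lev k (io D ((kst A (w ^+ k))%:P * q)).
Proof. by move=> h; exists (io D q); rewrite rmorphM akP canP. Qed.

Variables D0 D1 D2 D12 : ratDatum K n.
Hypothesis cov : covering D0 D1 D2 D12.
Let r1 := res (cov1 cov).
Let r2 := res (cov2 cov).
Let s1 := res (cov112 cov).
Let s2 := res (cov212 cov).

Let r1_lev k x : lev k x -> lev k (r1 x).
Proof. by have [g0 g1 g2 g3] := cov_den cov; have [h1 h2 h3 h4] := cov_sl cov; exact: res_lev. Qed.
Let r2_lev k x : lev k x -> lev k (r2 x).
Proof. by have [g0 g1 g2 g3] := cov_den cov; have [h1 h2 h3 h4] := cov_sl cov; exact: res_lev. Qed.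
Lemma cov_lev1 k x : lev k x -> lev k (s1 x).
Proof. by have [g0 g1 g2 g3] := cov_den cov; have [h1 h2 h3 h4] := cov_sl cov; exact: res_lev. Qed.
Lemma cov_lev2 k x : lev k x -> lev k (s2 x).
Proof. by have [g0 g1 g2 g3] := cov_den cov; have [h1 h2 h3 h4] := cov_sl cov; exact: res_lev. Qed.

(** The strictness of the covering extends from fractions to the completion by density. *)
Lemma cov_descent : exists C, forall k x, lev (k + C) (r1 x) -> lev (k + C) (r2 x) -> lev k x.
Proof.
have [g0 g1 g2 g3] := cov_den cov; have [e1 e2 _ _] := cov_ev cov.
have [C hC] := cov_strict cov; exists C => k x h1 h2.
have [q hq] := io_dense x (k + C).
rewrite -(subrK (io D0 q) x); apply: levD; first by apply: lev_decr hq; exact: leq_addr.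
have [q1 hq1] := e1 q; have [q2 hq2] := e2 q.
have l1 : lev (k + C) (io D1 q1).
  rewrite -(res_io (cov1 cov) g0 g1 (esym hq1)) -/(r1 _) -(subKr x (io D0 q)) rmorphB.
  by apply: levB => //; exact: r1_lev.
have l2 : lev (k + C) (io D2 q2).
  rewrite -(res_io (cov2 cov) g0 g2 (esym hq2)) -/(r2 _) -(subKr x (io D0 q)) rmorphB.
  by apply: levB => //; exact: r2_lev.
move: l1 l2 => /(lev_io _ _ g1) + /(lev_io _ _ g2); rewrite hq1 hq2 => l1 l2.
apply/(lev_io _ _ g0); have := hC _ l1 l2; rewrite mulrA -rmorphM /= -rmorphM.
have -> : topnil K ^+ C * w ^- (k + C) = w ^- k by rewrite exprD invfM mulrCA mulfV ?mulr1 // topnilX0.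
by [].
Qed.

Lemma cov_inj x : r1 x = 0 -> r2 x = 0 -> x = 0.
Proof.
move=> h1 h2; have [C hC] := cov_descent; apply: lev_sep => k; apply: hC.
  by rewrite h1; exact: lev_zero.
by rewrite h2; exact: lev_zero.
Qed.

(** Approximate x1 and x2 by fractions. Their difference is small on D12, hence the
    difference of small fractions on D1 and D2; after correction they agree, which gives
    an approximate solution. By descent these solutions form a Cauchy sequence. *)
Lemma cov_glue x1 x2 : s1 x1 = s2 x2 -> exists x, r1 x = x1 /\ r2 x = x2.
Proof.
move=> e12; have [g0 g1 g2 g3] := cov_den cov; have [e1 e2 e3 e4] := cov_ev cov.
have [e10 _] := cov_ev' cov.
have app k : exists x, lev k (x1 - r1 x) /\ lev k (x2 - r2 x).
  have [q1 h1] := io_dense x1 k; have [q2 h2] := io_dense x2 k.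
  have [q1' hq1] := e3 q1; have [q2' hq2] := e4 q2.
  have l12 : lev k (io D12 (q1' - q2')).
    rewrite rmorphB -(res_io (cov112 cov) g1 g3 (esym hq1)) -(res_io (cov212 cov) g2 g3 (esym hq2)) -/(s1 _) -/(s2 _).
    have -> : s1 (io D1 q1) - s2 (io D2 q2) = s2 (x2 - io D2 q2) - s1 (x1 - io D1 q1).
      by rewrite !rmorphB e12; exact: sub_common.
    by apply: levB; [exact: cov_lev2 | exact: cov_lev1].
  move: l12 => /(lev_io _ _ g3); rewrite rmorphB hq1 hq2 => /(cov_sum cov) [z1 [z2 [/sl_ev [t1 ht1 et1] /sl_ev [t2 ht2 et2] e]]].
  have hw : fr (kst A (w ^+ k)) * fr (kst A (w ^- k)) = 1.
    by rewrite -rmorphM /= -rmorphM mulfV ?topnilX0 // !rmorph1.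
  pose c := (kst A (w ^+ k))%:P : {poly A}.
  have E : ev D1 (q1 - c * t1) = ev D2 (q2 + c * t2).
    rewrite rmorphB rmorphD !rmorphM !evC et1 et2; apply/eqP; rewrite subr_eq -addrA -mulrDr [z2 + z1]addrC -e.
    by rewrite mulrA hw mul1r addrC subrK.
  have [q0 hq0] := e10 (q1 - c * t1); exists (io D0 q0); split.
    rewrite /r1 (res_io _ g0 g1 hq0) rmorphB opprB addrCA -[X in lev k X]addrC; apply: levD => //.
    by apply: lev_kst; exact/ao_io.
  rewrite /r2 (res_io _ g0 g2 (etrans hq0 E)) rmorphD opprD addrA; apply: levB => //.
  by apply: lev_kst; exact/ao_io.
have [C hC] := cov_descent; have [v hv] := choice app.
have [|s hs] := lev_limit (u := fun k => v (k + C)%N).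
  move=> k; apply: hC; rewrite rmorphB.
    have -> : r1 (v (k.+1 + C)%N) - r1 (v (k + C)%N) = (x1 - r1 (v (k + C)%N)) - (x1 - r1 (v (k.+1 + C)%N)).
      exact: sub_common.
    by apply: levB; [exact: (hv _).1 | apply: lev_decr (hv _).1; rewrite addSn].
  have -> : r2 (v (k.+1 + C)%N) - r2 (v (k + C)%N) = (x2 - r2 (v (k + C)%N)) - (x2 - r2 (v (k.+1 + C)%N)).
    exact: sub_common.
  by apply: levB; [exact: (hv _).2 | apply: lev_decr (hv _).2; rewrite addSn].
exists s; split; apply/eqP; rewrite -subr_eq0; apply/eqP/lev_sep => k.
  have -> : r1 s - x1 = r1 (s - v (k + C)%N) - (x1 - r1 (v (k + C)%N)).
    by rewrite rmorphB opprB addrA subrK.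
  by apply: levB; [exact: r1_lev | apply: (lev_decr (leq_addr C k)); exact: (hv _).1].
have -> : r2 s - x2 = r2 (s - v (k + C)%N) - (x2 - r2 (v (k + C)%N)).
  by rewrite rmorphB opprB addrA subrK.
by apply: levB; [exact: r2_lev | apply: (lev_decr (leq_addr C k)); exact: (hv _).2].
Qed.

(** The splitting of fractions, applied to successive remainders, and completeness. *)
Lemma cov_split z : ao z -> exists z1 z2, [/\ ao z1, ao z2 & z = s1 z1 + s2 z2].
Proof.
have [g0 g1 g2 g3] := cov_den cov; have [e1 e2 e3 e4] := cov_ev cov.
have step (x : QD D12) : exists t : QD D1 * QD D2 * QD D12, ao x ->
    [/\ ao t.1.1, ao t.1.2, ao t.2 & x = s1 t.1.1 + s2 t.1.2 + ak (QD D12) (w ^+ 1) * t.2].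
  have [hx|hx] := pselect (ao x); last by exists (0, 0, 0).
  have [q hq] := io_dense x 1.
  have : ao (io D12 q) by rewrite -(subKr x (io D12 q)); apply: aoB => //; exact: lev_ao hq.
  move=> /(ao_sl g3) /(cov_sum cov) [z1 [z2 [/sl_ev [t1 ht1 et1] /sl_ev [t2 ht2 et2] e]]].
  have [t1' ht1'] := e3 t1; have [t2' ht2'] := e4 t2.
  case: hq => z' [hz' ez']; exists (io D1 t1, io D2 t2, z') => _; split=> //=; try exact/ao_io.
  rewrite /s1 /s2 (res_io _ g1 g3 (esym ht1')) (res_io _ g2 g3 (esym ht2')) -ez' -rmorphD.
  have -> : io D12 (t1' + t2') = io D12 q by apply: (ev_eq g3); rewrite rmorphD ht1' ht2' et1 et2.
  by rewrite addrC subrK.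
have [t ht] := choice step => hz.
pose Z := fix Z k := if k is k'.+1 then (t (Z k')).2 else z.
have aZ k : ao (Z k) by elim: k => //= k /ht [].
have [|y1 h1] := @ao_complete _ _ _ (QD D1) (fun k => (t (Z k)).1.1).
  by move=> k; have [] := ht _ (aZ k).
have [|y2 h2] := @ao_complete _ _ _ (QD D2) (fun k => (t (Z k)).1.2).
  by move=> k; have [] := ht _ (aZ k).
exists y1, y2; split.
- by have [z' [hz' e]] := h1 0%N; apply/lev0E; exists z'; split=> //; rewrite -e big_ord0 subr0.
- by have [z' [hz' e]] := h2 0%N; apply/lev0E; exists z'; split=> //; rewrite -e big_ord0 subr0.
pose S1 N := \sum_(k < N) ak (QD D1) (w ^+ k) * (t (Z k)).1.1.
pose S2 N := \sum_(k < N) ak (QD D2) (w ^+ k) * (t (Z k)).1.2.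
have tele N : z = s1 (S1 N) + s2 (S2 N) + ak (QD D12) (w ^+ N) * Z N.
  elim: N => [|N ih].
    by rewrite /S1 /S2 !big_ord0 !raddf0 addr0 add0r expr0 rmorph1 mul1r.
  have [_ _ _ e] := ht _ (aZ N).
  rewrite {1}ih {1}e /S1 /S2 !big_ord_recr !rmorphD !rmorphM !res_ak /= -(addn1 N) exprD rmorphM.
  set u1 := s1 (\sum_(i < N) _); set u2 := s2 (\sum_(i < N) _).
  set b1 := s1 (t _).1.1; set b2 := s2 (t _).1.2; set k1 := ak _ _; set k2 := ak _ (w ^+ 1).
  by rewrite !mulrDr mulrA !addrA; congr (_ + _); rewrite -!addrA; congr (_ + _); rewrite addrCA.
apply/eqP; rewrite -subr_eq0; apply/eqP/lev_sep => N.
have -> : z - (s1 y1 + s2 y2) = ak (QD D12) (w ^+ N) * Z N - s1 (y1 - S1 N) - s2 (y2 - S2 N).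
  rewrite {1}(tele N) !rmorphB; move: (ak _ _ * _) (s1 _) (s2 _) (s1 _) (s2 _) => c u1 u2 v1 v2.
  exact: sub_shuffle.
apply: levB; first apply: levB.
- by exists (Z N).
- by apply: cov_lev1; case: (h1 N) => z' [? ?]; exists z'.
- by apply: cov_lev2; case: (h2 N) => z' [? ?]; exists z'.
Qed.

Lemma cov_dense z k : exists y, lev k (z - s2 y).
Proof.
have [g0 g1 g2 g3] := cov_den cov; have [_ e12] := cov_ev' cov.
have [q hq] := io_dense z k; have [q' hq'] := e12 q; exists (io D2 q').
by rewrite /s2 (res_io _ g2 g3 hq').
Qed.

Theorem cov_cartan N (G Gi : 'M[QD D12]_N) : approximable s2 G Gi ->
  exists (v1 v1' : 'M_N) (v2 v2' : 'M_N),
  [/\ v1 *m v1' = 1%:M, v2 *m v2' = 1%:M & map_mx s1 v1 = map_mx s2 v2 *m G].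
Proof.
have hk c : s1 (ak _ c) = ak _ c /\ s2 (ak _ c) = ak _ c by split; exact: res_ak.
have := @cartan R p K (QD D1) (QD D2) (QD D12) s1 s2 cov_lev1 cov_lev2 cov_split hk N G Gi.
exact.
Qed.
End Covering.

(** ** Dividing a rational subset *)

Section Triples.
Variables (R : realType) (p : nat) (K : perfectoidField R p) (n : nat).
Local Notation A := (PT K n).
Local Notation X := (perfDisk K n).
Local Notation fr := (@fr R p K n).
Local Notation wA := (wA K n).

Definition triple := (seq A * nat * A)%type.
Definition rd (t : triple) : ratDatum K n := std t.1.1 t.1.2 t.2.
Definition full (t : triple) : seq A := t.2 :: wA t.1.2 :: t.1.1.
Definition meet (t t' : triple) : triple :=
  ([seq x * y | x <- full t, y <- full t'], (t.1.2 + t'.1.2)%N, t.2 * t'.2).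

Lemma fullP (t : triple) x : x \in full t -> [\/ x = t.2, x = wA t.1.2 | x \in t.1.1].
Proof. by rewrite !in_cons => /or3P [/eqP|/eqP|]; [exact: Or31 | exact: Or32 | exact: Or33]. Qed.

Lemma rdP (t : triple) (x : X) : rat_subset (rd t) x <-> (forall a, a \in full t -> val_le x a t.2).
Proof.
rewrite stdP; split=> [[h1 h2] a|h]; last by split=> [a ha|]; apply: h; rewrite !inE ?ha ?eqxx ?orbT.
by rewrite !inE => /or3P [/eqP ->|/eqP ->|/h1] //; exact: (pv_refl (point_preval x)).
Qed.

Lemma rd_neq0 (t : triple) (x : X) : rat_subset (rd t) x -> ~ val_le x t.2 0.
Proof. by case. Qed.

Lemma meetE (t t' : triple) : rat_subset (rd (meet t t')) = rat_subset (rd t) `&` rat_subset (rd t').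
Proof.
have zero (x : X) a b : val_le x a 0 -> val_le x (a * b) 0.
  by move=> h; have := val_mul b h; rewrite mul0r.
apply/seteqP; split=> x; have pv := point_preval x.
  move=> h; have nz := rd_neq0 h; move: h => /stdP [h _].
  have n1 : ~ val_le x t.2 0 by move=> h0; apply: nz; exact: zero.
  have n2 : ~ val_le x t'.2 0 by move=> h0; apply: nz; rewrite /= mulrC; exact: zero.
  split; apply/rdP => a ha.
    by apply: (pv_cancel pv n2); apply: h; apply: allpairs_f => //; rewrite inE eqxx.
  by apply: (pv_cancel pv n1); rewrite ![_ * t.2]mulrC; apply: h; apply: allpairs_f => //; rewrite inE eqxx.
move=> [/rdP h /rdP h']; apply/stdP; split=> [_ /allpairsP [[a b] [ha hb ->]]|].
  by apply: (pv_mul2 pv); [exact: h | exact: h'].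
by rewrite wAD; apply: (pv_mul2 pv); [apply: h | apply: h']; rewrite !inE eqxx orbT.
Qed.

Definition gens (t : triple) : set (FF K n) := [set fr x / fr t.2 | x in [set x | x \in full t]].

Lemma gens_sl (t : triple) : t.2 != 0 -> gens t `<=` sl (rd t).
Proof.
move=> t0 _ [x + <-]; rewrite /= in_cons => /orP [/eqP ->|hx].
  by rewrite divff ?fr_neq0 //; case: (sl_subring (rd t)).
have [i hi hx'] := nthP 0 hx; apply: adjoin_gen.
by exists (Ordinal (hi : (i < (size t.1.1).+1)%N)); rewrite // -hx'.
Qed.

Lemma sl_least (t : triple) (S : set (FF K n)) : subring_set S -> unit_ball fr `<=` S -> gens t `<=` S ->
  sl (rd t) `<=` S.
Proof.
move=> hS uS gS; apply: adjoin_sub => // _ [i _ <-]; apply: gS.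
exists (nth 0 (wA t.1.2 :: t.1.1) i) => //=; rewrite in_cons; apply/orP; right.
by rewrite mem_nth // ltn_ord.
Qed.

Lemma ball_sl (t : triple) : unit_ball fr `<=` sl (rd t). Proof. exact: adjoin_base. Qed.

Lemma sl_meet (t t' : triple) : t.2 != 0 -> t'.2 != 0 ->
  sl (rd (meet t t')) = adjoin (sl (rd t)) (gens t').
Proof.
move=> t0 t0'; have m0 : (meet t t').2 != 0 by rewrite mulf_neq0.
have f0 := fr_neq0 t0; have f0' := fr_neq0 t0'.
have hS := sl_subring (rd t); have hA := adjoin_subring hS (gens t').
apply/seteqP; split.
  apply: sl_least => //; first by move=> x /(@ball_sl t); exact: adjoin_base.
  have key a b : a \in full t -> b \in full t' -> adjoin (sl (rd t)) (gens t') (fr (a * b) / fr (t.2 * t'.2)).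
    move=> ha hb; have -> : fr (a * b) / fr (t.2 * t'.2) = (fr a / fr t.2) * (fr b / fr t'.2).
      by rewrite !rmorphM; exact: mulf_div_eq.
    apply: adjoin_mul; last by apply: adjoin_gen; exists b.
    by apply: adjoin_base; apply: gens_sl => //; exists a.
  have fd u : u.2 \in full u by rewrite inE eqxx.
  have fw u : wA u.1.2 \in full u by rewrite !inE eqxx orbT.
  move=> _ [x /fullP [->|->|/allpairsP [[a b] [ha hb ->]]] <-]; [exact: key | | exact: key].
  by rewrite /= wAD; exact: key.
have fd u : u.2 \in full u by rewrite inE eqxx.
have inm a b : a \in full t -> b \in full t' -> a * b \in full (meet t t').
  by move=> ha hb; rewrite 2!in_cons; apply/or3P/Or33; exact: allpairs_f.
apply: adjoin_sub; first exact: sl_subring.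
  apply: sl_least; [exact: sl_subring | exact: ball_sl |] => _ [a ha <-].
  apply: gens_sl => //; exists (a * t'.2); first exact: inm.
  by rewrite /= !rmorphM; exact: mulf_cancelr.
move=> _ [b hb <-]; apply: gens_sl => //; exists (t.2 * b); first exact: inm.
by rewrite /= !rmorphM; exact: mulf_cancell.
Qed.
End Triples.

Section Division.
Variables (R : realType) (p : nat) (K : perfectoidField R p) (n : nat).
Local Notation A := (PT K n).
Local Notation T := (TA K n).
Local Notation X := (perfDisk K n).
Local Notation w := (topnil K).
Local Notation fr := (@fr R p K n).
Local Notation wA := (wA K n).

Lemma ev_sub_den (D D' : ratDatum K n) : (exists q, ev D' q = (fr (rat_den D))^-1) -> ev_sub D D'.
Proof.
move=> [r hr]; elim/poly_ind => [|q c [q' hq']]; first by exists 0; rewrite !rmorph0.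
exists (q' * r + c%:P); rewrite !rmorphD !rmorphM hq' hr !evC; congr (_ * _ + _).
by rewrite evX.
Qed.

Lemma ev_sub_mul (D D' : ratDatum K n) c : c != 0 -> (rat_den D' : A) = (rat_den D : A) * c -> ev_sub D D'.
Proof.
move=> c0 e; apply: ev_sub_den; exists (c%:P * 'X); rewrite rmorphM evC evX e rmorphM.
by apply: inv_cancel_r; exact: fr_neq0.
Qed.

Lemma ev_sub_div (D D' : ratDatum K n) c e j : (rat_den D : A) != 0 ->
  (rat_den D' : A) = (rat_den D : A) * c -> c * e = (rat_den D : A) ^+ j -> ev_sub D' D.
Proof.
move=> d0 h h'; apply: ev_sub_den; exists (e%:P * 'X^j * 'X).
rewrite !rmorphM rmorphXn evC evX h rmorphM exprVn.
have f0 := fr_neq0 d0.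
have : fr c * fr e = fr (rat_den D : A) ^+ j by rewrite -rmorphM h' rmorphXn.
move=> ce; have n0 : fr c * fr e != 0 by rewrite ce expf_neq0.
have e0 : fr e != 0 by apply: contraNneq n0 => ->; rewrite mulr0.
by rewrite -ce mulrC [fr c * _]mulrC inv_cancel_l // invfM.
Qed.

Section Level.
Variables (m : nat) (s : seq T) (M N : nat) (g a b : T).
Hypotheses (g0 : g != 0) (a0 : a != 0) (b0 : b != 0).
Let lv := level m : chom T A.
Let kT c : T := kst T c.

Definition lvS : seq T := [seq x * y | x <- g :: kT (w ^+ M) :: s, y <- [:: b; kT (w ^+ N)]].

(** The constant w^N is at most b on the rational subset, so w^N / b may be added to its
    ring of definition. Then h = a / b alone generates the ring of definition of D1 over
    that of D0, and 1 / h that of D2. *)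
Definition tr0 : triple K n := ([seq lv x | x <- lvS], (M + N)%N, lv (g * b)).
Definition tr1 := meet tr0 ([:: lv a], N, lv b).
Definition tr2 := meet tr0 ([:: lv b], N, lv a).
Definition tr12 := meet tr1 tr2.

Lemma lv_w k : lv (kT (w ^+ k)) = wA k. Proof. exact: ch_kst. Qed.
Lemma lv_inj : injective lv.
Proof.
move=> x y e; apply/eqP; rewrite -subr_eq0; apply/eqP/nm_eq0.
by rewrite -(@level_iso R p K n m) rmorphB e subrr nm0.
Qed.
Lemma lv_neq0 x : x != 0 -> lv x != 0.
Proof. by move=> x0; rewrite -(rmorph0 lv) (inj_eq lv_inj). Qed.

Lemma tr0E : tr0 = meet ([seq lv x | x <- s], M, lv g) ([::], N, lv b).
Proof.
have e (s1 s2 : seq T) : [seq lv x | x <- [seq x * y | x <- s1, y <- s2]] =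
    [seq x * y | x <- [seq lv x | x <- s1], y <- [seq lv x | x <- s2]].
  by rewrite map_allpairs allpairs_mapl allpairs_mapr; apply: eq_allpairs => x y; exact: rmorphM.
by rewrite /tr0 /lvS e rmorphM /meet /full -!lv_w.
Qed.

Let h : FF K n := fr (lv a) / fr (lv b).
Let fa := fr_neq0 (lv_neq0 a0).
Let fb := fr_neq0 (lv_neq0 b0).
Let fg := fr_neq0 (lv_neq0 g0).
Let h0 : h != 0. Proof. exact: mulf_neq0 fa (invr_neq0 fb). Qed.
Let d0 : tr0.2 != 0. Proof. by rewrite lv_neq0 // mulf_neq0. Qed.
Let d1 : tr1.2 != 0. Proof. by rewrite mulf_neq0 // lv_neq0. Qed.
Let d2 : tr2.2 != 0. Proof. by rewrite mulf_neq0 // lv_neq0. Qed.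
Let d12 : tr12.2 != 0. Proof. by rewrite mulf_neq0. Qed.

Let sl_wb : sl (rd tr0) (fr (wA N) / fr (lv b)).
Proof.
rewrite tr0E sl_meet ?lv_neq0 //; apply: adjoin_gen; exists (wA N) => //.
by rewrite /= !in_cons eqxx orbT.
Qed.

Lemma sl_tr1 : sl (rd tr1) = adjoin (sl (rd tr0)) [set h].
Proof.
have hS := sl_subring (rd tr0).
rewrite (sl_meet d0 (lv_neq0 b0 : ([:: lv a], N, lv b).2 != 0)); apply: (@set_eq (FF K n)); apply: adjoin_sub; try exact: adjoin_subring.
- exact: adjoin_base.
- move=> _ [x /fullP [->|->|hx] <-].
  + by rewrite (divff fb); apply: adjoin_base; case: hS.
  + exact: adjoin_base.
  + by move: hx; rewrite mem_seq1 => /eqP ->; exact: adjoin_gen.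
- exact: adjoin_base.
- move=> _ ->; apply: adjoin_gen; exists (lv a) => //.
  by rewrite /= !in_cons eqxx !orbT.
Qed.

Lemma sl_tr2 : sl (rd tr2) = adjoin (sl (rd tr0)) [set h^-1].
Proof.
have hS := sl_subring (rd tr0); have hi : h^-1 = fr (lv b) / fr (lv a) by rewrite invf_div.
rewrite (sl_meet d0 (lv_neq0 a0 : ([:: lv b], N, lv a).2 != 0)); apply: (@set_eq (FF K n)); apply: adjoin_sub; try exact: adjoin_subring.
- exact: adjoin_base.
- move=> _ [x /fullP [->|->|hx] <-].
  + by rewrite (divff fa); apply: adjoin_base; case: hS.
  + have -> : fr (wA N) / fr (lv a) = fr (wA N) / fr (lv b) * h^-1 by rewrite hi; exact: (esym (frac_trans _ _ fb)).
    by apply: adjoin_mul; [exact: adjoin_base | exact: adjoin_gen].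
  + by move: hx; rewrite mem_seq1 => /eqP ->; rewrite -hi; exact: adjoin_gen.
- exact: adjoin_base.
- move=> _ ->; rewrite hi; apply: adjoin_gen; exists (lv b) => //.
  by rewrite /= !in_cons eqxx !orbT.
Qed.

Lemma sl_tr12 : sl (rd tr12) = adjoin (adjoin (sl (rd tr0)) [set h]) [set h^-1].
Proof.
have hS := sl_subring (rd tr0).
have e2 := sl_tr2; have e1 := sl_tr1.
rewrite sl_meet // e1; apply: (@set_eq (FF K n)); apply: adjoin_sub; do ?exact/adjoin_subring/adjoin_subring.
- exact: adjoin_base.
- move=> x /(gens_sl d2); rewrite e2; move: x; apply: adjoin_sub; first exact/adjoin_subring/adjoin_subring.
    by move=> x hx; do 2!apply: adjoin_base.
  exact: adjoin_gen.
- exact: adjoin_base.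
- move=> _ ->; rewrite -e1 -sl_meet //.
  have : sl (rd tr2) h^-1 by rewrite e2; exact: adjoin_gen.
  rewrite -/tr12; move: (h^-1); apply: sl_least; [exact: sl_subring | exact: ball_sl |].
  by rewrite sl_meet //; exact: adjoin_gen.
Qed.

(** The element h = a / b is a polynomial in the fractions that define tr0, because w^N
    / b is one of them. *)
Lemma strict_level : exists C, forall x, sl (rd tr1) x -> sl (rd tr2) x -> sl (rd tr0) (fr (wA C) * x).
Proof.
pose k := (size lvS).+1; pose f l := nth 0 (kT (w ^+ (M + N)) :: lvS) l.
pose u (l : nat) : T := if l == 0%N then kT (w ^- (M + N)) else 0.
have fu : \sum_(l < k) u l * f l = 1.
  rewrite big_ord_recl big1 ?addr0 => [|i _]; last by rewrite /u /= mul0r.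
  by rewrite /u /f /= -rmorphM mulVf ?rmorph1 // topnilX0.
have gb0 : g * b != 0 by rewrite mulf_neq0.
pose phi : {rmorphism T -> FF K n} := fr \o lv.
have latE : lat m fr k f (g * b) = sl (rd tr0).
  apply: (@set_eq (FF K n)).
    apply: adjoin_sub; [exact: sl_subring | exact: ball_sl |] => _ [l lk <-].
    apply: gens_sl => //; exists (lv (f l)) => //.
    rewrite /= in_cons; apply/orP; right.
    have hl : (l < size (kT (w ^+ (M + N)) :: lvS))%N := lk.
    by have := map_f lv (mem_nth 0 hl); rewrite -/(f l) /= lv_w.
  apply: sl_least; [exact: lat_subring | exact: adjoin_base |] => _ [x /fullP [->|->|hx] <-].
  - by rewrite divff ?fr_neq0 //; case: (lat_subring m fr k f (g * b)).
  - apply: adjoin_gen; exists 0%N => //; by rewrite /nfrac /f /= lv_w.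
  - have /mapP [y hy ->] := hx; have [i hi <-] := nthP 0 hy.
    by apply: adjoin_gen; exists i.+1.
have [l0 [l0k hl0]] : exists l0, (l0 < k)%N /\ f l0 = g * kT (w ^+ N).
  have hin : g * kT (w ^+ N) \in lvS.
    by apply: allpairs_f; rewrite !in_cons eqxx ?orbT.
  have [i hi e] := nthP 0 hin; by exists i.+1.
pose H : npoly T k := nconst T k (a * kT (w ^- N)) * nvar T k l0.
have nH : nev phi k f (g * b) H = h.
  rewrite rmorphM [X in X * _]neval_const [X in _ * X]neval_var // /nfrac hl0 /phi /=.
  have e : a * kT (w ^- N) * (g * kT (w ^+ N)) = g * a.
    have : kT (w ^- N) * kT (w ^+ N) = 1 by rewrite -rmorphM mulVf ?rmorph1 // topnilX0.
    by rewrite mulrACA => ->; rewrite mulr1 mulrC.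
  by rewrite mulrA -2!rmorphM e 2!rmorphM /= 2!rmorphM mulf_cancell.
have hH : nev phi k f (g * b) H != 0 by rewrite nH.
have [c [c0 c1 hc]] := strict_covering (@fr_inj R p K n) gb0 fu hH.
rewrite -/phi nH latE in hc.
have [C hC] := topnil_small K (pf_abs_gt0 c0); exists C => x; rewrite sl_tr1 sl_tr2 => h1 h2.
have -> : wA C = kst A (w ^+ C / c) * kst A c by rewrite -rmorphM divfK.
rewrite rmorphM -mulrA; apply: adjoin_mul; last exact: hc.
apply: sl_ball; rewrite nm_kst pf_absM pf_absV ler_pdivrMr ?mul1r //; exact: pf_abs_gt0.
Qed.

Lemma covering_level : covering (rd tr0) (rd tr1) (rd tr2) (rd tr12).
Proof.
have hS := sl_subring (rd tr0).
have la : lv a != 0 by exact: lv_neq0.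
have lb : lv b != 0 by exact: lv_neq0.
have e0 : tr0.2 = lv g * lv b by exact: rmorphM.
split.
- by split.
- by rewrite meetE => x [].
- by rewrite meetE => x [].
- by rewrite meetE => x [].
- by rewrite meetE => x [].
- split; rewrite ?sl_tr1 ?sl_tr2 ?sl_tr12; try exact: adjoin_base.
  apply: adjoin_sub; [exact/adjoin_subring/adjoin_subring | | exact: adjoin_gen].
  by move=> x hx; do 2!apply: adjoin_base.
- split.
  + exact: (ev_sub_mul (c := lv b)).
  + exact: (ev_sub_mul (c := lv a)).
  + exact: (ev_sub_mul (c := tr2.2)).
  + by apply: (ev_sub_mul (c := tr1.2)) => //; exact: mulrC.
- split.
    apply: (ev_sub_div (c := lv b) (e := lv g) (j := 1)) => //.
    by rewrite expr1 [RHS]e0 mulrC.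
  apply: (ev_sub_div (c := tr1.2) (e := lv g * lv a ^+ 2) (j := 2)) => //; first exact: mulrC.
  have -> : tr1.2 = lv g * lv b * lv b by rewrite -e0.
  have -> : (rat_den (rd tr2) : A) = lv g * lv b * lv a by rewrite -e0.
  by move: (lv a) (lv b) (lv g) => x y z; rewrite !expr2; ring.
- by move=> x; rewrite sl_tr12 sl_tr1 sl_tr2; exact: adjoin_two.
- exact: strict_level.
Qed.
End Level.
End Division.

(** ** Reduction to finite level *)

Section Perturbation.
Variables (R : realType) (p : nat) (K : perfectoidField R p) (n : nat).
Local Notation A := (PT K n).
Local Notation T := (TA K n).
Local Notation X := (perfDisk K n).
Local Notation w := (topnil K).
Local Notation wA := (wA K n).
Local Notation close E a b := (nm (a - b : A) <= pf_abs (w ^+ E)).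

(** An element approximated by 0 is replaced by a small constant, to keep the
    denominators nonzero. *)
Lemma level_dense_seq (s : seq A) E : exists m (phi : A -> T), forall x, x \in s ->
  phi x != 0 /\ close E x (level m (phi x)).
Proof.
have e0 : 0 < pf_abs (w ^+ E) by apply: pf_abs_gt0; exact: topnilX0.
have [m hm] : exists m0, forall m, (m0 <= m)%N -> forall x, x \in s ->
    exists t : T, close E x (level m t).
  elim: s => [|y s [m0 h0]]; first by exists 0%N.
  have [m1 h1] := level_dense y e0; exists (maxn m0 m1) => m; rewrite geq_max => /andP [h2 h3] x.
  by rewrite inE => /orP [/eqP ->|hx]; [exact: h1 | exact: h0].
have ex (x : A) : exists t : T, x \in s -> t != 0 /\ close E x (level m t).
  have [hx|//] := boolP (x \in s); last by exists 0.
  have [t ht] := hm m (leqnn m) x hx; have [t0|t0] := eqVneq t 0; last by exists t.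
  exists (kst T (w ^+ E)) => _; split.
    by apply/eqP => h; have := nm_kst T (w ^+ E); rewrite h nm0 => /esym/pf_abs_eq0/eqP; rewrite (negPf (topnilX0 _ _)).
  rewrite ch_kst; move: ht; rewrite t0 rmorph0 subr0 => ht.
  by apply: nmB_le => //; rewrite nm_kst.
by have [phi hphi] := choice ex; exists m, phi.
Qed.

Lemma close_sym E a b : close E a b -> close E b a.
Proof. by rewrite -opprB nmN. Qed.

Section Point.
Variable x : X.
Let pv := point_preval x.

Lemma close_le M E a a' g : (M <= E)%N -> close E a a' -> val_le x (wA M) g -> val_le x a g ->
  val_le x a' g.
Proof.
move=> ME /wA_div [z hz e] hM h; have -> : a' = a + wA E * (- z) by rewrite mulrN -e subKr.
apply: (pv_add pv) => //; apply: (pv_trans pv _ hM); apply: (pv_trans pv _ (pv_wA_decr pv ME)).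
by rewrite mulrC; apply: (pv_intl pv); rewrite nmN.
Qed.

Lemma close_eq M E a a' : (M < E)%N -> close E a a' -> val_le x (wA M) a ->
  val_le x a a' /\ val_le x a' a.
Proof.
move=> ME h hM; split; last by apply: close_le h hM (pv_refl pv a); exact: ltnW.
have [h'|h'] := pv_total pv (wA E) a'.
  exact: close_le (leqnn E) (close_sym h) h' (pv_refl pv a').
have h1 := close_le (leqnn E) (close_sym h) (pv_refl pv (wA E)) h'.
case: (wA_strict pv (@point_small _ _ _ _ x) (N := M)).
exact: (pv_trans pv hM (pv_trans pv h1 (pv_wA_decr pv ME))).
Qed.

Lemma close_den M E a a' : (M < E)%N -> close E a a' -> val_le x (wA M) a -> val_le x (wA M) a'.
Proof. by move=> ME h hM; exact: (pv_trans pv hM (close_eq ME h hM).1). Qed.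

(** By the ultrametric inequality a perturbation smaller than the right hand side does
    not change the value of that side, and keeps the left hand side below it. *)
Lemma close_ineq M E a a' g g' : (M < E)%N -> close E a a' -> close E g g' ->
  val_le x (wA M) g -> val_le x a g -> val_le x a' g'.
Proof.
move=> ME ha hg hM h; apply: (pv_trans pv _ (close_eq ME hg hM).1).
exact: close_le (ltnW ME) ha hM h.
Qed.
End Point.

(** A rational subset is unchanged by small perturbations of its data, so all data may
    be assumed to come from a finite level, where the covering is acyclic. *)
Theorem split_covering (D : ratDatum K n) (a b : A) N :
  (forall x, rat_subset D x -> val_le x (wA N) b) ->
  exists D0 D1 D2 D12, covering D0 D1 D2 D12 /\
  [/\ rat_subset D0 = rat_subset D,
      rat_subset D1 = rat_subset D `&` [set x | val_le x a b],
      rat_subset D2 = rat_subset D `&` [set x | val_le x b a] &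
      rat_subset D12 = rat_subset D1 `&` rat_subset D2].
Proof.
move=> hb; have [M eD] := std_ex D; move: eD; set s := nums D; set g := den D => eD.
(* smaller than the lower bounds of both denominators g and b *)
pose E := (maxn M N).+1.
have ME : (M < E)%N by rewrite ltnS leq_maxl.
have NE : (N < E)%N by rewrite ltnS leq_maxr.
have [m [phi hphi]] := level_dense_seq (g :: a :: b :: s) E.
have [g0 cg] := hphi g (mem_head _ _).
have [a0 ca] : phi a != 0 /\ close E a (level m (phi a)) by apply: hphi; rewrite !inE eqxx ?orbT.
have [b0 cb] : phi b != 0 /\ close E b (level m (phi b)) by apply: hphi; rewrite !inE eqxx ?orbT.
have cs y : y \in s -> close E y (level m (phi y)) by move=> hy; apply: (hphi y _).2; rewrite !inE hy !orbT.
have h0 := @covering_level R p K n m (map phi s) M N (phi g) (phi a) (phi b) g0 a0 b0.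
have e0 : rat_subset (rd (tr0 m (map phi s) M N (phi g) (phi b))) = rat_subset D.
  rewrite tr0E meetE -eD; apply/seteqP; split=> x.
    move=> [/stdP [h1 h2] /stdP [_ h3]]; apply/stdP; split; last exact: close_den ME (close_sym cg) h2.
    move=> y hy; apply: (close_ineq ME (close_sym (cs y hy)) (close_sym cg) h2).
    by apply: h1; rewrite -map_comp; apply/mapP; exists y.
  move=> hx; have := hb x; rewrite -eD => /(_ hx) hN; move: hx => /stdP [h1 h2].
  split; apply/stdP; split=> //=; [| exact: close_den ME cg h2 | exact: close_den NE cb hN].
  move=> y'; rewrite -map_comp => /mapP [y hy ->]; apply: (close_ineq ME (cs y hy) cg h2).
  exact: h1.
exists (rd (tr0 m (map phi s) M N (phi g) (phi b))), (rd (tr1 m (map phi s) M N (phi g) (phi a) (phi b))).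
exists (rd (tr2 m (map phi s) M N (phi g) (phi a) (phi b))), (rd (tr12 m (map phi s) M N (phi g) (phi a) (phi b))).
split=> //; split; rewrite ?meetE ?e0 //; apply/seteqP; split=> x.
- move=> [Dx /stdP [h1 h2]]; split=> //; apply: (close_ineq NE (close_sym ca) (close_sym cb) h2).
  by apply: h1; rewrite inE.
- move=> [Dx /= h]; split=> //; have hN := hb x Dx; apply/stdP; split; last exact: close_den NE cb hN.
  by move=> y; rewrite inE => /eqP ->; exact: close_ineq NE ca cb hN h.
- move=> [Dx /stdP [h1 h2]]; split=> //; apply: (close_ineq NE (close_sym cb) (close_sym ca) h2).
  by apply: h1; rewrite inE.
- move=> [Dx /= h]; split=> //; have hN := pv_trans (point_preval x) (hb x Dx) h.
  apply/stdP; split; last exact: close_den NE ca hN.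
  by move=> y; rewrite inE => /eqP ->; exact: close_ineq NE cb ca hN h.
Qed.
End Perturbation.

(** * The structure sheaf *)

#[local] Transparent QD io can.
Section Bridge.
Variables (R : realType) (p : nat) (K : perfectoidField R p) (n : nat).
Implicit Types D : ratDatum K n.

Lemma lev_cont D D' (phi : {rmorphism QD D -> QD D'}) :
  (forall j, exists i, forall s : QD D, completion_nbh i s -> completion_nbh j (phi s)) <->
  (forall k, exists i, forall x, lev i x -> lev k (phi x)).
Proof.
split=> h k.
  have [j hj] := @lev_nbh _ _ K n D' k; have [i hi] := h j; exists i => x [z [hz ->]].
  by apply: hj; apply: hi; exact: pow_nbh.
have [i hi] := h k; have [j hj] := @lev_nbh _ _ K n D i; exists j => s hs.
by have [z [hz ->]] := hi s (hj s hs); exact: pow_nbh.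
Qed.

Lemma restriction_cont D D' (phi : {rmorphism rat_ring D -> rat_ring D'}) :
  rat_restriction phi -> cont_res (phi : {rmorphism QD D -> QD D'}).
Proof. by move=> [h1 h2]; split=> [a|]; [exact: h1 | exact/lev_cont]. Qed.

Lemma cont_restriction D D' (phi : {rmorphism QD D -> QD D'}) :
  cont_res phi -> rat_restriction (phi : {rmorphism rat_ring D -> rat_ring D'}).
Proof. by move=> [h1 h2]; split=> [a|]; [exact: h1 | exact/lev_cont]. Qed.

Section Values.
Variable W : set (perfDisk K n).
Implicit Types s t : strSheaf W.
Definition sval s D (h : rat_subset D `<=` W) : QD D := str_val s h.

Lemma sval_res s D D' (h : rat_subset D `<=` W) (h' : rat_subset D' `<=` W)
  (sub : rat_subset D' `<=` rat_subset D) : res sub (sval s h) = sval s h'.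
Proof. exact: (str_compat s h h' sub (cont_restriction (resP sub))). Qed.

Lemma svalP s t : (forall D (h : rat_subset D `<=` W), sval s h = sval t h) -> s = t.
Proof. by move=> h; apply: strP => D hD; exact: h. Qed.

Lemma mksheaf (v : forall D, rat_subset D `<=` W -> QD D) :
  (forall D D' (h : rat_subset D `<=` W) (h' : rat_subset D' `<=` W)
     (sub : rat_subset D' `<=` rat_subset D), res sub (v D h) = v D' h') ->
  exists s, forall D h, sval s h = v D h.
Proof.
move=> c; have compat D D' (h : rat_subset D `<=` W) (h' : rat_subset D' `<=` W) :
    rat_subset D' `<=` rat_subset D -> forall phi : {rmorphism rat_ring D -> rat_ring D'},
    rat_restriction phi -> phi (v D h) = v D' h'.
  move=> sub phi /restriction_cont hphi; rewrite -(c D D' h h' sub).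
  exact: (restriction_unique hphi (resP sub)).
by exists (StrSheaf compat).
Qed.

Section AtDatum.
Variables (D : ratDatum K n) (h : rat_subset D `<=` W).
Definition svalm s : QD D := sval s h.
Fact svalm_zmod : zmod_morphism svalm. Proof. by []. Qed.
Fact svalm_monoid : monoid_morphism svalm. Proof. by []. Qed.
HB.instance Definition _ := GRing.isZmodMorphism.Build (strSheaf W) (QD D) svalm svalm_zmod.
HB.instance Definition _ := GRing.isMonoidMorphism.Build (strSheaf W) (QD D) svalm svalm_monoid.
End AtDatum.
End Values.

Section Restriction.
Variables (W V : set (perfDisk K n)) (VW : V `<=` W).
Definition sres : strSheaf W -> strSheaf V := str_res VW.
Lemma sval_sres s D (h : rat_subset D `<=` V) (h' : rat_subset D `<=` W) :
  sval (sres s) h = sval s h'.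
Proof. by rewrite /sval /=; congr (str_val s _); exact: Prop_irrelevance. Qed.
Fact sres_zmod : zmod_morphism sres.
Proof. by move=> s t; apply: svalP. Qed.
Fact sres_monoid : monoid_morphism sres.
Proof. by split=> [|s t]; apply: svalP. Qed.
HB.instance Definition _ := GRing.isZmodMorphism.Build (strSheaf W) (strSheaf V) sres sres_zmod.
HB.instance Definition _ := GRing.isMonoidMorphism.Build (strSheaf W) (strSheaf V) sres sres_monoid.
End Restriction.
End Bridge.
#[global] Opaque QD io can sval.
Arguments sres {R p K n W V}.

Section Sheaf.
Variables (R : realType) (p : nat) (K : perfectoidField R p) (n : nat).
Local Notation A := (PT K n).
Local Notation X := (perfDisk K n).
Implicit Types (D : ratDatum K n) (V W : set X).

Lemma sres_comp W V U (VW : V `<=` W) (UV : U `<=` V) (UW : U `<=` W) s :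
  sres UV (sres VW s) = sres UW s.
Proof.
apply: svalP => D h; have hV := subset_trans h UV; have hW := subset_trans h UW.
by rewrite (sval_sres _ _ _ hV) (sval_sres _ _ _ hW) (sval_sres _ _ _ hW).
Qed.

Lemma cont_comp D D' D'' (phi : {rmorphism QD D -> QD D'}) (psi : {rmorphism QD D' -> QD D''}) :
  cont_res phi -> cont_res psi -> cont_res (psi \o phi).
Proof.
move=> [h1 h2] [h3 h4]; split=> [a|k]; first by rewrite /= h1 h3.
by have [j hj] := h4 k; have [i hi] := h2 j; exists i => x /hi /hj.
Qed.

Lemma res_comp D D' D'' (h : rat_subset D' `<=` rat_subset D) (h' : rat_subset D'' `<=` rat_subset D')
  (h'' : rat_subset D'' `<=` rat_subset D) x : res h' (res h x) = res h'' x.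
Proof. exact: (restriction_unique (cont_comp (resP h) (resP h')) (resP h'')). Qed.

Lemma res_id D (h : rat_subset D `<=` rat_subset D) x : res h x = x.
Proof.
apply: (@restriction_unique _ _ _ _ _ _ (res h) idfun); first exact: resP.
by split=> // k; exists k.
Qed.

(** The rational subset itself is the largest one contained in W, so the value there
    determines all others. *)
Lemma sval_inj W D (h : rat_subset D `<=` W) (h' : W `<=` rat_subset D) : injective (svalm h).
Proof.
move=> s t e; apply: svalP => D' k.
have sub := subset_trans k h'; rewrite -(sval_res s h k sub) -(sval_res t h k sub).
by rewrite -[sval s h]/(svalm h s) e.
Qed.

Lemma sval_surj W D (h : rat_subset D `<=` W) (h' : W `<=` rat_subset D) x :
  exists s, svalm h s = x.
Proof.
have [|s hs] := @mksheaf _ _ _ _ W (fun D' k => res (subset_trans k h') x).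
  by move=> D' D'' k k' sub; apply: res_comp.
by exists s; rewrite /svalm hs; apply: res_id.
Qed.

Lemma sval_mx_surj W D (h : rat_subset D `<=` W) (h' : W `<=` rat_subset D) a b (M : 'M[QD D]_(a, b)) :
  exists S : 'M[strSheaf W]_(a, b), map_mx (svalm h) S = M.
Proof.
have [f hf] := choice (sval_surj h h'); exists (map_mx f M).
by apply/matrixP => i j; rewrite !mxE.
Qed.

Lemma map_mx_inj0 (Q Q' : pzRingType) (f : {rmorphism Q -> Q'}) a b (M M' : 'M[Q]_(a, b)) :
  injective f -> map_mx f M = map_mx f M' -> M = M'.
Proof. by move=> fi /matrixP e; apply/matrixP => i j; have := e i j; rewrite !mxE => /fi. Qed.

(** The bound on b makes the pieces of a rational subset rational: w^N may be added to
    the numerators. *)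
Definition division W W1 W2 := exists (a b : A) N, [/\ forall x, W x -> val_le x (wA K n N) b,
  W1 = W `&` [set x | val_le x a b] & W2 = W `&` [set x | val_le x b a]].

Lemma division_sub W W1 W2 V : division W W1 W2 -> V `<=` W -> division V (V `&` W1) (V `&` W2).
Proof.
move=> [a [b [N [h -> ->]]]] VW; exists a, b, N; split.
- by move=> x /VW; exact: h.
- by rewrite setIA (setIidl VW).
- by rewrite setIA (setIidl VW).
Qed.

Lemma divisionU W W1 W2 : division W W1 W2 -> W = W1 `|` W2.
Proof.
move=> [a [b [N [h -> ->]]]]; rewrite -setIUr; apply/seteqP; split=> [x Wx|x []//].
by split=> //; exact: val_total.
Qed.

Lemma division_covering W W1 W2 D : division W W1 W2 -> rat_subset D `<=` W ->
  exists D0 D1 D2 D12, covering D0 D1 D2 D12 /\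
  [/\ rat_subset D0 = rat_subset D, rat_subset D1 = rat_subset D `&` W1,
      rat_subset D2 = rat_subset D `&` W2 & rat_subset D12 = rat_subset D1 `&` rat_subset D2].
Proof.
move=> [a [b [N [h -> ->]]]] DW; have [|D0 [D1 [D2 [D12 [c [e0 e1 e2 e12]]]]]] := @split_covering R p K n D a b N.
  by move=> x /DW; exact: h.
by exists D0, D1, D2, D12; split=> //; split=> //; rewrite setIA (setIidl DW).
Qed.

Lemma division_zero W W1 W2 D (DW : rat_subset D `<=` W) (x : QD D) : division W W1 W2 ->
  (forall D' (k : rat_subset D' `<=` rat_subset D), rat_subset D' `<=` W1 -> res k x = 0) ->
  (forall D' (k : rat_subset D' `<=` rat_subset D), rat_subset D' `<=` W2 -> res k x = 0) -> x = 0.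
Proof.
move=> dv h1 h2; have [D0 [D1 [D2 [D12 [c [e0 e1 e2 e12]]]]]] := division_covering dv DW.
have k : rat_subset D0 `<=` rat_subset D by rewrite e0.
have k' : rat_subset D `<=` rat_subset D0 by rewrite e0.
have z : res k x = 0.
  apply: (cov_inj (cov := c)).
    have sub := subset_trans (cov1 c) k; rewrite (res_comp _ _ sub); apply: h1.
    by rewrite e1 => y [].
  have sub := subset_trans (cov2 c) k; rewrite (res_comp _ _ sub); apply: h2.
  by rewrite e2 => y [].
by rewrite -(res_id (@subset_refl _ _) x) -(res_comp k k') z rmorph0.
Qed.

Lemma sheaf_inj W W1 W2 (h1 : W1 `<=` W) (h2 : W2 `<=` W) s t : division W W1 W2 ->
  sres h1 s = sres h1 t -> sres h2 s = sres h2 t -> s = t.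
Proof.
move=> dv e1 e2; apply: svalP => D h; apply/eqP; rewrite -subr_eq0; apply/eqP.
apply: (division_zero h dv) => D' k l; rewrite rmorphB.
  have l' := subset_trans l h1.
  by rewrite !(sval_res _ _ l') -!(sval_sres h1 _ l) e1 subrr.
have l' := subset_trans l h2.
by rewrite !(sval_res _ _ l') -!(sval_sres h2 _ l) e2 subrr.
Qed.

(** A section over W is a compatible family over the rational subsets D of W; each D is
    divided in the same way, and the two values are glued there. Compatibility follows
    from uniqueness of the glued value. *)
Lemma sheaf_glue W W1 W2 (h1 : W1 `<=` W) (h2 : W2 `<=` W) (s1 : strSheaf W1) (s2 : strSheaf W2) :
  division W W1 W2 -> sres (@subIsetl _ W1 W2) s1 = sres (@subIsetr _ W1 W2) s2 ->
  exists s, sres h1 s = s1 /\ sres h2 s = s2.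
Proof.
move=> dv e12.
pose good D (x : QD D) :=
  (forall D' (k : rat_subset D' `<=` rat_subset D) (l : rat_subset D' `<=` W1), res k x = sval s1 l) /\
  (forall D' (k : rat_subset D' `<=` rat_subset D) (l : rat_subset D' `<=` W2), res k x = sval s2 l).
have ex D : rat_subset D `<=` W -> exists x : QD D, good D x.
  move=> DW; have [D0 [D1 [D2 [D12 [c [e0 e1 e2 ei]]]]]] := division_covering dv DW.
  have l1 : rat_subset D1 `<=` W1 by rewrite e1 => y [].
  have l2 : rat_subset D2 `<=` W2 by rewrite e2 => y [].
  have l12 : rat_subset D12 `<=` W1 `&` W2.
    by rewrite ei => y [/l1 ? /l2 ?].
  have l121 := subset_trans l12 (@subIsetl _ W1 W2); have l122 := subset_trans l12 (@subIsetr _ W1 W2).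
  have [|x0 [hx1 hx2]] := @cov_glue _ _ _ _ _ _ _ _ c (sval s1 l1) (sval s2 l2).
    rewrite (sval_res _ _ l121) (sval_res _ _ l122).
    by rewrite -(sval_sres (@subIsetl _ W1 W2) _ l12) e12 (sval_sres _ _ _ l122).
  have k' : rat_subset D `<=` rat_subset D0 by rewrite e0.
  exists (res k' x0); split=> D' k l.
    have m1 : rat_subset D' `<=` rat_subset D1 by rewrite e1 => y hy; split; [exact: k | exact: l].
    have m0 := subset_trans m1 (cov1 c).
    by rewrite (res_comp _ _ m0) -(res_comp (cov1 c) m1) hx1; exact: sval_res.
  have m1 : rat_subset D' `<=` rat_subset D2 by rewrite e2 => y hy; split; [exact: k | exact: l].
  have m0 := subset_trans m1 (cov2 c).
  by rewrite (res_comp _ _ m0) -(res_comp (cov2 c) m1) hx2; exact: sval_res.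
have un D (h : rat_subset D `<=` W) x y : good D x -> good D y -> x = y.
  move=> [a1 a2] [b1 b2]; apply/eqP; rewrite -subr_eq0; apply/eqP.
  by apply: (division_zero h dv) => D' k l; rewrite rmorphB ?(a1 _ _ l) ?(b1 _ _ l) ?(a2 _ _ l) ?(b2 _ _ l) subrr.
have [|s hs] := @mksheaf _ _ _ _ W (fun D h => projT1 (cid (ex D h))).
  move=> D D' h h' sub; case: cid => x [gx1 gx2] /=; case: cid => y gy /=.
  apply: (un D' h' _ _ _ gy); split=> D'' k l; have m := subset_trans k sub.
    by rewrite (res_comp _ _ m); exact: gx1.
  by rewrite (res_comp _ _ m); exact: gx2.
have val D (h : rat_subset D `<=` W) : good D (sval s h) by rewrite hs; case: cid.
exists s; split; apply: svalP => D l.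
  have h := subset_trans l h1; rewrite (sval_sres _ _ _ h) -(res_id (@subset_refl _ _) (sval s h)).
  exact: (val D h).1.
have h := subset_trans l h2; rewrite (sval_sres _ _ _ h) -(res_id (@subset_refl _ _) (sval s h)).
exact: (val D h).2.
Qed.

Section Patching.
Variables (Q : pzRingType) (N1 N2 : nat) (B : 'M[Q]_(N1, N2)) (C : 'M[Q]_(N2, N1)).
Definition upper : 'M[Q]_(N1 + N2) := block_mx 1%:M B 0 1%:M.
Definition lower : 'M[Q]_(N1 + N2) := block_mx 1%:M 0 C 1%:M.
End Patching.

Lemma map_upper (Q Q' : pzRingType) (f : {rmorphism Q -> Q'}) N1 N2 (B : 'M[Q]_(N1, N2)) :
  map_mx f (upper B) = upper (map_mx f B).
Proof. by rewrite /upper map_block_mx !map_mx1 map_mx0. Qed.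
Lemma map_lower (Q Q' : pzRingType) (f : {rmorphism Q -> Q'}) N1 N2 (C : 'M[Q]_(N2, N1)) :
  map_mx f (lower C) = lower (map_mx f C).
Proof. by rewrite /lower map_block_mx !map_mx1 map_mx0. Qed.

(** The entries of elementary matrices can be approximated by sections over one of the
    pieces, because one denominator serves both W2 and the intersection; so products of
    them can be factored. *)
Theorem sheaf_cartan D W1 W2 N1 N2 (B : 'M[strSheaf (W1 `&` W2)]_(N1, N2)) (C : 'M[strSheaf (W1 `&` W2)]_(N2, N1)) :
  division (rat_subset D) W1 W2 ->
  exists (v1 v1' : 'M[strSheaf W1]_(N1 + N2)) (v2 v2' : 'M[strSheaf W2]_(N1 + N2)),
  [/\ v1 *m v1' = 1%:M, v2 *m v2' = 1%:M &
    map_mx (sres (@subIsetl _ W1 W2)) v1 =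
    map_mx (sres (@subIsetr _ W1 W2)) v2 *m (upper (- B) *m lower C *m upper (- B))].
Proof.
move=> dv; have [D0 [D1 [D2 [D12 [c [e0 e1 e2 e12]]]]]] := division_covering dv (@subset_refl _ _).
have W1D : W1 `<=` rat_subset D by move: dv => [a [b [N [_ -> _]]]] x [].
have W2D : W2 `<=` rat_subset D by move: dv => [a [b [N [_ _ ->]]]] x [].
have E1 : rat_subset D1 = W1 by rewrite e1; exact: setIidr.
have E2 : rat_subset D2 = W2 by rewrite e2; exact: setIidr.
have E12 : rat_subset D12 = W1 `&` W2 by rewrite e12 E1 E2.
have l1 : rat_subset D1 `<=` W1 by rewrite E1.
have l2 : rat_subset D2 `<=` W2 by rewrite E2.
have l12 : rat_subset D12 `<=` W1 `&` W2 by rewrite E12.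
have m1 : W1 `<=` rat_subset D1 by rewrite E1.
have m2 : W2 `<=` rat_subset D2 by rewrite E2.
have m12 : W1 `&` W2 `<=` rat_subset D12 by rewrite E12.
have dense := @cov_dense _ _ _ _ _ _ _ _ c.
pose B' := map_mx (svalm l12) B; pose C' := map_mx (svalm l12) C.
have aU : approximable (res (cov212 c)) (upper (- B')) (upper B').
  by have := approximable_upper dense (- B'); rewrite opprK.
have aL := approximable_lower dense C'.
have aG := approximable_mul (approximable_mul aU aL) aU.
have [V1 [V1' [V2 [V2' [f1 f2 f12]]]]] := cov_cartan aG.
have [v1 hv1] := sval_mx_surj l1 m1 V1; have [v1' hv1'] := sval_mx_surj l1 m1 V1'.
have [v2 hv2] := sval_mx_surj l2 m2 V2; have [v2' hv2'] := sval_mx_surj l2 m2 V2'.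
exists v1, v1', v2, v2'; split.
- by apply: (map_mx_inj0 (sval_inj (h := l1) m1)); rewrite map_mxM map_mx1 hv1 hv1'.
- by apply: (map_mx_inj0 (sval_inj (h := l2) m2)); rewrite map_mxM map_mx1 hv2 hv2'.
apply: (map_mx_inj0 (sval_inj (h := l12) m12)); rewrite !map_mxM !map_upper !map_lower !map_mxN -/B' -/C'.
have -> : map_mx (svalm l12) (map_mx (sres (@subIsetl _ W1 W2)) v1) = map_mx (res (cov112 c)) V1.
  rewrite -hv1; apply/matrixP => i j; rewrite !mxE.
  have k := subset_trans l12 (@subIsetl _ W1 W2).
  by rewrite /svalm (sval_sres _ _ _ k) (sval_res _ _ k).
have -> : map_mx (svalm l12) (map_mx (sres (@subIsetr _ W1 W2)) v2) = map_mx (res (cov212 c)) V2.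
  rewrite -hv2; apply/matrixP => i j; rewrite !mxE.
  have k := subset_trans l12 (@subIsetr _ W1 W2).
  by rewrite /svalm (sval_sres _ _ _ k) (sval_res _ _ k).
by rewrite f12.
Qed.
End Sheaf.

(** * Vector bundles: charts and their gluing *)

Lemma conj_idem (Q : pzRingType) N N' (P : 'M[Q]_(N', N)) (S : 'M[Q]_(N, N')) e : S *m P = 1%:M ->
  e *m e = e -> P *m e *m S *m (P *m e *m S) = P *m e *m S.
Proof.
by move=> c ee; rewrite !mulmxA -[_ *m S *m P]mulmxA c mulmx1 -[_ *m e *m e]mulmxA ee.
Qed.

Section Frames.
Variables (Q : pzRingType) (M : lmodType Q).
Definition comb N (v : 'rV[Q]_N) (t : 'I_N -> M) : M := \sum_i v 0 i *: t i.
Definition mact N' N (P : 'M[Q]_(N', N)) (t : 'I_N -> M) : 'I_N' -> M := fun i => comb (row i P) t.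

Lemma comb_mact N' N (v : 'rV[Q]_N') (P : 'M[Q]_(N', N)) t : comb v (mact P t) = comb (v *m P) t.
Proof.
rewrite /comb /mact /comb; under eq_bigr do rewrite scaler_sumr.
rewrite exchange_big; apply: eq_bigr => j _; rewrite mxE scaler_suml.
by apply: eq_bigr => i _; rewrite mxE scalerA.
Qed.
Lemma combB N (u v : 'rV[Q]_N) t : comb (u - v) t = comb u t - comb v t.
Proof. by rewrite /comb -sumrB; apply: eq_bigr => i _; rewrite !mxE scalerBl. Qed.
Lemma comb0 N t : comb (0 : 'rV[Q]_N) t = 0.
Proof. by rewrite /comb big1 // => i _; rewrite mxE scale0r. Qed.
Lemma mact1 N t : mact (1%:M : 'M[Q]_N) t = t.
Proof.
apply/funext => i; rewrite /mact /comb (bigD1 i) //= !mxE eqxx scale1r big1 ?addr0 // => j ji.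
by rewrite !mxE eq_sym (negPf ji) scale0r.
Qed.
Lemma mactM N N' N'' (P : 'M[Q]_(N'', N')) (S : 'M[Q]_(N', N)) t : mact (P *m S) t = mact P (mact S t).
Proof. by apply/funext => i; rewrite /mact row_mul -comb_mact. Qed.
Lemma eq_mact N N' (P S : 'M[Q]_(N', N)) t : mact (P - S) t = (fun=> 0) -> mact P t = mact S t.
Proof.
move=> h; apply/funext => i; apply/eqP; rewrite -subr_eq0; have := congr1 (fun f => f i) h.
by rewrite /mact /= linearB /= combB => ->.
Qed.

(** M is then isomorphic to the image of e, and t corresponds to the rows of e. *)
Definition frame N (t : 'I_N -> M) (e : 'M[Q]_N) :=
  (forall s, exists v, comb v t = s) /\ (forall v, comb v t = 0 <-> v *m e = 0).

Lemma frame_transport N N' (t : 'I_N -> M) e (P : 'M[Q]_(N', N)) (S : 'M[Q]_(N, N')) :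
  S *m P = 1%:M -> frame t e -> frame (mact P t) (P *m e *m S).
Proof.
move=> SP [h1 h2]; split=> [s|v].
  by have [v <-] := h1 s; exists (v *m S); rewrite comb_mact -mulmxA SP mulmx1.
rewrite comb_mact h2 !mulmxA; split=> [->|h]; first by rewrite mul0mx.
by rewrite -[LHS]mulmx1 -SP mulmxA h mul0mx.
Qed.

Lemma frame_mact0 N N' (t : 'I_N -> M) e (P : 'M[Q]_(N', N)) : frame t e -> P *m e = 0 ->
  mact P t = (fun=> 0).
Proof. by move=> [_ h] Pe; apply/funext => i; apply/h; rewrite -row_mul Pe row0. Qed.

Lemma frame_idem N (t : 'I_N -> M) e : frame t e -> e *m e = e -> mact e t = t.
Proof.
move=> fr ee; rewrite -[RHS]mact1; apply: eq_mact; apply: (frame_mact0 fr).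
by rewrite mulmxBl ee mul1mx subrr.
Qed.

Lemma frame_rows N N' (t : 'I_N -> M) e (s : 'I_N' -> M) : frame t e -> exists P : 'M[Q]_(N', N), s = mact P t.
Proof.
move=> [h _]; have [v hv] := choice (fun i => h (s i)); exists (\matrix_i v i).
by apply/funext => i; rewrite /mact rowK.
Qed.

Lemma frame_eq0 N N' (t : 'I_N -> M) e (P : 'M[Q]_(N', N)) : frame t e -> mact P t = (fun=> 0) -> P *m e = 0.
Proof.
move=> [_ h] Pt; apply/row_matrixP => i; rewrite row_mul row0; apply/h.
by have := congr1 (fun f => f i) Pt.
Qed.

(** Matrices expressing each frame by the other, cut by the idempotents. Their products
    fix the frames, hence differ from the idempotents by relations, which the
    idempotents kill. *)
Lemma frame_transition N1 N2 (t1 : 'I_N1 -> M) (t2 : 'I_N2 -> M) e1 e2 :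
  frame t1 e1 -> frame t2 e2 -> e1 *m e1 = e1 -> e2 *m e2 = e2 ->
  exists (B : 'M[Q]_(N1, N2)) (C : 'M[Q]_(N2, N1)),
  [/\ t2 = mact C t1, B *m C = e1, C *m B = e2, e1 *m B = B & [/\ e2 *m C = C, C *m e1 = C & B *m e2 = B]].
Proof.
move=> f1 f2 i1 i2; have [B0 hB] := frame_rows t1 f2; have [C0 hC] := frame_rows t2 f1.
pose B := e1 *m B0 *m e2; pose C := e2 *m C0 *m e1.
have tB : t1 = mact B t2 by rewrite !mactM (frame_idem f2 i2) -hB (frame_idem f1 i1).
have tC : t2 = mact C t1 by rewrite !mactM (frame_idem f1 i1) -hC (frame_idem f2 i2).
have e1B : e1 *m B = B by rewrite /B !mulmxA i1.
have Be2 : B *m e2 = B by rewrite /B -mulmxA i2.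
have e2C : e2 *m C = C by rewrite /C !mulmxA i2.
have Ce1 : C *m e1 = C by rewrite /C -mulmxA i1.
exists B, C; split=> //.
- have : (B *m C - 1%:M) *m e1 = 0.
    apply: (frame_eq0 f1); apply/funext => i.
    have := congr1 (fun f => f i) (mactM B C t1); rewrite -tC -tB.
    by rewrite /mact linearB /= combB => ->; have := congr1 (fun f => f i) (mact1 t1); rewrite /mact => ->; rewrite subrr.
  by rewrite mulmxBl mul1mx -mulmxA Ce1 => /eqP; rewrite subr_eq0 => /eqP.
- have : (C *m B - 1%:M) *m e2 = 0.
    apply: (frame_eq0 f2); apply/funext => i.
    have := congr1 (fun f => f i) (mactM C B t2); rewrite -tB -tC.
    by rewrite /mact linearB /= combB => ->; have := congr1 (fun f => f i) (mact1 t2); rewrite /mact => ->; rewrite subrr.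
  by rewrite mulmxBl mul1mx -mulmxA Be2 => /eqP; rewrite subr_eq0 => /eqP.
Qed.

(** The classical conjugation of two idempotents with isomorphic images after adding
    complements, as a product of elementary matrices. *)
Lemma transition_block N1 N2 (B : 'M[Q]_(N1, N2)) (C : 'M[Q]_(N2, N1)) e1 e2 :
  B *m C = e1 -> C *m B = e2 -> e1 *m B = B ->
  upper (- B) *m lower C *m upper (- B) = block_mx (1%:M - e1) (- B) C (1%:M - e2).
Proof.
move=> BC CB eB; rewrite /upper /lower !mulmx_block.
rewrite !(mul1mx, mulmx1, mulmx0, mul0mx, add0r, addr0, mulNmx, mulmxN) BC CB.
by rewrite mulmxBl mul1mx eB subrr oppr0 add0r [- e2 + _]addrC.
Qed.
End Frames.

Section Charts.
Variables (R : realType) (p : nat) (K : perfectoidField R p) (n : nat).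
Local Notation X := (perfDisk K n).
Variable E : modSheaf K n.
Implicit Types (U V W : set X).
Local Notation rs h s := (@ms_res _ _ _ _ E _ _ h s).
Local Notation rt h t := (fun i => @ms_res _ _ _ _ E _ _ h (t i)).

Lemma ms_res0 W V (h : V `<=` W) : open W -> open V -> rs h 0 = 0.
Proof. by move=> oW oV; apply: (addrI (rs h 0)); rewrite -ms_resD // !addr0. Qed.

Lemma ms_res_comb W V (h : V `<=` W) N (v : 'rV_N) (t : 'I_N -> E W) : open W -> open V ->
  rs h (comb v t) = comb (map_mx (sres h) v) (rt h t).
Proof.
move=> oW oV; rewrite /comb (big_morph _ (fun a b => ms_resD h oW oV a b) (ms_res0 h oW oV)).
by apply: eq_bigr => i _; rewrite ms_resZ // mxE.
Qed.

Lemma ms_res_mact W V (h : V `<=` W) N N' (P : 'M_(N', N)) (t : 'I_N -> E W) : open W -> open V ->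
  rt h (mact P t) = mact (map_mx (sres h) P) (rt h t).
Proof. by move=> oW oV; apply/funext => i; rewrite /mact ms_res_comb // map_row. Qed.

Section Pair.
Variables (W W1 W2 : set X).
Hypotheses (oW : open W) (o1 : open W1) (o2 : open W2) (eW : W = W1 `|` W2).
Variables (h1 : W1 `<=` W) (h2 : W2 `<=` W).

Lemma ms_pair (s1 : E W1) (s2 : E W2) : rs (@subIsetl _ W1 W2) s1 = rs (@subIsetr _ W1 W2) s2 ->
  exists! t, rs h1 t = s1 /\ rs h2 t = s2.
Proof.
move=> e12; pose U (b : bool) := if b then W1 else W2.
have hU b : U b `<=` W by case: b.
have oU b : open (U b) by case: b.
have eU : W = \bigcup_b U b.
  rewrite eW; apply/seteqP; split=> [x [hx|hx]|x [[] _ hx]]; [by exists true | by exists false | by left | by right].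
pose s (b : bool) : E (U b) := if b return E (U b) then s1 else s2.
have [|t [ht hu]] := ms_sheaf hU oW oU eU (s := s).
  move=> [] [] //=; rewrite ?e12 //.
  - congr (ms_res _ _); exact: Prop_irrelevance.
  - have key A1 A2 (a1 : E A1) (a2 : E A2) : open A1 -> open A2 ->
        rs (@subIsetl _ A1 A2) a1 = rs (@subIsetr _ A1 A2) a2 ->
        rs (@subIsetl _ A2 A1) a2 = rs (@subIsetr _ A2 A1) a1.
      move=> oA1 oA2; have h : A2 `&` A1 `<=` A1 `&` A2 by rewrite setIC.
      have oI : open (A1 `&` A2) by exact: openI.
      have oI' : open (A2 `&` A1) by exact: openI.
      move=> /(congr1 (fun z => rs h z)).
      by rewrite (ms_res_comp _ _ (@subIsetr _ A2 A1)) // (ms_res_comp _ _ (@subIsetl _ A2 A1)).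
    exact: key.
  - congr (ms_res _ _); exact: Prop_irrelevance.
have irr V (k k' : V `<=` W) (z : E W) : rs k z = rs k' z by congr (ms_res _ _); exact: Prop_irrelevance.
exists t; split.
  by split; [rewrite (irr _ h1 (hU true)); exact: (ht true) | rewrite (irr _ h2 (hU false)); exact: (ht false)].
move=> t' [e1 e2]; apply: hu => -[]; first by rewrite (irr _ _ h1).
by rewrite (irr _ _ h2).
Qed.

Lemma ms_inj (s t : E W) : rs h1 s = rs h1 t -> rs h2 s = rs h2 t -> s = t.
Proof.
move=> e1 e2; have oI : open (W1 `&` W2) by exact: openI.
have k := subset_trans (@subIsetl _ W1 W2) h1.
have [|u [_ hu]] := @ms_pair (rs h1 s) (rs h2 s).
  by rewrite (ms_res_comp _ _ k) // (ms_res_comp _ _ k).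
by rewrite -(hu s) // (hu t) // e1 e2.
Qed.
End Pair.

Lemma comb_zero_frame V N (t : 'I_N -> E V) e (v : 'rV_N) : frame t e -> e *m e = e ->
  comb (v *m e) t = comb v t.
Proof. by move=> f ee; rewrite -comb_mact (frame_idem f ee). Qed.

Lemma sres_mxM W V (h : V `<=` W) a b c (M : 'M[strSheaf W]_(a, b)) (M' : 'M[strSheaf W]_(b, c)) :
  map_mx (sres h) (M *m M') = map_mx (sres h) M *m map_mx (sres h) M'.
Proof. exact: map_mxM. Qed.

Lemma sres_mx_comp W V U (VW : V `<=` W) (UV : U `<=` V) (UW : U `<=` W) a b (M : 'M[strSheaf W]_(a, b)) :
  map_mx (sres UV) (map_mx (sres VW) M) = map_mx (sres UW) M.
Proof. by apply/matrixP => i j; rewrite !mxE; exact: sres_comp. Qed.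

Lemma sheaf_mx_inj W W1 W2 (h1 : W1 `<=` W) (h2 : W2 `<=` W) a b (M M' : 'M[strSheaf W]_(a, b)) :
  division W W1 W2 -> map_mx (sres h1) M = map_mx (sres h1) M' ->
  map_mx (sres h2) M = map_mx (sres h2) M' -> M = M'.
Proof.
move=> dv /matrixP e1 /matrixP e2; apply/matrixP => i j; apply: (sheaf_inj (h1 := h1) (h2 := h2) dv).
  by have := e1 i j; rewrite !mxE.
by have := e2 i j; rewrite !mxE.
Qed.

Lemma sheaf_mx_glue W W1 W2 (h1 : W1 `<=` W) (h2 : W2 `<=` W) a b
  (M1 : 'M[strSheaf W1]_(a, b)) (M2 : 'M[strSheaf W2]_(a, b)) :
  division W W1 W2 -> map_mx (sres (@subIsetl _ W1 W2)) M1 = map_mx (sres (@subIsetr _ W1 W2)) M2 ->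
  exists M, map_mx (sres h1) M = M1 /\ map_mx (sres h2) M = M2.
Proof.
move=> dv /matrixP e; have [f hf] := choice (fun ij : 'I_a * 'I_b =>
  sheaf_glue h1 h2 dv (etrans (esym (mxE _ _ _ _)) (etrans (e ij.1 ij.2) (mxE _ _ _ _)))).
exists (\matrix_(i, j) f (i, j)); split; apply/matrixP => i j; rewrite !mxE.
  exact: (hf (i, j)).1.
exact: (hf (i, j)).2.
Qed.

(** A presentation of E over W by an idempotent. The condition is imposed on all open
    subsets, because E is not assumed to be determined by its sections over W. *)
Definition chart W := exists N (t : 'I_N -> E W) (e : 'M[strSheaf W]_N), e *m e = e /\
  forall V (h : V `<=` W), open V -> frame (rt h t) (map_mx (sres h) e).

(** A section over W is expressed by the frame on both pieces; multiplication by e makes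
    the coefficients unique, so that they agree on the intersection and glue. *)
Lemma frame_glue W W1 W2 (h1 : W1 `<=` W) (h2 : W2 `<=` W) (h12 : W1 `&` W2 `<=` W)
  N (t : 'I_N -> E W) e : open W -> open W1 -> open W2 -> division W W1 W2 -> e *m e = e ->
  frame (rt h1 t) (map_mx (sres h1) e) -> frame (rt h2 t) (map_mx (sres h2) e) ->
  frame (rt h12 t) (map_mx (sres h12) e) -> frame t e.
Proof.
move=> oW o1 o2 dv ee f1 f2 f12; have eU := divisionU dv; have o12 : open (W1 `&` W2) by exact: openI.
have idem V (h : V `<=` W) : map_mx (sres h) e *m map_mx (sres h) e = map_mx (sres h) e.
  by rewrite -sres_mxM ee.
split=> [s|v].
  have [v1 hv1] := f1.1 (rs h1 s); have [v2 hv2] := f2.1 (rs h2 s).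
  pose u1 := v1 *m map_mx (sres h1) e; pose u2 := v2 *m map_mx (sres h2) e.
  have hu1 : comb u1 (rt h1 t) = rs h1 s by rewrite (comb_zero_frame _ f1) // idem.
  have hu2 : comb u2 (rt h2 t) = rs h2 s by rewrite (comb_zero_frame _ f2) // idem.
  have ue1 : map_mx (sres (@subIsetl _ W1 W2)) u1 *m map_mx (sres h12) e = map_mx (sres (@subIsetl _ W1 W2)) u1.
    by rewrite -(sres_mx_comp h1 (@subIsetl _ W1 W2)) -sres_mxM /u1 -mulmxA idem.
  have ue2 : map_mx (sres (@subIsetr _ W1 W2)) u2 *m map_mx (sres h12) e = map_mx (sres (@subIsetr _ W1 W2)) u2.
    by rewrite -(sres_mx_comp h2 (@subIsetr _ W1 W2)) -sres_mxM /u2 -mulmxA idem.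
  have c1 : comb (map_mx (sres (@subIsetl _ W1 W2)) u1) (rt h12 t) = rs h12 s.
    have := congr1 (fun z => rs (@subIsetl _ W1 W2) z) hu1; rewrite ms_res_comb // (ms_res_comp _ _ h12) // => <-.
    by congr comb; apply/funext => i; rewrite (ms_res_comp _ _ h12).
  have c2 : comb (map_mx (sres (@subIsetr _ W1 W2)) u2) (rt h12 t) = rs h12 s.
    have := congr1 (fun z => rs (@subIsetr _ W1 W2) z) hu2; rewrite ms_res_comb // (ms_res_comp _ _ h12) // => <-.
    by congr comb; apply/funext => i; rewrite (ms_res_comp _ _ h12).
  have e12 : map_mx (sres (@subIsetl _ W1 W2)) u1 = map_mx (sres (@subIsetr _ W1 W2)) u2.
    have /f12.2 : comb (map_mx (sres (@subIsetl _ W1 W2)) u1 - map_mx (sres (@subIsetr _ W1 W2)) u2) (rt h12 t) = 0.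
      by rewrite combB c1 c2 subrr.
    by rewrite mulmxBl ue1 ue2 => /eqP; rewrite subr_eq0 => /eqP.
  have [u [hu1' hu2']] := sheaf_mx_glue h1 h2 dv e12; exists u.
  apply: (ms_inj oW o1 o2 eU (h1 := h1) (h2 := h2)); rewrite ms_res_comb //.
    by rewrite hu1'.
  by rewrite hu2'.
split=> hv.
  apply: (sheaf_mx_inj (h1 := h1) (h2 := h2) dv); rewrite sres_mxM map_mx0.
    by apply/f1.2; rewrite -ms_res_comb // hv ms_res0.
  by apply/f2.2; rewrite -ms_res_comb // hv ms_res0.
apply: (ms_inj oW o1 o2 eU (h1 := h1) (h2 := h2)); rewrite ms_res_comb // ms_res0 //.
  by apply/f1.2; rewrite -sres_mxM hv map_mx0.
by apply/f2.2; rewrite -sres_mxM hv map_mx0.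
Qed.

Lemma chart_trivial W V r : open V -> open W -> W `<=` V -> trivial_on E V r -> chart W.
Proof.
move=> oV oW WV [f [fb fr]]; exists r, (fun i => f W (delta_mx 0 i)), 1%:M; split; first by rewrite mulmx1.
move=> U h oU; have UV := subset_trans h WV.
have key v : comb v (fun i => rs h (f W (delta_mx 0 i))) = f U v.
  rewrite [in RHS](row_sum_delta v) linear_sum; apply: eq_bigr => i _; rewrite linearZ /=; congr (_ *: _).
  by rewrite fr //; congr (f U _); apply/matrixP => a b; rewrite !mxE; exact: (rmorph_nat (sres h)).
have [g gK fK] := fb U oU UV; rewrite map_mx1; split=> [s|v]; first by exists (g s); rewrite key.
rewrite key mulmx1; split=> [h0|->]; last by rewrite linear0.
by rewrite -(gK v) h0 -[X in g X](linear0 (f U)) gK.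
Qed.

Lemma chart_empty : chart set0.
Proof.
exists 0%N, (fun=> 0), 0; split; first by rewrite mulmx0.
move=> V h oV; have V0 : V = \bigcup_(i : 'I_0) set0.
  by apply/seteqP; split=> [x /h //|x [[]]].
split=> [s|v]; last by split=> _; [exact: thinmx0 | rewrite /comb big_ord0].
exists 0; rewrite comb0.
have [||t [_ hu]] := @ms_sheaf _ _ _ _ E 'I_0 (fun=> set0) V (fun i => @sub0set _ V) oV _ V0 (fun i => 0).
- by move=> i; exact: open0.
- by move=> [].
by rewrite -(hu 0) ?(hu s) // => -[].
Qed.

(** After adding free complements, the two idempotents are conjugate over the
    intersection by a product of elementary matrices. Cartan factorization writes it
    as a quotient of invertible matrices over W1 and over W2; the charts changed by
    these agree on the intersection and glue. *)
Theorem chart_glue (D : ratDatum K n) W1 W2 : open (rat_subset D) -> open W1 -> open W2 ->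
  division (rat_subset D) W1 W2 -> chart W1 -> chart W2 -> chart (rat_subset D).
Proof.
set W := rat_subset D => oW o1 o2 dv [N1 [t1 [e1 [i1 f1]]]] [N2 [t2 [e2 [i2 f2]]]].
have eU := divisionU dv; have o12 : open (W1 `&` W2) by exact: openI.
have h1 : W1 `<=` W by rewrite eU; exact: subsetUl.
have h2 : W2 `<=` W by rewrite eU; exact: subsetUr.
pose r1 := @subIsetl _ W1 W2; pose r2 := @subIsetr _ W1 W2.
have F1 := f1 _ r1 o12; have F2 := f2 _ r2 o12.
set E1 := map_mx (sres r1) e1 in F1; set E2 := map_mx (sres r2) e2 in F2.
have I1 : E1 *m E1 = E1 by rewrite -sres_mxM i1.
have I2 : E2 *m E2 = E2 by rewrite -sres_mxM i2.
have [B [C [tC BC CB e1B [e2C Ce1 Be2]]]] := frame_transition F1 F2 I1 I2.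
have [v1 [v1' [v2 [v2' [vv1 vv2 vG]]]]] := sheaf_cartan B C dv.
rewrite (transition_block BC CB e1B) -/r1 -/r2 in vG.
set G := block_mx _ _ _ _ in vG.
pose P01 Q : 'M[Q : pzRingType]_(N1 + N2, N1) := col_mx 1%:M 0.
pose P02 Q : 'M[Q : pzRingType]_(N1 + N2, N2) := col_mx 0 1%:M.
pose S01 Q : 'M[Q : pzRingType]_(N1, N1 + N2) := row_mx 1%:M 0.
pose S02 Q : 'M[Q : pzRingType]_(N2, N1 + N2) := row_mx 0 1%:M.
have SP1 Q : S01 Q *m P01 Q = 1%:M by rewrite mul_row_col mul0mx addr0 mulmx1.
have SP2 Q : S02 Q *m P02 Q = 1%:M by rewrite mul_row_col mul0mx add0r mulmx1.
have mP1 (Q Q' : pzRingType) (f : {rmorphism Q -> Q'}) : map_mx f (P01 Q) = P01 Q' by rewrite map_col_mx map_mx1 map_mx0.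
have mP2 (Q Q' : pzRingType) (f : {rmorphism Q -> Q'}) : map_mx f (P02 Q) = P02 Q' by rewrite map_col_mx map_mx1 map_mx0.
have mS1 (Q Q' : pzRingType) (f : {rmorphism Q -> Q'}) : map_mx f (S01 Q) = S01 Q' by rewrite map_row_mx map_mx1 map_mx0.
have mS2 (Q Q' : pzRingType) (f : {rmorphism Q -> Q'}) : map_mx f (S02 Q) = S02 Q' by rewrite map_row_mx map_mx1 map_mx0.
pose P1 := v1 *m P01 _; pose S1 := S01 _ *m v1'.
pose P2 := v2 *m P02 _; pose S2 := S02 _ *m v2'.
have c1 : S1 *m P1 = 1%:M by rewrite mulmxA -[S01 _ *m v1' *m v1]mulmxA (mulmx1C vv1) mulmx1 SP1.
have c2 : S2 *m P2 = 1%:M by rewrite mulmxA -[S02 _ *m v2' *m v2]mulmxA (mulmx1C vv2) mulmx1 SP2.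
have GP : G *m P01 _ = col_mx (1%:M - E1) C.
  by rewrite mul_block_col !mulmx1 !mulmx0 !addr0.
have SG : S02 _ *m G = row_mx C (1%:M - E2).
  by rewrite mul_row_block !mul1mx !mul0mx !add0r.
have PC : P02 (strSheaf (W1 `&` W2)) *m C = col_mx 0 C by rewrite mul_col_mx mul0mx mul1mx.
have CS : C *m S01 (strSheaf (W1 `&` W2)) = row_mx C 0 by rewrite mul_mx_row mulmx0 mulmx1.
(* G P01 has the blocks 1 - E1, which kills t1, and C, which carries t1 to t2 *)
have te : rt r1 (mact P1 t1) = rt r2 (mact P2 t2).
  rewrite !ms_res_mact // !sres_mxM mP1 mP2 vG -mulmxA GP mactM [RHS]mactM; congr mact.
  rewrite [in RHS]tC -mactM PC; apply: eq_mact; apply: (frame_mact0 F1).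
  rewrite opp_col_mx add_col_mx oppr0 addr0 subrr mul_col_mx mul0mx mulmxBl mul1mx I1 subrr.
  by rewrite col_mx0.
have gv : G *m map_mx (sres r1) v1' = map_mx (sres r2) v2'.
  have a2 : map_mx (sres r2) v2' *m map_mx (sres r2) v2 = 1%:M by rewrite -sres_mxM (mulmx1C vv2) map_mx1.
  have a1 : map_mx (sres r1) v1 *m map_mx (sres r1) v1' = 1%:M by rewrite -sres_mxM vv1 map_mx1.
  by rewrite -[G]mul1mx -a2 -[_ *m G]mulmxA -vG -mulmxA a1 mulmx1.
(* G conjugates E1, in the first block, to E2, in the second *)
have ie : map_mx (sres r1) (P1 *m e1 *m S1) = map_mx (sres r2) (P2 *m e2 *m S2).
  rewrite !sres_mxM mP1 mP2 mS1 mS2 -/E1 -/E2 vG -gv.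
  move: (map_mx _ v1') (map_mx _ v2) => y x.
  have l : G *m P01 _ *m E1 = P02 _ *m C.
    by rewrite GP PC mul_col_mx mulmxBl mul1mx I1 subrr Ce1.
  have r : E2 *m (S02 _ *m G) = C *m S01 _.
    by rewrite SG CS mul_mx_row mulmxBr mulmx1 I2 subrr e2C.
  rewrite -!mulmxA [E2 *m _]mulmxA [E2 *m S02 _ *m _]mulmxA -[E2 *m S02 _ *m G]mulmxA r.
  by rewrite ![in LHS]mulmxA -[x *m G *m _]mulmxA -[x *m _ *m E1]mulmxA l !mulmxA.
have ex i : exists s, rs h1 s = mact P1 t1 i /\ rs h2 s = mact P2 t2 i.
  have [|s [hs _]] := @ms_pair W W1 W2 oW o1 o2 eU h1 h2 (mact P1 t1 i) (mact P2 t2 i).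
    by have := congr1 (fun f => f i) te.
  by exists s.
have [t ht] := choice ex.
have [e [he1 he2]] := sheaf_mx_glue h1 h2 dv ie.
have ee : e *m e = e.
  apply: (sheaf_mx_inj (h1 := h1) (h2 := h2) dv); rewrite sres_mxM ?he1 ?he2.
    exact: conj_idem.
  exact: conj_idem.
have loc1 V (k : V `<=` W1) (l : V `<=` W) : open V -> frame (rt l t) (map_mx (sres l) e).
  move=> oV; have c : map_mx (sres k) S1 *m map_mx (sres k) P1 = 1%:M by rewrite -sres_mxM c1 map_mx1.
  have := frame_transport c (f1 V k oV); rewrite -!sres_mxM -he1 (sres_mx_comp _ _ l) -ms_res_mact //.
  congr frame; apply/funext => i; rewrite -(ht i).1; exact: ms_res_comp.
have loc2 V (k : V `<=` W2) (l : V `<=` W) : open V -> frame (rt l t) (map_mx (sres l) e).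
  move=> oV; have c : map_mx (sres k) S2 *m map_mx (sres k) P2 = 1%:M by rewrite -sres_mxM c2 map_mx1.
  have := frame_transport c (f2 V k oV); rewrite -!sres_mxM -he2 (sres_mx_comp _ _ l) -ms_res_mact //.
  congr frame; apply/funext => i; rewrite -(ht i).2; exact: ms_res_comp.
exists (N1 + N2)%N, t, e; split=> // V h oV.
have oV1 : open (V `&` W1) by exact: openI.
have oV2 : open (V `&` W2) by exact: openI.
have oV12 : open (V `&` W1 `&` (V `&` W2)) by exact: openI.
have idem : map_mx (sres h) e *m map_mx (sres h) e = map_mx (sres h) e by rewrite -sres_mxM ee.
have k1 : V `&` W1 `<=` V by exact: subIsetl.
have k2 : V `&` W2 `<=` V by exact: subIsetl.
have k12 : V `&` W1 `&` (V `&` W2) `<=` V by move=> x [[]].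
have comp U (k : U `<=` V) (l : U `<=` W) : open U -> frame (rt l t) (map_mx (sres l) e) ->
    frame (rt k (rt h t)) (map_mx (sres k) (map_mx (sres h) e)).
  move=> oU; rewrite (sres_mx_comp _ _ l); congr frame; apply/funext => i.
  by rewrite (ms_res_comp _ _ l).
apply: (frame_glue oV oV1 oV2 (division_sub dv h) idem (h1 := k1) (h2 := k2) (h12 := k12)).
- by apply: (comp _ _ (subset_trans k1 h)) => //; apply: loc1 => //; exact: subIsetr.
- by apply: (comp _ _ (subset_trans k2 h)) => //; apply: loc2 => //; exact: subIsetr.
- by apply: (comp _ _ (subset_trans k12 h)) => //; apply: loc1 => // x [[]].
Qed.
End Charts.

(** * Global sections of the disk *)

Section Global.
Variables (R : realType) (p : nat) (K : perfectoidField R p) (n : nat).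
Local Notation A := (PT K n).
Local Notation X := (perfDisk K n).
Local Notation w := (topnil K).
Local Notation fr := (@fr R p K n).
Local Notation wA := (wA K n).

Definition whole : ratDatum K n := rd ([::], 0%N, 1).
Lemma wholeE : rat_subset whole = setT.
Proof.
apply/seteqP; split=> // x _; apply/stdP; split=> //=.
by rewrite wA0; exact: (pv_refl (point_preval x)).
Qed.


Let one0 : (rat_den whole : A) != 0. Proof. exact: oner_neq0. Qed.

Lemma sl_whole a : sl whole (fr a) -> nm a <= 1.
Proof.
have h : sl whole `<=` unit_ball fr.
  apply: sl_least => //; first exact: unit_ball_subring.
  move=> _ [x hx <-]; have -> : x = 1.
    by move: hx => /fullP [->|->|//] //; exact: wA0.
  by exists 1; rewrite /= ?nm1 // divff // rmorph1 oner_neq0.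
by move=> /h [b hb /fr_inj <-].
Qed.

Lemma lev_can k a : lev k (can whole a) -> nm a <= pf_abs (w ^+ k).
Proof.
rewrite levE akP -rmorphM canP => /(ao_sl one0); rewrite evC => /sl_whole.
by rewrite nmM nm_kst pf_absV mulrC ler_pdivrMr ?mul1r // pf_abs_gt0 // topnilX0.
Qed.

Lemma can_lev k a : nm a <= pf_abs (w ^+ k) -> lev k (can whole a).
Proof.
move=> h; rewrite levE akP -rmorphM canP; apply/(ao_sl one0); rewrite evC; apply: sl_ball.
by rewrite nmM nm_kst pf_absV mulrC ler_pdivrMr ?mul1r // pf_abs_gt0 // topnilX0.
Qed.

(** The whole disk is the rational subset with denominator 1: modulo X - 1 a polynomial
    is the sum of its coefficients. *)
Lemma io_whole q : exists a, io whole q = can whole a.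
Proof.
have r1 : root (q - q.[1]%:P) (1 : A) by rewrite /root hornerD hornerN hornerC subrr.
have [s hs] := factor_theorem _ _ r1; exists q.[1]; apply/eqP; rewrite canP -subr_eq0 -rmorphB hs.
have -> : s * ('X - 1%:P) = ((rat_den whole : A)%:P * 'X - 1) * s.
  by rewrite mulrC; congr (_ * _); rewrite [X in _ = X%:P * _ - _](_ : _ = 1) // polyC1 mul1r.
by apply/eqP; exact: io_ideal.
Qed.

Lemma can_inj : injective (can whole).
Proof.
move=> a b e; apply/eqP; rewrite -subr_eq0; apply/eqP/nm_eq0/le0_small; first exact: nm_ge0.
move=> e0 /topnil_small => /(_ p K) [k hk]; apply: le_trans hk; apply: lev_can.
by rewrite rmorphB e subrr; exact: lev_zero.
Qed.

(** A is dense in the sections over the whole disk, and the embedding is isometric with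
    complete source. *)
Lemma can_surj x : exists a, can whole a = x.
Proof.
have ex k : exists a, lev k (x - can whole a).
  by have [q hq] := io_dense x k; have [a ha] := io_whole q; exists a; rewrite -ha.
have [a ha] := choice ex.
have da k : nm (a k.+1 - a k) <= pf_abs (w ^+ k).
  apply: lev_can; rewrite rmorphB (sub_common x); apply: levB => //; exact: lev_decr (leqnSn k) (ha _).
have [|l hl] := @nm_complete _ _ _ A a; first by move=> k; apply: le_trans (da k) _; exact: topnil_le.
exists l; apply/eqP; rewrite -subr_eq0; apply/eqP/lev_sep => k.
have [m hm] := half_small (pf_abs_gt0 (topnilX0 K k)); pose M := maxn m k.
have -> : can whole l - x = can whole (l - a M) - (x - can whole (a M)).
  by rewrite rmorphB opprB addrA subrK.
apply: levB; last by apply: lev_decr (ha M); exact: leq_maxr.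
apply: can_lev; apply: le_trans (hl M) _; apply: le_trans hm.
by rewrite lef_pV2 ?posrE ?exprn_gt0 // ler_weXn2l ?ler1n // leq_maxl.
Qed.

(** The global functions form the perfectoid Tate algebra, so that the result on
    modules applies. *)
Lemma global_projective_free N (e : 'M[strSheaf (setT : set X)]_N) : e *m e = e ->
  exists r (U : 'M[strSheaf (setT : set X)]_(N, r)) (V : 'M_(r, N)), U *m V = e /\ V *m U = 1%:M.
Proof.
move=> ee; have h : rat_subset whole `<=` (setT : set X) by [].
have h' : (setT : set X) `<=` rat_subset whole by rewrite wholeE.
have [f hf] := choice can_surj.
pose e1 : 'M[A]_N := map_mx f (map_mx (svalm h) e).
have he1 : map_mx (can whole) e1 = map_mx (svalm h) e by apply/matrixP => i j; rewrite !mxE hf.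
have e11 : e1 *m e1 = e1.
  by apply: (map_mx_inj0 can_inj); rewrite map_mxM he1 -map_mxM ee.
have [r [U [V [UV VU]]]] := @perf_projective_free R p K n N e1 e11.
have [U' hU] := sval_mx_surj h h' (map_mx (can whole) U).
have [V' hV] := sval_mx_surj h h' (map_mx (can whole) V).
exists r, U', V'; split; apply: (map_mx_inj0 (sval_inj (h := h) h')).
  by rewrite map_mxM hU hV -map_mxM -he1; congr map_mx.
by rewrite map_mxM hU hV -map_mxM map_mx1 -(map_mx1 (can whole)); congr map_mx.
Qed.
End Global.

Section FreeFrames.
Variables (Q : pzRingType) (M : lmodType Q).

Lemma frame_split N r (t : 'I_N -> M) e (U : 'M[Q]_(N, r)) (V : 'M[Q]_(r, N)) : frame t e ->
  e *m e = e -> U *m V = e -> V *m U = 1%:M -> frame (mact V t) 1%:M.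
Proof.
move=> fr ee UV VU; split=> [s|v].
  have [v <-] := fr.1 s; exists (v *m U); rewrite comb_mact -mulmxA UV.
  by rewrite -comb_mact (frame_idem fr ee).
rewrite comb_mact fr.2 mulmx1 -UV; split=> [h|->]; last by rewrite !mul0mx.
by rewrite -[v]mulmx1 -VU -[LHS]mulmx1 -VU !mulmxA; move: h; rewrite !mulmxA => ->; rewrite mul0mx.
Qed.

Definition combl N (t : 'I_N -> M) (v : 'rV[Q]_N) : M := comb v t.
Fact combl_linear N (t : 'I_N -> M) : linear (combl t).
Proof.
move=> a u v; rewrite /combl /comb scaler_sumr -big_split; apply: eq_bigr => i _.
by rewrite !mxE scalerDl scalerA.
Qed.
HB.instance Definition _ N (t : 'I_N -> M) := GRing.isLinear.Build Q 'rV[Q]_N M *:%R (combl t) (combl_linear t).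

Lemma frame_bijective N (t : 'I_N -> M) : frame t 1%:M -> bijective (combl t).
Proof.
move=> [h1 h2]; have [g hg] := choice h1; exists g => [v|s]; last exact: hg.
apply/eqP; rewrite -subr_eq0; apply/eqP; rewrite -[LHS]mulmx1; apply/h2.
by rewrite combB hg subrr.
Qed.
End FreeFrames.

(** * The tournament *)

Section Tournament.
Variables (R : realType) (p : nat) (K : perfectoidField R p) (n : nat).
Local Notation A := (PT K n).
Local Notation X := (perfDisk K n).
Local Notation wA := (wA K n).
Variable E : modSheaf K n.

Lemma rat_open (D : ratDatum K n) : open (rat_subset D).
Proof.
exists [set rat_subset D]; last by rewrite bigcup_set1.
by move=> _ ->; apply: (@finI_from1 _ _ _ id); exists D.
Qed.

Lemma seq_meet (s : seq (set X)) : (forall S, S \in s -> exists D, rat_subset D = S) ->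
  exists t : triple K n, forall x, rat_subset (rd t) x <-> forall S, S \in s -> S x.
Proof.
elim: s => [|S s ih] h.
  by exists ([::], 0%N, 1) => x; split=> // _; have : setT x by []; rewrite -(@wholeE R p K n).
have [|t ht] := ih; first by move=> S' hS'; apply: h; rewrite inE hS' orbT.
have [D hD] := h S (mem_head _ _); have [M hM] := std_ex D.
exists (meet (nums D, M, den D) t) => x; rewrite meetE -[rd (nums D, M, den D)]/(std _ _ _) hM hD.
split=> [[Sx /ht hx] S'|hx].
  by rewrite inE => /orP [/eqP ->|/hx].
by split; [exact: hx (mem_head _ _) | apply/ht => S' hS'; apply: hx; rewrite inE hS' orbT].
Qed.

Lemma open_rational (V : set X) x : open V -> V x -> exists t : triple K n, rat_subset (rd t) x /\ rat_subset (rd t) `<=` V.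
Proof.
move=> [F FD <-] [S FS Sx]; have [s hs eS] := FD _ FS.
have [|t ht] := @seq_meet (finmap.enum_fset s : seq (set X)).
  by move=> S' /hs; rewrite inE => -[D _ <-]; exists D.
exists t; split; first by apply/ht => S' hS'; move: Sx; rewrite -eS; apply.
move=> y /ht hy; exists S => //; change ((S : set X) y).
by rewrite -eS => S' hS'; exact: hy.
Qed.

Section Products.
Variables (k : nat) (tau : 'I_k -> triple K n).
Hypothesis cov : forall x, exists l, rat_subset (rd (tau l)) x.
Hypothesis charts : forall l W, open W -> W `<=` rat_subset (rd (tau l)) -> chart E W.

Let B := \max_l size (full (tau l)).
Definition elt l i : A := nth (tau l).2 (full (tau l)) i.
Definition prd (s : {ffun 'I_k -> 'I_B.+1}) : A := \prod_l elt l (s l).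

(** The refinement of a rational covering by a standard one: the products are the
    generators, and at each point their maximum is a product of maxima, so it is
    attained by a marked one. *)
Definition marked (s : {ffun 'I_k -> 'I_B.+1}) := [exists l, s l == ord0].

Let sizeB l : (size (full (tau l)) <= B)%N. Proof. exact: (leq_bigmax l). Qed.

Lemma elt_index l a : a \in full (tau l) -> exists i : 'I_B.+1, elt l i = a.
Proof.
move=> ha; have h : (index a (full (tau l)) < B.+1)%N.
  by rewrite ltnS; apply: leq_trans (index_size _ _) (sizeB l).
by exists (Ordinal h); rewrite /elt nth_index.
Qed.

Section Point.
Variable x : X.
Let pv := point_preval x.

Lemma elt_le l i : rat_subset (rd (tau l)) x -> val_le x (elt l i) (tau l).2.
Proof.
move=> /rdP h; rewrite /elt; have [hi|hi] := ltnP i (size (full (tau l))).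
  by apply: h; exact: mem_nth.
by rewrite nth_default //; exact: (pv_refl pv).
Qed.

Lemma mul_neq0 a b : ~ val_le x a 0 -> ~ val_le x b 0 -> ~ val_le x (a * b) 0.
Proof. by move=> ha hb h; apply: ha; apply: (pv_cancel pv hb); rewrite mul0r. Qed.
Lemma mul_neq0r a b : ~ val_le x (a * b) 0 -> ~ val_le x b 0.
Proof. by move=> h hb; apply: h; have := pv_mull pv a hb; rewrite mulr0. Qed.

Lemma marked_neq0 : exists s, marked s /\ ~ val_le x (prd s) 0.
Proof.
have [i hi] := cov x; have B1 : (1 < B.+1)%N.
  by rewrite ltnS; apply: leq_trans (sizeB i).
(* the factor of index i is its denominator, the others are constants w^M *)
pose s : {ffun 'I_k -> 'I_B.+1} := [ffun l => if l == i then ord0 else Ordinal B1].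
exists s; split; first by apply/existsP; exists i; rewrite ffunE eqxx.
rewrite /prd; elim/big_ind: _ => [|a b|l _]; [exact: (pv_one pv) | exact: mul_neq0 |].
rewrite ffunE; case: eqP => [->|_]; first exact: rd_neq0 hi.
exact: (pv_wA pv).
Qed.

(** The point lies in some tau i; replacing the factor of index i by its denominator
    does not decrease a product, and replacing the factor of index l by a gives another
    marked product, so a is at most the denominator of tau l. *)
Lemma champion (s : {ffun 'I_k -> 'I_B.+1}) l : s l = ord0 -> (forall s', marked s' -> val_le x (prd s') (prd s)) ->
  rat_subset (rd (tau l)) x.
Proof.
move=> sl max; have [i hi] := cov x; have [<-//|il] := eqVneq i l.
have gi := rd_neq0 hi; apply/rdP => a /elt_index [j hj].
pose s' : {ffun 'I_k -> 'I_B.+1} := [ffun m => if m == l then j else if m == i then ord0 else s m].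
have m' : marked s' by apply/existsP; exists i; rewrite ffunE (negPf il) eqxx.
pose P := \prod_(m | (m != l) && (m != i)) elt m (s m).
have es : prd s = (tau l).2 * (elt i (s i) * P) by rewrite /prd (bigD1 l) //= (bigD1 i) //= sl.
have es' : prd s' = a * ((tau i).2 * P).
  rewrite /prd (bigD1 l) //= (bigD1 i) //= !ffunE eqxx (negPf il) eqxx hj; congr (_ * (_ * _)).
  by apply: eq_bigr => m /andP [/negPf h1 /negPf h2]; rewrite ffunE h1 h2.
have nz : ~ val_le x (prd s) 0.
  by have [s0 [h0 n0]] := marked_neq0; apply: (pv_0 pv n0); exact: max.
have nP : ~ val_le x P 0 by apply: (@mul_neq0r (elt i (s i))); apply: (@mul_neq0r (tau l).2); rewrite -es.
apply: (pv_cancel pv (mul_neq0 gi nP)); rewrite -es'; apply: (pv_trans pv (max _ m')); rewrite es.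
by apply: (pv_mull pv); apply: (pv_mul pv); exact: elt_le.
Qed.
End Point.

(** The maximum of the marked products vanishes nowhere, so it is bounded below by
    compactness. *)
Lemma marked_bound : exists N, forall x, exists s, marked s /\ ~ val_le x (prd s) (wA N).
Proof.
have [|m [j hj]] := @rational_compact R p K n (whole K n) ({s | marked s} * nat)%type
    (fun i => std [::] i.2 (prd (proj1_sig i.1))).
  move=> x _; have [s [ms ns]] := marked_neq0 x; have [N hN] := point_arch ns.
  by exists (exist _ s ms, N) => //; apply/stdP.
exists (\max_l (j l).2).+1 => x; have [|l _ /stdP [_ hl]] := hj x; first by rewrite wholeE.
exists (proj1_sig (j l).1); split; first exact: (proj2_sig (j l).1).
have pv := point_preval x; move=> h; apply: (wA_strict pv (@point_small _ _ _ _ x) (N := (j l).2)).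
apply: (pv_trans pv hl); apply: (pv_trans pv h); apply: (pv_wA_decr pv).
by rewrite ltnS; exact: (leq_bigmax l).
Qed.

(** The reigning champion a is compared with one marked product after the other; each
    comparison divides the rational subset into two pieces on which the winner is known.
    When nothing is left to compare, the subset is contained in a member of the
    covering. The constant w^N opens the tournament; it cannot win, as some marked
    product is greater. *)
Lemma tournament N : (forall x, exists s, marked s /\ ~ val_le x (prd s) (wA N)) ->
  forall (S : seq {ffun 'I_k -> 'I_B.+1}) (D : ratDatum K n) (a : A),
  (forall x, rat_subset D x -> val_le x (wA N) a) ->
  (exists s, marked s /\ a = prd s) \/ a = wA N ->
  (forall x s, rat_subset D x -> marked s -> s \in S \/ val_le x (prd s) a) ->
  chart E (rat_subset D).
Proof.
move=> hN; elim=> [|s S ih] D a ha ca hmax.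
  case: ca => [[s [/existsP [l /eqP sl] es]]|ea].
    apply: (charts (l := l)); first exact: rat_open.
    move=> x Dx; apply: (champion sl) => s' ms'; rewrite -es.
    by case: (hmax x s' Dx ms').
  have -> : rat_subset D = set0; last exact: chart_empty.
  apply/seteqP; split=> // x Dx; have [s [ms ns]] := hN x; apply: ns.
  by rewrite -ea; case: (hmax x s Dx ms).
have [ms|nms] := boolP (marked s); last first.
  apply: (ih D a) => // x s' Dx ms'; case: (hmax x s' Dx ms'); last by right.
  by rewrite inE => /orP [/eqP e|]; [move: nms; rewrite -e ms' | left].
have [D0 [D1 [D2 [D12 [_ [_ e1 e2 _]]]]]] := @split_covering R p K n D (prd s) a N ha.
apply: (@chart_glue _ _ _ _ _ D (rat_subset D1) (rat_subset D2)); try exact: rat_open.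
- by exists (prd s), a, N.
- apply: (ih D1 a) => //; first by move=> x; rewrite e1 => -[Dx _]; exact: ha.
  move=> x s'; rewrite e1 => -[Dx /= h] ms'; case: (hmax x s' Dx ms'); last by right.
  by rewrite inE => /orP [/eqP ->|]; [right | left].
- have pv (x : X) := point_preval x.
  apply: (ih D2 (prd s)); [| by left; exists s |].
    by move=> x; rewrite e2 => -[Dx /= h]; exact: (pv_trans (pv x) (ha x Dx) h).
  move=> x s'; rewrite e2 => -[Dx /= h] ms'; case: (hmax x s' Dx ms').
    by rewrite inE => /orP [/eqP ->|]; [right; exact: (pv_refl (pv x)) | left].
  by move=> h'; right; exact: (pv_trans (pv x) h' h).
Qed.

Lemma products_chart : chart E setT.
Proof.
have [N hN] := marked_bound; rewrite -(@wholeE R p K n).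
apply: (tournament hN (S := enum {: {ffun 'I_k -> 'I_B.+1}}) (a := wA N)).
- by move=> x _; exact: (pv_refl (point_preval x)).
- by right.
- by move=> x s _ _; left; rewrite mem_enum.
Qed.
End Products.

(** Local trivializations over rational subsets, finitely many of which cover the disk
    by compactness. *)
Theorem bundle_chart : finite_vector_bundle E -> chart E setT.
Proof.
move=> fvb; have ex x : exists t : triple K n, rat_subset (rd t) x /\
    forall W, open W -> W `<=` rat_subset (rd t) -> chart E W.
  have [V [r [oV Vx tV]]] := fvb x; have [t [tx tV']] := open_rational oV Vx.
  exists t; split=> // W oW Wt; apply: (chart_trivial oV oW _ tV); exact: subset_trans Wt tV'.
have [t ht] := choice ex.
have [|k [j hj]] := @rational_compact R p K n (whole K n) X (fun x => rd (t x)).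
  by move=> x _; exists x => //; exact: (ht x).1.
apply: (@products_chart k (fun l => t (j l))) => [x|l W]; last exact: (ht _).2.
by have [|l _ hl] := hj x; [rewrite wholeE | exists l].
Qed.

(** The chart over the whole disk is given by an idempotent over the perfectoid Tate
    algebra, and a factorization of this idempotent makes the chart a basis over every
    open subset. *)
Theorem bundle_free : finite_vector_bundle E -> free_bundle E.
Proof.
move=> /bundle_chart [N [t [e [ee hf]]]]; have [r [U [V [UV VU]]]] := global_projective_free ee.
have T W : W `<=` (setT : set X) by [].
exists r, (fun W => combl (fun i => ms_res (T W) (mact V t i)) : {linear _ -> _}); split.
  move=> W oW WT; apply: frame_bijective; rewrite ms_res_mact //; last exact: openT.
  apply: (frame_split (U := map_mx (sres (T W)) U) (hf W (T W) oW)); rewrite -!sres_mxM ?ee ?UV ?VU //.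
  by rewrite map_mx1.
move=> W W' h oW oW' _ v; rewrite [LHS]ms_res_comb //; congr comb.
by apply/funext => i; rewrite (ms_res_comp _ _ (T W')) //; exact: openT.
Qed.
End Tournament.

Theorem theorem2p18 (R : realType) (p : nat) (K : perfectoidField R p) (n : nat)
    (n_ge1 : (1 <= n)%N) :
  (forall M : lmodType (perfTate K n),
     finite_module M -> projective_module M -> finite_free_module M) /\
  (forall E : modSheaf K n, finite_vector_bundle E -> free_bundle E).
Proof.
split=> [M|E]; last exact: bundle_free.
exact: projective_free_module (@perf_projective_free R p K n).
Qed.
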